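(* Let $R$ be a ring. Let $G$ and $G'$ be two quasi-isometric groups that are relatively hyperbolic with respect to subgroups $H<G$ and $H'<G'$, respectively. Assume further that neither $G$ nor $G'$ contains $R$-torsion. Assume that both $H$ and $H'$ are unconstricted and of type $F_{\infty}$. Then $\mathrm{cd}_{R}(G,H)=\mathrm{cd}_{R}(G',H')$.
   Context: **$R$-torsion.** A group has no $R$-torsion if the order of each of its finite subgroups is invertible in $R$. **Unconstricted.** A group is unconstricted if one of its asymptotic cones is without cut-points. **Quasi-isometry.** Finitely generated groups are equipped with word metrics of finite symmetric generating sets. A map $q\colon G_1\to G_2$ is a quasi-isometry if there are $A,B>0$ with $A^{-1}d_{S_1}(x,y)-B\le d_{S_2}(q(x),q(y))\le A\,d_{S_1}(x,y)+B$ for all $x,y\in G_1$, and $C>0$ such that every $y\in G_2$ is within $d_{S_2}$-distance $C$ of $q(G_1)$. **Relative cohomology.** For a subgroup $H<G$, let $\mathbb{Z}[G/H]$ be the $\mathbb{Z}G$-module generated by the set $G/H$ of left cosets, let $\epsilon\colon\mathbb{Z}[G/H]\to\mathbb{Z}$ be the $\mathbb{Z}G$-morphism sending every coset to $1$, let $\Delta_{G/H}=\ker\epsilon$, and $\Delta^R_{G/H}=\Delta_{G/H}\otimes R$. For an $RG$-module $M$, $H^i(G,H;M):=\mathrm{Ext}^{i-1}_{RG}(\Delta^R_{G/H},M)$. The relative cohomological dimension is $\mathrm{cd}_R(G,H):=\sup\{i\mid H^i(G,H;M)\neq 0\text{ for some }RG\text{-module }M\}$. **Relative hyperbolicity (Farb).**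 Let $G$ be a finitely generated group with finite generating set $S$ and $H<G$. Let $\Gamma(G,S)$ be the Cayley graph with unit-length edges and the path metric. The coned-off Cayley graph $\hat\Gamma(G,S,H)$ is obtained from $\Gamma(G,S)$ by adding, for each left coset $gH$, a vertex $v(gH)$ and an edge of length $\tfrac12$ between $v(gH)$ and each element of $gH$; it carries the path metric $\hat d$. $G$ is weakly relatively hyperbolic with respect to $H$ if $\hat\Gamma(G,S,H)$ is Gromov hyperbolic. For a path $c$ in $\Gamma(G,S)$, its image $\hat c$ is the path in $\hat\Gamma(G,S,H)$ obtained by replacing every maximal subpath $c|_{[a,b]}$ all of whose vertices lie in one coset $gH$ by the path of length $1$ from $c(a)$ to $c(b)$ through $v(gH)$. With $l'$ the length of $\hat c$, $c$ is a $T$-relative quasi-geodesic if $T^{-1}|t-t'|\le\hat d(\hat c(t),\hat c(t'))\le T|t-t'|$ for all $t,t'\in[0,l']$. A path $c$ travels in a coset $\gamma H$ for more than $r$ if there is a subsegment of $c$ with vertices in $\gamma H$ whose endpoints are at distance at least $r$. $(G,H)$ has Bounded Coset Penetration (BCP) if for every $T>0$ there is $r=r_{BCP}(T)$ such that any two $T$-relative quasi-geodesics $c_1,c_2$ in $\Gamma(G,S)$ with the same starting point and the same endpoint satisfy: (1) if $c_1$ travels more than $r$ in a coset, then $c_2$ enters that coset; (2) if $c_1$ and $c_2$ enter the same coset, then their entry points (respectively, exit points) are at most $r$ apart. $G$ is relatively hyperbolic with respect to $H$ if it is weakly relatively hyperbolic with respect to $H$ and satisfies BCP. *)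

(* Defs.v *)
From HB Require Import structures.
From mathcomp Require Import all_boot all_order all_algebra.
From mathcomp Require Import all_classical all_reals all_analysis.
From mathcomp Require Import freeg.

Set Implicit Arguments.
Unset Strict Implicit.
Unset Printing Implicit Defensive.

Import Order.TTheory GRing.Theory Num.Theory.
Import numFieldNormedType.Exports.

Local Open Scope classical_set_scope.
Local Open Scope ring_scope.
Local Open Scope quotient_scope.

(******************************************************************************)
(* Discrete, possibly infinite, groups are [groupType]s. A subgroup of G is a *)
(* [H : groupClosed G], i.e. a boolean predicate closed under the group       *)
(* operations; [subgroup_type H] is H as a group in its own right.            *)
(* [K : realType] is the field of real numbers.                               *)
(******************************************************************************)

Section Subgroup.
Context (G : groupType) (H : groupClosed G).

Definition subgroup_type := {x : G | x \in H}.

HB.instance Definition _ := Choice.on subgroup_type.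
HB.instance Definition _ := SubChoice.on subgroup_type.

Let subgroup_closed : group_closed [pred x | x \in H].
Proof. by split=> [|x y]; rewrite ?inE; [exact: gpred1 | exact: gpredF]. Qed.

HB.instance Definition _ :=
  SubChoice_isSubGroup.Build G _ subgroup_type subgroup_closed.

Definition same_coset (x y : G) : bool := (x^-1 * y)%g \in H.

Lemma same_coset_refl : reflexive same_coset.
Proof. by move=> x; rewrite /same_coset mulVg gpred1. Qed.

Lemma same_coset_sym : symmetric same_coset.
Proof. by move=> x y; rewrite /same_coset -gpredV invgM invgK. Qed.

Lemma same_coset_trans : transitive same_coset.
Proof.
move=> y x z xy yz; have := gpredM _ _ xy yz.
by rewrite mulgA mulgK.
Qed.

Canonical same_coset_equiv :=
  EquivRel same_coset same_coset_refl same_coset_sym same_coset_trans.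

(* The set G/H of left cosets; the coset xH is [\pi_left_coset x]. *)
Definition left_coset := {eq_quot same_coset}.

HB.instance Definition _ := Quotient.on left_coset.
HB.instance Definition _ := Choice.on left_coset.

Definition coset_of (x : G) : left_coset := \pi_left_coset x.

Definition coset_act (g : G) (c : left_coset) : left_coset :=
  coset_of (g * repr c)%g.

Lemma coset_ofP x y : coset_of x = coset_of y <-> same_coset x y.
Proof. by split=> [/eqmodP|?]; last exact/eqmodP. Qed.

Lemma coset_actE g x : coset_act g (coset_of x) = coset_of (g * x)%g.
Proof.
apply/coset_ofP; rewrite /same_coset invgM -mulgA (mulgA (g^-1)%g) mulVg mul1g.
by apply/coset_ofP; rewrite /coset_of reprK.
Qed.

Lemma coset_act1 c : coset_act 1%g c = c.
Proof. by rewrite -[c]reprK -/(coset_of _) coset_actE mul1g. Qed.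

Lemma coset_actM g h c : coset_act (g * h)%g c = coset_act g (coset_act h c).
Proof. by rewrite -[c]reprK -/(coset_of _) !coset_actE mulgA. Qed.

End Subgroup.

Definition no_torsion (R : pzRingType) (G : groupType) : Prop :=
  forall (F : groupClosed G) (n : nat),
    ([set x | x \in F] #= `I_n)%card ->
    exists u : R, n%:R * u = 1 /\ u * n%:R = 1.

Section WordMetric.
Context (G : groupType).

Definition word_in (S w : seq G) (g : G) : Prop :=
  {subset w <= S} /\ (\prod_(s <- w) s)%g = g.

Definition generating_set (S : seq G) : Prop :=
  (forall s, s \in S -> (s^-1)%g \in S) /\
  (forall g, exists w, word_in S w g).

Definition word_norm (S : seq G) (g : G) : nat :=
  xget 0%N [set n | (exists2 w, word_in S w g & size w = n) /\
                    (forall w, word_in S w g -> (n <= size w)%N)].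

Definition word_dist (S : seq G) (x y : G) : nat := word_norm S (x^-1 * y)%g.

End WordMetric.

Section QuasiIsometry.
Context (K : realType) (G1 G2 : groupType).

Definition quasi_isometry (S1 : seq G1) (S2 : seq G2) (q : G1 -> G2) : Prop :=
  (exists A B : K, [/\ 0 < A, 0 < B & forall x y,
     A^-1 * (word_dist S1 x y)%:R - B <= (word_dist S2 (q x) (q y))%:R
       <= A * (word_dist S1 x y)%:R + B]) /\
  (exists2 C : K, 0 < C & forall y, exists x, (word_dist S2 (q x) y)%:R <= C).

Definition quasi_isometric : Prop :=
  exists (S1 : seq G1) (S2 : seq G2) (q : G1 -> G2),
    [/\ generating_set S1, generating_set S2 & quasi_isometry S1 S2 q].

End QuasiIsometry.

(* T with the topology defined by the (pseudo)metric d. *)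
Definition metric_topology (K : realType) (T : Type) (d : T -> T -> K) : Type :=
  T.

Section MetricTopology.
Context (K : realType) (T : Type) (d : T -> T -> K).

Local Notation MT := (metric_topology d).

HB.instance Definition _ := gen_eqMixin MT.
HB.instance Definition _ := gen_choiceMixin MT.

Definition metric_open (U : set MT) : Prop :=
  forall x, U x -> exists2 e : K, 0 < e & forall y, d x y < e -> U y.

Let metric_openT : metric_open setT.
Proof. by move=> x _; exists 1. Qed.

Let metric_openI : setI_closed metric_open.
Proof.
move=> U V oU oV x [/oU[e e0 eU] /oV[f f0 fV]].
exists (Num.min e f); first by rewrite lt_min e0.
by move=> y; rewrite lt_min => /andP[/eU ? /fV].
Qed.

Let metric_open_bigU (I : Type) (f : I -> set MT) :
  (forall i, metric_open (f i)) -> metric_open (\bigcup_i f i).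
Proof.
by move=> of_ x [i _ /of_[e e0 ef]]; exists e => // y /ef; exists i.
Qed.

HB.instance Definition _ :=
  isOpenTopological.Build MT metric_openT metric_openI metric_open_bigU.

End MetricTopology.

(* A connected space is understood to be nonempty here, so that the point of  *)
(* a one-point space is a cut-point; this only affects finite groups.         *)
Definition cut_point (X : topologicalType) (p : X) : Prop :=
  ~ ([set~ p] !=set0 /\ connected [set~ p]).

Section AsymptoticCone.
(* w is the ultrafilter, e the sequence of observation points, d the sequence *)
(* of scaling constants; the points of the cone are the classes of sequences  *)
(* at distance 0 from each other.                                             *)
Context (K : realType) (G : groupType) (S : seq G).
Context (w : set_system nat) (e : nat -> G) (d : nat -> K).

Definition cone_seq : Type :=
  {x : nat -> G | exists C : K,
     \forall n \near w, (word_dist S (x n) (e n))%:R / d n <= C}.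

Definition cone_seq_dist (x y : cone_seq) : K :=
  lim ((fun n => (word_dist S (sval x n) (sval y n))%:R / d n) @ w).

Definition cone_point : Type :=
  {A : set cone_seq | exists x, A = [set y | cone_seq_dist x y = 0]}.

Definition cone_repr (A : cone_point) : cone_seq := sval (cid (svalP A)).

Definition cone_dist (A B : cone_point) : K :=
  cone_seq_dist (cone_repr A) (cone_repr B).

Definition asymptotic_cone : topologicalType := metric_topology cone_dist.

End AsymptoticCone.

Definition unconstricted (K : realType) (G : groupType) : Prop :=
  exists (S : seq G) (w : set_system nat) (e : nat -> G) (d : nat -> K),
    [/\ generating_set S,
        UltraFilter w /\ (forall n, ~ w [set n]),
        (forall n, 0 < d n) /\ d n @[n --> w] --> +oo &
        forall p : asymptotic_cone S w e d, ~ cut_point p].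

Section MetricGraph.
(* A simple graph without loops with symmetric adjacency E, in which the edge *)
(* uv has length [len u v].                                                   *)
Context (K : realType) (V : eqType) (E : rel V) (len : V -> V -> K).

(* The points of the geometric realization are triples (u, v, t): the point   *)
(* of the edge uv at distance t from u. The vertex u is (u, u, 0), and also   *)
(* (u, v, 0) and (v, u, len v u) for all neighbours v: different triples for  *)
(* the same point are at distance 0.                                          *)
Definition gpoint : Type := (V * V * K)%type.

Definition on_graph (p : gpoint) : Prop :=
  let: (u, v, t) := p in (E u v /\ 0 <= t <= len u v) \/ (u = v /\ t = 0).

Fixpoint walk_len (u : V) (s : seq V) : K :=
  if s is v :: s' then len u v + walk_len v s' else 0.

Definition vertex_dist (u v : V) : K :=
  inf [set l | exists s, [/\ path E u s, last u s = v & l = walk_len u s]].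

Definition to_end (p : gpoint) (a : V) (l : K) : Prop :=
  let: (u, v, t) := p in
  (a = u /\ l = t) \/ [/\ E u v, a = v & l = len u v - t].

Definition along_edge (p q : gpoint) (l : K) : Prop :=
  let: (u, v, t) := p in let: (u', v', t') := q in
  [/\ u = u', v = v' & l = `|t - t'|] \/
  [/\ E u v, u = v', v = u' & l = `|t - (len u v - t')|].

(* The path metric: a shortest path between two points either stays in one    *)
(* edge or passes through an end of each of their edges.                      *)
Definition graph_dist (p q : gpoint) : K :=
  inf [set l | along_edge p q l \/
    exists a b l1 l2, [/\ to_end p a l1, to_end q b l2 &
                          l = l1 + vertex_dist a b + l2]].

Definition gromov_product (p q o : gpoint) : K :=
  (graph_dist p o + graph_dist q o - graph_dist p q) / 2.

Definition gromov_hyperbolic : Prop :=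
  exists delta : K, forall x y z o,
    on_graph x -> on_graph y -> on_graph z -> on_graph o ->
    Num.min (gromov_product x y o) (gromov_product y z o) - delta
      <= gromov_product x z o.

(* The point at arc length t on the walk starting at u with further vertices  *)
(* s; only used for 0 <= t <= walk_len u s.                                   *)
Fixpoint walk_at (u : V) (s : seq V) (t : K) : gpoint :=
  if s is v :: s' then
    if t <= len u v then (u, v, t) else walk_at v s' (t - len u v)
  else (u, u, 0).

Definition quasi_geodesic (T : K) (u : V) (s : seq V) : Prop :=
  forall t t', 0 <= t <= walk_len u s -> 0 <= t' <= walk_len u s ->
    T^-1 * `|t - t'| <= graph_dist (walk_at u s t) (walk_at u s t')
      <= T * `|t - t'|.

End MetricGraph.

Section RelativeHyperbolicity.
Context (K : realType) (G : groupType) (S : seq G) (H : groupClosed G).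

Definition cayley_adj : rel G := fun x y => (x != y) && ((x^-1 * y)%g \in S).

Definition cone_vertex : eqType := (G + left_coset H)%type.

Definition coned_adj : rel cone_vertex := fun u v =>
  match u, v with
  | inl x, inl y => cayley_adj x y
  | inl x, inr c | inr c, inl x => coset_of H x == c
  | inr _, inr _ => false
  end.

Definition coned_len (u v : cone_vertex) : K :=
  match u, v with inl _, inl _ => 1 | _, _ => 2^-1 end.

Definition weakly_relatively_hyperbolic : Prop :=
  gromov_hyperbolic coned_adj coned_len.

(* An edge path c in the Cayley graph is given by its first vertex x and the  *)
(* sequence s of its further vertices; [coned_path x s] lists the further     *)
(* vertices of its image in the coned-off graph. Maximal subpaths with at     *)
(* least one edge and all vertices in one coset are replaced; at the edge xy  *)
(* in such a subpath, the detour is output if y is the end of the subpath.    *)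
Fixpoint coned_path (x : G) (s : seq G) : seq cone_vertex :=
  if s is y :: s' then
    if same_coset H x y then
      if (if s' is z :: _ then same_coset H y z else false)
      then coned_path y s'
      else inr (coset_of H y) :: inl y :: coned_path y s'
    else inl y :: coned_path y s'
  else [::].

Definition relative_quasi_geodesic (T : K) (x : G) (s : seq G) : Prop :=
  path cayley_adj x s /\
  quasi_geodesic coned_adj coned_len T (inl x) (coned_path x s).

Implicit Types (p : seq G) (c : left_coset H).

Definition travels_more_than (r : K) p c : Prop :=
  exists p1 x p2 p3,
    [/\ p = p1 ++ (x :: p2) ++ p3,
        forall y, y \in x :: p2 -> coset_of H y = c &
        r <= (word_dist S x (last x p2))%:R].

Definition vertices_in p c : seq G := [seq y <- p | coset_of H y == c].

Definition enters p c : Prop := vertices_in p c != [::].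

Definition entry_point p c : G := head 1%g (vertices_in p c).

Definition exit_point p c : G := last 1%g (vertices_in p c).

Definition bounded_coset_penetration : Prop :=
  forall T : K, 0 < T -> exists r : K,
    forall x s1 s2,
      relative_quasi_geodesic T x s1 -> relative_quasi_geodesic T x s2 ->
      last x s1 = last x s2 ->
      let p1 := x :: s1 in let p2 := x :: s2 in
      (forall c, travels_more_than r p1 c -> enters p2 c) /\
      (forall c, enters p1 c -> enters p2 c ->
         (word_dist S (entry_point p1 c) (entry_point p2 c))%:R <= r /\
         (word_dist S (exit_point p1 c) (exit_point p2 c))%:R <= r).

End RelativeHyperbolicity.

(* As in Farb's work, S contains generators of H. Without this, a path in the *)
(* Cayley graph need not be able to follow a coset, and e.g. every pair (G,H) *)
(* with H of finite index and disjoint from S would qualify.                  *)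
Definition relatively_hyperbolic (K : realType) (G : groupType)
    (H : groupClosed G) : Prop :=
  exists S : seq G,
    [/\ generating_set S,
        forall h, h \in H -> exists w, word_in [seq s <- S | s \in H] w h,
        weakly_relatively_hyperbolic K S H &
        bounded_coset_penetration K S H].

Section CWComplex.
Context (K : realType).

Definition disc (n : nat) : set 'rV[K]_n := [set u | \sum_i u 0 i ^+ 2 <= 1].
Definition open_disc (n : nat) : set 'rV[K]_n :=
  [set u | \sum_i u 0 i ^+ 2 < 1].
Definition sphere_of_disc (n : nat) : set 'rV[K]_n :=
  [set u | \sum_i u 0 i ^+ 2 = 1].

Record cw_structure (X : topologicalType) := CWStructure {
  cell : nat -> Type;
  char_map : forall n, cell n -> 'rV[K]_n -> X;
  cw_hausdorff : hausdorff_space X;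
  cw_continuous : forall n (a : cell n),
    {within @disc n, continuous (char_map a)};
  (* X is the disjoint union of the open cells, and the characteristic maps   *)
  (* are injective on the open discs                                          *)
  cw_partition : forall x, exists! z : {n & (cell n * 'rV[K]_n)%type},
    @open_disc _ (projT2 z).2 /\ char_map (projT2 z).1 (projT2 z).2 = x;
  cw_closure_finite : forall n (a : cell n),
    exists2 F : set {m & cell m}, finite_set F &
      (forall z, F z -> (projT1 z < n)%N) /\
      (forall u, @sphere_of_disc n u -> exists z v,
         [/\ F z, @open_disc _ v & char_map (projT2 z) v = char_map a u]);
  cw_weak_topology : forall A : set X,
    (forall n (a : cell n), closed (@disc n `&` char_map a @^-1` A)) ->
    closed A
}.

End CWComplex.

Section EilenbergMacLane.
Context (K : realType) (X : topologicalType) (x0 : X).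

Local Notation I01 := (`[0, 1]%classic : set K).

Definition connecting_path (x y : X) (f : K -> X) : Prop :=
  [/\ {within I01, continuous f}, f 0 = x & f 1 = y].

Definition loop (f : K -> X) : Prop := connecting_path x0 x0 f.

Definition loop_concat (f g : K -> X) : K -> X :=
  fun t => if t <= 2^-1 then f (2 * t) else g (2 * t - 1).

Definition loop_homotopic (f g : K -> X) : Prop :=
  exists h : K * K -> X,
    [/\ {within I01 `*` I01, continuous h},
        forall t, I01 t -> h (0, t) = f t /\ h (1, t) = g t &
        forall s, I01 s -> h (s, 0) = x0 /\ h (s, 1) = x0].

Definition pi1_iso (G : groupType) : Prop :=
  exists phi : (K -> X) -> G,
    [/\ forall f g, loop f -> loop g ->
          phi (loop_concat f g) = (phi f * phi g)%g,
        forall f g, loop f -> loop g -> (phi f = phi g <-> loop_homotopic f g) &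
        forall a, exists2 f, loop f & phi f = a].

Definition cube (n : nat) : set 'rV[K]_n := [set u | forall i, 0 <= u 0 i <= 1].
Definition cube_boundary (n : nat) : set 'rV[K]_n :=
  cube (n := n) `&` [set u | exists i, u 0 i = 0 \/ u 0 i = 1].

Definition pi_trivial (n : nat) : Prop :=
  forall f : 'rV[K]_n -> X,
    {within @cube n, continuous f} ->
    (forall u, @cube_boundary n u -> f u = x0) ->
    exists h : K * 'rV[K]_n -> X,
      [/\ {within I01 `*` @cube n, continuous h},
          forall u, @cube n u -> h (0, u) = f u /\ h (1, u) = x0 &
          forall s u, I01 s -> @cube_boundary n u -> h (s, u) = x0].

Definition eilenberg_maclane (G : groupType) : Prop :=
  [/\ forall x, exists f, connecting_path x0 x f,
      pi1_iso G &
      forall n, (2 <= n)%N -> pi_trivial n].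

End EilenbergMacLane.

Definition type_Finfty (K : realType) (G : groupType) : Prop :=
  exists (X : topologicalType) (C : cw_structure K X),
    (exists x0 : X, eilenberg_maclane K x0 G) /\
    (forall n, finite_set [set: cell C n]).

(* A module over the group ring RG is an R-module with an R-linear G-action. *)
Record gmodule (R : pzRingType) (G : groupType) := GModule {
  gmod_sort :> lmodType R;
  gact : G -> gmod_sort -> gmod_sort;
  gact_linear : forall g, linear (gact g);
  gact1 : forall x, gact 1%g x = x;
  gactM : forall g h x, gact (g * h)%g x = gact g (gact h x)
}.

Definition equivariant (R R' : pzRingType) (G : groupType)
    (M : gmodule R G) (N : gmodule R' G) (f : M -> N) : Prop :=
  forall g x, f (gact g x) = gact g (f x).

Record ghom (R : pzRingType) (G : groupType) (M N : gmodule R G) := GHom {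
  ghom_fun :> {linear M -> N};
  ghom_equivariant : equivariant ghom_fun
}.

Section Ext.
Context (R : pzRingType) (G : groupType).

Definition surjection (M N : gmodule R G) (f : ghom M N) : Prop :=
  forall y, exists x, f x = y.

Definition projective (P : gmodule R G) : Prop :=
  forall (M N : gmodule R G) (p : ghom M N) (f : ghom P N), surjection p ->
    exists l : ghom P M, forall x, p (l x) = f x.

Record projective_resolution (A : gmodule R G) := ProjectiveResolution {
  res : nat -> gmodule R G;
  res_d : forall n, ghom (res n.+1) (res n);
  res_aug : ghom (res 0) A;
  res_projective : forall n, projective (res n);
  res_aug_surj : surjection res_aug;
  res_exact0 : forall x, res_aug x = 0 <-> exists y, res_d 0 y = x;
  res_exact : forall n x, res_d n x = 0 <-> exists y, res_d n.+1 y = x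
}.

Section Cohomology.
Context (A M : gmodule R G) (P : projective_resolution A).

Definition cocycle n (f : ghom (res P n) M) : Prop :=
  forall x, f (res_d P n x) = 0.

Definition coboundary n : ghom (res P n) M -> Prop :=
  match n with
  | 0%N => fun f => forall x, f x = 0
  | n'.+1 => fun f =>
      exists g : ghom (res P n') M, forall x, f x = g (res_d P n' x)
  end.

End Cohomology.

(* Ext^n_{RG}(A, M) is not zero. *)
Definition Ext_neq0 (n : nat) (A M : gmodule R G) : Prop :=
  exists (P : projective_resolution A) (f : ghom (res P n) M),
    cocycle f /\ ~ coboundary f.

(* iota exhibits D as the RG-module obtained from the ZG-module A by          *)
(* extension of scalars, i.e. as the tensor product of A and R over Z.        *)
Definition is_tensor (A : gmodule int G) (D : gmodule R G) (iota : A -> D) :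
    Prop :=
  [/\ {morph iota : x y / x + y}, equivariant iota &
      forall (M : gmodule R G) (f : A -> M),
        {morph f : x y / x + y} -> equivariant f ->
        exists F : ghom D M, (forall x, F (iota x) = f x) /\
          forall F' : ghom D M, (forall x, F' (iota x) = f x) ->
            forall y, F' y = F y].

End Ext.

Section AugmentationKernel.
Context (G : groupType) (H : groupClosed G).

Local Notation ZGH := {freeg (left_coset H) / int}.

Definition ZGH_act (g : G) : ZGH -> ZGH :=
  fglift (fun c => << coset_act g c >> : ZGH).

Lemma ZGH_actU g k c : ZGH_act g << k *g c >> = << k *g coset_act g c >>.
Proof.
rewrite /ZGH_act liftU; apply/eqP/freeg_eqP => x.
by rewrite coeffZ !coeffU mul1r.
Qed.

Lemma ZGH_act_additive g : additive (ZGH_act g).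
Proof. exact: lift_is_additive. Qed.

HB.instance Definition _ g :=
  GRing.isAdditive.Build ZGH ZGH (ZGH_act g) (ZGH_act_additive g).

Lemma ZGH_additive_ext (V : zmodType) (f f' : {additive ZGH -> V}) :
  (forall k c, f << k *g c >> = f' << k *g c >>) -> f =1 f'.
Proof.
move=> ff' D; rewrite -[D]freeg_sumE !raddf_sum.
by apply: eq_bigr => c _; apply: ff'.
Qed.

Lemma ZGH_act1 D : ZGH_act 1%g D = D.
Proof.
apply: (ZGH_additive_ext (f := ZGH_act 1%g) (f' := idfun)) => k c /=.
by rewrite ZGH_actU coset_act1.
Qed.

Lemma ZGH_actM g h D : ZGH_act (g * h)%g D = ZGH_act g (ZGH_act h D).
Proof.
apply: (ZGH_additive_ext (f := ZGH_act (g * h)%g)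
                         (f' := ZGH_act g \o ZGH_act h)) => k c /=.
by rewrite !ZGH_actU coset_actM.
Qed.

Lemma deg_ZGH_act g D : deg (ZGH_act g D) = deg D.
Proof.
apply: (ZGH_additive_ext (f := @deg _ \o ZGH_act g) (f' := @deg _)) => k c /=.
by rewrite ZGH_actU !degU.
Qed.

Lemma ZGH_act_linear g : linear (ZGH_act g).
Proof.
move=> k D E; rewrite raddfD; congr (_ + _).
by rewrite -[k]intz !scaler_int raddfMz.
Qed.

(* [deg] is the augmentation, which sends every coset to 1. *)
Definition aug_ker : {pred ZGH} := [pred D | deg D == 0].

Lemma aug_ker_submod : submod_closed aug_ker.
Proof.
split=> [|k D E]; rewrite !inE ?deg0// => /eqP D0 /eqP E0.
by rewrite degD E0 addr0 -[k]intz scaler_int raddfMz /= D0 mul0rz.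
Qed.

HB.instance Definition _ := GRing.isSubmodClosed.Build int ZGH aug_ker
  (GRing.submod_closed_semi aug_ker_submod).

Definition Delta_sort := {D : ZGH | D \in aug_ker}.

HB.instance Definition _ := Choice.on Delta_sort.
HB.instance Definition _ := SubChoice.on Delta_sort.
HB.instance Definition _ := [SubChoice_isSubLmodule of Delta_sort by <:].

Lemma ZGH_act_ker g (D : Delta_sort) : ZGH_act g (val D) \in aug_ker.
Proof. by rewrite inE deg_ZGH_act; have := valP D; rewrite inE. Qed.

Definition Delta_act (g : G) (D : Delta_sort) : Delta_sort :=
  Sub (ZGH_act g (val D)) (ZGH_act_ker g D).

Lemma Delta_act_linear g : linear (Delta_act g).
Proof. by move=> k D E; apply: val_inj; rewrite /= ZGH_act_linear. Qed.

Lemma Delta_act1 D : Delta_act 1%g D = D.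
Proof. by apply: val_inj; rewrite /= ZGH_act1. Qed.

Lemma Delta_actM g h D : Delta_act (g * h)%g D = Delta_act g (Delta_act h D).
Proof. by apply: val_inj; rewrite /= ZGH_actM. Qed.

Definition Delta : gmodule int G :=
  GModule Delta_act_linear Delta_act1 Delta_actM.

End AugmentationKernel.

Section RelativeCohomology.
Context (R : pzRingType) (G : groupType) (H : groupClosed G).

(* H^i(G, H; M) is not zero. It is zero for i = 0. *)
Definition relative_cohomology_neq0 (i : nat) (M : gmodule R G) : Prop :=
  exists n, i = n.+1 /\
    exists (D : gmodule R G) (iota : Delta H -> D),
      is_tensor iota /\ Ext_neq0 n D M.

Definition relative_cd (K : realType) : \bar K :=
  ereal_sup [set (i%:R)%:E | i in
               [set i | exists M, relative_cohomology_neq0 i M]].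

End RelativeCohomology.

(* Main.v *)
(** BCP makes the coned-off graph fine: a bounded walk between neighbours of a
    cone vertex which avoids that vertex joins points at bounded word distance.
    Hence the vertices of a coned-off geodesic are transition points, close to
    every other geodesic path between the same cosets.  If the image of a coset
    under a quasi-isometry were far from every coset, these transition points
    would separate the asymptotic cone of the peripheral subgroup, which has no
    cut point.  So a quasi-isometry can be adjusted to one which,
    together with a quasi-inverse, maps cosets into cosets.

    Gluing combinatorial horoballs to the cosets yields a hyperbolic graph with
    vertex set [G * nat], on which G acts freely.  Its Rips complex and that of
    each horoball are acyclic, so that the alternating chains of the Rips complex
    modulo the simplices lying over one coset resolve the kernel of the
    augmentation of R[G/H].  A simplex lying over two cosets has bounded depth, so the
    resolution has finite length, and without R-torsion its terms are
    projective, by averaging over the stabilizers of unordered simplices.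

    In the top degree Ext is nonzero with coefficients in some module of
    finitely supported functions from G to M, that is, on relative cochains
    finitely supported with values in M.  Such cochains pull back along a proper
    map of cusped graphs, and the prism homotopy makes the pull-backs inverse to
    each other in cohomology; the group action on M plays no role. *)

From HB Require Import structures.
Require Import Defs.
From mathcomp Require Import all_boot all_order all_algebra.
From mathcomp Require Import all_classical all_reals all_analysis.
From mathcomp Require Import freeg zify ring lra.

Set Implicit Arguments.
Unset Strict Implicit.
Unset Printing Implicit Defensive.

Import Order.TTheory GRing.Theory Num.Theory.
Import numFieldNormedType.Exports.

(** * Hyperbolic graphs *)

(** A quasi-isometry says nothing about the actions of the two groups on coefficients, so cochains
    with values in an arbitrary module cannot be transported. An equivariant map from relative
    chains to finitely supported functions [G -> M], however, amounts to an [R]-linear map to [M]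
    that sees only finitely many simplices: evaluate at 1, and conversely spread over the
    translates. This correspondence requires finitely many orbits of simplices in each degree, which
    is why the simplices over one coset are divided out. The passage to such coefficients is a right
    exactness argument that relies on vanishing one degree higher; therefore only the largest
    degrees with nonzero Ext are compared.

    Transport enlarges the Rips parameter, so three parameters are in play. Nothing is lost, because
    the inclusion of one Rips complex into a larger one induces a chain map between resolutions of
    the same module.

    Lengths in the coned-off graph are doubled to make them natural numbers, and hyperbolicity is
    always the four-point inequality, so that the metric estimates become linear arithmetic. *)

Section Walks.
Context (V : eqType) (E : rel V) (wt : V -> V -> nat).

Fixpoint wlen (u : V) (s : seq V) : nat :=
  if s is v :: s' then wt u v + wlen v s' else 0.

Lemma wlen_cat u s1 s2 : wlen u (s1 ++ s2) = wlen u s1 + wlen (last u s1) s2.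
Proof. by elim: s1 u => //= v s1 IH u; rewrite IH addnA. Qed.

(** The path metric, specified by two properties: no walk is shorter, and some walk attains the
    value. Weights are needed because edges of the coned-off graph have two lengths. *)
Definition graph_metric (d : V -> V -> nat) : Prop :=
  (forall u s, path E u s -> d u (last u s) <= wlen u s) /\
  (forall u v, exists s, [/\ path E u s, last u s = v & wlen u s = d u v]).

Lemma graph_metric_exists :
  (forall u v, exists s, path E u s /\ last u s = v) ->
  exists d, graph_metric d.
Proof.
move=> conn.
have H u v : exists n, (exists s, [/\ path E u s, last u s = v & wlen u s = n]) /\
    forall s, path E u s -> last u s = v -> n <= wlen u s.
  have [s [ps ls]] := conn u v.
  pose P n := `[< exists s, [/\ path E u s, last u s = v & wlen u s = n] >].
  have exP : exists n, P n by exists (wlen u s); apply/asboolP; exists s.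
  exists (ex_minn exP); case: ex_minnP => n /asboolP Pn nmin; split=> // t pt lt.
  by apply: nmin; apply/asboolP; exists t.
have [d dP] := choice (fun p : V * V => H p.1 p.2).
exists (fun u v => d (u, v)); split=> [u s ps|u v].
- exact: (dP (u, last u s)).2.
- exact: (dP (u, v)).1.
Qed.

End Walks.

Section GraphMetric.
Context (V : eqType) (E : rel V) (wt : V -> V -> nat) (wm : nat).
Context (d : V -> V -> nat).
Hypothesis Esym : symmetric E.
Hypothesis wtC : forall u v, wt u v = wt v u.
Hypothesis wt_gt0 : forall u v, 0 < wt u v.
Hypothesis wt_le : forall u v, wt u v <= wm.+1.
Hypothesis dP : graph_metric E wt d.

Lemma gd_le u s : path E u s -> d u (last u s) <= wlen wt u s.
Proof. exact: dP.1. Qed.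

Lemma gd_refl u : d u u = 0.
Proof. by apply/eqP; rewrite -leqn0; exact: (@gd_le u [::]). Qed.

Lemma gd_tri v u w : d u w <= d u v + d v w.
Proof.
have [s [ps ls <-]] := dP.2 u v; have [t [pt lt <-]] := dP.2 v w.
rewrite -ls in pt lt *; have := @gd_le u (s ++ t).
by rewrite cat_path ps pt last_cat lt wlen_cat => /(_ isT).
Qed.

Lemma gd_adj u v : E u v -> d u v <= wt u v.
Proof. by move=> uv; have := @gd_le u [:: v]; rewrite /= uv addn0; apply. Qed.

Lemma rev_walk u s : path E u s ->
  [/\ path E (last u s) (rev (belast u s)), last (last u s) (rev (belast u s)) = u &
      wlen wt (last u s) (rev (belast u s)) = wlen wt u s].
Proof.
move=> ps; split.
- by rewrite rev_path (eq_path (e' := E)) // => x y; rewrite Esym.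
- by case: s {ps} => //= v s; rewrite rev_cons last_rcons.
- elim: s u {ps} => //= v s IH u; rewrite rev_cons -cats1 wlen_cat IH /=.
  rewrite addn0 addnC; congr (_ + _); rewrite wtC; congr wt.
  by case: s {IH} => //= w s; rewrite rev_cons last_rcons.
Qed.

Lemma gd_sym u v : d u v = d v u.
Proof.
have le a b : d a b <= d b a.
  have [s [ps ls <-]] := dP.2 b a; have [ps' ls' ws'] := rev_walk ps.
  by have := gd_le ps'; rewrite ws' ls' ls.
by apply/eqP; rewrite eqn_leq !le.
Qed.

Lemma gd_eq0 u v : d u v = 0 -> u = v.
Proof.
have [[|w s] [_ ls <-]] := dP.2 u v; first by [].
by move=> /=; have := wt_gt0 u w; lia.
Qed.

Definition geod (u : V) (s : seq V) : bool :=
  path E u s && (wlen wt u s == d u (last u s)).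

Lemma geod_exists u v : exists s, geod u s /\ last u s = v.
Proof. by have [s [ps ls ws]] := dP.2 u v; exists s; rewrite /geod ps ls ws /=. Qed.

Lemma geod_path u s : geod u s -> path E u s.
Proof. by case/andP. Qed.

Lemma geod_len u s : geod u s -> wlen wt u s = d u (last u s).
Proof. by case/andP => _ /eqP. Qed.

Lemma geod_cat u s1 s2 : geod u (s1 ++ s2) ->
  [/\ geod u s1, geod (last u s1) s2 &
  d u (last u s1) + d (last u s1) (last u (s1 ++ s2)) = d u (last u (s1 ++ s2))].
Proof.
rewrite /geod cat_path last_cat wlen_cat => /andP[/andP[p1 p2] /eqP e].
have := gd_le p1; have := gd_le p2; have := gd_tri (last u s1) u (last (last u s1) s2).
by rewrite p1 p2 /= => *; split; [apply/eqP| apply/eqP|]; lia.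
Qed.

Lemma geod_rev u s : geod u s -> geod (last u s) (rev (belast u s)).
Proof.
case/andP=> ps /eqP ws; have [ps' ls' ws'] := rev_walk ps.
by rewrite /geod ps' ws' ls' ws gd_sym /=.
Qed.

Lemma geod_split u s z : geod u s -> z \in u :: s ->
  exists s1 s2, [/\ s = s1 ++ s2, last u s1 = z, geod u s1 & geod z s2].
Proof.
move=> gs; rewrite in_cons => /orP[/eqP->|zs].
  by exists [::], s; rewrite gs /geod /= gd_refl.
case/splitPr: zs gs => s1 s2; rewrite -cat_rcons => gs.
exists (rcons s1 z), s2; have [] := geod_cat gs.
by rewrite last_rcons => -> -> _.
Qed.

Lemma geod_mem u s z : geod u s -> z \in u :: s ->
  d u z + d z (last u s) = d u (last u s).
Proof.
move=> gs zs; have [s1 [s2 [es l1 _ _]]] := geod_split gs zs.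
by move: gs; rewrite es => /geod_cat[_ _]; rewrite l1.
Qed.

Lemma geod_uniq u s : geod u s -> uniq (u :: s).
Proof.
elim: s u => //= v s IH u gs; have [_ gs' e] := geod_cat (s1 := [:: v]) gs.
rewrite IH // andbT; apply/negP => us.
have := geod_mem gs' us; rewrite /= in e *; rewrite (gd_sym v u).
by have := wt_gt0 u v; have := geod_len gs; have := geod_len gs'; rewrite /=; lia.
Qed.

(** Consecutive vertices of a geodesic are at most [wm.+1] apart, so some vertex overshoots a
    prescribed distance by at most [wm]. *)
Lemma geod_at u s t : geod u s -> t <= d u (last u s) ->
  exists2 z, z \in u :: s & t <= d u z <= t + wm.
Proof.
elim/last_ind: s => [|s v IH] gs; rewrite ?last_rcons.
  by rewrite /= => tle; exists u; rewrite ?inE //; move: tle; rewrite gd_refl; lia.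
move=> tle; have gs1 : geod u s by move: gs; rewrite -cats1 => /geod_cat[].
case: (leqP t (d u (last u s))) => [tle'|tgt].
  by have [z zs zt] := IH gs1 tle'; exists z; rewrite // -rcons_cons mem_rcons inE zs orbT.
exists v; first by rewrite -rcons_cons mem_rcons inE eqxx.
rewrite tle /=; move: gs; rewrite -cats1 => /geod_cat[_ g _].
have := gd_tri (last u s) u v; have := geod_len g; rewrite /= addn0 => <-.
by have := wt_le (last u s) v; lia.
Qed.

Lemma mid_point u v t : t <= d u v ->
  exists2 z, d u z + d z v = d u v & t <= d u z <= t + wm.
Proof.
have [s [gs <-]] := geod_exists u v.
by move=> /(geod_at gs)[z /(geod_mem gs) zs zt]; exists z.
Qed.

Section Hyperbolic.
Context (delta : nat).
Hypothesis hyp : forall x y z o,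
  d x z + d y o <= maxn (d x y + d z o) (d y z + d x o) + delta.

(** The four-point inequality at [x] is used twice along [x'], [y], [z], [x'']: the Gromov product
    of [x'] and [x''] is bounded below by the least of the three intermediate products. All products
    are doubled; [d x y + d x z - d y z] is that of [y] and [z]. *)
Lemma fellow x y z x' x'' :
  d x x' + d x' y = d x y -> d x x'' + d x'' z = d x z ->
  d x' x'' + minn (2 * d x x') (minn (2 * d x x'') (d x y + d x z - d y z))
    <= d x x' + d x x'' + 2 * delta.
Proof.
move=> e1 e2; have := hyp x' y z x; have := hyp x' z x'' x.
have := gd_tri x y z; move: (gd_sym y x) (gd_sym z x) (gd_sym x' x) (gd_sym x'' x)
  (gd_sym z x''); lia.
Qed.

(** [p] is compared with the vertex at the same distance from [x] on the side to [z], or with the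
    one at the same distance from [y], according to whether it comes before or after the Gromov
    product. *)
Lemma near_sides x y z p s t :
  d x p + d p y = d x y -> geod x s -> last x s = z -> geod z t -> last z t = y ->
  exists2 q, q \in x :: s ++ t & d p q <= 2 * delta + wm.
Proof.
move=> ep gs ls gt lt; have T1 := gd_tri x y z; have T2 := gd_tri y x z.
have T3 := gd_tri z x y.
move: (gd_sym y x) (gd_sym z x) (gd_sym z y) (gd_sym p y) => s1 s2 s3 s4.
case: (leqP (2 * d x p) (d x y + d x z - d y z)) => [le|gt'].
  have [|q qs qd] := geod_at gs (t := d x p); first by rewrite ls; lia.
  exists q; first by move: qs; rewrite !in_cons mem_cat => /orP[->|->]; rewrite ?orbT.
  have eq := geod_mem gs qs; rewrite ls in eq.
  by have := fellow ep eq; lia.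
have gr := geod_rev gt; rewrite lt in gr.
have lr : last y (rev (belast z t)) = z.
  by rewrite -{1}lt; case: (rev_walk (geod_path gt)).
have [|q qs qd] := geod_at gr (t := d y p); first by rewrite lr; lia.
exists q.
  move: qs; rewrite -lt -mem_rev rev_cons revK -lastI in_cons => /orP[/eqP->|qt].
    by rewrite -ls -cat_cons mem_cat mem_last.
  by rewrite in_cons mem_cat qt !orbT.
have eq := geod_mem gr qs; rewrite lr in eq.
have ep' : d y p + d p x = d y x by rewrite (gd_sym y p) (gd_sym p x); lia.
by have := fellow ep' eq; lia.
Qed.

End Hyperbolic.

(** * Replacing geodesic polygons by short walks that avoid a vertex *)

Section Detour.
Context (delta : nat).
Hypothesis hyp : forall x y z o,
  d x z + d y o <= maxn (d x y + d z o) (d y z + d x o) + delta.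
Context (o : V).

Definition seg (u w : V) : Prop :=
  exists s, [/\ geod u s, last u s = w & o \notin u :: s].

Inductive poly : nat -> V -> V -> Prop :=
| poly_nil u : poly 0 u u
| poly_cons k u v w : seg u v -> poly k v w -> poly k.+1 u w.

Definition awalk (n : nat) (u w : V) : Prop :=
  exists s, [/\ path E u s, last u s = w, wlen wt u s <= n & o \notin u :: s].

Lemma seg_neq u w : seg u w -> u != o /\ w != o.
Proof.
case=> s [_ <- os]; split; apply: contra os => /eqP <-; first by rewrite mem_head.
exact: mem_last.
Qed.

Lemma seg_sym u w : seg u w -> seg w u.
Proof.
case=> s [gs <- os]; exists (rev (belast u s)); split; first exact: geod_rev.
  by case: (rev_walk (geod_path gs)).
by rewrite -mem_rev rev_cons revK -lastI.
Qed.

Lemma seg_refl u : u != o -> seg u u.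
Proof. by move=> uo; exists [::]; rewrite /geod /= gd_refl inE eq_sym. Qed.

Lemma poly1 u w : seg u w -> poly 1 u w.
Proof. by move=> s; apply: poly_cons s (poly_nil _). Qed.

Lemma poly_cat k l u v w : poly k u v -> poly l v w -> poly (k + l) u w.
Proof.
by elim=> // {k u v} k u v v' s p IH pl; apply: poly_cons s _; exact: IH.
Qed.

Lemma awalk_cat n m u v w : awalk n u v -> awalk m v w -> awalk (n + m) u w.
Proof.
case=> s [ps ls ws os] [t [pt lt ws' ot]]; exists (s ++ t).
rewrite cat_path ps ls pt last_cat ls lt wlen_cat ls leq_add //; split=> //.
move: os ot; rewrite !in_cons mem_cat !negb_or => /andP[-> ->] /andP[_ ->].
by [].
Qed.

Lemma awalk_le n m u w : n <= m -> awalk n u w -> awalk m u w.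
Proof. by move=> nm [s [? ? ? ?]]; exists s; split=> //; lia. Qed.

Lemma awalk_far u w : d u w < d o u -> awalk (d u w) u w.
Proof.
move=> h; have [s [gs ls]] := geod_exists u w; exists s; split=> //.
- exact: geod_path.
- by rewrite (geod_len gs) ls.
apply/negP => os; have := geod_mem gs os; rewrite ls (gd_sym u o); lia.
Qed.

Lemma awalk_sub u s z z' : geod u s -> o \notin u :: s ->
  z \in u :: s -> z' \in u :: s -> awalk (d z z') z z'.
Proof.
wlog lezz' : z z' / d u z <= d u z'.
  move=> W gs os zs z's; case: (leqP (d u z) (d u z')) => [|/ltnW] le; first exact: W.
  have [t [pt lt wt' ot]] := W _ _ le gs os z's zs.
  have [pr lr wr] := rev_walk pt; rewrite lt in pr lr wr.
  exists (rev (belast z' t)); rewrite pr lr wr gd_sym; split=> //.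
  by rewrite -lt -mem_rev rev_cons revK -lastI.
move=> gs os zs z's; have [s1 [s2 [es l1 g1 g2]]] := geod_split gs zs.
have z's2 : z' \in z :: s2.
  move: z's; rewrite es in_cons mem_cat => /orP[/eqP e|/orP[zs1|zs2]]; last by rewrite in_cons zs2 orbT.
    have /gd_eq0 e' : d u z = 0 by move: lezz'; rewrite e gd_refl; lia.
    by rewrite e -e' mem_head.
  have z'u : z' \in u :: s1 by rewrite in_cons zs1 orbT.
  have := geod_mem g1 z'u; rewrite l1 => e.
  have /gd_eq0 -> : d z' z = 0 by lia.
  exact: mem_head.
have [t1 [t2 [et lt1 gt1 gt2]]] := geod_split g2 z's2.
exists t1; split=> //; first exact: geod_path.
  by rewrite (geod_len gt1) lt1.
apply: contra os; rewrite es et in_cons => /orP[/eqP->|ot1].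
  by rewrite -l1 -cat_cons mem_cat mem_last.
by rewrite in_cons !mem_cat ot1 !orbT.
Qed.

(** Large enough that a geodesic of length at most [2 * delta + 2 * wm] starting at this distance
    from [o] cannot reach [o]. *)
Definition detour_radius := 4 * delta + 4 * wm + 1.

(** Projection to the ball of radius [detour_radius] about [o]: points of the ball stay, all others
    move along a geodesic towards [o], with slack [wm] because only vertices are available. *)
Definition is_proj (a z : V) : Prop :=
  (d o a <= detour_radius /\ z = a) \/
  [/\ detour_radius < d o a, detour_radius <= d o z <= detour_radius + wm &
      d o z + d z a = d o a].

Lemma is_proj_exists a : exists z, is_proj a z.
Proof.
case: (leqP (d o a) detour_radius) => h; first by exists a; left.
by have [z e zt] := mid_point (ltnW h); exists z; right.
Qed.

Definition detour_len := 10 * detour_radius + 10 * wm.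

(** When the Gromov product of [a] and [b] at [o] is less than the radius, the geodesic from [a] to
    [o] follows the side from [a] to [b] until it reaches the ball. The short walk from the
    projection to the side stays away from [o]. *)
Lemma proj_near_seg a b s a' : geod a s -> last a s = b -> o \notin a :: s ->
  is_proj a a' -> d o a + d o b - d a b < 2 * detour_radius ->
  exists2 u, u \in a :: s & d a' u <= 2 * delta + wm /\ awalk (2 * delta + wm) a' u.
Proof.
move=> gs ls os [[_ ->] _|[h1 h2 h3] h4].
  exists a; rewrite ?mem_head // gd_refl; split=> //; exists [::]; split=> //=.
  by move: os; rewrite in_cons negb_or inE => /andP[].
have T := gd_tri o a b; have T2 := gd_tri b o a.
move: (gd_sym a' a) (gd_sym a o) (gd_sym a' o) (gd_sym b o) (gd_sym a b) => *.
have [|u us ud] := geod_at gs (t := d a a'); first by rewrite ls; lia.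
have e := geod_mem gs us; rewrite ls in e.
have e' : d a a' + d a' o = d a o by lia.
have F := fellow hyp e' e.
have le : d a' u <= 2 * delta + wm by lia.
exists u => //; split=> //; apply: awalk_le (awalk_far _) => //.
by rewrite /detour_radius in h1 h2 *; lia.
Qed.

(** If the Gromov product of [a] and [b] at [o] is large, the geodesics from [o] to [a] and [b]
    fellow-travel and the projections are close to each other. Otherwise both projections are close
    to the side, and the piece of the side between them is short, however long the side is. *)
Lemma detour a b a' b' : seg a b -> is_proj a a' -> is_proj b b' ->
  awalk detour_len a' b'.
Proof.
move=> sab pa pb; case: (leqP (2 * detour_radius) (d o a + d o b - d a b)) => h.
  have T1 := gd_tri b o a; have T2 := gd_tri a o b.
  move: (gd_sym a b) => *.
  have ha : detour_radius <= d o a' <= detour_radius + wm /\ d o a' + d a' a = d o a.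
    by case: pa => [[? ->]|[? ? ?]]; rewrite ?gd_refl; lia.
  have hb : detour_radius <= d o b' <= detour_radius + wm /\ d o b' + d b' b = d o b.
    by case: pb => [[? ->]|[? ? ?]]; rewrite ?gd_refl; lia.
  have F := fellow hyp ha.2 hb.2.
  have le : d a' b' <= 2 * delta + 2 * wm by lia.
  apply: awalk_le (awalk_far _); rewrite /detour_len /detour_radius in ha hb *; lia.
have [s [gs ls os]] := sab; have gr := geod_rev gs; rewrite ls in gr.
have mr : b :: rev (belast a s) =i a :: s.
  by move=> v; rewrite -[in LHS]ls -mem_rev rev_cons revK -lastI.
have lr : last b (rev (belast a s)) = a.
  by rewrite -{1}ls; case: (rev_walk (geod_path gs)).
have or : o \notin b :: rev (belast a s) by rewrite mr.
have [u us [du wu]] := proj_near_seg gs ls os pa h.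
have [|u' us' [du' wu']] := proj_near_seg gr lr or pb.
  by rewrite addnC (gd_sym b a).
rewrite mr in us'; have w := awalk_sub gs os us us'.
have wu'' : awalk (2 * delta + wm) u' b'.
  have [r [pr lr' wr or']] := wu'; have [pr' lr'' wr'] := rev_walk pr.
  exists (rev (belast b' r)); rewrite lr' in pr' lr'' wr'; split=> //; first by rewrite wr'.
  by rewrite -lr' -mem_rev rev_cons revK -lastI.
apply: awalk_le (awalk_cat (awalk_cat wu w) wu'').
have ha : d o a' <= detour_radius + wm by case: pa => [[? ->]|[? ? ?]]; lia.
have hb : d o b' <= detour_radius + wm by case: pb => [[? ->]|[? ? ?]]; lia.
have T1 := gd_tri a' u u'; have T2 := gd_tri o a' u'; have T3 := gd_tri b' o u'.
move: (gd_sym a' u) (gd_sym a' o) => *.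
by rewrite /detour_len /detour_radius in ha hb h *; lia.
Qed.

(** Project all corners to the ball and join consecutive projections. The ends already lie in the
    ball and are fixed. *)
Lemma poly_detour k u w : poly k u w -> u != o -> w != o ->
  d o u <= detour_radius -> d o w <= detour_radius -> awalk (k * detour_len) u w.
Proof.
move=> p uo wo du dw; have [f fP] := choice is_proj_exists.
have fE v : d o v <= detour_radius -> f v = v.
  by case: (fP v) => [[_ ->]//|[]]; lia.
suff : awalk (k * detour_len) (f u) (f w) by rewrite !fE.
elim: p uo => {k u w wo du dw} [v vo|k u v w s _ IH _].
  by exists [::]; split=> //; rewrite inE; case: (fP v) => [[? ->]|[]];
    rewrite /detour_radius 1?eq_sym //; case: eqP => // <-; rewrite gd_refl; lia.
have [uo vo] := seg_neq s.
by rewrite mulSn; apply: awalk_cat (IH vo); apply: detour s _ _.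
Qed.

End Detour.
End GraphMetric.

(** * A criterion for hyperbolicity by guessing geodesics *)

Section GuessingGeodesics.
Context (V : eqType) (E : rel V) (d : V -> V -> nat).
Hypothesis Esym : symmetric E.
Let wt (u v : V) := 1.
Hypothesis dP : graph_metric E wt d.
Let wtC u v : wt u v = wt v u. Proof. by []. Qed.

Lemma unit_wlen u s : wlen wt u s = size s.
Proof. by elim: s u => //= v s IH u; rewrite IH. Qed.

Lemma unit_geod_size u s : geod E wt d u s -> size s = d u (last u s).
Proof. by move=> gs; rewrite -(geod_len gs) unit_wlen. Qed.

Let dC := gd_sym Esym wtC dP.
Let tri := gd_tri dP.

Section Criterion.
Context (L : V -> V -> V -> Prop) (h : nat).
Hypothesis h_gt0 : 0 < h.
Hypothesis L_conn : forall u w, exists s,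
  [/\ path (fun a b => d a b <= h) u s, last u s = w &
      forall p, p \in u :: s -> L u w p].
Hypothesis L_thin : forall u v w p, L u w p ->
  exists2 q, L u v q \/ L v w q & d p q <= h.
Hypothesis L_short : forall u w p, d u w <= 1 -> L u w p -> d p u <= h.

(** Halve the path: thinness of the triangle over its middle vertex moves the point by at most [h],
    and [m] halvings reach a single edge. *)
Lemma guess_log m u s p : path E u s -> size s <= 2 ^ m -> L u (last u s) p ->
  exists2 q, q \in u :: s & d p q <= h * m.+1.
Proof.
elim: m u s p => [|m IH] u s p ps szs Lp.
  exists u; rewrite ?mem_head // muln1; apply: L_short Lp.
  by have := gd_le dP ps; rewrite unit_wlen; lia.
have es := cat_take_drop (2 ^ m) s; set s1 := take _ s in es; set s2 := drop _ s in es.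
move: ps Lp; rewrite -es cat_path last_cat => /andP[p1 p2] Lp.
have sz1 : size s1 <= 2 ^ m by rewrite size_take_min geq_minl.
have sz2 : size s2 <= 2 ^ m by rewrite size_drop; move: szs; rewrite expnS; lia.
have [q [Lq|Lq] dq] := L_thin (last u s1) Lp.
  have [r r1 dr] := IH _ _ _ p1 sz1 Lq; exists r; last by have := tri q p r; lia.
  by rewrite -cat_cons mem_cat r1.
have [r r2 dr] := IH _ _ _ p2 sz2 Lq; exists r; last by have := tri q p r; lia.
move: r2; rewrite -cat_cons mem_cat !in_cons => /orP[/eqP->|->]; last by rewrite orbT.
by rewrite -in_cons mem_last.
Qed.

Definition guess_bound n t := forall u s, geod E wt d u s -> size s <= n ->
  forall p, L u (last u s) p -> exists2 q, q \in u :: s & d p q <= t.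

(** A long [s1] is cut [t + 3 * h + 1] edges before its end. If the point is near the guess for the
    final piece, this piece is short enough for the logarithmic bound. Otherwise the assumed bound
    [t] yields a vertex of the initial piece, which is farther than [t + 3 * h] from the end. *)
Lemma guess_left n t m u s1 s2 p r :
  guess_bound n t -> geod E wt d u (s1 ++ s2) -> size (s1 ++ s2) <= n ->
  t + 3 * h + 1 <= 2 ^ m -> L u (last u s1) r -> d p r <= 2 * h ->
  (exists2 q, q \in u :: s1 & d p q <= 4 * h + h * m) \/
  (exists2 a, a \in u :: s1 & d p a <= t + 3 * h /\ t + 3 * h < d a (last u s1)).
Proof.
move=> B gs szs Ym Lr dr; have [g1 g2 _] := geod_cat dP gs.
have [le|gt] := leqP (size s1) (2 ^ m).
  have [q qs dq] := guess_log (geod_path g1) le Lr.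
  by left; exists q => //; have := tri r p q; rewrite mulnS in dq; lia.
pose k := size s1 - (t + 3 * h + 1).
have es := cat_take_drop k s1; set s3 := take _ s1 in es; set s4 := drop _ s1 in es.
have sz4 : size s4 = t + 3 * h + 1 by rewrite size_drop /k; lia.
have g3 := g1; rewrite -es in g3; have [g31 g32 _] := geod_cat dP g3.
have ly : last u s1 = last (last u s3) s4 by rewrite -es last_cat.
have [q Lq dq] := L_thin (last u s3) Lr.
case: Lq => [Lq|Lq]; last first.
  rewrite ly in Lq.
  have [|q' qs dq'] := guess_log (geod_path g32) _ Lq (m := m); first by lia.
  left; exists q'; last by have := tri r p q'; have := tri q r q'; rewrite mulnS in dq'; lia.
  move: qs; rewrite -[in X in _ -> X]es in_cons => /orP[/eqP->|qs].
    by rewrite -cat_cons mem_cat mem_last.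
  by rewrite -cat_cons mem_cat qs orbT.
have [|a as3 da] := B _ _ g31 _ _ Lq.
  by move: szs; rewrite size_cat -es size_cat; lia.
right; exists a; first by rewrite -es -cat_cons mem_cat as3.
split; first by have := tri r p a; have := tri q r a; lia.
have e1 := geod_mem dP g31 as3.
have a1 : a \in u :: s1 by rewrite -es -cat_cons mem_cat as3.
have e2 := geod_mem dP g1 a1.
have y1 : last u s3 \in u :: s1 by rewrite -es -cat_cons mem_cat mem_last.
have e3 := geod_mem dP g1 y1; have := unit_geod_size g32.
by rewrite -ly sz4; lia.
Qed.

Lemma guess_right n t m z s2 p r :
  guess_bound n t -> geod E wt d z s2 -> size s2 <= n ->
  t + 3 * h + 1 <= 2 ^ m -> L z (last z s2) r -> d p r <= 2 * h ->
  (exists2 q, q \in z :: s2 & d p q <= 4 * h + h * m) \/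
  (exists2 a, a \in z :: s2 & d p a <= t + 3 * h /\ t + 3 * h < d z a).
Proof.
move=> B g1 szs Ym Lr dr.
have [le|gt] := leqP (size s2) (2 ^ m).
  have [q qs dq] := guess_log (geod_path g1) le Lr.
  by left; exists q => //; have := tri r p q; rewrite mulnS in dq; lia.
pose k := t + 3 * h + 1.
have es := cat_take_drop k s2; set s3 := take _ s2 in es; set s4 := drop _ s2 in es.
have sz3 : size s3 = t + 3 * h + 1 by rewrite size_take_min /k; lia.
have g3 := g1; rewrite -es in g3; have [g31 g32 _] := geod_cat dP g3.
have ly : last z s2 = last (last z s3) s4 by rewrite -es last_cat.
have [q Lq dq] := L_thin (last z s3) Lr.
case: Lq => [Lq|Lq].
  have [|q' qs dq'] := guess_log (geod_path g31) _ Lq (m := m); first by lia.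
  left; exists q'; last by have := tri r p q'; have := tri q r q'; rewrite mulnS in dq'; lia.
  by rewrite -es -cat_cons mem_cat qs.
rewrite ly in Lq.
have [|a as4 da] := B _ _ g32 _ _ Lq.
  by move: szs; rewrite -es size_cat; lia.
have a1 : a \in z :: s2.
  rewrite -es -cat_cons mem_cat; move: as4; rewrite in_cons => /orP[/eqP->|->].
    by rewrite mem_last.
  by rewrite orbT.
right; exists a => //.
split; first by have := tri r p a; have := tri q r a; lia.
have e1 := geod_mem dP g32 as4.
have e2 := geod_mem dP g1 a1.
have y1 : last z s3 \in z :: s2 by rewrite -es -cat_cons mem_cat mem_last.
have e3 := geod_mem dP g1 y1; have := unit_geod_size g31.
by rewrite -ly in e1; rewrite sz3; lia.
Qed.

(** Improves a bound to about its logarithm. [z] is the last vertex before the guess from [u] comes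
    close to [p], so [p] is close to [z] itself or to the guesses on both sides of it. If neither
    side gave the logarithmic bound, [p] would be within [t + 3 * h] of two vertices of the geodesic
    on different sides of [z], each farther than this from [z]; passing through [p] would shorten
    the geodesic. *)
Lemma guess_step n t m : guess_bound n t -> t + 3 * h + 1 <= 2 ^ m ->
  guess_bound n (4 * h + h * m).
Proof.
move=> B Ym u s gs szs p Lp.
pose A k := `[< exists2 q, L u (last u (take k s)) q & d p q <= h >].
have exA : exists k, A k.
  by exists (size s); apply/asboolP; rewrite take_size; exists p; rewrite ?(gd_refl dP).
case: (ex_minnP exA) => k /asboolP Ak kmin.
case: k Ak kmin => [|k] [q Lq dq] kmin.
  exists u; rewrite ?mem_head //; rewrite take0 /= in Lq.
  have := L_short _ Lq; rewrite (gd_refl dP) => /(_ isT).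
  by have := tri q p u; lia.
have es := cat_take_drop k s; set s1 := take k s in es; set s2 := drop k s in es.
set z := last u s1.
have Bz : exists2 q, L z (last u s) q & d p q <= h.
  have [q' [Lq'|Lq'] dq'] := L_thin z Lp; last by exists q'.
  by have /kmin : A k; [apply/asboolP; exists q' | rewrite ltnn].
have zs : z \in u :: s by rewrite -es -cat_cons mem_cat mem_last.
have near_z w : d p w <= 2 * h -> (L u z w) \/ d p z <= 4 * h -> 
   L u z w \/ exists2 q, q \in u :: s & d p q <= 4 * h + h * m.
  by move=> _ [?|?]; [left | right; exists z => //; lia].
have [r Lr dr] : exists2 r, L u z r \/ d p z <= 4 * h & d p r <= 2 * h.
  have [r [Lr|Lr] dr] := L_thin z Lq; exists r; try (by have := tri q p r; lia).
    by left.
  right; have [lt|ge] := ltnP k (size s); last first.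
    by move: Lr; rewrite take_oversize; [|lia]; rewrite /z /s1 take_oversize // => Lr;
       have := L_short _ Lr; rewrite (gd_refl dP) => /(_ isT);
       have := tri q p (last u s); have := tri r q (last u s); lia.
  have := L_short _ Lr; have := tri q p z; have := tri r q z.
  suff : d z (last u (take k.+1 s)) <= 1 by move=> le1 H1 H2 /(_ le1); lia.
  rewrite (take_nth u) // last_rcons.
  have : path E z s2 by move: (geod_path gs); rewrite -es cat_path => /andP[].
  rewrite /s2 (drop_nth u) //= => /andP[Ez _].
  by have := gd_adj dP Ez.
case: (near_z _ dr Lr) => [Lur|//].
have gs' := gs; rewrite -es in gs'; have szs' := szs; rewrite -es in szs'.
have [[q' qs dq']|[a as1 [da la]]] := guess_left B gs' szs' Ym Lur dr.
  by exists q' => //; rewrite -es -cat_cons mem_cat qs.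
have [_ g2 _] := geod_cat dP gs'.
have [r' Lr' dr'] := Bz.
have lz : last z s2 = last u s by rewrite -es last_cat.
rewrite -lz in Lr'.
have sz2 : size s2 <= n by move: szs'; rewrite size_cat; lia.
have dr2 : d p r' <= 2 * h by lia.
have [[q' qs dq']|[b bs2 [db lb]]] := guess_right B g2 sz2 Ym Lr' dr2.
  exists q' => //; move: qs; rewrite -[in X in _ -> X]es in_cons => /orP[/eqP->|qs].
    by rewrite -cat_cons mem_cat mem_last.
  by rewrite -cat_cons mem_cat qs orbT.
have [g1 _ _] := geod_cat dP gs'.
have e1 := geod_mem dP g1 as1; have e2 := geod_mem dP g2 bs2; rewrite lz in e2.
have e3 := geod_mem dP gs zs; rewrite -/z in e1 la e2 lb.
have := tri p a b; have := tri a u b; have := tri b u (last u s).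
move: (dC p a) (dC p b); lia.
Qed.

(** [m] is about [t / h]. Then [2 ^ m] exceeds the square of [m / 2], hence [t + 3 * h] once [t] is
    large. *)
Lemma guess_growth : exists K, forall t, K <= t ->
  exists2 m, t + 3 * h + 1 <= 2 ^ m & 4 * h + h * m < t.
Proof.
exists (h * (2 * (4 * h + 20) + 1) + 4 * h + 2) => t tK.
pose m := (t - 1 - 4 * h) %/ h; exists m; last first.
  have := leq_trunc_div (t - 1 - 4 * h) h; rewrite -/m (mulnC m h); lia.
have lt : t - 1 - 4 * h < h * m.+1.
  by rewrite (mulnC h) -ltn_divLR.
pose k := m %/ 2; have k1 : 2 * k <= m <= 2 * k + 1 by rewrite /k; lia.
have k2 : 4 * h + 20 <= k.
  rewrite leqNgt; apply/negP => kl.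
  have : h * m.+1 <= h * (2 * (4 * h + 20)) by rewrite leq_mul2l; apply/orP; right; lia.
  lia.
have k3 : k.+1 <= 2 ^ k by exact: ltn_expl.
have : 2 ^ (k + k) <= 2 ^ m by rewrite leq_pexp2l //; lia.
have : k.+1 * k.+1 <= 2 ^ (k + k) by rewrite expnD leq_mul.
have : (4 * h + 20) * k.+1 <= k.+1 * k.+1 by rewrite leq_mul2r; apply/orP; right; lia.
have : h * m.+1 <= h * (2 * k + 2) by rewrite leq_mul2l; apply/orP; right; lia.
move: (2 ^ (k + k)) (2 ^ m) => X Y; nia.
Qed.

(** The initial bound depends on the length of the geodesic, but it can be lowered as long as it
    exceeds [K]. *)
Lemma guess_near_geod : exists K, forall u s, geod E wt d u s ->
  forall p, L u (last u s) p -> exists2 q, q \in u :: s & d p q <= K.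
Proof.
have [K KP] := guess_growth; exists K => u s gs.
suff H t : guess_bound (size s) t -> guess_bound (size s) K.
  apply: (H (h * (size s).+1)) => // {H} v r gr szr p Lp.
  by apply: (guess_log (geod_path gr) _ Lp); apply: leq_trans szr _; exact/ltnW/ltn_expl.
elim/ltn_ind: t => t IH B; have [le|/ltnW le] := leqP t K.
  by move=> v r gr szr p /(B _ _ gr szr)[q qs dq]; exists q => //; lia.
by have [m m1 m2] := KP _ le; apply: (IH _ m2); apply: guess_step B m1.
Qed.

Lemma chain_switch (r : rel V) (P Q : V -> Prop) u s :
  path r u s -> (forall p, p \in u :: s -> P p \/ Q p) -> P u -> Q (last u s) ->
  (exists2 p, p \in u :: s & P p /\ Q p) \/
  exists p q, [/\ p \in u :: s, q \in u :: s, P p, Q q & r p q].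
Proof.
elim: s u => [|v s IH] u /=; first by move=> _ _ Pu Qu; left; exists u; rewrite ?mem_head.
move=> /andP[ruv ps] PQ Pu Ql.
have [Pv|Qv] := PQ v (mem_behead (s := [:: u, v & s]) (mem_head _ _)); last first.
  by right; exists u, v; rewrite ?mem_head in_cons mem_head orbT.
have [|[p ps' H]|[p [q [p1 q1 H1 H2 H3]]]] := IH v ps _ Pv Ql.
- by move=> p ps'; apply: PQ; rewrite in_cons ps' orbT.
- by left; exists p; rewrite // in_cons ps' orbT.
- by right; exists p, q; rewrite in_cons p1 orbT in_cons q1 orbT.
Qed.

(** A connectedness argument: each point of the guessed chain is close to the part of the geodesic
    before [g] or to the part after it. Where the chain switches it is close to both, and therefore
    to [g]. *)
Lemma guess_geod_near : exists K, forall u s, geod E wt d u s ->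
  forall g, g \in u :: s -> exists2 p, L u (last u s) p & d g p <= K.
Proof.
have [K KP] := guess_near_geod; exists (3 * K + h) => u s gs g gin.
have [c [pc lc cL]] := L_conn u (last u s).
have [s1 [s2 [es l1 g1 g2]]] := geod_split dP gs gin.
have ls : last g s2 = last u s by rewrite es last_cat l1.
pose P p := exists2 a, d p a <= K & d u a + d a g = d u g.
pose Q p := exists2 a, d p a <= K & d g a + d a (last u s) = d g (last u s).
have PQ p : p \in u :: c -> P p \/ Q p.
  move=> /cL /(KP _ _ gs)[q]; rewrite es -cat_cons mem_cat => /orP[qs|qs] dq.
    by left; exists q => //; rewrite -l1; exact: (geod_mem dP g1).
  by right; exists q => //; rewrite -ls; apply: (geod_mem dP g2); rewrite in_cons qs orbT.
have Pu : P u by exists u; rewrite (gd_refl dP).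
have Ql : Q (last u c) by rewrite lc; exists (last u s); rewrite (gd_refl dP) ?addn0.
have emb := geod_mem dP gs gin.
have [[p pin [[a da ea] [b db eb]]]|[p [p' [pin p'in [a da ea] [b db eb] pp]]]] :=
  chain_switch pc PQ Pu Ql.
  exists p; first exact: cL.
  have := tri p a b; have := tri a u b; have := tri b u (last u s).
  have := tri a g p; have := tri a u (last u s).
  move: (dC p a) (dC p b) (dC g a); lia.
exists p; first exact: cL.
have := tri p a b; have := tri p' p b; have := tri a u b; have := tri b u (last u s).
have := tri a g p; have := tri a u (last u s).
move: (dC p a) (dC p b) (dC g a); lia.
Qed.

Lemma guess_thin : exists C, forall x y z r s t,
  geod E wt d x r -> last x r = y -> geod E wt d x s -> last x s = z ->
  geod E wt d z t -> last z t = y ->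
  forall g, g \in x :: r -> exists2 q, q \in x :: s \/ q \in z :: t & d g q <= C.
Proof.
have [K1 K1P] := guess_near_geod; have [K2 K2P] := guess_geod_near.
exists (K2 + h + K1) => x y z r s t gr lr gs ls gt lt g gin.
have [p Lp dp] := K2P _ _ gr _ gin; rewrite lr in Lp.
have [q Lq dq] := L_thin z Lp.
have [q' qs dq'] : exists2 q', q' \in x :: s \/ q' \in z :: t & d q q' <= K1.
  case: Lq => Lq.
    by rewrite -ls in Lq; have [q' ? ?] := K1P _ _ gs _ Lq; exists q'; [left|].
  by rewrite -lt in Lq; have [q' ? ?] := K1P _ _ gt _ Lq; exists q'; [right|].
by exists q' => //; have := tri p g q'; have := tri q p q'; lia.
Qed.

(** On a geodesic from [x] to [z] some vertex [g] is near both other sides of the triangle with [o],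
    so [d o g] is at most the Gromov product of [x] and [z] at [o] plus a constant. As [g] is also
    near a side that ends in [y], its distance from [o] is at least the Gromov product of the ends
    of that side, up to a constant. *)
Theorem guess_hyperbolic : exists delta, forall x y z o,
  d x z + d y o <= maxn (d x y + d z o) (d y z + d x o) + delta.
Proof.
have [C CP] := guess_thin; exists (6 * C + 2) => x y z o.
have [r [gr lr]] := geod_exists dP x z.
have [s [gs ls]] := geod_exists dP x o; have [t [gt lt]] := geod_exists dP o z.
have [s' [gs' ls']] := geod_exists dP x y; have [t' [gt' lt']] := geod_exists dP y z.
pose P g := exists2 q, d g q <= C & d x q + d q o = d x o.
pose Q g := exists2 q, d g q <= C & d o q + d q z = d o z.
have PQ g : g \in x :: r -> P g \/ Q g.
  move=> /(CP _ _ _ _ _ _ gr lr gs ls gt lt)[q [qs|qs] dq].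
    by left; exists q => //; rewrite -ls; exact: (geod_mem dP gs).
  by right; exists q => //; rewrite -lt; exact: (geod_mem dP gt).
have Px : P x by exists x; rewrite (gd_refl dP).
have Ql : Q (last x r) by rewrite lr; exists z; rewrite (gd_refl dP) ?addn0.
have [g gin H] : exists2 g, g \in x :: r &
    2 * d o g + d x z <= d o x + d o z + 4 * C + 2.
  have [[g gin [[a da ea] [b db eb]]]|[g [g' [gin g'in [a da ea] [b db eb] gg]]]] :=
    chain_switch (geod_path gr) PQ Px Ql; exists g => //.
    have := geod_mem dP gr gin; rewrite lr.
    have := tri g o a; have := tri a x g; have := tri b o g; have := tri b g z.
    have := tri a o g.
    move: (dC g a) (dC g b) (dC o a) (dC o x); lia.
  have := geod_mem dP gr gin; have := geod_mem dP gr g'in; rewrite lr.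
  have : d g g' <= 1 by have := gd_adj dP gg.
  have := tri a x g; have := tri b o g'; have := tri b g' z.
  have := tri a o g; have := tri g' o g; have := tri g' g z; have := tri g x g'.
  move: (dC g a) (dC g' b) (dC o a) (dC o x) (dC g g'); lia.
have [q [qs|qs] dq] := CP _ _ _ _ _ _ gr lr gs' ls' gt' lt' _ gin.
  have := geod_mem dP gs' qs; rewrite ls'.
  have := tri q o x; have := tri q o y; have := tri g o q.
  move: (dC o x) (dC q x) (dC y o) (dC o z); lia.
have := geod_mem dP gt' qs; rewrite lt'.
have := tri q o y; have := tri q o z; have := tri g o q.
move: (dC o x) (dC q y) (dC y o) (dC o z); lia.
Qed.

End Criterion.
End GuessingGeodesics.

Lemma nat_upper_bound (K : realType) (x : K) : exists n : nat, (x <= n%:R)%R.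
Proof.
exists (Num.bound `|x|%R); apply: le_trans (ler_norm x) _.
exact/ltW/archi_boundP.
Qed.

Lemma inf_min (K : realType) (A : set K) (m : K) :
  A m -> (forall x, A x -> (m <= x)%R) -> inf A = m.
Proof.
move=> Am mA; apply/eqP; rewrite eq_le; apply/andP; split.
  by apply: ge_inf => //; exists m => x /mA.
by apply: lb_le_inf => [|x /mA //]; exists m.
Qed.

(** * Fineness of the coned-off graph *)

Section WordMetricTheory.
Context (G : groupType) (S : seq G).

Definition cay : rel G := fun x y => (x^-1 * y)%g \in S.

Lemma word_path w x : {subset w <= S} ->
  [/\ path cay x (scanl (@monoid.mul G) x w), last x (scanl (@monoid.mul G) x w) = (x * \prod_(s <- w) s)%g &
      size (scanl (@monoid.mul G) x w) = size w].
Proof.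
elim: w x => [|s w IH] x sw; first by rewrite big_nil mulg1.
have [|p l e] := IH (x * s)%g; first by move=> t tw; apply: sw; rewrite in_cons tw orbT.
by rewrite /= big_cons e p l /cay mulKg sw ?mem_head //; split; rewrite ?mulgA.
Qed.

Lemma path_word x s : path cay x s -> exists2 w, word_in S w (x^-1 * last x s)%g & size w = size s.
Proof.
elim: s x => [|y s IH] x /=.
  by move=> _; exists [::] => //; split=> //; rewrite big_nil mulVg.
case/andP=> xy /IH[w [ws wp] sz]; exists ((x^-1 * y)%g :: w); last by rewrite /= sz.
split; first by move=> t; rewrite in_cons => /orP[/eqP->|/ws].
by rewrite big_cons wp mulgA mulgK.
Qed.

Hypothesis gS : generating_set S.

Lemma word_normP g : (exists2 w, word_in S w g & size w = word_norm S g) /\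
  (forall w, word_in S w g -> word_norm S g <= size w).
Proof.
rewrite /word_norm; case: xgetP => [n -> []//|] H; exfalso.
have [w ww] := gS.2 g.
pose P n := `[< exists2 w, word_in S w g & size w = n >].
have exP : exists n, P n by exists (size w); apply/asboolP; exists w.
case: (ex_minnP exP) => m /asboolP Pm mmin; apply: (H m); split=> // v vg.
by apply: mmin; apply/asboolP; exists v.
Qed.

Lemma cay_sym : symmetric cay.
Proof.
have le x y : cay x y -> cay y x.
  by rewrite /cay => /gS.1; rewrite invgM invgK.
by move=> x y; apply/idP/idP; apply: le.
Qed.

Lemma word_metric : graph_metric cay (fun _ _ => 1) (word_dist S).
Proof.
have sz u s : wlen (fun _ _ : G => 1) u s = size s by elim: s u => //= v s IH u; rewrite IH.
split=> [u s ps|u v].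
  by have [w ww szw] := path_word ps; rewrite sz -szw; apply: (word_normP _).2.
have [[w [ws wp] szw] _] := word_normP (u^-1 * v)%g.
have [p l e] := word_path u ws; exists (scanl (@monoid.mul G) u w); rewrite sz e szw; split=> //.
by rewrite l wp mulVKg.
Qed.

Lemma wd_refl x : word_dist S x x = 0. Proof. exact: gd_refl word_metric _. Qed.

Lemma wd_sym x y : word_dist S x y = word_dist S y x.
Proof. by apply: gd_sym cay_sym _ word_metric _ _. Qed.

Lemma wd_tri y x z : word_dist S x z <= word_dist S x y + word_dist S y z.
Proof. exact: gd_tri word_metric _ _ _. Qed.

Lemma wd_gen x y : (x^-1 * y)%g \in S -> word_dist S x y <= 1.
Proof. by move=> xy; have := gd_adj word_metric (u := x) (v := y) xy. Qed.

Lemma wd_walk x y : exists s, [/\ path cay x s, last x s = y & size s = word_dist S x y].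
Proof.
have [s [ps ls ws]] := word_metric.2 x y; exists s; split=> //.
by rewrite -ws; elim: s x {ps ls ws} => //= v s IH u; rewrite -IH.
Qed.

Lemma wd_le_walk x s : path cay x s -> word_dist S x (last x s) <= size s.
Proof.
move=> ps; have := gd_le word_metric ps.
suff -> : wlen (fun _ _ : G => 1) x s = size s by [].
by elim: s x {ps} => //= v s IH u; rewrite IH.
Qed.

Lemma wd_mull g x y : word_dist S (g * x)%g (g * y)%g = word_dist S x y.
Proof. by rewrite /word_dist invgM mulgA mulgVK. Qed.

Lemma wd_ball n : exists l : seq G, forall g, word_norm S g <= n -> g \in l.
Proof.
elim: n => [|n [l lP]].
  exists [:: 1%g] => g; have [[w [_ <-] <-] _] := word_normP g.
  by rewrite leqn0 => /nilP->; rewrite big_nil mem_head.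
exists (l ++ [seq (s * x)%g | s <- S, x <- l]) => g.
have [[w [ws wp] szw] _] := word_normP g; case: w ws wp szw => [|s w] ws wp szw.
  move=> _; rewrite mem_cat lP //; rewrite big_nil in wp.
  by rewrite -szw.
move=> le; rewrite mem_cat; apply/orP; right.
apply/allpairsP; exists (s, \prod_(s <- w) s)%g; split=> /=.
- by apply: ws; rewrite mem_head.
- apply: lP; apply: leq_trans ((word_normP _).2 w _) _; last by move: szw => /= szw; lia.
  by split=> // t tw; apply: ws; rewrite in_cons tw orbT.
- by rewrite -wp big_cons.
Qed.

Lemma wd_ball_at x n : exists l : seq G, forall y, word_dist S x y <= n -> y \in l.
Proof.
have [l lP] := wd_ball n; exists [seq (x * g)%g | g <- l] => y /lP yl.
by apply/mapP; exists (x^-1 * y)%g => //; rewrite mulVKg.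
Qed.

End WordMetricTheory.

Lemma word_dist_change (G : groupType) (S T : seq G) :
  generating_set S -> generating_set T ->
  exists C, forall x y, word_dist T x y <= C * word_dist S x y.
Proof.
move=> gS gT; pose C := \max_(s <- S) word_norm T s; exists C => x y.
have [s [ps <- <-]] := wd_walk gS x y.
elim: s x ps => [|z s IH] x /=; first by rewrite (wd_refl gT).
case/andP=> xz /IH le; have := wd_tri gT z x (last z s).
have : word_dist T x z <= C by rewrite /C /word_dist; apply: (leq_bigmax_seq (F := word_norm T)) xz _.
by rewrite mulnS; lia.
Qed.

Section ConedOff.
Context (K : realType) (G : groupType) (S : seq G) (H : groupClosed G).
Hypothesis gS : generating_set S.

Notation CV := (cone_vertex H).
Notation CE := (coned_adj S (H := H)).

(** Twice [coned_len], so that the vertex metric is integer valued. *)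
Definition cwt (u v : CV) : nat :=
  match u, v with inl _, inl _ => 2 | _, _ => 1 end.

Lemma cwtC u v : cwt u v = cwt v u. Proof. by case: u; case: v. Qed.
Lemma cwt_gt0 u v : 0 < cwt u v. Proof. by case: u; case: v. Qed.
Lemma cwt_le u v : cwt u v <= 1.+1. Proof. by case: u; case: v. Qed.

Lemma coned_lenE u v : coned_len K u v = ((cwt u v)%:R / 2)%R.
Proof. by case: u v => [x|c] [y|c'] //=; rewrite ?divff ?mul1r ?pnatr_eq0. Qed.

Lemma coned_walk_len u s : walk_len (@coned_len K G H) u s = ((wlen cwt u s)%:R / 2)%R.
Proof.
elim: s u => [|v s IH] u /=; first by rewrite mul0r.
by rewrite IH coned_lenE natrD mulrDl.
Qed.

Lemma coned_sym : symmetric CE.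
Proof.
case=> [x|c] [y|c'] //=; rewrite /cayley_adj eq_sym; congr (_ && _).
exact: (cay_sym gS).
Qed.

Lemma coned_cay x s : path (cay S) x s ->
  exists t, path CE (inl x) t /\ last (inl x : CV) t = inl (last x s).
Proof.
elim: s x => [|y s IH] x; first by exists [::].
case/andP=> xy /IH[t [pt lt]]; have [<-|nxy] := eqVneq y x; first by exists t.
exists (inl y :: t); split=> //; rewrite /= /cayley_adj eq_sym nxy pt andbT.
exact: xy.
Qed.

Lemma coned_conn (u v : CV) : exists s, path CE u s /\ last u s = v.
Proof.
have to_grp (a : CV) : exists x s, path CE (inl x) s /\ last (inl x : CV) s = a.
  case: a => [x|c]; first by exists x, [::].
  by exists (repr c), [:: inr c]; split=> //=; rewrite /coned_adj /coset_of reprK eqxx.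
have from_grp (a : CV) : exists x s, path CE a s /\ last a s = inl x.
  case: a => [x|c]; first by exists x, [::].
  by exists (repr c), [:: inl (repr c)]; split=> //=; rewrite /coset_of reprK eqxx.
have [x [s [ps ls]]] := from_grp u; have [y [t [pt lt]]] := to_grp v.
have [r [pr lr _]] := wd_walk gS x y; have [q [pq lq]] := coned_cay pr.
rewrite lr in lq; exists (s ++ q ++ t).
by rewrite !cat_path ps ls pq lq pt !last_cat ls lq lt.
Qed.

Lemma coned_metric_exists : exists d, graph_metric CE cwt d.
Proof. by apply: graph_metric_exists coned_conn. Qed.

Section Distance.
Context (dh : CV -> CV -> nat).
Hypothesis dhP : graph_metric CE cwt dh.

Lemma vertex_distE u v :
  vertex_dist CE (@coned_len K G H) u v = ((dh u v)%:R / 2)%R.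
Proof.
apply: inf_min.
  have [s [ps ls ws]] := dhP.2 u v; exists s; split=> //.
  by rewrite coned_walk_len ws.
move=> _ [s [ps <- ->]]; rewrite coned_walk_len ler_pM2r ?invr_gt0 ?ltr0n //.
by rewrite ler_nat; apply: dhP.1.
Qed.

Lemma graph_dist_vertex u v :
  graph_dist CE (@coned_len K G H) (u, u, 0%R) (v, v, 0%R) = ((dh u v)%:R / 2)%R.
Proof.
have nE a : ~~ CE a a by case: a => //= x; rewrite /cayley_adj eqxx.
apply: inf_min.
  right; exists u, v, 0%R, 0%R; split; rewrite ?vertex_distE ?addr0 ?add0r //.
  - by left.
  - by left.
move=> l [[[-> _ ->]|[]]|[a [b [l1 [l2 [ha hb ->]]]]]].
- by rewrite subrr normr0 (gd_refl dhP) mul0r.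
- by rewrite (negbTE (nE u)).
- case: ha => [[-> ->]|[]]; last by rewrite (negbTE (nE u)).
  case: hb => [[-> ->]|[]]; last by rewrite (negbTE (nE v)).
  by rewrite addr0 add0r vertex_distE.
Qed.

Lemma coned_hyperbolic : weakly_relatively_hyperbolic K S H ->
  exists delta, forall x y z o,
    dh x z + dh y o <= maxn (dh x y + dh z o) (dh y z + dh x o) + delta.
Proof.
(* The factor 4: true distances are half of [dh], and the Gromov product halves once more. *)
case=> delta0 hyp; have [delta le] := nat_upper_bound (4 * delta0)%R.
exists delta => x y z o.
have ong a : on_graph CE (@coned_len K G H) (a, a, 0%R) by right.
have := hyp _ _ _ _ (ong x) (ong y) (ong z) (ong o).
rewrite /gromov_product !graph_dist_vertex.
rewrite -(ler_nat K) !natrD.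
have -> : ((maxn (dh x y + dh z o) (dh y z + dh x o))%:R =
    Num.max ((dh x y)%:R + (dh z o)%:R) ((dh y z)%:R + (dh x o)%:R) :> K)%R.
  rewrite -!natrD; case: (leqP (dh x y + dh z o) (dh y z + dh x o)) => h.
    by rewrite max_r // ler_nat.
  by rewrite max_l // ler_nat ltnW.
rewrite minEle maxEle.
case: ifP => h1 h2; case: ifP => h3; lra.
Qed.

End Distance.
End ConedOff.

Section WalkAt.
Context (K : realType) (V : eqType) (E : rel V) (len : V -> V -> K).

Lemma walk_atP u s t : s != [::] -> (0 <= t <= walk_len len u s)%R ->
  exists s1 y s2, [/\ s = s1 ++ y :: s2,
    walk_at len u s t = (last u s1, y, (t - walk_len len u s1)%R) &
    (0 <= t - walk_len len u s1 <= len (last u s1) y)%R].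
Proof.
elim: s u t => // v s IH u t _ /= /andP[t0 t1]; case: ifP => [le|/negbT].
  by exists [::], v, s; rewrite /= subr0 t0 le.
rewrite -ltNge => gt.
have s0 : s != [::] by case: s t1 {IH} => //=; rewrite addr0 leNgt gt.
have [|s1 [y [s2 [-> -> h]]]] := IH v (t - len u v)%R s0.
  by rewrite subr_ge0 (ltW gt) lerBlDl.
by exists (v :: s1), y, s2; rewrite /= opprD addrA; split=> //.
Qed.

Lemma walk_at2 u s t t' : s != [::] -> (0 <= t)%R -> (t <= t')%R ->
  (t' <= walk_len len u s)%R ->
  (exists s1 y s2 r r', [/\ s = s1 ++ y :: s2, walk_at len u s t = (last u s1, y, r),
      walk_at len u s t' = (last u s1, y, r'),
      (0 <= r <= r')%R /\ (r' <= len (last u s1) y)%R & (t' - t = r' - r)%R]) \/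
  (exists s1 y s2 y' s3 r r', [/\ s = s1 ++ y :: s2 ++ y' :: s3,
      walk_at len u s t = (last u s1, y, r),
      walk_at len u s t' = (last y s2, y', r'),
      (0 <= r <= len (last u s1) y)%R /\ (0 <= r' <= len (last y s2) y')%R &
      (t' - t = len (last u s1) y - r + walk_len len y s2 + r')%R]).
Proof.
elim: s u t t' => // v s IH u t t' _ t0 tt' /= t'1.
case: ifP => [le|/negbT]; case: ifP => [le'|/negbT].
- by left; exists [::], v, s, t, t'; rewrite /= t0 tt' le'; split.
- rewrite -ltNge => gt'; right.
  have s0 : s != [::] by case: s t'1 {IH} => //=; rewrite addr0 leNgt gt'.
  have [|s2 [y [s3 [e w h]]]] := @walk_atP v s (t' - len u v)%R s0.
    by rewrite subr_ge0 (ltW gt') lerBlDl.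
  exists [::], v, s2, y, s3, t, (t' - len u v - walk_len len v s2)%R.
  split=> //=; [by rewrite e | by rewrite t0 le | lra].
- by rewrite -ltNge => gt; move: (lt_le_trans gt (le_trans tt' le')); rewrite ltxx.
rewrite -!ltNge => gt' gt.
have s0 : s != [::] by case: s t'1 {IH} => //=; rewrite addr0 leNgt gt'.
have [||| |] := IH v (t - len u v)%R (t' - len u v)%R s0; try by lra.
- case=> s1 [y [s2 [r [r' [-> -> -> h e]]]]]; left.
  by exists (v :: s1), y, s2, r, r'; split=> //=; lra.
- case=> s1 [y [s2 [y' [s3 [r [r' [-> -> -> h e]]]]]]]; right.
  by exists (v :: s1), y, s2, y', s3, r, r'; split=> //=; lra.
Qed.

End WalkAt.

Lemma inf_between (K : realType) (A : set K) (c l : K) :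
  A l -> (forall x, A x -> (c <= x)%R) -> (c <= inf A <= l)%R.
Proof.
move=> Al cA; apply/andP; split; first by apply: lb_le_inf => [|x /cA //]; exists l.
by apply: ge_inf => //; exists c => x /cA.
Qed.

(** * Short simple walks are quasi-geodesics *)

Section Fine.
Context (K : realType) (G : groupType) (S : seq G) (H : groupClosed G).
Context (dh : cone_vertex H -> cone_vertex H -> nat).
Hypothesis dhP : graph_metric (coned_adj S (H := H)) (@cwt G H) dh.
Hypothesis gS : generating_set S.
Hypothesis gH : forall h, h \in H -> exists w, word_in [seq s <- S | s \in H] w h.
Hypothesis bcp : bounded_coset_penetration K S H.

Notation CV := (cone_vertex H).
Notation CE := (coned_adj S (H := H)).
Notation len := (@coned_len K G H).

Lemma coned_irr : irreflexive CE.
Proof. by case=> //= x; rewrite /cayley_adj eqxx. Qed.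

Lemma vertex_dist_ge_half (a b : CV) : a != b -> (2^-1 <= vertex_dist CE len a b :> K)%R.
Proof.
rewrite (vertex_distE K dhP).
case: (posnP (dh a b)) => [/(gd_eq0 (@cwt_gt0 G H) dhP)->|gt0 _]; first by rewrite eqxx.
by rewrite -[leLHS]mul1r ler_pM2r ?invr_gt0 ?ltr0n // ler1n.
Qed.

Lemma vertex_distC (a b : CV) : vertex_dist CE len a b = vertex_dist CE len b a :> K.
Proof. by rewrite !(vertex_distE K dhP) (gd_sym (coned_sym (H := H) gS) (@cwtC G H) dhP). Qed.

Lemma vertex_dist_refl (a : CV) : vertex_dist CE len a a = 0%R :> K.
Proof.
rewrite (vertex_distE K dhP).
by rewrite (gd_refl dhP) mul0r.
Qed.

Lemma vertex_dist_walk (a : CV) s :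
  path CE a s -> (vertex_dist CE len a (last a s) <= walk_len len a s :> K)%R.
Proof.
rewrite (vertex_distE K dhP) coned_walk_len.
by move=> /(gd_le dhP) le; rewrite ler_pM2r ?invr_gt0 ?ltr0n // ler_nat.
Qed.

Lemma vertex_dist_ge0 (a b : CV) : (0 <= vertex_dist CE len a b :> K)%R.
Proof.
have [->|/vertex_dist_ge_half] := eqVneq a b; first by rewrite vertex_dist_refl.
by apply: le_trans; rewrite invr_ge0 ler0n.
Qed.

(** Moving along the walk gives the upper bound. For the lower one, a connection through two
    distinct ends has length at least 1/2, which suffices because the walk has length at most
    [n / 2]; a connection along one edge or through a common end has length at least [t' - t]. Hence
    BCP applies to every simple walk of bounded length. *)
Lemma simple_quasi_geodesic n u s : path CE u s -> uniq (u :: s) -> wlen (@cwt G H) u s <= n ->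
  quasi_geodesic CE len (n%:R : K)%R u s.
Proof.
move=> ps us ws.
have [s0|s0] := eqVneq s [::].
  rewrite s0 => t t' /=; rewrite -!eq_le => /eqP <- /eqP <-.
  by rewrite subrr normr0 !mulr0 (graph_dist_vertex K dhP) (gd_refl dhP) mul0r lexx.
have n0 : 0 < n.
  by case: s s0 ws {ps us} => //= v s _; have := @cwt_gt0 G H u v; lia.
have n1 : (1 <= n%:R :> K)%R by rewrite ler1n.
have nV : (n%:R^-1 <= 1 :> K)%R by rewrite invf_le1 // ltr0n.
have nV0 : (0 <= n%:R^-1 :> K)%R by rewrite invr_ge0 ler0n.
have wl : (walk_len len u s <= n%:R / 2 :> K)%R.
  by rewrite coned_walk_len ler_pM2r ?invr_gt0 ?ltr0n // ler_nat.
suff main (t t' : K) : (0 <= t)%R -> (t <= t')%R -> (t' <= walk_len len u s)%R ->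
    (n%:R^-1 * (t' - t) <= graph_dist CE len (walk_at len u s t) (walk_at len u s t')
      <= t' - t)%R /\
    (n%:R^-1 * (t' - t) <= graph_dist CE len (walk_at len u s t') (walk_at len u s t)
      <= t' - t)%R.
  have fin (a x : K) : (0 <= a)%R -> (n%:R^-1 * a <= x <= a)%R ->
      (n%:R^-1 * a <= x <= n%:R * a)%R.
    move=> a0 /andP[-> /le_trans -> //]; by rewrite -[leLHS]mul1r ler_wpM2r.
  move=> t t' /andP[t0 t1] /andP[t'0 t'1]; case/orP: (le_total t t') => le.
    by rewrite ler0_norm ?subr_le0 // opprB; apply: fin; rewrite ?subr_ge0 //; case: (main _ _ t0 le t'1).
  by rewrite ger0_norm ?subr_ge0 //; apply: fin; rewrite ?subr_ge0 //; case: (main _ _ t'0 le t1).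
move=> t0 tt' t'1.
have lehalf : (n%:R^-1 * (t' - t) <= 2^-1 :> K)%R.
  rewrite mulrC ler_pdivrMr ?ltr0n //; have := wl; lra.
have lediff : (n%:R^-1 * (t' - t) <= t' - t :> K)%R.
  by rewrite -[leRHS]mul1r ler_wpM2r // subr_ge0.
have far (a b : CV) (l1 l2 : K) : (0 <= l1)%R -> (0 <= l2)%R -> a != b ->
    (n%:R^-1 * (t' - t) <= l1 + vertex_dist CE len a b + l2)%R.
  by move=> l10 l20 /vertex_dist_ge_half; lra.
case: (walk_at2 s0 t0 tt' t'1).
  case=> s1 [y [s2 [r [r' [es -> -> [/andP[r0 rr'] r'1] e]]]]].
  have xy : last u s1 != y.
    apply/eqP => xy; move: us; rewrite es -cat_cons cat_uniq => /and3P[_ /hasPn /(_ y)].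
    by rewrite mem_head -xy mem_last => /(_ isT).
  split; apply: inf_between.
  - by left; left; split=> //; rewrite distrC ger0_norm ?subr_ge0.
  - move=> l [[[_ _ ->]|[_ /eqP]]|[a [b [l1 [l2 [ha hb ->]]]]]].
    + by rewrite distrC ger0_norm ?subr_ge0 // -e.
    + by rewrite (negbTE xy).
    have [ab|nab] := eqVneq a b; last first.
      by apply: far => //; [case: ha => [[_ ->]|[_ _ ->]] | case: hb => [[_ ->]|[_ _ ->]]]; lra.
    rewrite -ab vertex_dist_refl; apply: (le_trans lediff); rewrite e.
    case: ha => [[ea ->]|[_ ea ->]]; case: hb => [[eb ->]|[_ eb ->]]; try lra.
    by move: xy; rewrite -ea ab eb eqxx.
  - by left; left; split=> //; rewrite ger0_norm ?subr_ge0.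
  - move=> l [[[_ _ ->]|[_ /eqP]]|[a [b [l1 [l2 [ha hb ->]]]]]].
    + by rewrite ger0_norm ?subr_ge0 // -e.
    + by rewrite (negbTE xy).
    have [ab|nab] := eqVneq a b; last first.
      by apply: far => //; [case: ha => [[_ ->]|[_ _ ->]] | case: hb => [[_ ->]|[_ _ ->]]]; lra.
    rewrite -ab vertex_dist_refl; apply: (le_trans lediff); rewrite e.
    case: ha => [[ea ->]|[_ ea ->]]; case: hb => [[eb ->]|[_ eb ->]]; try lra.
    by move: xy; rewrite -ea ab eb eqxx.
case=> s1 [y [s2 [y' [s3 [r [r' [es -> -> [/andP[r0 r1] /andP[r'0 r'1]] e]]]]]]].
set x := last u s1 in r1 e *; set x' := last y s2 in r'1 e *.
have xin : x \in u :: s1 by rewrite mem_last.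
have x'in : x' \in y :: s2 by rewrite mem_last.
have us' : uniq ((u :: s1) ++ (y :: s2) ++ y' :: s3) by rewrite /= -es.
have N1 : forall z, z \in y :: s2 -> x != z.
  move=> z zin; apply/eqP => xz; move: us'; rewrite cat_uniq => /and3P[_ /hasPn /(_ z)].
  by rewrite mem_cat zin -xz xin => /(_ isT).
have N2 : x != y'.
  apply/eqP => xz; move: us'; rewrite cat_uniq => /and3P[_ /hasPn /(_ y')].
  by rewrite mem_cat mem_head orbT -xz xin => /(_ isT).
have N3 : y' \notin y :: s2.
  move: us'; rewrite cat_uniq => /and3P[_ _]; rewrite cat_uniq => /and3P[_ /hasPn /(_ y')].
  by rewrite mem_head => /(_ isT).
have U2 : uniq (y :: s2) by move: us'; rewrite cat_uniq => /and3P[_ _]; rewrite cat_uniq => /and3P[].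
have ps' := ps; rewrite es cat_path /= cat_path /= in ps'.
have /and5P[_ Exy p2 Ex'y' _] := ps'.
have [vw len0] : (vertex_dist CE len y x' <= walk_len len y s2 :> K)%R /\
    (s2 = [::] -> walk_len len y s2 = 0 :> K)%R.
  by split; [exact: vertex_dist_walk | move->].
have ends a b l1 l2 : to_end CE len (x, y, r) a l1 -> to_end CE len (x', y', r') b l2 ->
    (n%:R^-1 * (t' - t) <= l1 + vertex_dist CE len a b + l2)%R.
  move=> ha hb.
  have l10 : (0 <= l1)%R by case: ha => [[_ ->]|[_ _ ->]]; lra.
  have l20 : (0 <= l2)%R by case: hb => [[_ ->]|[_ _ ->]]; lra.
  have [ab|nab] := eqVneq a b; last exact: far.
  move: ha hb => [[ea e1]|[_ ea e1]] [[eb e2]|[_ eb e2]].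
  - by have := N1 _ x'in; rewrite -ea ab eb eqxx.
  - by move: N2; rewrite -ea ab eb eqxx.
  - have s20 : s2 = [::].
      have exy : last y s2 = y by rewrite -/x' -eb -ab.
      move: U2 exy; case: (s2) => // z s2' /= /andP[/negP nin _] el; case: nin.
      by rewrite -el mem_last.
    by apply: le_trans lediff _; have := vertex_dist_ge0 a b; have := len0 s20; lra.
  - by move: N3; rewrite -eb -ab ea mem_head.
have elt : (len x y - r + vertex_dist CE len y x' + r' <= t' - t)%R by lra.
split.
- have : (n%:R^-1 * (t' - t) <= graph_dist CE len (x, y, r) (x', y', r')
      <= len x y - r + vertex_dist CE len y x' + r')%R.
    apply: inf_between.
      by right; exists y, x', (len x y - r)%R, r'; split=> //; [right | left].
    move=> l [[[ex]|[_ ex]]|[a [b [l1 [l2 [ha hb ->]]]]]]; last exact: ends.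
      by have := N1 _ x'in; rewrite ex eqxx.
    by move: N2; rewrite ex eqxx.
  by move=> /andP[-> /le_trans ->].
- have : (n%:R^-1 * (t' - t) <= graph_dist CE len (x', y', r') (x, y, r)
      <= len x y - r + vertex_dist CE len y x' + r')%R.
    apply: inf_between.
      right; exists x', y, r', (len x y - r)%R; split; [by left | by right|].
      by rewrite (vertex_distC x'); lra.
    move=> l [[[ex]|[_ _ ex]]|[a [b [l1 [l2 [ha hb ->]]]]]].
    + by have := N1 _ x'in; rewrite ex eqxx.
    + by move: N2; rewrite ex eqxx.
    rewrite -addrA addrC addrAC -addrA.
    rewrite (vertex_distC a).
    by have := ends _ _ _ _ hb ha; lra.
  by move=> /andP[-> /le_trans ->].
Qed.

End Fine.

(** * Fineness from bounded coset penetration *)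

Section FineGraph.
Context (K : realType) (G : groupType) (S : seq G) (H : groupClosed G).
Context (dh : cone_vertex H -> cone_vertex H -> nat).
Hypothesis dhP : graph_metric (coned_adj S (H := H)) (@cwt G H) dh.
Hypothesis gS : generating_set S.
Hypothesis gH : forall h, h \in H -> exists w, word_in [seq s <- S | s \in H] w h.
Hypothesis bcp : bounded_coset_penetration K S H.

Notation CV := (cone_vertex H).
Notation CE := (coned_adj S (H := H)).
Notation same := (same_coset H).
Notation co := (coset_of H).

Lemma same_trans x y z : same x y -> same x z = same y z.
Proof.
move=> xy; apply/idP/idP; last exact: same_coset_trans xy.
by rewrite same_coset_sym in xy; apply: same_coset_trans xy.
Qed.

Lemma coset_ofE x y : (co x == co y) = same x y.
Proof. by apply/eqP/idP => /coset_ofP. Qed.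

Lemma coset_walk x y : same x y -> x != y -> exists2 s, s != [::] &
  [/\ path (cayley_adj S) x s, last x s = y & all (same x) s].
Proof.
move=> xy nxy; have [w [ws wp]] := gH xy.
suff H1 v : {subset v <= [seq s <- S | s \in H]} -> forall a, exists s,
    [/\ path (cayley_adj S) a s, last a s = (a * \prod_(s <- v) s)%g & all (same a) s].
  have [s [ps ls as_]] := H1 _ ws x; exists s; rewrite ?ls ?wp ?mulVKg //.
  by apply: contra nxy => /eqP s0; rewrite s0 /= wp mulVKg in ls; rewrite ls eqxx.
elim: v => [|g v IH] vs a; first by exists [::]; rewrite big_nil mulg1.
have [|s [ps ls as_]] := IH _ (a * g)%g; first by move=> t tv; apply: vs; rewrite in_cons tv orbT.
have : g \in [seq s <- S | s \in H] by apply: vs; rewrite mem_head.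
rewrite mem_filter => /andP[gHH gSS].
have sa : same a (a * g)%g by rewrite /same_coset mulKg.
have as' : all (same a) s by apply: sub_all as_ => z; rewrite (same_trans _ sa).
have [g1|g1] := eqVneq (a * g)%g a.
  by rewrite g1 in ps ls; exists s; rewrite big_cons mulgA g1 ps ls as'.
exists ((a * g)%g :: s); rewrite /= ls big_cons mulgA ps sa as'; split=> //.
by rewrite /cayley_adj eq_sym g1 mulKg gSS.
Qed.

Definition rel_adj (x y : G) : bool := (x != y) && (same x y || ((x^-1 * y)%g \in S)).

(** No vertex shares its coset with a vertex after its successor. Every coset is then visited once,
    in at most one jump, which makes the image in the coned-off graph simple. *)
Fixpoint sparse (x : G) (s : seq G) : bool :=
  if s is y :: s' then all (fun z => ~~ same x z) s' && sparse y s' else true.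

Fixpoint expand (x : G) (s : seq G) : seq CV :=
  if s is y :: s' then
    if same x y then inr (co y) :: inl y :: expand y s' else inl y :: expand y s'
  else [::].

(** If a vertex beyond the successor of [x] lies in the coset of [x], jump there at once; the path
    becomes shorter. *)
Lemma sparse_exists x s : path rel_adj x s -> exists s',
  [/\ path rel_adj x s', last x s' = last x s, sparse x s',
      {subset s' <= s} & size s' <= size s].
Proof.
have [n le_n] := ubnP (size s); elim: n s x le_n => // n IH [|y s] x le_n.
  by move=> _; exists [::].
case/andP=> xy ps; have [s' [ps' ls' sp' ss' sz']] := IH s y le_n ps.
case: (boolP (all (fun z => ~~ same x z) s')) => [a|].
  exists (y :: s'); rewrite /= ls' xy ps' a sp'; split=> // z.
  by rewrite !in_cons => /orP[->//|/ss' ->]; rewrite orbT.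
move=> /allPn[z zs' /negPn xz].
case/splitPr: zs' ps' ls' sp' ss' sz' => s1 s2 ps' ls' sp' ss' sz'.
have p2 : path rel_adj z s2 by move: ps'; rewrite cat_path /= => /and3P[].
have l2 : last z s2 = last y s by rewrite -ls' last_cat.
have sz2 : size s2 < size s by move: sz'; rewrite size_cat /=; lia.
have sub2 : {subset z :: s2 <= y :: s}.
  by move=> w ws; rewrite in_cons ss' ?orbT // mem_cat ws orbT.
have [xz0|xz0] := eqVneq x z.
  have [|s'' [p3 l3 sp3 ss3 sz3]] := IH s2 z _ p2; first exact: ltn_trans sz2 le_n.
  exists s''; rewrite xz0 l3 l2; split=> // [w /ss3 ws|]; last exact: leq_trans sz3 (leq_trans (ltnW sz2) (leqnSn _)).
  by apply: sub2; rewrite in_cons ws orbT.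
have p3 : path rel_adj x (z :: s2) by rewrite /= p2 /rel_adj xz0 xz.
have [|s'' [p4 l4 sp4 ss4 sz4]] := IH (z :: s2) x _ p3; first exact: leq_ltn_trans sz2 le_n.
exists s''; rewrite l4 /= l2; split=> // [w /ss4 /sub2 //|].
exact: leq_trans sz4 (leq_trans sz2 (leqnSn _)).
Qed.

Lemma coned_path_run x q p : q != [::] -> all (same x) q ->
  (if p is z :: _ then ~~ same x z else true) ->
  coned_path H x (q ++ p) = inr (co x) :: inl (last x q) :: coned_path H (last x q) p.
Proof.
elim: q x => // y q IH x _ axy hp; have /andP[xy aq] := axy; clear axy.
have exy : co x = co y by apply/coset_ofP.
case: q IH aq => [|z q] IH aq.
  rewrite /= xy exy; case: p hp {IH} => // w p hp.
  by rewrite -(same_trans _ xy) (negbTE hp).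
have aq0 : all (same x) (z :: q) by [].
have aq' : all (same y) (z :: q) by apply: sub_all aq0 => w; rewrite (same_trans _ xy).
have -> : coned_path H x ((y :: z :: q) ++ p) = coned_path H y ((z :: q) ++ p).
  by rewrite /= xy; case/andP: aq' => ->.
rewrite IH // ?exy //.
by case: p hp {IH} => //= w p; rewrite (same_trans _ xy).
Qed.

(** Jumps are realised by words in the generators of [H] that belong to [S], so each becomes a
    maximal subpath in its coset. The last clause records the first vertex, which decides whether a
    preceding run in a coset ends there. *)
Lemma lift_sparse x s : path rel_adj x s -> sparse x s -> exists p,
  [/\ path (cayley_adj S) x p, last x p = last x s, coned_path H x p = expand x s,
      forall z, z \in p -> exists2 y, y \in x :: s & same y z &
      if s is y :: s' then ~~ same x y -> exists p', p = y :: p' else p = [::]].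
Proof.
elim: s x => [|y s IH] x; first by move=> _ _; exists [::]; split.
move=> /= /andP[/andP[nxy xy] ps] /andP[al sp].
have [p [pp lp cp mp hp]] := IH y ps sp.
case: (boolP (same x y)) => [sxy|nsxy]; last first.
  rewrite (negbTE nsxy) /= in xy.
  exists (y :: p); rewrite /= lp pp /cayley_adj nxy xy (negbTE nsxy) cp; split=> //.
    move=> z; rewrite in_cons => /orP[/eqP->|/mp[w ws wz]].
      by exists y; rewrite ?same_coset_refl // in_cons mem_head orbT.
    by exists w; rewrite // in_cons ws orbT.
  by exists p.
have [q q0 [pq lq aq]] := coset_walk sxy nxy.
exists (q ++ p); rewrite cat_path last_cat lq pq pp lp; split=> //.
- rewrite coned_path_run // ?lq ?cp.
    by have -> : co x = co y by apply/coset_ofP.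
  case: s hp al {IH ps sp lp cp mp} => [->//|z s] hp /= /andP[nz _].
  by have [|p' ->//] := hp; rewrite -(same_trans _ sxy).
- move=> z; rewrite mem_cat => /orP[zq|/mp[w ws wz]].
    by exists x; rewrite ?mem_head //; move/allP: aq; apply.
  by exists w; rewrite // in_cons ws orbT.
Qed.

Lemma expand_walk x s : path rel_adj x s -> sparse x s ->
  [/\ path CE (inl x) (expand x s), uniq (inl x :: expand x s) &
      wlen (@cwt G H) (inl x) (expand x s) = 2 * size s].
Proof.
have inl_in y z t : (inl z : CV) \in expand y t -> z \in t.
  elim: t y => //= w t IH y; case: ifP => _; rewrite !in_cons /= => /orP[/eqP[->]|/IH->];
    by rewrite ?eqxx ?orbT.
have inr_in y c t : (inr c : CV) \in expand y t -> exists2 z, z \in t & c = co z.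
  elim: t y => //= w t IH y; case: ifP => _; rewrite !in_cons /=.
    case/orP=> [/eqP[->]|/IH[z zt ->]]; first by exists w; rewrite ?mem_head.
    by exists z; rewrite // in_cons zt orbT.
  by case/IH=> z zt ->; exists z; rewrite // in_cons zt orbT.
elim: s x => [|y s IH] x; first by [].
move=> /= /andP[/andP[nxy xy] ps] /andP[al sp].
have [pe ue we] := IH y ps sp.
have xs : x \notin s by apply/negP => /(allP al); rewrite same_coset_refl.
have xy' : (inl x : CV) != inl y by apply: contra nxy => /eqP[->].
have xe : (inl x : CV) \notin expand y s by apply: contra xs => /inl_in.
case: ifP => sxy /=; last first.
  rewrite sxy /= in xy; rewrite in_cons negb_or xy' xe we /cayley_adj nxy xy pe.
  by move: ue => /= ->; split=> //; lia.
rewrite pe we !in_cons !negb_or xy' xe /=; move: ue => /= ->; split.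
- by rewrite !coset_ofE sxy same_coset_refl.
- rewrite andbT; apply/negP => /inr_in[z /(allP al) nz /coset_ofP yz].
  by rewrite (same_trans _ sxy) yz in nz.
- by rewrite /=; lia.
Qed.

(** The walk from [a] outside the coset competes with the walk that passes through [h1], the coset
    and [h2]. The images of both are simple and of bounded length, hence quasi-geodesics; if [h1]
    and [h2] were far apart, BCP would force the first walk to enter the coset. *)
Lemma fine_core n : exists r, forall h1 h2 a s,
  same h1 h2 -> (h1^-1 * a)%g \in S -> ((last a s)^-1 * h2)%g \in S ->
  path rel_adj a s -> (forall z, z \in a :: s -> ~~ same h1 z) -> size s <= n ->
  word_dist S h1 h2 <= r.
Proof.
(* [2 * n] bounds the doubled length of the first walk; that of the second is 2 + 1 + 1 + 2. *)
pose N := 2 * n + 6.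
have T0 : (0 < N%:R :> K)%R by rewrite ltr0n /N addn_gt0 orbT.
have [r0 r0P] := bcp T0; have [r rP] := nat_upper_bound r0.
(* The summand 2 covers the case that both neighbours outside the coset coincide, where the second
   walk is not simple. *)
exists (r + 2) => h1 h2 a s h12 ha bh ps av szs.
rewrite leqNgt; apply/negP => gt.
have [s' [ps' ls' sp' ss' sz']] := sparse_exists ps.
have [p [pp lp cp mp _]] := lift_sparse ps' sp'.
have [pe ue we] := expand_walk ps' sp'.
set b := last a s in bh.
have na : ~~ same h1 a by apply: av; rewrite mem_head.
have nb : ~~ same h1 b by apply: av; rewrite mem_last.
have nh : h1 != h2 by apply/eqP => e; rewrite e (wd_refl gS) in gt.
have ah : ((a^-1 * h1)%g \in S) by have := cay_sym gS h1 a; rewrite /cay ha => <-.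
have nab : a != b.
  apply/eqP => ab; have := wd_tri gS a h1 h2.
  have := wd_gen gS ha; have := wd_gen gS (x := a) (y := h2); rewrite {1}ab bh => /(_ isT).
  by clear -gt; lia.
have [q q0 [pq lq aq]] := coset_walk h12 nh.
have same1 : relative_quasi_geodesic S H (N%:R : K)%R a p.
  split=> //; rewrite cp; apply: simple_quasi_geodesic => //; try exact: dhP.
  by rewrite we; apply: leq_trans (leq_addr _ _); rewrite leq_mul2l /= (leq_trans sz' szs).
have na1 : a != h1 by apply: contraNneq na => ->; rewrite same_coset_refl.
have nb2 : h2 != b by apply: contraNneq nb => <-.
have cq : coned_path H a (h1 :: q ++ [:: b]) = [:: inl h1; inr (co h1); inl h2; inl b].
  rewrite /= (same_coset_sym H a) (negbTE na) coned_path_run // lq /=.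
  by rewrite -(same_trans _ h12) (negbTE nb).
have same2 : relative_quasi_geodesic S H (N%:R : K)%R a (h1 :: q ++ [:: b]).
  split.
    rewrite /= cat_path pq lq /= /cayley_adj na1 ah nb2 andbT /=.
    by have := cay_sym gS b h2; rewrite /cay bh => <-.
  rewrite cq; apply: simple_quasi_geodesic => //; try exact: dhP.
  - rewrite /= /cayley_adj na1 ah nb2 /=.
    have -> : (h2^-1 * b)%g \in S by have := cay_sym gS b h2; rewrite /cay bh => <-.
    by rewrite eqxx coset_ofE same_coset_sym h12.
  - have inlE (x y : G) : (inl x == inl y :> CV) = (x == y) by apply/eqP/eqP => [[]|->].
    have na2 : a != h2 by apply: contraNneq na => ->.
    have nb1 : h1 != b by apply: contraNneq nb => <-; rewrite same_coset_refl.
    by rewrite /= !inE !inlE !negb_or na1 na2 nab nh nb1 nb2.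
  - exact: leq_addl.
have [|tr _] := r0P _ _ _ same2 same1.
  by rewrite /= last_cat lq /= lp ls'.
have /tr : travels_more_than S r0 (a :: h1 :: q ++ [:: b]) (co h1).
  exists [:: a], h1, q, [:: b]; split=> //.
    move=> y; rewrite in_cons => /orP[/eqP->//|yq]; apply/coset_ofP.
    by rewrite same_coset_sym; apply: (allP aq).
  by rewrite lq; apply: le_trans rP _; rewrite ler_nat; clear -gt; lia.
rewrite /enters /vertices_in; case e: [seq _ <- _ | _] => [//|z l] _.
have : z \in [seq y <- a :: p | co y == co h1] by rewrite e mem_head.
rewrite mem_filter in_cons coset_ofE same_coset_sym => /andP[hz /orP[/eqP za|/mp[y ys yz]]].
  by rewrite za (negbTE na) in hz.
have : ~~ same h1 y.
  apply: av; move: ys; rewrite !in_cons => /orP[->//|/ss' ->]; by rewrite orbT.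
by rewrite (same_trans _ hz) same_coset_sym yz.
Qed.

(** Moves of the coned-off graph without the cone vertex over the coset of [x0]. *)
Definition weak_adj (x0 x y : G) : bool :=
  ((x^-1 * y)%g \in S) || (same x y && ~~ same x0 x).

(** Cut the walk at its returns to the coset; each excursion is bounded by [fine_core]. *)
Lemma fine_weak n : exists r, forall x0 h1 h2 s,
  same x0 h1 -> same x0 h2 -> path (weak_adj x0) h1 s -> last h1 s = h2 ->
  size s <= n -> word_dist S h1 h2 <= size s * r.
Proof.
have [r rP] := fine_core n; exists r.+1 => x0 h1 h2 s.
have [m le_m] := ubnP (size s); elim: m s h1 le_m => // m IH [|a s] h1 le_m sh1 sh2.
  by move=> _ <- _; rewrite (wd_refl gS).
move=> /= /andP[]; rewrite {1}/weak_adj sh1 andbF orbF => ha ps ls szs.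
have [sa|nsa] := boolP (same x0 a).
  have := IH s a le_m sa sh2 ps ls (ltnW szs).
  by have := wd_tri gS a h1 h2; have := wd_gen gS ha; rewrite mulSn; clear; lia.
have hs : has (same x0) s.
  case: s ls {le_m ps szs} => [/= e|z s ls]; first by rewrite -e (negbTE nsa) in sh2.
  by apply/hasP; exists h2 => //; rewrite -ls /= mem_last.
move: ps ls szs le_m; case/split_find: hs => z s1 s2 sz ns1.
rewrite cat_path rcons_path last_cat last_rcons => /andP[/andP[p1 e1] p2] ls szs le_m.
have nsb : ~~ same x0 (last a s1).
  have := mem_last a s1; rewrite in_cons => /orP[/eqP->//|l1].
  by apply: contra ns1 => sl; apply/hasP; exists (last a s1).
have bz : ((last a s1)^-1 * z)%g \in S.
  move: e1; rewrite /weak_adj => /orP[//|/andP[sl _]]; case/negP: nsb.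
  by rewrite same_coset_sym in sl; exact: same_coset_trans sz sl.
have [t [pt lt st szt]] : exists t, [/\ path rel_adj a t, last a t = last a s1,
    {subset t <= s1} & size t <= size s1].
  elim: s1 a p1 {ns1 e1 szs le_m nsa ha nsb bz p2 ls} => [|y s1 IHs] a /=.
    by move=> _; exists [::].
  case/andP=> ay /IHs[t [pt lt st szt]]; have [->|nay] := eqVneq a y.
    exists t; rewrite pt lt; split=> // [w /st ws|]; last exact: leq_trans szt _.
    by rewrite in_cons ws orbT.
  exists (y :: t); rewrite /= pt lt; split=> //.
    by rewrite /rel_adj nay; move: ay; rewrite /weak_adj => /orP[->|/andP[->]]; rewrite ?orbT.
  by move=> w; rewrite !in_cons => /orP[->//|/st ->]; rewrite orbT.
have szs' : size s1 + size s2 < n.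
  by apply: leq_trans szs; rewrite /= size_cat size_rcons addSn ltnW.
have d1 : word_dist S h1 z <= r.
  have sh1z : same h1 z by rewrite -(same_trans _ sh1).
  apply: (rP h1 z a t) => //; first by rewrite lt.
    move=> w; rewrite -(same_trans _ sh1) in_cons => /orP[/eqP->//|/st ws].
    by apply: contra ns1 => sl; apply/hasP; exists w.
  exact: leq_trans szt (leq_trans (leq_addr _ _) (ltnW szs')).
have szs2 : size s2 <= n by apply: leq_trans (leq_addl _ _) (ltnW szs').
have ltm : size s2 < m.
  apply: leq_ltn_trans (leq_addl (size s1).+1 _) _.
  by move: le_m; rewrite /= size_cat size_rcons ltnS.
apply: leq_trans (wd_tri gS z h1 h2) _; rewrite size_cat size_rcons mulSn !mulnDl.
apply: leq_trans (leq_add d1 (IH s2 z ltm sz sh2 p2 ls szs2)) _.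
by rewrite mulSn; clear; lia.
Qed.

Lemma fine n : exists r, forall c h1 h2, co h1 = c -> co h2 = c ->
  awalk CE (@cwt G H) (inr c) n (inl h1) (inl h2) -> word_dist S h1 h2 <= r.
Proof.
have [r rP] := fine_weak n; exists (n * r) => c h1 h2 h1c h2c [s [ps ls ws os]].
suff [t [pt lt szt]] : exists t, [/\ path (weak_adj h1) h1 t, last h1 t = h2 & size t <= n].
  have h12 : same h1 h2 by apply/coset_ofP; rewrite h1c h2c.
  apply: leq_trans (rP h1 h1 h2 t _ _ pt lt szt) _; rewrite ?same_coset_refl //.
  by rewrite leq_mul2r szt orbT.
have {os} os : inr (co h1) \notin s.
  by move: os; rewrite in_cons negb_or h1c => /andP[].
have sw : forall m (s : seq CV) x, size s <= m -> path CE (inl x) s -> last (inl x : CV) s = inl h2 ->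
    inr (co h1) \notin s -> exists t, [/\ path (weak_adj h1) x t, last x t = h2 &
    size t <= wlen (@cwt G H) (inl x) s].
  elim=> [|m IH] [|v s'] x //.
    1,2: by move=> _ _ [->] _; exists [::].
  case: v => [y|c'] szs /= /andP[e p] l.
    rewrite in_cons /= => os'; have [t [pt lt szt]] := IH s' y szs p l os'.
    exists (y :: t); rewrite /= pt lt; split=> //; last by rewrite -add1n leq_add.
    by move: e; rewrite /cayley_adj /weak_adj => /andP[_ ->].
  case: s' szs p l => [//|[y|//] s'] szs /= /andP[e' p] l.
  rewrite !in_cons !negb_or => /and3P[nc _ os'].
  have [|t [pt lt szt]] := IH s' y _ p l os'; first exact: ltnW.
  exists (y :: t); rewrite /= pt lt; split=> //; last by rewrite -add1n leq_add // (leq_trans szt) // leq_addl.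
  apply/andP; split=> //; apply/orP; right.
  rewrite -coset_ofE (eqP e) (eqP e') eqxx /= -coset_ofE (eqP e).
  by apply: contra nc => /eqP->.
have [t [pt lt szt]] := sw _ s h1 (leqnn _) ps ls os.
by exists t; split=> //; apply: leq_trans szt ws.
Qed.

End FineGraph.

Lemma subgroup_valVM (G : groupType) (H : groupClosed G) (a b : subgroup_type H) :
  val (a^-1 * b)%g = ((val a)^-1 * val b)%g.
Proof. by rewrite valM; congr (_ * _)%g; apply/esym/mulg1_eq; rewrite -valM mulgV val1. Qed.

(** * Word-closeness of coned-off geodesics, projections to cosets *)

Section FineHyperbolic.
Context (G : groupType) (S : seq G) (H : groupClosed G).
Context (dh : cone_vertex H -> cone_vertex H -> nat) (delta : nat).
Hypothesis gS : generating_set S.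
Notation CV := (cone_vertex H).
Notation CE := (coned_adj S (H := H)).
Notation wt := (@cwt G H).
Notation co := (coset_of H).
Hypothesis dhP : graph_metric CE wt dh.
Hypothesis hyp : forall x y z o,
  dh x z + dh y o <= maxn (dh x y + dh z o) (dh y z + dh x o) + delta.
Hypothesis fineP : forall n, exists r, forall c h1 h2, co h1 = c -> co h2 = c ->
  awalk CE wt (inr c) n (inl h1) (inl h2) -> word_dist S h1 h2 <= r.

Let Esym := coned_sym (H := H) gS.
Let wC := @cwtC G H.
Let wpos := @cwt_gt0 G H.
Let wle2 := @cwt_le G H.
Notation geo := (geod CE wt dh).
Notation sg := (seg CE wt dh).
Notation pl := (poly CE wt dh).

(** The main tool for what follows: a polygon with few sides of any length is replaced by a bounded
    walk that still avoids the cone vertex, and fineness measures this walk. *)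
Lemma gap N : exists R, forall k c h h', k <= N -> co h = c -> co h' = c ->
  pl (inr c) k (inl h) (inl h') -> word_dist S h h' <= R.
Proof.
have one k : exists R, forall c h h', co h = c -> co h' = c ->
    pl (inr c) k (inl h) (inl h') -> word_dist S h h' <= R.
  have [R RP] := fineP (k * detour_len 1 delta); exists R => c h h' hc h'c p.
  have adj g : co g = c -> dh (inr c) (inl g) <= detour_radius 1 delta.
    move=> gc; apply: leq_trans (gd_adj dhP (u := inr c) (v := inl g) _) _ => //=.
      by apply/eqP.
    by rewrite /detour_radius addn1.
  apply: (RP c) => //.
  by apply: (poly_detour Esym wC wpos wle2 dhP hyp p) => //; apply: adj.
elim: N => [|N [R RP]].
  by have [R RP] := one 0; exists R => k c h h'; rewrite leqn0 => /eqP->; apply: RP.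
have [R' RP'] := one N.+1; exists (maxn R R') => k c h h'.
rewrite leq_eqVlt ltnS leq_max => /orP[/eqP->|kN] hc h'c p; apply/orP.
  by right; apply: RP' p.
by left; apply: RP p.
Qed.

Lemma geo_seg u s o : geo u s -> o \notin u :: s -> sg o u (last u s).
Proof. by move=> gs os; exists s. Qed.

Lemma poly_along x s t o q : geo x s -> geo (last x s) t -> o \notin x :: s ++ t ->
  q \in x :: s ++ t -> exists2 k, k <= 2 & pl o k x q.
Proof.
move=> gs gt; rewrite -cat_cons !mem_cat negb_or => /andP[os ot].
have oz : o \notin last x s :: t.
  rewrite in_cons negb_or ot andbT; apply: contra os => /eqP->; exact: mem_last.
case/orP=> [qs|qt].
  have [s1 [s2 [es <- g1 _]]] := geod_split dhP gs qs; exists 1 => //.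
  apply/poly1/(geo_seg g1); apply: contra os.
  by rewrite es -cat_cons mem_cat => ->.
have qt' : q \in last x s :: t by rewrite in_cons qt orbT.
have [t1 [t2 [et <- g1 _]]] := geod_split dhP gt qt'; exists 2 => //.
apply: poly_cons (geo_seg gs os) _; apply/poly1/(geo_seg g1); apply: contra oz.
by rewrite et -cat_cons mem_cat => ->.
Qed.

Lemma coned_pred (u : CV) c : CE u (inr c) -> exists2 h, u = inl h & co h = c.
Proof. by case: u => //= h /eqP; exists h. Qed.

Lemma first_visit x s t c : geo x s -> geo (last x s) t -> x != inr c ->
  inr c \in x :: s ++ t -> exists h, [/\ co h = c, (inl h : CV) \in x :: s ++ t &
    exists2 k, k <= 2 & pl (inr c) k x (inl h)].
Proof.
move=> gs gt xc; rewrite in_cons eq_sym (negbTE xc) /= => cin.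
have pst : path CE x (s ++ t) by rewrite cat_path (geod_path gs) (geod_path gt).
case: (boolP (inr c \in s)) => cs.
  case/splitPr: cs gs {gt cin pst} => s1 s2 gs.
  have us := geod_uniq Esym wC wpos dhP gs.
  have [g1 _ _] := geod_cat dhP gs; have := geod_path gs.
  rewrite cat_path /= => /and3P[_ /coned_pred[h eh hc] _].
  exists h; split=> //; first by rewrite -eh -catA -cat_cons mem_cat mem_last.
  exists 1 => //; rewrite -eh; apply/poly1/(geo_seg g1).
  by move: us; rewrite -cat_cons cat_uniq => /and3P[_ /hasPn/(_ (inr c))]; rewrite mem_head => /(_ isT).
have ct : inr c \in t by move: cin; rewrite mem_cat (negbTE cs).
case/splitPr: ct gt {cin pst} => t1 t2 gt.
have ut := geod_uniq Esym wC wpos dhP gt.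
have [g1 _ _] := geod_cat dhP gt; have := geod_path gt.
rewrite cat_path /= => /and3P[_ /coned_pred[h eh hc] _].
exists h; split=> //.
  rewrite -eh in_cons mem_cat mem_cat; have := mem_last (last x s) t1.
  rewrite in_cons => /orP[/eqP->|->]; rewrite ?orbT //.
  by have := mem_last x s; rewrite in_cons => /orP[->//|->]; rewrite orbT.
exists 2 => //; rewrite -eh; apply: (poly_cons (v := last x s)).
  by apply: (geo_seg gs); rewrite in_cons negb_or eq_sym xc.
apply/poly1/(geo_seg g1).
by move: ut; rewrite -cat_cons cat_uniq => /and3P[_ /hasPn/(_ (inr c))]; rewrite mem_head => /(_ isT).
Qed.

Lemma mem_rev_belast (T : eqType) (u : T) s z :
  (z \in last u s :: rev (belast u s)) = (z \in u :: s).
Proof. by rewrite -mem_rev rev_cons revK -lastI. Qed.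

Lemma geo_rev x s : geo x s -> geo (last x s) (rev (belast x s)).
Proof. exact: geod_rev Esym wC dhP _ _. Qed.

Lemma geo_rev_last x s : geo x s -> last (last x s) (rev (belast x s)) = x.
Proof. by move=> /geod_path/(rev_walk Esym wC)[]. Qed.

(** A geodesic meets [o] at most once, so one end of the side can be reached from [p] without
    meeting [o]. Reversing the other two sides if necessary, they start at this end. *)
Lemma side_arm x y s t r p o : geo x s -> geo (last x s) t -> last (last x s) t = y ->
  geo x r -> last x r = y -> p \in x :: r -> p != o ->
  exists x' s' t', [/\ geo x' s', geo (last x' s') t', x' :: s' ++ t' =i x :: s ++ t,
    sg o p x' & x' = x \/ x' = y].
Proof.
move=> gs gt lt gr lr pr po; have [r1 [r2 [er l1 g1 g2]]] := geod_split dhP gr pr.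
have ur := geod_uniq Esym wC wpos dhP gr.
case: (boolP (o \in x :: r1)) => or1; last first.
  exists x, s, t; split=> //; last by left.
  by apply: (seg_sym Esym wC dhP); rewrite -l1; exact: geo_seg.
have or2 : o \notin p :: r2.
  rewrite in_cons negb_or eq_sym po /=; apply/negP => o2.
  by move: ur; rewrite er -cat_cons cat_uniq => /and3P[_ /hasPn/(_ _ o2)]; rewrite or1.
have gt' := geo_rev gt; have lt' := geo_rev_last gt; rewrite lt in gt' lt'.
exists y, (rev (belast (last x s) t)), (rev (belast x s)); rewrite lt'.
have ly : last p r2 = y by rewrite -lr er last_cat l1.
split=> //; [exact: geo_rev | | by rewrite -ly; exact: geo_seg | by right].
move=> v; rewrite -cat_cons mem_cat -lt mem_rev_belast mem_rev -[in RHS]cat_cons.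
by rewrite (lastI x s) cat_rcons mem_cat orbC.
Qed.

(** Thin triangles give a short walk [w] from [g] to a nearest vertex [q0] of the other two sides.
    Where [w] passes through a cone vertex, its entry and exit points in the coset are word-close by
    [gap]: a polygon leads from the entry back to [g], along the side to an end, along the other
    sides to [q0] and back along [w] to the exit. It avoids the cone vertex because [w] meets the
    other sides only at [q0]. *)
Lemma two_sides_close : exists R, forall x s t r g, geo x s -> geo (last x s) t ->
  geo x r -> last x r = last (last x s) t -> inl g \in x :: r ->
  exists2 q, inl q \in x :: s ++ t & word_dist S g q <= R.
Proof.
have [R RP] := gap 6; pose C := 2 * delta + 1.
exists (C * (R + 1)) => x s t r g gs gt gr lr gin.
set eta := x :: s ++ t.
have [q0 [q0e q0C q0min]] : exists q0, [/\ q0 \in eta, dh (inl g) q0 <= C &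
    forall q, q \in eta -> dh (inl g) q0 <= dh (inl g) q].
  pose P n := has (fun q => dh (inl g) q == n) eta.
  have e := geod_mem dhP gr gin; rewrite lr in e.
  have [q qe dq] := near_sides Esym wC wle2 dhP hyp e gs (erefl _) gt (erefl _).
  have exP : exists n, P n by exists (dh (inl g) q); apply/hasP; exists q.
  case: (ex_minnP exP) => n /hasP[q0 q0e /eqP dq0] nmin; exists q0; split=> //.
    by rewrite dq0; apply: leq_trans dq; apply: nmin; apply/hasP; exists q.
  by move=> q' q'e; rewrite dq0; apply: nmin; apply/hasP; exists q'.
have [w [gw lw]] := geod_exists dhP (inl g) q0.
have szw : size w <= C.
  apply: leq_trans q0C; rewrite -lw -(geod_len gw).
  by elim: w (inl g : CV) {gw lw} => //= v w IH u; rewrite -add1n leq_add.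
have uw := geod_uniq Esym wC wpos dhP gw.
have nolow b w1 w2 : w = w1 ++ b :: w2 -> w2 != [::] -> b \notin eta.
  move=> ew w20; apply/negP => /q0min; have gw' := gw; rewrite ew -cat_rcons in gw'.
  have [_ g2 ed] := geod_cat dhP gw'; rewrite last_rcons in g2 ed.
  move: ed; rewrite cat_rcons -ew lw => ed.
  have : 0 < dh b q0.
    rewrite -lw ew last_cat /= -(geod_len g2).
    by case: w2 w20 {ew gw' g2 ed} => //= v w2 _; rewrite addn_gt0 wpos.
  by clear -ed; lia.
suff H1 w1 w2 a : w = w1 ++ w2 -> last (inl g) w1 = inl a ->
    word_dist S g a <= size w1 * (R + 1) ->
    exists2 q, inl q \in eta & word_dist S g q <= C * (R + 1).
  by apply: (H1 [::] w g) => //; rewrite (wd_refl gS).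
have [m le_m] := ubnP (size w2); elim: m w1 w2 a le_m => // m IH w1 w2 a le_m ew la da.
case: w2 le_m ew => [|[b|c] w2] le_m ew.
- rewrite cats0 in ew; exists a; first by rewrite -la -ew lw.
  by apply: leq_trans da _; rewrite leq_mul2r -ew szw orbT.
- apply: (IH (rcons w1 (inl b)) w2 b) => //; rewrite ?cat_rcons ?last_rcons //.
  have := geod_path gw; rewrite ew cat_path la /= => /and3P[_ /andP[_ ab] _].
  rewrite size_rcons mulSn addnC; apply: leq_trans (wd_tri gS a _ _) _.
  by apply: leq_add => //; apply: leq_trans (wd_gen gS ab) _; rewrite addn1.
have := geod_path gw; rewrite ew cat_path la => /andP[_ /=/andP[ac p2]].
have /eqP aco := ac.
have gw' := gw; rewrite ew in gw'; have [g1 _ _] := geod_cat dhP gw'.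
have c1 : inr c \notin (inl g : CV) :: w1.
  move: uw; rewrite ew -cat_cons cat_uniq => /and3P[_ /hasPn/(_ (inr c))].
  by rewrite mem_head => /(_ isT).
have sag : sg (inr c) (inl a) (inl g).
  by apply: (seg_sym Esym wC dhP); rewrite -la; exact: geo_seg.
have [x' [s' [t' [gs' gt' em sx _]]]] := side_arm (o := inr c) gs gt (erefl _) gr lr gin isT.
(* If the nearest vertex is itself a cone vertex, the vertex before it on the two sides takes its
   place. *)
case: w2 le_m ew p2 gw' => [|v w2] le_m ew p2 gw'.
  have q0c : q0 = inr c by rewrite -lw ew last_cat.
  have ce : inr c \in x' :: s' ++ t' by rewrite em -q0c.
  have [h [hc he [k k2 pk]]] := first_visit gs' gt' (seg_neq sx).2 ce.
  exists h; first by rewrite -em.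
  have dah : word_dist S a h <= R.
    apply: (RP k.+2 c) => //; first by rewrite !ltnS (leq_trans k2).
    exact: poly_cons sag (poly_cons sx pk).
  apply: leq_trans (wd_tri gS a _ _) _; apply: leq_trans (leq_add da dah) _.
  have szw' : (size w1).+1 <= C by move: szw; rewrite ew size_cat addn1.
  apply: leq_trans (leq_mul szw' (leqnn _)); rewrite mulSn addnC leq_add2r.
  exact: leq_addr.
have ce : inr c \notin x' :: s' ++ t' by rewrite em; apply: nolow ew _.
case: v le_m ew p2 gw' => [b|//] le_m ew /andP[bc _] gw'.
have /eqP bco := bc.
apply: (IH (w1 ++ [:: inr c; inl b]) w2 b); rewrite -?catA ?last_cat //.
  by move: le_m; rewrite /= ltnS; exact: ltnW.
suff dab : word_dist S a b <= R.
  apply: leq_trans (wd_tri gS a _ _) _; apply: leq_trans (leq_add da dab) _.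
  rewrite size_cat /= mulnDl leq_add2l; clear; lia.
have gb : geo (inl b) w2.
  have gw2 : geo (inl g) ((w1 ++ [:: inr c; inl b]) ++ w2) by rewrite -catA.
  by have [_] := geod_cat dhP gw2; rewrite last_cat.
have lb : last (inl b) w2 = q0 by rewrite -lw ew last_cat.
have cb : inr c \notin (inl b : CV) :: w2.
  move: uw; rewrite ew => /= /andP[_]; rewrite cat_uniq => /and3P[_ _ /=/andP[]].
  by [].
have q0e' : q0 \in x' :: s' ++ t' by rewrite em.
have [k k2 pk] := poly_along gs' gt' ce q0e'.
apply: (RP (k.+2 + 1) c) => //; first by rewrite addn1 !ltnS (leq_trans k2).
apply: poly_cat (poly_cons sag (poly_cons sx pk)) _.
by apply/poly1/(seg_sym Esym wC dhP); rewrite -lb; exact: geo_seg.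
Qed.

(** A coarse nearest-point projection: [gap] with two sides shows that all such [h] for one [x] are
    close together. *)
Definition coset_proj (c : left_coset H) (x h : G) : Prop :=
  co h = c /\ sg (inr c) (inl h) (inl x).

Lemma coset_proj_exists c x : exists h, coset_proj c x h.
Proof.
have [s [gs ls]] := geod_exists dhP (inr c) (inl x).
case: s gs ls => [//|[h|c'] s] gs ls; have := geod_path gs => //= /andP[/eqP hc _].
exists h; split=> //; have [_ g _] := geod_cat dhP (s1 := [:: inl h]) gs.
exists s; split=> //.
by have /= /andP[] := geod_uniq Esym wC wpos dhP gs.
Qed.

Lemma coset_proj_self c x : co x = c -> coset_proj c x x.
Proof. by move=> xc; split=> //; exists [::]; split=> //; rewrite /geod /= (gd_refl dhP). Qed.

Lemma edge_dist (u v : CV) : CE u v -> dh u v = wt u v.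
Proof.
move=> uv; apply/eqP; rewrite eqn_leq (gd_adj dhP uv) /=.
have [s [ps ls <-]] := dhP.2 u v; case: s ps ls => [_ e|a [|b s] _ /= e].
- by rewrite -e coned_irr in uv.
- by rewrite e addn0.
- by apply: leq_trans (wle2 u v) (leq_add (wpos u a) _); rewrite addn_gt0 wpos.
Qed.

Lemma edge_seg o (u v : CV) : u != o -> v != o -> CE u v -> sg o u v.
Proof.
move=> uo vo uv; exists [:: v]; split=> //.
  by rewrite /geod /= uv addn0 (edge_dist uv) eqxx.
by rewrite !in_cons !negb_or eq_sym uo eq_sym vo.
Qed.

(** Projections of adjacent points are joined by a polygon with three sides. Projections of two
    points of another coset are joined by four sides through the cone vertex of that coset, whatever
    the distance of the points. *)
Lemma coset_proj_lipschitz : exists R, forall c x y h h',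
  coset_proj c x h -> coset_proj c y h' ->
  word_dist S h h' <= R * (word_dist S x y).+1 /\
  (co x = co y -> co x != c -> word_dist S h h' <= R).
Proof.
have [R RP] := gap 4; exists R => c x y h h' ph ph'; split; last first.
  move=> xy xc; apply: (RP 4 c) => //; [exact: ph.1 | exact: ph'.1 |].
  have nc : (inr (co x) : CV) != inr c by apply: contra xc => /eqP[->].
  apply: poly_cons ph.2 _; apply: (poly_cons (v := inr (co x))).
    by apply: edge_seg => //=.
  apply: (poly_cons (v := inl y)); first by apply: edge_seg => //=; rewrite xy.
  exact/poly1/(seg_sym Esym wC dhP)/ph'.2.
have [s [ps ls <-]] := wd_walk gS x y.
elim: s x h ph ps ls => [|z s IH] x h ph /=.
  move=> _ xy; rewrite muln1; apply: (RP 2 c) => //; [exact: ph.1 | exact: ph'.1 |].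
  by apply: poly_cons ph.2 _; rewrite xy; apply/poly1/(seg_sym Esym wC dhP)/ph'.2.
case/andP=> xz ps ls; have [h2 ph2] := coset_proj_exists c z.
apply: leq_trans (wd_tri gS h2 _ _) _; rewrite mulnS.
apply: leq_add (IH z h2 ph2 ps ls); apply: (RP 3 c) => //; [exact: ph.1 | exact: ph2.1 |].
apply: poly_cons ph.2 _; apply: (poly_cons (v := inl z)).
  have [->|nxz] := eqVneq x z; first exact: seg_refl dhP _ _ _.
  by apply: edge_seg => //=; rewrite /cayley_adj nxz.
exact/poly1/(seg_sym Esym wC dhP)/ph2.2.
Qed.

(** Under projection to [c] the points of [c] stay and all of [c'] goes to a bounded set. The bound
    is linear in [t], so that it survives rescaling. *)
Lemma near_two_cosets : exists C, forall c c' a b u v u' v' t, c != c' ->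
  co u = c -> co v = c' -> co u' = c -> co v' = c' ->
  word_dist S a u <= t -> word_dist S a v <= t ->
  word_dist S b u' <= t -> word_dist S b v' <= t ->
  word_dist S a b <= C * t.+1.
Proof.
have [R RP] := coset_proj_lipschitz; exists (5 * R + 2).
move=> c c' a b u v u' v' t cc uc vc u'c v'c au av bu' bv'.
have [h ph] := coset_proj_exists c v; have [h' ph'] := coset_proj_exists c v'.
have [d1 _] := RP _ _ _ _ _ (coset_proj_self uc) ph.
have [d2 _] := RP _ _ _ _ _ (coset_proj_self u'c) ph'.
have [_ d3] := RP _ _ _ _ _ ph ph'.
have {}d3 : word_dist S h h' <= R by apply: d3; rewrite ?vc ?v'c // eq_sym.
have uv : word_dist S u v <= 2 * t.
  by apply: leq_trans (wd_tri gS a _ _) _; rewrite (wd_sym gS) mul2n -addnn leq_add.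
have uv' : word_dist S u' v' <= 2 * t.
  by apply: leq_trans (wd_tri gS b _ _) _; rewrite (wd_sym gS) mul2n -addnn leq_add.
have d1' : word_dist S u h <= R * (2 * t).+1.
  by apply: leq_trans d1 _; rewrite leq_mul2l ltnS uv orbT.
have d2' : word_dist S u' h' <= R * (2 * t).+1.
  by apply: leq_trans d2 _; rewrite leq_mul2l ltnS uv' orbT.
have T1 := wd_tri gS u a b; have T2 := wd_tri gS h u b; have T3 := wd_tri gS h' h b.
have T4 := wd_tri gS u' h' b.
move: (wd_sym gS h' u') (wd_sym gS u' b) => E1 E2.
clear -T1 T2 T3 T4 E1 E2 d1' d2' d3 au bu'; nia.
Qed.

(** Project a path of [G] between points of [H] to [H]: consecutive projections differ by one of
    finitely many elements, whose norms with respect to [T] have a maximum. *)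
Lemma undistorted (T : seq (subgroup_type H)) : generating_set T ->
  exists C, forall x y : subgroup_type H,
    word_dist T x y <= C * (word_dist S (val x) (val y)).+1.
Proof.
move=> gT; have [R RP] := coset_proj_lipschitz.
have [l lP] := wd_ball gS (2 * R); pose f (g : G) := word_norm T (insubd (1%g : subgroup_type H) g).
pose C := \max_(g <- l) f g; exists C => x y.
have step (a b : subgroup_type H) : word_dist S (val a) (val b) <= 2 * R -> word_dist T a b <= C.
  move=> ab; have : f ((val a)^-1 * val b)%g = word_dist T a b.
    rewrite /f /word_dist -subgroup_valVM; congr word_norm.
    by apply: val_inj; rewrite val_insubd (valP (a^-1 * b)%g).
  by move=> <-; apply: (leq_bigmax_seq (F := f)) (lP _ ab) _.
have inH (g : G) : co g = co 1%g -> g \in H.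
  by move/coset_ofP; rewrite same_coset_sym /same_coset invg1 mul1g.
have Hin (g : subgroup_type H) : co (val g) = co 1%g.
  by apply/coset_ofP; rewrite same_coset_sym /same_coset invg1 mul1g (valP g).
have [s [ps ls <-]] := wd_walk gS (val x) (val y).
suff main a (h : subgroup_type H) : coset_proj (co 1%g) a (val h) -> path (cay S) a s -> last a s = val y ->
    word_dist T h y <= C * (size s).+1.
  exact: (main _ x (coset_proj_self (Hin x)) ps ls).
elim: s a h {ps ls} => [|z s IH] a h ph /=.
  move=> _ ay; rewrite muln1; apply: step.
  rewrite ay in ph; have [d _] := RP _ _ _ _ _ ph (coset_proj_self (Hin y)).
  by move: d; rewrite (wd_refl gS) muln1 => d; apply: leq_trans d _; rewrite mul2n -addnn leq_addr.
case/andP=> az ps ls; have [h2 ph2] := coset_proj_exists (co 1%g) z.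
have h2H := inH _ ph2.1; pose k : subgroup_type H := Sub h2 h2H.
apply: leq_trans (wd_tri gT k _ _) _; rewrite mulnS; apply: leq_add.
  apply: step; have [d _] := RP _ _ _ _ _ ph ph2; apply: leq_trans d _.
  by rewrite mulnC leq_mul2r ltnS (wd_gen gS az) orbT.
by apply: (IH z k) => //.
Qed.

End FineHyperbolic.

(** * Transition points *)

Section Transition.
Context (G : groupType) (S : seq G) (H : groupClosed G).
Context (dh : cone_vertex H -> cone_vertex H -> nat) (delta : nat).
Hypothesis gS : generating_set S.
Notation CV := (cone_vertex H).
Notation CE := (coned_adj S (H := H)).
Notation wt := (@cwt G H).
Notation co := (coset_of H).
Hypothesis dhP : graph_metric CE wt dh.
Hypothesis hyp : forall x y z o,
  dh x z + dh y o <= maxn (dh x y + dh z o) (dh y z + dh x o) + delta.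
Hypothesis fineP : forall n, exists r, forall c h1 h2, co h1 = c -> co h2 = c ->
  awalk CE wt (inr c) n (inl h1) (inl h2) -> word_dist S h1 h2 <= r.
Notation geo := (geod CE wt dh).
Notation wd := (word_dist S).

Definition group_vertices (s : seq CV) : seq G :=
  pmap (fun v : CV => if v is inl g then Some g else None) s.

Lemma mem_group_vertices s g : (g \in group_vertices s) = ((inl g : CV) \in s).
Proof. by elim: s => //= -[h|c] s IH; rewrite /= !in_cons IH. Qed.

Definition coarse_step (a b : G) : bool := (wd a b <= 1) || (co a == co b).

Lemma group_vertices_chain x y s : path CE (inl x) s -> last (inl x : CV) s = inl y ->
  path coarse_step x (group_vertices s) /\ last x (group_vertices s) = y.
Proof.
have [n le_n] := ubnP (size s); elim: n s x le_n => // n IH [|[z|c] s] x le_n /=.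
- by move=> _ [->].
- move=> /andP[/andP[_ xz] ps] ls; have [|-> ->] := IH s z _ ps ls.
    by rewrite ltnS in le_n; apply: leq_trans le_n.
  by rewrite /coarse_step (wd_gen gS xz).
case: s le_n => [|[z|c'] s] le_n /=; [by move=> _ | | by rewrite andbF].
move=> /andP[/eqP xc /andP[/eqP cz ps]] ls.
have [|-> ->] := IH s z _ ps ls.
  by rewrite /= ltnS in le_n; apply: leq_trans le_n; exact: leqnSn.
by rewrite /coarse_step xc cz eqxx orbT.
Qed.

(** [tr x y] consists of the group vertices of a chosen coned-off geodesic; the four properties are
    all that the argument in the asymptotic cone uses. The last one holds because transition points
    satisfy the thinness assumptions of [guess_log] in the word metric, and a logarithmic bound is
    in particular linear. *)
Lemma transition_exists : exists (tr : G -> G -> seq G) (R : nat),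
  [/\ forall x y, path coarse_step x (tr x y) /\ last x (tr x y) = y,
      forall x p, p \in x :: tr x x -> p = x,
      forall x y z p, p \in x :: tr x y -> exists2 q, q \in x :: tr x z \/ q \in z :: tr z y &
        wd p q <= R &
      forall x y p, p \in x :: tr x y -> wd p y <= R * (wd x y).+1].
Proof.
have [f fP] := choice (fun xy : G * G => geod_exists dhP (inl xy.1) (inl xy.2)).
pose tr x y := group_vertices (f (x, y)).
have memtr x y p : (p \in x :: tr x y) = ((inl p : CV) \in inl x :: f (x, y)).
  by rewrite !in_cons mem_group_vertices.
have tr_short x y p : wd x y <= 1 -> p \in x :: tr x y -> wd p x <= 1.
  move=> xy; rewrite memtr => pin.
  have [gf lf] := fP (x, y); have e := geod_mem dhP gf pin; rewrite lf /= in e.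
  have two (a b : G) : a != b -> 2 <= dh (inl a) (inl b).
    move=> ab; have [s [ps ls <-]] := dhP.2 (inl a) (inl b).
    case: s ps ls => [_ [eab]|v [|u s] _ /= ev]; first by rewrite eab eqxx in ab.
      by rewrite ev.
    exact: (@leq_add 1 1 _ _ (cwt_gt0 (inl a) v) (leq_trans (cwt_gt0 v u) (leq_addr _ _))).
  have dxy : dh (inl x) (inl y) <= 2.
    have [->|nxy] := eqVneq x y; first by rewrite (gd_refl dhP).
    have [s [ps ls sz]] := wd_walk gS x y.
    case: s ps ls sz => [_ /= e0|z [|z' s] ps ls sz]; first by rewrite e0 eqxx in nxy.
      have E : CE (inl x) (inl y).
        by move: ps; rewrite /= in ls *; rewrite ls andbT /cayley_adj nxy.
      by have := gd_adj dhP E.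
    by rewrite -sz in xy.
  have [->|nxp] := eqVneq p x; first by rewrite (wd_refl gS).
  have [->|npy] := eqVneq p y; first by rewrite (wd_sym gS).
  have h1 : 2 <= dh (inl x) (inl p) by apply: two; rewrite eq_sym.
  by have := leq_trans (leq_add h1 (two p y npy)) (leq_trans (eq_leq e) dxy).
have [R RP] := two_sides_close gS dhP hyp fineP.
have thin x y z p : p \in x :: tr x y -> exists2 q, q \in x :: tr x z \/ q \in z :: tr z y &
    wd p q <= R.+1.
  rewrite memtr => pin; have [g1 l1] := fP (x, z); have [g2 l2] := fP (z, y).
  have [g3 l3] := fP (x, y).
  have g2' : geo (last (inl x) (f (x, z))) (f (z, y)) by rewrite l1.
  have l3' : last (inl x) (f (x, y)) = last (last (inl x) (f (x, z))) (f (z, y)).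
    by rewrite l3 l1 l2.
  have [q qin dq] := RP _ _ _ _ _ g1 g2' g3 l3' pin.
  exists q; last exact: leqW; move: qin; rewrite -cat_cons mem_cat => /orP[q1|q2].
    by left; rewrite memtr.
  by right; rewrite memtr in_cons q2 orbT.
exists tr, (2 * R + 4); split=> //.
- by move=> x y; have [g1 l1] := fP (x, y); exact: group_vertices_chain (geod_path g1) l1.
- move=> x p; rewrite memtr => pin; have [gf lf] := fP (x, x).
  have := geod_mem dhP gf pin; rewrite lf /= (gd_refl dhP) => /eqP.
  by rewrite addn_eq0 => /andP[/eqP/(gd_eq0 (@cwt_gt0 G H) dhP)[]].
- move=> x y z p /(thin x y z)[q ? dq]; exists q => //; apply: leq_trans dq _.
  by clear; lia.
move=> x y p pin; have [s [ps ls sz]] := wd_walk gS x y.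
have L_thin u v w p0 : p0 \in u :: tr u w -> exists2 q, q \in u :: tr u v \/ q \in v :: tr v w &
  wd p0 q <= R.+1 by exact: thin.
have sz2 : size s <= 2 ^ size s by exact/ltnW/ltn_expl.
have pin' : p \in x :: tr x (last x s) by rewrite ls.
have [q qin dq] := guess_log (d := wd) (L := fun u w p => p \in u :: tr u w)
    (h := R.+1) (word_metric gS) (ltn0Sn R) (fun u v w p => thin u w v p)
    (fun u w p uw pu => leq_trans (tr_short u w p uw pu) (ltn0Sn R)) ps sz2 pin'.
rewrite sz in dq; have [s1 [s2 [es l1 _ _]]] : exists s1 s2,
    [/\ s = s1 ++ s2, last x s1 = q, path (cay S) x s1 & path (cay S) q s2].
  move: qin; rewrite in_cons => /orP[/eqP->|qs]; first by exists [::], s.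
  case/splitPr: qs ps => s1 s2 ps; exists (rcons s1 q), s2; rewrite last_rcons cat_rcons.
  by move: ps; rewrite -cat_rcons cat_path last_rcons => /andP[-> ->].
have qy : wd q y <= wd x y.
  have p2 : path (cay S) q s2 by move: ps; rewrite es cat_path l1 => /andP[].
  have := wd_le_walk gS p2; rewrite -ls es last_cat l1 => /leq_trans -> //.
  by rewrite -[last q s2]/(last q s2) -{1}l1 -last_cat -es ls -sz es size_cat leq_addl.
have := wd_tri gS q p y; move: dq qy; clear; nia.
Qed.

(** Project to [c]. The cosets [c1] and [c2] have bounded projections and come close to each other
    at [z], so the projections of [v] and [s'] are close; they are also close to [x] and [y]. *)
Lemma three_cosets : exists C, forall c c1 c2 x y z u v v' s s' u' t,
  c1 != c -> c2 != c ->
  co u = c -> co v = c1 -> co v' = c1 -> co s = c2 -> co s' = c2 -> co u' = c ->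
  wd x u <= t -> wd x v <= t -> wd z v' <= t -> wd z s <= t -> wd y s' <= t -> wd y u' <= t ->
  wd x y <= C * t.+1.
Proof.
have [R RP] := coset_proj_lipschitz gS dhP hyp fineP; exists (10 * R + 4).
move=> c c1 c2 x y z u v v' s s' u' t n1 n2 uc vc v'c sc s'c u'c xu xv zv zs ys yu.
have [hv pv] := coset_proj_exists gS dhP c v; have [hv' pv'] := coset_proj_exists gS dhP c v'.
have [hs ps] := coset_proj_exists gS dhP c s; have [hs' ps'] := coset_proj_exists gS dhP c s'.
have [d1 _] := RP _ _ _ _ _ (coset_proj_self dhP uc) pv.
have [_ d2] := RP _ _ _ _ _ pv pv'.
have [d3 _] := RP _ _ _ _ _ pv' ps.
have [_ d4] := RP _ _ _ _ _ ps ps'.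
have [d5 _] := RP _ _ _ _ _ ps' (coset_proj_self dhP u'c).
have {}d2 : wd hv hv' <= R by apply: d2; rewrite ?vc.
have {}d4 : wd hs hs' <= R by apply: d4; rewrite ?sc.
have E a b e : wd e a <= t -> wd e b <= t -> R * (wd a b).+1 <= R * (2 * t).+1.
  move=> ea eb; rewrite leq_mul2l ltnS; apply/orP; right.
  by apply: leq_trans (wd_tri gS e _ _) _; rewrite (wd_sym gS) mul2n -addnn leq_add.
have {}d1 := leq_trans d1 (E _ _ _ xu xv); have {}d3 := leq_trans d3 (E _ _ _ zv zs).
have {}d5 := leq_trans d5 (E _ _ _ ys yu).
have := wd_tri gS u x y; have := wd_tri gS hv u y; have := wd_tri gS hv' hv y.
have := wd_tri gS hs hv' y; have := wd_tri gS hs' hs y; have := wd_tri gS u' hs' y.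
have := wd_sym gS u' y; move: xu d1 d2 d3 d4 d5 yu; clear; nia.
Qed.

End Transition.

(** * Images of cosets under quasi-isometries *)

Section UltraLimits.
Local Open Scope classical_set_scope.
Context (K : realType) (w : set_system nat) {wU : UltraFilter w}.

Lemma ultra_dec (P : nat -> Prop) :
  w [set n | P n]%classic \/ w [set n | ~ P n]%classic.
Proof. exact: in_ultra_setVsetC. Qed.

Lemma ultra_not (P : nat -> Prop) :
  ~ w [set n | P n]%classic -> w [set n | ~ P n]%classic.
Proof. by case: (ultra_dec P). Qed.

Lemma ultra_contra (P : nat -> Prop) : w [set n | P n]%classic -> (forall n, ~ P n) -> False.
Proof. by move=> /filter_ex[n Pn] /(_ n). Qed.

Lemma ultra_lim (F : nat -> K) (C : K) :
  w [set n | (0 <= F n <= C)%R]%classic ->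
  [/\ forall e : K, (0 < e)%R -> w [set n | (`|F n - lim (F @ w)| < e)%R]%classic,
      (0 <= lim (F @ w))%R & True].
Proof.
move=> wF.
have FU : UltraFilter (F @ w)%classic.
  split=> [|A AF sA]; first exact: fmap_proper_filter.
  rewrite predeqE => B; split; last exact: sA.
  move=> AB; have [//|nB] := ultra_dec (fun n => B (F n)).
  have : A (~` B)%classic by apply: sA.
  by move=> /(filterI AB) /filter_ex[x []].
have cpt := @segment_compact K 0%R C; rewrite compact_ultra in cpt.
have [|l [/= lin Fl]] := cpt (F @ w)%classic FU.
  by apply: filterS wF => n h; rewrite /= in_itv /=; exact: h.
have -> : lim (F @ w) = l by apply/cvg_lim.
split=> //; last by move: lin; rewrite in_itv /= => /andP[].
move=> e e0; have /cvgrPdist_lt/(_ e e0) := Fl.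
by apply: filterS => n /=; rewrite distrC.
Qed.

End UltraLimits.

Section ConeArgument.
Local Open Scope classical_set_scope.
Context (K : realType) (Hg : groupType) (T : seq Hg).
Hypothesis gT : generating_set T.
Context (w : set_system nat) (e : nat -> Hg) (d : nat -> K).
Context {wU : UltraFilter w}.
Let wPF : ProperFilter w := @ultra_proper _ _ wU.
Let wFF : Filter w := @filter_filter _ _ wPF.
Let wI (A B : set nat) : w A -> w B -> w (A `&` B) := fun a b => @filterI _ w wFF A B a b.
Let wS (A B : set nat) : A `<=` B -> w A -> w B := fun a b => @filterS _ w wFF A B a b.
Let wcontra := @ultra_contra w wU.
Let wnot := @ultra_not w wU.
Let wT0 : w setT := @filterT _ w wFF.
Hypothesis d_gt0 : forall n, (0 < d n)%R.
Hypothesis d_inf : (d n @[n --> w] --> +oo)%R.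
Hypothesis nocut : forall p : asymptotic_cone T w e d, ~ cut_point p.

Notation wT := (word_dist T).

(** The distances that vanish in the cone after rescaling by [d]. *)
Definition small (a : nat -> nat) : Prop :=
  forall eps : K, (0 < eps)%R -> w [set n | ((a n)%:R <= eps * d n)%R]%classic.

Lemma d_large (M : K) : w [set n | (M <= d n)%R]%classic.
Proof. by have /cvgryPge/(_ M) := d_inf. Qed.

Lemma small_lin C (a b : nat -> nat) :
  w [set n | a n <= C * (b n).+1]%classic -> small b -> small a.
Proof.
move=> wab sb eps eps0.
have e2 : (0 < eps / (2 * C.+1%:R))%R by rewrite divr_gt0 // mulr_gt0 // ltr0n.
have H := wI (wI wab (sb _ e2)) (d_large (2 * C.+1%:R / eps)%R).
apply: (wS _ H) => n /= [[h1 h2] h3].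
have C0 : (0 < C.+1%:R :> K)%R by rewrite ltr0n.
have h4 : ((a n)%:R <= C.+1%:R * ((b n)%:R + 1) :> K)%R.
  rewrite natr1 -natrM ler_nat; apply: leq_trans h1 _.
  by rewrite leq_mul2r leqnSn orbT.
apply: le_trans h4 _; rewrite mulrDr mulr1.
have h5 : (C.+1%:R * (b n)%:R <= eps / 2 * d n)%R.
  apply: le_trans (ler_wpM2l (ltW C0) h2) _.
  have cN : (C.+1%:R != 0 :> K)%R by rewrite gt_eqF.
  rewrite le_eqVlt; apply/orP; left; apply/eqP.
  by move: (C.+1%:R : K)%R cN => c cN; field.
have h6 : (C.+1%:R <= eps / 2 * d n)%R.
  by move: h3; rewrite ler_pdivrMr // => h3; lra.
lra.
Qed.

Lemma small_le (a b : nat -> nat) : w [set n | a n <= b n]%classic -> small b -> small a.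
Proof.
move=> wab sb; apply: (@small_lin 1 a b) => //.
by apply: wS wab => n /= h; rewrite mul1n; exact: leqW.
Qed.

Lemma small_add (a b : nat -> nat) : small a -> small b -> small (fun n => a n + b n).
Proof.
move=> sa sb eps eps0; have e2 : (0 < eps / 2)%R by rewrite divr_gt0.
apply: wS (wI (sa _ e2) (sb _ e2)) => n /= [h1 h2].
by rewrite natrD; lra.
Qed.

Lemma not_small (a : nat -> nat) : ~ small a ->
  exists2 eps : K, (0 < eps)%R & w [set n | (eps * d n < (a n)%:R)%R]%classic.
Proof.
move=> /existsNP[eps /not_implyP[eps0 h]]; exists eps => //.
by apply: wS (wnot h) => n /negP; rewrite -ltNge.
Qed.

Lemma small_contra (a : nat -> nat) (eps : K) : (0 < eps)%R -> small a ->
  w [set n | (eps * d n < (a n)%:R)%R]%classic -> False.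
Proof.
move=> eps0 sa h; have := wcontra (wI (sa _ eps0) h); apply=> n /= [h1 h2].
by move: (lt_le_trans h2 h1); rewrite ltxx.
Qed.

Notation cs := (cone_seq T w e d).

Lemma cone_dist_ratio (x y : cs) : exists C : K,
  w [set n | (0 <= (wT (sval x n) (sval y n))%:R / d n <= C)%R]%classic.
Proof.
have [C1 h1] := svalP x; have [C2 h2] := svalP y; exists (C1 + C2)%R.
apply: wS (wI h1 h2) => n /= [k1 k2].
rewrite divr_ge0 ?(ltW (d_gt0 n)) //=; apply: le_trans (lerD k1 k2).
rewrite -mulrDl ler_wpM2r ?invr_ge0 ?(ltW (d_gt0 n)) // -natrD ler_nat.
by rewrite (wd_sym gT (sval y n)) (wd_tri gT).
Qed.

Lemma cone_dist_lim (x y : cs) (eps : K) : (0 < eps)%R ->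
  w [set n | (`|(wT (sval x n) (sval y n))%:R / d n - cone_seq_dist x y| < eps)%R]%classic.
Proof. by have [C /ultra_lim[h _ _]] := cone_dist_ratio x y; exact: h. Qed.

Lemma cone_seq_dist_ge0 (x y : cs) : (0 <= cone_seq_dist x y)%R.
Proof. by have [C /ultra_lim[]] := cone_dist_ratio x y. Qed.

Lemma cone_seq_dist0 (x y : cs) :
  cone_seq_dist x y = 0%R <-> small (fun n => wT (sval x n) (sval y n)).
Proof.
split=> [h eps eps0|sm].
  apply: wS (cone_dist_lim x y eps0) => n /=; rewrite h subr0.
  by rewrite ger0_norm ?divr_ge0 ?(ltW (d_gt0 n)) // ltr_pdivrMr // => /ltW.
apply/eqP; rewrite eq_le cone_seq_dist_ge0 andbT; apply/negPn/negP; rewrite -ltNge => gt0.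
have h2 : (0 < cone_seq_dist x y / 2)%R by rewrite divr_gt0.
have := wcontra (wI (cone_dist_lim x y h2) (sm _ h2)); apply => n /= [k1 k2].
move: k1; rewrite ltr_norml => /andP[k1 _]; rewrite -ler_pdivrMr // in k2.
lra.
Qed.

Lemma cone_seq_dist_lt (x y : cs) (r : K) : (cone_seq_dist x y < r)%R ->
  w [set n | ((wT (sval x n) (sval y n))%:R < r * d n)%R]%classic.
Proof.
move=> lt; have h : (0 < r - cone_seq_dist x y)%R by rewrite subr_gt0.
apply: wS (cone_dist_lim x y h) => n /=; rewrite ltr_norml => /andP[_ k].
by rewrite -ltr_pdivrMr //; lra.
Qed.

Local Notation cone := (asymptotic_cone T w e d).

Definition cone_pt (x : cs) : cone_point T w e d :=
  exist _ [set y | cone_seq_dist x y = 0%R]%classic (ex_intro _ x erefl).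

Lemma cone_reprE (A : cone_point T w e d) :
  sval A = [set y | cone_seq_dist (cone_repr A) y = 0%R]%classic.
Proof. exact: (svalP (cid (svalP A))). Qed.

Lemma small_refl (x : nat -> Hg) : small (fun n => wT (x n) (x n)).
Proof.
move=> eps eps0; apply: wS (wT0) => n _ /=.
by rewrite (wd_refl gT) mulr_ge0 // ltW.
Qed.

Lemma small_sym (x y : nat -> Hg) : small (fun n => wT (x n) (y n)) -> small (fun n => wT (y n) (x n)).
Proof. by move=> h eps /h; apply: wS => n /=; rewrite (wd_sym gT). Qed.

Lemma small_trans (x y z : nat -> Hg) : small (fun n => wT (x n) (y n)) ->
  small (fun n => wT (y n) (z n)) -> small (fun n => wT (x n) (z n)).
Proof.
move=> h1 h2; apply: small_le (small_add h1 h2).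
by apply: wS (wT0) => n _ /=; exact: wd_tri.
Qed.

Lemma cone_repr_pt (x : cs) : small (fun n => wT (sval (cone_repr (cone_pt x)) n) (sval x n)).
Proof.
have : sval (cone_pt x) (cone_repr (cone_pt x)).
  by rewrite cone_reprE /=; apply/cone_seq_dist0/small_refl.
by move=> /= /cone_seq_dist0/small_sym.
Qed.

Lemma cone_pt_eq (A B : cone_point T w e d) :
  small (fun n => wT (sval (cone_repr A) n) (sval (cone_repr B) n)) -> A = B.
Proof.
move=> h; suff : sval A = sval B.
  by case: A B {h} => a pa [b pb] /= ab; exact: eq_exist.
rewrite !cone_reprE predeqE => y.
split=> /= /cone_seq_dist0 k; apply/cone_seq_dist0.
  exact: small_trans (small_sym h) k.
exact: small_trans h k.
Qed.

Lemma cone_open (U : set cone) :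
  (forall x, U x -> exists2 r : K, (0 < r)%R & forall y, (cone_dist x y < r)%R -> U y) -> open U.
Proof. by move=> h; rewrite openE => x Ux; exists U; split=> //; exact: h. Qed.

(** Off [p] both [U] and its complement are open, while the complement of [p] is connected. *)
Lemma cone_connected (p : cone) (U : set cone) (x y : cone) :
  x <> p -> y <> p -> U y -> ~ U x ->
  (forall z, z <> p -> exists2 r : K, (0 < r)%R & forall z', (cone_dist z z' < r)%R ->
     (U z <-> U z')) -> False.
Proof.
move=> xp yp Uy nUx loc; have [_ con] := contrapT (@nocut p).
have away z : z <> p -> exists2 r : K, (0 < r)%R & forall z', (cone_dist z z' < r)%R -> z' <> p.
  move=> zp; exists (cone_dist z p); last by move=> z' lt e'; rewrite e' ltxx in lt.
  rewrite lt_neqAle cone_seq_dist_ge0 andbT eq_sym; apply/eqP => /cone_seq_dist0 h.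
  by apply: zp; exact: cone_pt_eq.
have op (W : set cone) : (W = U \/ W = ~` U)%classic -> open (W `&` [set~ p])%classic.
  move=> WU; apply: cone_open => z [Wz zp].
  have [r r0 rP] := loc z zp; have [r' r'0 r'P] := away z zp.
  exists (Num.min r r'); first by rewrite lt_min r0.
  move=> z'; rewrite lt_min => /andP[h1 h2]; split; last exact: r'P.
  by have := rP _ h1; case: WU Wz => -> /= Wz [k1 k2]; [exact: k1 | move=> /k2].
have : U `&` [set~ p] = [set~ p]; last by rewrite predeqE => /(_ x)[_ /(_ xp)[]].
apply: con.
- by exists y.
- exists (U `&` [set~ p])%classic; first by apply: op; left.
  by rewrite predeqE => z; split=> [[]|[] ? []].
- exists (~` (~` U `&` [set~ p]))%classic; first by apply: open_closedC; apply: op; right.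
  rewrite predeqE => z; split=> [[Uz zp]|[zp h]]; first by split=> // -[].
  by split=> //; apply: contrapT => nUz; apply: h.
Qed.

End ConeArgument.

Lemma argmax_seq (I : eqType) (f : I -> nat) (x : I) (s : seq I) :
  exists2 p, p \in x :: s & forall q, q \in x :: s -> f q <= f p.
Proof.
elim: s x => [|y s IH] x; first by exists x; rewrite ?mem_head // => q; rewrite inE => /eqP->.
have [p pin pmax] := IH y; case: (leqP (f x) (f p)) => le.
  exists p; first by rewrite in_cons pin orbT.
  by move=> q; rewrite in_cons => /orP[/eqP->//|/pmax].
exists x; first exact: mem_head.
move=> q; rewrite in_cons => /orP[/eqP->//|/pmax h]; exact: leq_trans h (ltnW le).
Qed.

(** * A transition point in the image would separate the cone *)

Section Peripheral.
Local Open Scope classical_set_scope.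
Context (K : realType) (Hg : groupType) (T : seq Hg).
Hypothesis gT : generating_set T.
Context (w : set_system nat) (e : nat -> Hg) (d : nat -> K).
Context {wU : UltraFilter w}.
Let wPF : ProperFilter w := @ultra_proper _ _ wU.
Let wFF : Filter w := @filter_filter _ _ wPF.
Let wI (A B : set nat) : w A -> w B -> w (A `&` B) := fun a b => @filterI _ w wFF A B a b.
Let wS (A B : set nat) : A `<=` B -> w A -> w B := fun a b => @filterS _ w wFF A B a b.
Let wcontra := @ultra_contra w wU.
Let wnot := @ultra_not w wU.
Let wT0 : w setT := @filterT _ w wFF.
Hypothesis d_gt0 : forall n, (0 < d n)%R.
Hypothesis d_inf : (d n @[n --> w] --> +oo)%R.
Hypothesis nocut : forall p : asymptotic_cone T w e d, ~ cut_point p.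

Notation wT := (word_dist T).
Notation sm := (small w d).
Notation cs := (cone_seq T w e d).
Notation pt := (cone_point T w e d).
Notation rp := cone_repr.

Let slin C a b := @small_lin K w d wU d_inf C a b.
Let sle a b := @small_le K w d wU d_inf a b.
Let sadd a b := @small_add K w d wU a b.
Let snot a := @not_small K w d wU a.
Let scontra a eps := @small_contra K w d wU a eps.
Let dlarge := d_large d_inf.
Let ptE := cone_pt_eq (e := e) gT d_gt0 d_inf.
Let rpt := cone_repr_pt (e := e) (wU := wU) gT d_gt0.

Lemma const_small C : sm (fun=> C).
Proof.
move=> eps eps0; apply: wS (dlarge (C%:R / eps)%R) => n /=.
by rewrite ler_pdivrMr // mulrC.
Qed.

(** A bounded group has a one-point cone, and its point counts as a cut-point because the complement
    is empty. Prefixes of a geodesic word then realise every norm. *)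
Lemma group_unbounded n : exists h : Hg, word_norm T h = n.
Proof.
have wnE h : wT 1%g h = word_norm T h by rewrite /word_dist invg1 mul1g.
have [h nh] : exists h : Hg, n <= word_norm T h.
  apply: contrapT => /forallNP bd.
  have bd' x y : wT x y <= n by have /negP := bd (x^-1 * y)%g; rewrite -ltnNge => /ltnW.
  have base : \forall k \near w, ((word_dist T (e k) (e k))%:R / d k <= 0)%R.
    by apply: wS wT0 => k _ /=; rewrite (wd_refl gT) mul0r.
  pose p : pt := cone_pt (exist _ e (ex_intro _ 0%R base)).
  have [[q qp] _] := contrapT (@nocut p); apply: qp; apply: ptE.
  by apply: sle (const_small n); apply: wS wT0 => k _ /=; exact: bd'.
have [s [gs ls]] := geod_exists (word_metric gT) 1%g h.
have szs := unit_geod_size gs; rewrite ls wnE in szs.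
have [g1 _ _] : [/\ geod (cay T) (fun _ _ => 1) wT 1%g (take n s), True & True].
  by move: gs; rewrite -{1}(cat_take_drop n s) => /(geod_cat (word_metric gT))[].
exists (last 1%g (take n s)); have := unit_geod_size g1.
by rewrite wnE size_take_min szs => <-; apply/minn_idPl.
Qed.

(** Move [x n] by an element whose norm exceeds the distance to [y n] by at least [d n]. The upper
    bound on this norm keeps the sequence in the cone. *)
Lemma third_point (x y : cs) : exists z : cs,
  ~ sm (fun n => wT (sval x n) (sval z n)) /\ ~ sm (fun n => wT (sval y n) (sval z n)).
Proof.
have H n : exists h : Hg, ((wT (sval x n) (sval y n))%:R + d n <= (word_norm T h)%:R :> K)%R /\
   ((word_norm T h)%:R <= (wT (sval x n) (sval y n))%:R + d n + 1 :> K)%R.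
  have [h nh] := group_unbounded (wT (sval x n) (sval y n) + (Num.truncn (d n)).+1).
  exists h; rewrite nh natrD; have /andP[h1 h2] := truncn_itv (ltW (d_gt0 n)).
  by rewrite -natr1 in h2 *; split; lra.
have [h hP] := choice H.
have wxz n : wT (sval x n) (sval x n * h n)%g = word_norm T (h n).
  by rewrite /word_dist mulKg.
have [C1 C1P] := svalP x; have [C2 C2P] := cone_dist_ratio gT d_gt0 x y.
have zb : exists C : K, \forall n \near w, ((word_dist T (sval x n * h n)%g (e n))%:R / d n <= C)%R.
  exists (C1 + (C2 + 1 + 1))%R; apply: wS (wI (wI C1P C2P) (dlarge 1%R)) => n /= [[k1 /andP[_ k2]] k3].
  have dn := d_gt0 n; have [_ h2] := hP n.
  rewrite !ler_pdivrMr // in k1 k2 *.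
  have := wd_tri gT (sval x n) (sval x n * h n)%g (e n).
  rewrite (wd_sym gT _ (sval x n)) wxz -(ler_nat K) natrD => h3.
  have h4 : (1 <= 1 * d n)%R by rewrite mul1r.
  by nra.
have [z zE] : exists z : cs, forall n, sval z n = (sval x n * h n)%g.
  by exists (exist _ (fun n => (sval x n * h n)%g) zb).
have h20 : (0 < 2^-1 :> K)%R by rewrite invr_gt0 ltr0n.
exists z; split=> sz; have := wcontra (sz _ h20); apply=> n; rewrite zE.
  rewrite wxz; have [h1 _] := hP n; have := d_gt0 n.
  by have : (0 <= (wT (sval x n) (sval y n))%:R :> K)%R by []; move=> *; lra.
have [h1 _] := hP n; have := d_gt0 n.
have := wd_tri gT (sval y n) (sval x n) (sval x n * h n)%g.
by rewrite wxz -(ler_nat K) natrD; move=> *; lra.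
Qed.

Context (G : groupType) (S : seq G) (H : groupClosed G).
Hypothesis gS : generating_set S.
Notation wd := (word_dist S).
Notation co := (coset_of H).
Context (tr : G -> G -> seq G) (R : nat).
Hypothesis tr_path : forall x y, path (coarse_step S H) x (tr x y) /\ last x (tr x y) = y.
Hypothesis tr_refl : forall x p, p \in x :: tr x x -> p = x.
Hypothesis tr_thin : forall x y z p, p \in x :: tr x y ->
  exists2 q, q \in x :: tr x z \/ q \in z :: tr z y & wd p q <= R.
Hypothesis tr_linear : forall x y p, p \in x :: tr x y -> wd p y <= R * (wd x y).+1.
Context (Fam : (Hg -> G) -> Prop) (A : nat).
Hypothesis FamU : forall f, Fam f -> forall a b, wd (f a) (f b) <= A * (wT a b).+1.
Hypothesis FamD : forall f, Fam f -> forall a b, wT a b <= A * (wd (f a) (f b)).+1.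

Section Separation.
Context (F : nat -> Hg -> G).
Hypothesis FF : forall n, Fam (F n).

Notation im x n := (F n (sval x n)).

Lemma im_small (x y : cs) : sm (fun n => wT (sval x n) (sval y n)) <->
  sm (fun n => wd (im x n) (im y n)).
Proof.
split=> h; apply: slin h; apply: wS wT0 => n _ /=; first exact: FamU.
exact: FamD.
Qed.

Section Transition.
Context (p : nat -> G) (x : cs).

(** In the limit [p] lies on the transition path from the image of [x] to that of [z]: seen from
    [x], the point [z] is behind [p]. *)
Definition beyond (z : cs) : Prop := forall eps : K, (0 < eps)%R ->
  w [set n | exists2 q, q \in im x n :: tr (im x n) (im z n) &
                        ((wd (p n) q)%:R <= eps * d n)%R].

(** By thinness, a transition point near [p] between [x] and [a] is close to one between [x] and [b]
    or to one between [b] and [a]. The latter stay near [a] by [tr_linear], hence away from [p]. *)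
Lemma beyond_local (a b : cs) (eps : K) : (0 < eps)%R ->
  w [set n | (eps * d n < (wd (p n) (im a n))%:R)%R] ->
  w [set n | ((wT (sval a n) (sval b n))%:R <= eps / (4 * (R * A + 1)%:R) * d n)%R] ->
  beyond a -> beyond b.
Proof.
move=> eps0 fa ab Ba; apply: contrapT => /existsNP[e1 /not_implyP[e10 /wnot nB]].
pose e2 := Num.min (e1 / 2)%R (eps / 4)%R.
have e20 : (0 < e2)%R by rewrite lt_min !divr_gt0.
have big := wI (dlarge (R%:R * 2 / e1)%R) (dlarge ((R + R * A + R)%:R * 4 / eps)%R).
have := wcontra (wI (wI (wI fa ab) (wI (Ba _ e20) nB)) big); apply=> n /=.
move=> [[[h1 h2] [[q qin dq] h3]] [b1 b2]].
have dn := d_gt0 n.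
rewrite ler_pdivrMr // in b1; rewrite ler_pdivrMr // in b2.
have [q1 q2] : ((wd (p n) q)%:R <= e1 / 2 * d n :> K)%R /\ ((wd (p n) q)%:R <= eps / 4 * d n :> K)%R.
  by split; apply: le_trans dq _; rewrite ler_pM2r // ge_min lexx ?orbT.
have [q' [q'in|q'in] dq'] := tr_thin (im b n) qin.
  apply: h3; exists q' => //.
  have := wd_tri gS q (p n) q'; rewrite -(ler_nat K) natrD => h5.
  by rewrite -(ler_nat K) in dq'; lra.
have l1 := tr_linear q'in.
have l2 := FamU (FF n) (sval b n) (sval a n).
have l3 : wd q' (im a n) <= R * A * wT (sval a n) (sval b n) + (R * A + R).
  apply: leq_trans l1 _; rewrite (wd_sym gT (sval a n)).
  apply: (@leq_trans (R * (A * (wT (sval b n) (sval a n)).+1).+1)).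
    by rewrite leq_mul2l ltnS l2 orbT.
  by rewrite !mulnS !mulnDr mulnA; clear; lia.
have l4 := wd_tri gS q (p n) (im a n); have l5 := wd_tri gS q' q (im a n).
have l6 : wd (p n) (im a n) <= wd (p n) q + (R * A * wT (sval a n) (sval b n) + (R + R * A + R)).
  by apply: leq_trans l4 _; rewrite leq_add2l; apply: leq_trans l5 _; move: dq' l3; clear; lia.
rewrite -(ler_nat K) natrD (natrD _ (R * A * _)) natrM in l6.
have c0 : (0 < (R * A + 1)%:R :> K)%R by rewrite addn1 ltr0n.
have l7 : ((R * A)%:R * (wT (sval a n) (sval b n))%:R <= eps / 4 * d n :> K)%R.
  apply: (@le_trans _ _ ((R * A + 1)%:R * (wT (sval a n) (sval b n))%:R)%R).
    by rewrite ler_wpM2r // ler_nat leq_addr.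
  apply: le_trans (ler_wpM2l (ltW c0) h2) _.
  have cN : ((R * A + 1)%:R != 0 :> K)%R by rewrite gt_eqF.
  rewrite le_eqVlt; apply/orP; left; apply/eqP.
  by move: ((R * A + 1)%:R : K)%R cN => c cN; field.
have ed := mulr_gt0 eps0 dn.
lra.
Qed.

End Transition.

(** The points beyond [p] form a set that contains [Q] but not [P] and is locally constant away from
    the only point of the cone whose image can be at [p]. Removing that point would disconnect the
    cone. *)
Lemma no_transition (P Q : pt) (p : nat -> G) (eps : K) : (0 < eps)%R ->
  w [set n | p n \in im (rp P) n :: tr (im (rp P) n) (im (rp Q) n)] ->
  w [set n | (eps * d n < (wd (p n) (im (rp P) n))%:R)%R] ->
  w [set n | (eps * d n < (wd (p n) (im (rp Q) n))%:R)%R] -> False.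
Proof.
move=> eps0 pin fP fQ.
pose U : set (asymptotic_cone T w e d) := [set z | beyond p (rp P) (rp z)].
pose near_p (z : pt) := sm (fun n => wd (p n) (im (rp z) n)).
have nP : ~ near_p P by move=> /scontra; apply; [exact: eps0 | exact: fP].
have nQ : ~ near_p Q by move=> /scontra; apply; [exact: eps0 | exact: fQ].
have near_uniq z z' : near_p z -> near_p z' -> z = z'.
  move=> h h'; apply: ptE; apply/im_small; apply: sle (sadd h h').
  by apply: wS wT0 => n _ /=; rewrite (wd_sym gS (p n)) (wd_tri gS).
(* If no point of the cone is at [p], some third point is removed instead. *)
have [r [rP rQ rnear]] : exists r : pt, [/\ P <> r, Q <> r & forall z, z <> r -> ~ near_p z].
  have [[z nz]|nn] := pselect (exists z, near_p z).
    exists z; split; [by move=> e0; apply: nP; rewrite e0 | by move=> e0; apply: nQ; rewrite e0 |].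
    by move=> z' zz' /(near_uniq _ _ nz) e0; apply: zz'.
  have [z [h1 h2]] := third_point (rp P) (rp Q); exists (cone_pt z).
  have h3 := rpt z.
  split; first by move=> e0; apply: h1; rewrite {1}e0.
    by move=> e0; apply: h2; rewrite {1}e0.
  by move=> z' _ nz'; apply: nn; exists z'.
apply: (cone_connected gT d_gt0 d_inf nocut (p := r) (U := U) rP rQ).
- move=> e1 e10; apply: wS pin => n /= pn; exists (p n) => //.
  by rewrite (wd_refl gS) mulr_ge0 // ltW.
- move=> h; have := wcontra (wI (h _ eps0) fP); apply=> n /= [[q /tr_refl -> h1] h2].
  by move: (lt_le_trans h2 h1); rewrite ltxx.
move=> z /rnear /snot[e1 e10 fz].
have c0 : (0 < (R * A + 1)%:R :> K)%R by rewrite addn1 ltr0n.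
pose r1 : K := (e1 / 2 / (4 * (R * A + 1)%:R))%R.
have r10 : (0 < r1)%R by rewrite !divr_gt0 // mulr_gt0.
pose r2 : K := (e1 / (4 * A.+1%:R))%R.
have A0 : (0 < A.+1%:R :> K)%R by rewrite ltr0n.
have r20 : (0 < r2)%R by rewrite divr_gt0 // mulr_gt0.
exists (Num.min r1 r2); first by rewrite lt_min r10.
move=> z'; rewrite lt_min => /andP[lt1 lt2].
have k1 := cone_seq_dist_lt (wU := wU) gT d_gt0 lt1; have k2 := cone_seq_dist_lt (wU := wU) gT d_gt0 lt2.
have mono : (r1 <= e1 / (4 * (R * A + 1)%:R))%R.
  by rewrite /r1 ler_pM2r ?invr_gt0 ?mulr_gt0 //; lra.
split.
  apply: (beyond_local e10 fz); apply: wS k1 => n /= /ltW h; apply: le_trans h _.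
  by rewrite ler_pM2r.
have e12 : (0 < e1 / 2)%R by rewrite divr_gt0.
apply: (beyond_local e12).
  apply: wS (wI (wI fz k2) (dlarge (A.+1%:R * 4 / e1)%R)) => n /= [[h1 h2] h3].
  have dn := d_gt0 n; rewrite ler_pdivrMr // in h3.
  have l1 := FamU (FF n) (sval (rp z') n) (sval (rp z) n).
  rewrite (wd_sym gT (sval (rp z') n)) in l1.
  have l2 := wd_tri gS (im (rp z') n) (p n) (im (rp z) n).
  have l3 : wd (p n) (im (rp z) n) <= wd (p n) (im (rp z') n) + A.+1 * (wT (sval (rp z) n) (sval (rp z') n)).+1.
    apply: leq_trans l2 _; rewrite leq_add2l; apply: leq_trans l1 _.
    by rewrite leq_mul2r leqnSn orbT.
  rewrite -(ler_nat K) natrD natrM -[X in (_ * X)%R]natr1 mulrDr mulr1 in l3.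
  have h4 : (A.+1%:R * (wT (sval (rp z) n) (sval (rp z') n))%:R <= e1 / 4 * d n :> K)%R.
    apply: le_trans (ler_wpM2l (ltW A0) (ltW h2)) _.
    have cN : (A.+1%:R != 0 :> K)%R by rewrite gt_eqF.
    rewrite le_eqVlt; apply/orP; left; apply/eqP; rewrite /r2.
    by move: (A.+1%:R : K)%R cN => c cN; field.
  lra.
by apply: wS k1 => n /= /ltW; rewrite (wd_sym gT).
Qed.

End Separation.
End Peripheral.

(** * The image of the peripheral subgroup lies near one coset *)

Section NearCoset.
Local Open Scope classical_set_scope.
Context (K : realType) (Hg : groupType) (T : seq Hg).
Hypothesis gT : generating_set T.
Context (w : set_system nat) (e : nat -> Hg) (d : nat -> K).
Context {wU : UltraFilter w}.
Let wPF : ProperFilter w := @ultra_proper _ _ wU.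
Let wFF : Filter w := @filter_filter _ _ wPF.
Let wI (A B : set nat) : w A -> w B -> w (A `&` B) := fun a b => @filterI _ w wFF A B a b.
Let wS (A B : set nat) : A `<=` B -> w A -> w B := fun a b => @filterS _ w wFF A B a b.
Let wnot := @ultra_not w wU.
Let wT0 : w setT := @filterT _ w wFF.
Hypothesis d_gt0 : forall n, (0 < d n)%R.
Hypothesis d_inf : (d n @[n --> w] --> +oo)%R.
Hypothesis nocut : forall p : asymptotic_cone T w e d, ~ cut_point p.

Notation wT := (word_dist T).
Notation sm := (small w d).
Notation cs := (cone_seq T w e d).
Notation pt := (cone_point T w e d).
Notation rp := cone_repr.

Let slin C a b := @small_lin K w d wU d_inf C a b.
Let sle a b := @small_le K w d wU d_inf a b.
Let sadd a b := @small_add K w d wU a b.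
Let snot a := @not_small K w d wU a.
Let scontra a eps := @small_contra K w d wU a eps.
Let dlarge := d_large d_inf.
Let ptE := cone_pt_eq (e := e) gT d_gt0 d_inf.
Let rpt := cone_repr_pt (e := e) (wU := wU) gT d_gt0.

Context (G : groupType) (S : seq G) (H : groupClosed G).
Hypothesis gS : generating_set S.
Notation wd := (word_dist S).
Notation co := (coset_of H).
Context (tr : G -> G -> seq G) (R : nat).
Hypothesis tr_path : forall x y, path (coarse_step S H) x (tr x y) /\ last x (tr x y) = y.
Hypothesis tr_refl : forall x p, p \in x :: tr x x -> p = x.
Hypothesis tr_thin : forall x y z p, p \in x :: tr x y ->
  exists2 q, q \in x :: tr x z \/ q \in z :: tr z y & wd p q <= R.
Hypothesis tr_linear : forall x y p, p \in x :: tr x y -> wd p y <= R * (wd x y).+1.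
Context (C3 : nat).
Hypothesis three_cosetsP : forall c c1 c2 x y z u v v' s s' u' t,
  c1 != c -> c2 != c ->
  co u = c -> co v = c1 -> co v' = c1 -> co s = c2 -> co s' = c2 -> co u' = c ->
  wd x u <= t -> wd x v <= t -> wd z v' <= t -> wd z s <= t -> wd y s' <= t -> wd y u' <= t ->
  wd x y <= C3 * t.+1.
Context (Fam : (Hg -> G) -> Prop) (A : nat).
Hypothesis FamU : forall f, Fam f -> forall a b, wd (f a) (f b) <= A * (wT a b).+1.
Hypothesis FamD : forall f, Fam f -> forall a b, wT a b <= A * (wd (f a) (f b)).+1.
Hypothesis FamL : forall f g, Fam f -> Fam (fun h => f (g * h)%g).

Section Limit.
Context (F : nat -> Hg -> G).
Hypothesis FF : forall n, Fam (F n).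

Notation im x n := (F n (sval x n)).

Let imS (x y : cs) := im_small (wU := wU) d_inf FamU FamD FF x y.

Definition near_coset (c : nat -> left_coset H) (z : nat -> G) : Prop :=
  exists u : nat -> G, (forall n, co (u n) = c n) /\ sm (fun n => wd (z n) (u n)).

(** Let [m] be the maximum over the transition points of the distance to the nearer end; by
    [no_transition] it is negligible. The transition chain must jump from near one end to near the
    other, and its only long steps are those inside a coset. *)
Lemma common_coset (P Q : pt) : P <> Q ->
  exists c, near_coset c (fun n => im (rp P) n) /\ near_coset c (fun n => im (rp Q) n).
Proof.
move=> PQ; set X := fun n => im (rp P) n; set Y := fun n => im (rp Q) n.
have ex n : exists q : (left_coset H * G * G * G)%type,
    let: (c, u, v, p) := q in let m := minn (wd p (X n)) (wd p (Y n)) in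
    [/\ co u = c, co v = c, p \in X n :: tr (X n) (Y n) &
        2 * m + 1 < wd (X n) (Y n) -> wd (X n) u <= m /\ wd (Y n) v <= m].
  have [p pin pmax] := argmax_seq (fun p => minn (wd p (X n)) (wd p (Y n))) (X n) (tr (X n) (Y n)).
  set m := minn (wd p (X n)) (wd p (Y n)) in pmax.
  have [small_XY|big] := leqP (wd (X n) (Y n)) (2 * m + 1).
    (* Default values: the last clause is vacuous here, and [PQ] excludes this case for almost all
       [n]. *)
    by exists (co 1%g, 1%g, 1%g, p); split=> //; rewrite -/m ltnNge small_XY.
  have [ptr ltr] := tr_path (X n) (Y n).
  have PQ' q : q \in X n :: tr (X n) (Y n) -> wd q (X n) <= m \/ wd q (Y n) <= m.
    by move/pmax; rewrite geq_min => /orP.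
  have [||[q _ [h1 h2]]|[q [q' [_ _ h1 h2 h3]]]] := chain_switch ptr PQ'.
  - by rewrite (wd_refl gS).
  - by rewrite ltr (wd_refl gS).
  - have := wd_tri gS q (X n) (Y n); rewrite (wd_sym gS (X n) q).
    by move: big h1 h2; clear; lia.
  case/orP: h3 => [h3|/eqP h3].
    have := wd_tri gS q (X n) (Y n); have := wd_tri gS q' q (Y n); rewrite (wd_sym gS (X n) q).
    by move: big h1 h2 h3; clear; lia.
  exists (co q, q, q', p); split=> // _; rewrite (wd_sym gS) h1 (wd_sym gS).
  by split.
have [f fP] := choice ex; pose p n := (f n).2.
pose m n := minn (wd (p n) (X n)) (wd (p n) (Y n)).
have sm_m : sm m.
  apply: contrapT => /snot[eps eps0 h].
  apply: (no_transition gT d_gt0 d_inf nocut gS tr_refl tr_thin tr_linear FamU FamD FF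
    (P := P) (Q := Q) (p := p) eps0).
  - by apply: wS wT0 => n _ /=; have := fP n; rewrite /p; case: (f n) => [[[c u] v] q] [].
  - by apply: wS h => n /= /lt_le_trans; apply; rewrite ler_nat geq_minl.
  - by apply: wS h => n /= /lt_le_trans; apply; rewrite ler_nat geq_minr.
have big : w [set n | 2 * m n + 1 < wd (X n) (Y n)].
  apply: contrapT => /wnot h; apply: PQ; apply: ptE; apply/imS.
  by apply: (slin (C := 2) (b := m)) => //; apply: wS h => n /= /negP;
  rewrite -leqNgt => h1; apply: leq_trans h1 _; clear; lia.
exists (fun n => (f n).1.1.1); split.
  exists (fun n => (f n).1.1.2); split.
    by move=> n; have := fP n; case: (f n) => [[[c u] v] q] [].
  apply: sle sm_m; apply: wS big => n /=; have := fP n; rewrite /m /p.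
  by case: (f n) => [[[c u] v] q] /= [_ _ _ h /h[]].
exists (fun n => (f n).1.2); split.
  by move=> n; have := fP n; case: (f n) => [[[c u] v] q] [].
apply: sle sm_m; apply: wS big => n /=; have := fP n; rewrite /m /p.
by case: (f n) => [[[c u] v] q] /= [_ _ _ h /h[]].
Qed.

Lemma near_coset_eq (c c' : nat -> left_coset H) z : w [set n | c n = c' n] ->
  near_coset c z -> near_coset c' z.
Proof.
move=> cc [u [uc su]]; exists (fun n => if c n == c' n then u n else repr (c' n)); split.
  by move=> n; case: eqP => [<- //|_]; rewrite /coset_of reprK.
by apply: sle su; apply: wS cc => n /= ->; rewrite eqxx.
Qed.

(** A third point shares a coset with [P] and one with [Q]. If both differed from [c], the three
    cosets would come together pairwise near the three points, and [three_cosetsP] would identify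
    [P] with [Q]. *)
Lemma single_coset (P Q : pt) c : P <> Q ->
  near_coset c (fun n => im (rp P) n) -> near_coset c (fun n => im (rp Q) n) ->
  forall Z : pt, near_coset c (fun n => im (rp Z) n).
Proof.
move=> PQ nP nQ Z; have [<-//|PZ] := pselect (P = Z); have [<-//|QZ] := pselect (Q = Z).
have [c1 [n1P n1Z]] := common_coset PZ; have [c2 [n2Q n2Z]] := common_coset QZ.
have [e1|/wnot d1] := pselect (w [set n | c1 n = c n]); first exact: near_coset_eq e1 n1Z.
have [e2|/wnot d2] := pselect (w [set n | c2 n = c n]); first exact: near_coset_eq e2 n2Z.
exfalso; apply: PQ; apply: ptE; apply/imS.
have [u [uc su]] := nP; have [v [vc sv]] := n1P; have [v' [v'c sv']] := n1Z.
have [s [sc ss]] := n2Z; have [s' [s'c ss']] := n2Q; have [u' [u'c su']] := nQ.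
have tot := sadd (sadd (sadd su sv) (sadd sv' ss)) (sadd ss' su').
apply: slin tot; apply: wS (wI d1 d2) => n /= [/eqP n1 /eqP n2].
apply: (three_cosetsP (c := c n) (z := im (rp Z) n) n1 n2 (uc n) (vc n) (v'c n) (sc n) (s'c n) (u'c n));
  clear; lia.
Qed.

End Limit.

(** Otherwise there is a counterexample [f n] for every large [d n]. Translated to the observation
    points [e n] they define a limit map with one common coset, and the points at which they fail
    define a point of the cone that is not near this coset. *)
Lemma local_coset (M eps : K) : (0 < eps)%R -> exists2 n, (M <= d n)%R &
  forall f, Fam f -> exists c, forall h, ((wT 1%g h)%:R <= d n)%R ->
    exists2 u, co u = c & ((wd (f h) u)%:R <= eps * d n)%R.
Proof.
move=> eps0; apply: contrapT => N.
have [f0 Ff0] : exists f, Fam f.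
  apply: contrapT => nF; apply: N; have [n nM] := filter_ex (dlarge M).
  by exists n => // f Ff; case: nF; exists f.
have bad n : exists f, Fam f /\ ((M <= d n)%R -> forall c, exists h,
    ((wT 1%g h)%:R <= d n)%R /\ forall u, co u = c -> (eps * d n < (wd (f h) u)%:R)%R).
  have [Mn|Mn] := pselect (M <= d n)%R; last by exists f0.
  apply: contrapT => nf; apply: N; exists n => // f Ff; apply: contrapT => nc; apply: nf.
  exists f; split=> // _ c; apply: contrapT => nh; apply: nc; exists c => h hd.
  apply: contrapT => nu; apply: nh; exists h; split=> // u uc.
  by rewrite ltNge; apply/negP => le; apply: nu; exists u.
have [f fP] := choice bad.
pose F n h := f n ((e n)^-1 * h)%g.
have FF n : Fam (F n) by apply: FamL; case: (fP n).
have base : \forall k \near w, ((wT (e k) (e k))%:R / d k <= 0)%R.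
  by apply: wS wT0 => k _ /=; rewrite (wd_refl gT) mul0r.
pose x : cs := exist _ e (ex_intro _ 0%R base).
have [z [nz _]] := third_point gT d_gt0 d_inf nocut x x.
pose P := cone_pt x; pose Q := cone_pt z.
have PQ : P <> Q.
  move=> PQ; apply: nz; apply: (small_trans gT d_inf (y := sval (rp P))).
    by apply: small_sym => //; exact: rpt.
  by rewrite PQ; exact: rpt.
have [c [nP nQ]] := common_coset FF PQ.
have exh n : exists h : Hg, (M <= d n)%R -> ((wT 1%g h)%:R <= d n)%R /\
    forall u, co u = c n -> (eps * d n < (wd (f n h) u)%:R)%R.
  have [_ h] := fP n; have [Mn|Mn] := pselect (M <= d n)%R; last by exists 1%g.
  by have [h' h'P] := h Mn (c n); exists h'.
have [h hP] := choice exh.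
have yb : exists C : K, \forall n \near w, ((wT (e n * h n)%g (e n))%:R / d n <= C)%R.
  exists 1%R; apply: wS (dlarge M) => n /= /hP[le _].
  rewrite ler_pdivrMr // mul1r (wd_sym gT) -[X in wT X]mulg1 (wd_mull T (e n)) //.
have [y yE] : exists y : cs, forall n, sval y n = (e n * h n)%g.
  by exists (exist _ (fun n => (e n * h n)%g) yb).
have [u [uc su]] := single_coset FF PQ nP nQ (cone_pt y).
have sy : sm (fun n => wd (F n (sval y n)) (F n (sval (rp (cone_pt y)) n))).
  apply/(im_small (wU := wU) d_inf FamU FamD FF y (rp (cone_pt y))).
  by apply: small_sym => //; exact: rpt.
apply: (scontra eps0 (sadd sy su)); apply: wS (dlarge M) => n /= /hP[_ /(_ _ (uc n))].
move=> /lt_le_trans; apply; rewrite ler_nat.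
by have := wd_tri gS (F n (sval (rp (cone_pt y)) n)) (F n (sval y n)) (u n); rewrite yE /F mulKg.
Qed.

Hypothesis near_twoP : exists C, forall c c' a b u v u' v' t, c != c' ->
  co u = c -> co v = c' -> co u' = c -> co v' = c' ->
  wd a u <= t -> wd a v <= t -> wd b u' <= t -> wd b v' <= t -> wd a b <= C * t.+1.

(** From balls to the whole group: the cosets belonging to [f] and to its translate by a generator
    are both near the images of two points at distance [D - 1], so they agree by [near_twoP]. By
    induction all translates of [f] have the same coset, and every value of [f] is the value of a
    translate at 1. A family closed under translation makes [E] independent of [f]. *)
Theorem image_near_coset : exists E, forall f, Fam f -> exists c, forall h,
  exists2 u, co u = c & wd (f h) u <= E.
Proof.
have [C CP] := near_twoP.
have A0 : (0 < A.+1%:R :> K)%R by rewrite ltr0n.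
have C0 : (0 < C.+1%:R :> K)%R by rewrite ltr0n.
(* Small enough for [D3]: points whose images are near two different cosets are closer together than
   [D - 1]. *)
pose eps : K := (1 / (4 * A.+1%:R * C.+1%:R))%R.
have eps0 : (0 < eps)%R by rewrite divr_gt0 // !mulr_gt0.
have [n nM nP] := local_coset ((2 * C.+1%:R + 2) * 4 * A.+1%:R)%R eps0.
have dn := d_gt0 n.
pose D := Num.truncn (d n); have /andP[D1 D2] := truncn_itv (ltW dn).
pose E := Num.truncn (eps * d n)%R; have ed0 : (0 < eps * d n)%R by rewrite mulr_gt0.
have leE k : (k%:R <= eps * d n)%R = (k <= E) by rewrite truncn_ge_nat // ltW.
have leD k : (k%:R <= d n)%R = (k <= D) by rewrite truncn_ge_nat // ltW.
have [cf cfP] := choice (fun f : {f | Fam f} => nP (sval f) (svalP f)).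
have {}cfP f (Ff : Fam f) h : wT 1%g h <= D -> exists2 u, co u = cf (exist _ f Ff) & wd (f h) u <= E.
  by rewrite -leD => /(cfP (exist _ f Ff))[u uc]; rewrite leE => ?; exists u.
have D3 : A * (C * E.+1).+1 + 1 < D.
  rewrite -(ltr_nat K) natrD natrM; apply: (@le_lt_trans _ _ (d n - 1)%R); last first.
    by rewrite -/D -natr1 in D2; lra.
  have h1 : ((C * E.+1).+1%:R <= C.+1%:R * (E%:R + 2) :> K)%R.
    have -> : (E%:R + 2 = (E + 2)%N%:R :> K)%R by rewrite natrD.
    by rewrite -natrM ler_nat; clear; nia.
  have h2 : (E%:R <= eps * d n)%R by rewrite leE.
  have h3 : (A%:R * (C * E.+1).+1%:R <= A.+1%:R * (C.+1%:R * (eps * d n + 2)) :> K)%R.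
    apply: ler_pM => //; first by rewrite ler_nat.
    by apply: le_trans h1 _; rewrite ler_wpM2l ?(ltW C0) //; lra.
  have h4 : (A.+1%:R * (C.+1%:R * (eps * d n + 2)) = d n / 4 + 2 * C.+1%:R * A.+1%:R :> K)%R.
    rewrite /eps; have : (A.+1%:R != 0 :> K)%R by rewrite gt_eqF.
    have : (C.+1%:R != 0 :> K)%R by rewrite gt_eqF.
    by move: (A.+1%:R : K)%R (C.+1%:R : K)%R => a c cN aN; field; rewrite cN aN.
  have h5 : (1 <= A.+1%:R :> K)%R by rewrite ler1n.
  have h6 : (2 * C.+1%:R * A.+1%:R + 2 <= d n / 4)%R.
    by move: nM h5; move: (A.+1%:R : K)%R (C.+1%:R : K)%R => a c; nra.
  lra.
have step f (Ff : Fam f) s (Ffs : Fam (fun h => f (s * h)%g)) : s \in T ->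
    cf (exist _ f Ff) = cf (exist _ _ Ffs).
  move=> sT; apply/eqP; apply/negPn/negP => ne.
  have s1 : wT 1%g s <= 1 by apply: (wd_gen gT); rewrite invg1 mul1g.
  have [h hn] := group_unbounded gT d_gt0 d_inf nocut (D - 1).
  have h1 : wT 1%g h = D - 1 by rewrite /word_dist invg1 mul1g.
  have shD : wT 1%g (s * h)%g <= D.
    apply: leq_trans (wd_tri gT s _ _) _; have := wd_mull T s 1%g h; rewrite mulg1 => ->.
    by move: s1 h1 D3; clear; lia.
  have [|u uc du] := cfP f Ff s; first by move: s1 D3; clear; lia.
  have [|v vc dv] := cfP _ Ffs 1%g; first by rewrite (wd_refl gT).
  have [|u' u'c du'] := cfP f Ff (s * h)%g; first exact: shD.
  have [|v' v'c dv'] := cfP _ Ffs h; first by rewrite h1 leq_subr.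
  rewrite mulg1 in dv.
  have le1 := CP _ _ _ _ _ _ _ _ _ ne uc vc u'c v'c du dv du' dv'.
  have le2 := FamD Ff s (s * h)%g; have := wd_mull T s 1%g h; rewrite mulg1 h1 => h2.
  rewrite h2 in le2.
  have : D - 1 <= A * (C * E.+1).+1 by apply: leq_trans le2 _; rewrite leq_mul2l ltnS le1 orbT.
  by move: D3; clear; lia.
exists E => f Ff; exists (cf (exist _ f Ff)) => g.
have key g' : forall Fg : Fam (fun h => f (g' * h)%g), cf (exist _ f Ff) = cf (exist _ _ Fg).
  have [[v [vT <-] _] _] := word_normP gT g'.
  elim: v vT f Ff {g} => [|s v IH] vT f Ff.
    rewrite big_nil => Fg; congr cf; apply: eq_exist; apply: funext => h; by rewrite mul1g.
  rewrite big_cons => Fg; have Ffs := FamL s Ff.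
  rewrite (step f Ff s Ffs); last by apply: vT; rewrite mem_head.
  have vT' : {subset v <= T} by move=> t tv; apply: vT; rewrite in_cons tv orbT.
  rewrite (IH vT' _ Ffs (FamL _ Ffs)); congr cf; apply: eq_exist; apply: funext => h /=.
  by rewrite mulgA.
have [|u uc du] := cfP _ (FamL g Ff) 1%g; first by rewrite (wd_refl gT).
by exists u; [rewrite (key g (FamL g Ff)) | rewrite mulg1 in du].
Qed.

End NearCoset.

(** * Quasi-isometries of pairs *)

Record fine_hyperbolic (G : groupType) (H : groupClosed G) (S : seq G)
    (dh : cone_vertex H -> cone_vertex H -> nat) (delta : nat) : Prop := FineHyperbolic {
  fh_gen : generating_set S;
  fh_metric : graph_metric (coned_adj S (H := H)) (@cwt G H) dh;
  fh_hyp : forall x y z o,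
    dh x z + dh y o <= maxn (dh x y + dh z o) (dh y z + dh x o) + delta;
  fh_fine : forall n, exists r, forall c h1 h2, coset_of H h1 = c -> coset_of H h2 = c ->
    awalk (coned_adj S (H := H)) (@cwt G H) (inr c) n (inl h1) (inl h2) ->
    word_dist S h1 h2 <= r
}.

Lemma relatively_hyperbolic_fine (K : realType) (G : groupType) (H : groupClosed G) :
  relatively_hyperbolic K H -> exists S dh delta, @fine_hyperbolic G H S dh delta.
Proof.
case=> S [gS gH wh bcp]; have [dh dhP] := coned_metric_exists H gS.
have [delta hyp] := coned_hyperbolic dhP wh.
by exists S, dh, delta; split=> //; exact: fine dhP gS gH bcp.
Qed.

Definition coarse_lipschitz (G1 G2 : groupType) (S1 : seq G1) (S2 : seq G2) (A : nat)
    (f : G1 -> G2) : Prop :=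
  forall x y, word_dist S2 (f x) (f y) <= A * (word_dist S1 x y).+1.

Lemma nat_quasi_isometry (K : realType) (G1 G2 : groupType) (S1 : seq G1) (S2 : seq G2) :
  generating_set S1 -> generating_set S2 -> quasi_isometric K G1 G2 ->
  exists q q' A, [/\ coarse_lipschitz S1 S2 A q, coarse_lipschitz S2 S1 A q',
    forall x, word_dist S1 (q' (q x)) x <= A & forall y, word_dist S2 (q (q' y)) y <= A].
Proof.
move=> g1 g2 [T1 [T2 [q [gT1 gT2 [[A0 [B0 [A00 B00 qi]]] [C0 C00 sur]]]]]].
have [M1 M1P] := word_dist_change g1 gT1; have [N1 N1P] := word_dist_change gT1 g1.
have [M2 M2P] := word_dist_change g2 gT2; have [N2 N2P] := word_dist_change gT2 g2.
have [a aP] := nat_upper_bound A0; have [b bP] := nat_upper_bound B0.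
have [c cP] := nat_upper_bound C0.
have up x y : word_dist T2 (q x) (q y) <= a * word_dist T1 x y + b.
  have /andP[_ h] := qi x y; rewrite -(ler_nat K) natrD natrM; apply: le_trans h _.
  by rewrite lerD // ler_wpM2r.
have low x y : word_dist T1 x y <= a * (word_dist T2 (q x) (q y) + b).
  have /andP[h _] := qi x y; rewrite -(ler_nat K) natrM natrD.
  rewrite lerBlDr mulrC ler_pdivrMr // in h; apply: le_trans h _; rewrite mulrC.
  by apply: ler_pM; rewrite ?addr_ge0 ?(ltW A00) ?(ltW B00) // lerD2l.
have [q' q'P] := choice sur.
have near y : word_dist T2 (q (q' y)) y <= c by rewrite -(ler_nat K); exact: le_trans (q'P y) cP.
exists q, q'.
pose A1 := N2 * (a * M1 + b); pose A2 := N1 * (a * (M2 + 2 * c + b)).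
pose A3 := N1 * (a * (c + b)); pose A4 := N2 * c.
exists (A1 + A2 + A3 + A4); split.
- move=> x y; apply: (@leq_trans (A1 * (word_dist S1 x y).+1)).
    apply: leq_trans (N2P _ _) _; rewrite /A1 -mulnA leq_mul2l; apply/orP; right.
    apply: leq_trans (up _ _) _.
    apply: (@leq_trans (a * (M1 * word_dist S1 x y) + b)).
      by rewrite leq_add2r leq_mul2l M1P orbT.
    by move: (word_dist S1 x y) => z; clear; nia.
  by rewrite leq_mul2r -!addnA leq_addr orbT.
- move=> x y; apply: (@leq_trans (A2 * (word_dist S2 x y).+1)).
    apply: leq_trans (N1P _ _) _; rewrite /A2 -!mulnA leq_mul2l; apply/orP; right.
    apply: leq_trans (low _ _) _; rewrite leq_mul2l; apply/orP; right.
    have h1 := wd_tri gT2 x (q (q' x)) (q (q' y)); have h2 := wd_tri gT2 y x (q (q' y)).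
    have := near x; have := near y; have := M2P x y; have := wd_sym gT2 y (q (q' y)).
    by move: h1 h2; clear; nia.
  by rewrite leq_mul2r; apply/orP; right; clear; lia.
- move=> x; apply: (@leq_trans A3); last by clear; lia.
  apply: leq_trans (N1P _ _) _; rewrite leq_mul2l; apply/orP; right.
  by apply: leq_trans (low _ _) _; rewrite leq_mul2l leq_add2r near orbT.
- move=> y; apply: (@leq_trans A4); last by clear; lia.
  by apply: leq_trans (N2P _ _) _; rewrite leq_mul2l near orbT.
Qed.

Section PairMaps.
Context (K : realType) (G G' : groupType) (H : groupClosed G) (H' : groupClosed G').
Context (S : seq G) (S' : seq G').
Context (dh : cone_vertex H -> cone_vertex H -> nat) (delta : nat).
Context (dh' : cone_vertex H' -> cone_vertex H' -> nat) (delta' : nat).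
Hypothesis fh : fine_hyperbolic S dh delta.
Hypothesis fh' : fine_hyperbolic S' dh' delta'.
Notation wd := (word_dist S).
Notation wd' := (word_dist S').
Notation co := (coset_of H).
Notation co' := (coset_of H').

Let gS := fh_gen fh.
Let gS' := fh_gen fh'.

Lemma peripheral_unbounded : unconstricted K (subgroup_type H) ->
  forall n, exists2 h, h \in H & n <= wd 1%g h.
Proof.
case=> T [w [e [d [gT [wU _] [d0 dinf] nocut]]]] n.
have [C CP] := undistorted gS (fh_metric fh) (fh_hyp fh) (fh_fine fh) gT.
have [h hn] := group_unbounded gT d0 dinf nocut (C * n.+1 + 1).
exists (val h); first exact: valP.
have := CP 1%g h; rewrite /word_dist invg1 mul1g hn val1 invg1 mul1g.
by move: (word_norm S _) => x; case: (leqP n x) => //; clear; nia.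
Qed.

(** As [H] is undistorted, the maps that send [h] to [q (g * h)] have common constants, so every
    coset goes near some coset. Moving the values into it changes [q] by a bounded amount. *)
Lemma coset_preserving (q : G -> G') A : unconstricted K (subgroup_type H) ->
  coarse_lipschitz S S' A q -> (forall x y, wd x y <= A * (wd' (q x) (q y)).+1) ->
  exists (qb : G -> G') (cf : left_coset H -> left_coset H') B,
    (forall x, wd' (q x) (qb x) <= B) /\ forall x, co' (qb x) = cf (co x).
Proof.
case=> T [w [e [d [gT [wU _] [d0 dinf] nocut]]]] qL qD.
have [C CP] := undistorted gS (fh_metric fh) (fh_hyp fh) (fh_fine fh) gT.
pose M := \max_(t <- T) word_norm S (val t).
have up (x y : subgroup_type H) : wd (val x) (val y) <= M * word_dist T x y.
  have [s [ps <- <-]] := wd_walk gT x y.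
  elim: s x ps => [|z s IH] x /=; first by rewrite (wd_refl gS).
  case/andP=> xz /IH le; apply: leq_trans (wd_tri gS (val z) _ _) _; rewrite mulnS.
  apply: leq_add le; rewrite /word_dist -subgroup_valVM.
  exact: (leq_bigmax_seq (F := fun t => word_norm S (val t))) xz _.
have [tr [R [t1 t2 t3 t4]]] := transition_exists gS' (fh_metric fh') (fh_hyp fh') (fh_fine fh').
have [C3 C3P] := three_cosets gS' (fh_metric fh') (fh_hyp fh') (fh_fine fh').
pose Fam (f : subgroup_type H -> G') := exists g, f = fun h => q (g * val h)%g.
have FU f : Fam f -> forall a b, wd' (f a) (f b) <= (A * M.+1 + C * (A.+1).+1) * (word_dist T a b).+1.
  move=> [g ->] a b; apply: leq_trans (qL _ _) _; rewrite (wd_mull S).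
  by have := up a b; clear; nia.
have FD f : Fam f -> forall a b, word_dist T a b <= (A * M.+1 + C * (A.+1).+1) * (wd' (f a) (f b)).+1.
  move=> [g ->] a b; apply: leq_trans (CP _ _) _.
  have := qD (g * val a)%g (g * val b)%g; rewrite (wd_mull S).
  move: (wd _ _) (wd' _ _) => x y h; apply: (@leq_trans (C * (A * y.+1).+1)).
    by rewrite leq_mul2l ltnS h orbT.
  by clear; nia.
have FL f g : Fam f -> Fam (fun h => f (g * h)%g).
  move=> [k ->]; exists (k * val g)%g; apply: funext => h; congr q.
  by rewrite valM mulgA.
have [E EP] := image_near_coset gT d0 dinf nocut gS' t1 t2 t3 t4 C3P FU FD FL
   (near_two_cosets gS' (fh_metric fh') (fh_hyp fh') (fh_fine fh')).
have [cf cfP] := choice (fun c : left_coset H => EP _ (ex_intro _ (repr c) erefl)).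
have ex x : exists y, co' y = cf (co x) /\ wd' (q x) y <= E.
  have hH : ((repr (co x))^-1 * x)%g \in H.
    by apply/coset_ofP; rewrite /coset_of reprK.
  have [u uc du] := cfP (co x) (exist (fun z => z \in H) _ hH).
  by exists u; split=> //; move: du; rewrite /= mulVKg.
have [qb qbP] := choice ex.
by exists qb, cf, E; split=> x; case: (qbP x).
Qed.

End PairMaps.

(** The two maps are adjusted independently and remain quasi-inverse. Their composites map cosets
    into cosets and move points a bounded distance; such a map preserves each coset, since an
    unbounded coset cannot stay near a different one. *)
Lemma pair_quasi_isometry (K : realType) (G G' : groupType)
    (H : groupClosed G) (H' : groupClosed G') (S : seq G) (S' : seq G') dh delta dh' delta' :
  @fine_hyperbolic G H S dh delta -> @fine_hyperbolic G' H' S' dh' delta' ->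
  unconstricted K (subgroup_type H) -> unconstricted K (subgroup_type H') ->
  quasi_isometric K G G' ->
  exists (phi : G -> G') (psi : G' -> G) B,
    [/\ coarse_lipschitz S S' B phi /\ coarse_lipschitz S' S B psi,
        forall x y, same_coset H x y -> same_coset H' (phi x) (phi y),
        forall x y, same_coset H' x y -> same_coset H (psi x) (psi y),
        forall x, word_dist S (psi (phi x)) x <= B /\ same_coset H x (psi (phi x)) &
        forall y, word_dist S' (phi (psi y)) y <= B /\ same_coset H' y (phi (psi y))].
Proof.
move=> fh fh' uH uH' qi; have gS := fh_gen fh; have gS' := fh_gen fh'.
have [q [q' [A [qL q'L qq q'q]]]] := nat_quasi_isometry gS gS' qi.
have lower (G1 G2 : groupType) (S1 : seq G1) (S2 : seq G2) (f : G1 -> G2) (g : G2 -> G1) :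
    generating_set S1 -> generating_set S2 -> coarse_lipschitz S2 S1 A g ->
    (forall x, word_dist S1 (g (f x)) x <= A) ->
    forall x y, word_dist S1 x y <= (3 * A) * (word_dist S2 (f x) (f y)).+1.
  move=> g1 g2 gL gf x y; have h1 := wd_tri g1 (g (f x)) x y.
  have h2 := wd_tri g1 (g (f y)) (g (f x)) y; have h3 := gf x; have h4 := gf y.
  have h5 := gL (f x) (f y); rewrite (wd_sym g1 x (g _)) in h1.
  by move: h1 h2 h3 h4 h5; clear; nia.
have A3 (G1 G2 : groupType) (S1 : seq G1) (S2 : seq G2) (f : G1 -> G2) :
    coarse_lipschitz S1 S2 A f -> coarse_lipschitz S1 S2 (3 * A) f.
  by move=> h x y; apply: leq_trans (h x y) _; clear; nia.
have [phi [cf [B1 [d1 c1]]]] := coset_preserving fh fh' uH (A3 _ _ _ _ _ qL) (lower _ _ _ _ _ _ gS gS' q'L qq).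
have [psi [cg [B2 [d2 c2]]]] := coset_preserving fh' fh uH' (A3 _ _ _ _ _ q'L) (lower _ _ _ _ _ _ gS' gS qL q'q).
have lip (G1 G2 : groupType) (S1 : seq G1) (S2 : seq G2) (f fb : G1 -> G2) B :
    generating_set S2 -> coarse_lipschitz S1 S2 A f ->
    (forall x, word_dist S2 (f x) (fb x) <= B) -> coarse_lipschitz S1 S2 (A + 2 * B) fb.
  move=> g2 fL fB x y; have h1 := wd_tri g2 (f x) (fb x) (fb y).
  have h2 := wd_tri g2 (f y) (f x) (fb y); have h3 := fB x; have h4 := fB y.
  have h5 := fL x y; rewrite (wd_sym g2 (fb x) (f _)) in h1.
  by move: h1 h2 h3 h4 h5; clear; nia.
have comp (G1 G2 : groupType) (S1 : seq G1) (S2 : seq G2) (f fb : G1 -> G2) (g gb : G2 -> G1) Ba Bb :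
    generating_set S1 -> generating_set S2 -> coarse_lipschitz S2 S1 A g ->
    (forall x, word_dist S2 (f x) (fb x) <= Ba) -> (forall y, word_dist S1 (g y) (gb y) <= Bb) ->
    (forall x, word_dist S1 (g (f x)) x <= A) ->
    forall x, word_dist S1 (gb (fb x)) x <= A * Ba.+1 + Bb + A.
  move=> g1 g2 gL fB gB gf x; have h1 := wd_tri g1 (g (fb x)) (gb (fb x)) x.
  have h2 := wd_tri g1 (g (f x)) (g (fb x)) x; have h3 := gB (fb x); have h4 := gf x.
  have h5 := gL (fb x) (f x); have h6 := fB x.
  rewrite (wd_sym g1 (gb _) (g _)) in h1; rewrite (wd_sym g2 (fb x) (f _)) in h5.
  by move: h1 h2 h3 h4 h5 h6; clear; nia.
have e1 := comp _ _ _ _ _ _ _ _ _ _ gS gS' q'L d1 d2 qq.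
have e2 := comp _ _ _ _ _ _ _ _ _ _ gS' gS qL d2 d1 q'q.
have stay (G1 G2 : groupType) (H1 : groupClosed G1) (S1 : seq G1) dh1 delta1
    (f : G1 -> G1) B (ch : left_coset H1 -> left_coset H1) :
    @fine_hyperbolic G1 H1 S1 dh1 delta1 -> unconstricted K (subgroup_type H1) ->
    (forall x, word_dist S1 (f x) x <= B) -> (forall x, coset_of H1 (f x) = ch (coset_of H1 x)) ->
    forall x, same_coset H1 x (f x).
  move=> fh1 uH1 fB fc x; have g1 := fh_gen fh1; apply/coset_ofP/eqP/negPn/negP => ne.
  have [C CP] := near_two_cosets g1 (fh_metric fh1) (fh_hyp fh1) (fh_fine fh1).
  have [h hH hn] := peripheral_unbounded fh1 uH1 (C * B.+1).+1.
  have xh : coset_of H1 (x * h)%g = coset_of H1 x.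
    by apply/coset_ofP; rewrite same_coset_sym /same_coset mulKg.
  have := CP _ _ x (x * h)%g x (f x) (x * h)%g (f (x * h)%g) B ne erefl erefl xh.
  rewrite fc xh -fc !(wd_refl g1) !(wd_sym g1 _ (f _)) !fB => /(_ erefl isT isT isT isT).
  have := wd_mull S1 x 1%g h; rewrite mulg1 => ->.
  by rewrite leqNgt hn.
exists phi, psi, (A + 2 * B1 + (A + 2 * B2) + (A * B1.+1 + B2 + A) + (A * B2.+1 + B1 + A)); split.
- split=> x y.
    have := lip _ _ _ _ _ _ _ gS' qL d1 x y.
    by move: (word_dist S x y) (word_dist S' _ _) => a b; clear; nia.
  have := lip _ _ _ _ _ _ _ gS q'L d2 x y.
  by move: (word_dist S' x y) (word_dist S _ _) => a b; clear; nia.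
- by move=> x y /coset_ofP xy; apply/coset_ofP; rewrite !c1 xy.
- by move=> x y /coset_ofP xy; apply/coset_ofP; rewrite !c2 xy.
- move=> x; split; first by apply: leq_trans (e1 x) _; clear; lia.
  by apply: (stay _ G' _ _ _ _ _ _ (cg \o cf) fh uH e1) => z /=; rewrite c2 c1.
- move=> y; split; first by apply: leq_trans (e2 y) _; clear; lia.
  by apply: (stay _ G _ _ _ _ _ _ (cf \o cg) fh' uH' e2) => z /=; rewrite c1 c2.
Qed.

(** * The cusped graph *)

Section UnitMetric.
Context (V : eqType) (E : rel V) (d : V -> V -> nat).
Hypothesis dP : graph_metric E (fun _ _ => 1) d.

Lemma unit_walk u v : exists s, [/\ path E u s, last u s = v & size s = d u v].
Proof. by have [s [ps ls ws]] := dP.2 u v; exists s; rewrite -ws unit_wlen. Qed.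

Lemma unit_le u s : path E u s -> d u (last u s) <= size s.
Proof. by move=> /(gd_le dP); rewrite unit_wlen. Qed.

Lemma unit_adj u v : E u v -> d u v <= 1.
Proof. by move=> uv; have := unit_le (u := u) (s := [:: v]); rewrite /= uv; apply. Qed.

Lemma unit_le1 u v : d u v <= 1 -> u = v \/ E u v.
Proof.
have [s [ps <- <-]] := unit_walk u v; case: s ps => [|a [|b s]] //=; first by left.
by rewrite andbT; right.
Qed.

Lemma edge_lipschitz (W : Type) (d2 : W -> W -> nat) (f : V -> W) C :
  (forall x, d2 x x = 0) -> (forall y x z, d2 x z <= d2 x y + d2 y z) ->
  (forall u v, E u v -> d2 (f u) (f v) <= C) ->
  forall u v, d2 (f u) (f v) <= C * d u v.
Proof.
move=> d0 dt fE u v; have [s [ps <- <-]] := unit_walk u v.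
elim: s u ps => [|w s IH] u /=; first by rewrite d0.
case/andP=> uw /IH le; apply: leq_trans (dt (f w) _ _) _.
by rewrite mulnS leq_add // fE.
Qed.

End UnitMetric.

Section Cusped.
Context (G : groupType) (S : seq G) (H : groupClosed G).
Hypothesis gS : generating_set S.
Notation wd := (word_dist S).
Notation co := (coset_of H).
Notation CV := (G * nat)%type.
Implicit Types (u v w p : CV) (x y z : G).

(** The combinatorial horoballs of Groves and Manning, built with the word metric of [G] instead of
    that of [H]. Loops are left in; they do not change distances. *)
Definition cusp_adj : rel CV := fun u v =>
  [|| (u.1 == v.1) && ((u.2 == v.2.+1) || (v.2 == u.2.+1)),
      [&& u.2 == 0, v.2 == 0 & (u.1^-1 * v.1)%g \in S] |
      [&& u.2 == v.2, same_coset H u.1 v.1 & wd u.1 v.1 <= 2 ^ u.2]].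

Lemma cusp_sym : symmetric cusp_adj.
Proof.
have le u v : cusp_adj u v -> cusp_adj v u.
  have cs := cay_sym gS u.1 v.1; rewrite /cay in cs.
  case/or3P=> [/andP[/eqP e1 e2]|/and3P[/eqP u0 /eqP v0 e]|/and3P[/eqP e1 e2 e3]].
  - by rewrite /cusp_adj e1 eqxx [(v.2 == _) || _]orbC e2.
  - by apply/or3P/Or32; rewrite u0 v0 -cs e.
  - by apply/or3P/Or33; rewrite e1 eqxx same_coset_sym e2 (wd_sym gS) -e1.
by move=> u v; apply/idP/idP; exact: le.
Qed.

Lemma cusp_vert x k n : exists s, path cusp_adj (x, k) s /\ last (x, k) s = (x, k + n) /\ size s = n.
Proof.
elim: n k => [|n IH] k; first by exists [::]; rewrite addn0.
have [s [ps [ls sz]]] := IH k.+1; exists ((x, k.+1) :: s); rewrite /= ps ls sz; split; first by rewrite /cusp_adj /= !eqxx orbT.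
by rewrite addSnnS.
Qed.

Lemma cusp_conn u v : exists s, path cusp_adj u s /\ last u s = v.
Proof.
case: u v => x k [y l]; have [s1 [p1 [l1 _]]] := cusp_vert x 0 k.
have [p1' l1' _] := rev_walk (wt := fun _ _ => 1) cusp_sym (fun _ _ => erefl) p1.
have [s3 [p3 [l3 _]]] := cusp_vert y 0 l; rewrite l1 in p1' l1'.
have [t [pt lt _]] := wd_walk gS x y.
exists (rev (belast (x, 0) s1) ++ [seq (z, 0) | z <- t] ++ s3).
rewrite !cat_path !last_cat l1' (last_map (fun z => (z, 0))) lt p3 l3 p1' andbT; split=> //=.
by rewrite path_map; apply: sub_path pt => a b ab; apply/or3P/Or32; exact: ab.
Qed.

Lemma cusp_metric_exists : exists rho, graph_metric cusp_adj (fun _ _ => 1) rho.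
Proof. exact: graph_metric_exists cusp_conn. Qed.

Context (rho : CV -> CV -> nat).
Hypothesis rhoP : graph_metric cusp_adj (fun _ _ => 1) rho.

Lemma rho_refl u : rho u u = 0. Proof. exact: gd_refl rhoP u. Qed.
Lemma rho_eq0 u v : rho u v = 0 -> u = v. Proof. by apply: gd_eq0 _ rhoP _ _. Qed.
Lemma rho_tri v u w : rho u w <= rho u v + rho v w. Proof. exact: gd_tri rhoP v u w. Qed.
Lemma rho_sym u v : rho u v = rho v u. Proof. by apply: gd_sym cusp_sym _ rhoP _ _. Qed.

Lemma rho_mull g u v : rho ((g * u.1)%g, u.2) ((g * v.1)%g, v.2) = rho u v.
Proof.
have le h a b : rho ((h * a.1)%g, a.2) ((h * b.1)%g, b.2) <= rho a b.
  rewrite -[X in _ <= X]mul1n.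
  apply: (edge_lipschitz rhoP (f := fun a => ((h * a.1)%g, a.2)) rho_refl rho_tri) => {}a {}b ab.
  apply: (unit_adj rhoP); move: ab; rewrite /cusp_adj /= /same_coset (wd_mull S).
  by rewrite (inj_eq (mulgI h)) invgM !mulgA mulgVK.
apply/eqP; rewrite eqn_leq le /=.
have := le (g^-1)%g ((g * u.1)%g, u.2) ((g * v.1)%g, v.2).
by rewrite /= !mulKg -!surjective_pairing.
Qed.

Lemma rho_depth u v : u.2 <= v.2 + rho u v.
Proof.
suff : (u.2 - v.2) + (v.2 - u.2) <= 1 * rho u v.
  by case: u v => x k [y l] /=; move: (rho _ _); clear; lia.
apply: (edge_lipschitz rhoP (d2 := fun a b => (a - b) + (b - a)) (f := snd)) => [a|a b c|a b]; try by clear; lia.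
case: a b => x k [y l] /or3P[/andP[_]|/and3P[/eqP/= -> /eqP/= -> _]|/and3P[/eqP/= -> _ _]] //=; last by clear; lia.
by case/orP => /eqP->; clear; lia.
Qed.

Lemma rho_vert x k l : rho (x, k) (x, l) = (k - l) + (l - k).
Proof.
have le a n : rho (x, a) (x, a + n) <= n.
  by have [s [ps [<- <-]]] := cusp_vert x a n; exact: (unit_le rhoP ps).
apply/eqP; rewrite eqn_leq; apply/andP; split; last first.
  by have := rho_depth (x, k) (x, l); have := rho_depth (x, l) (x, k); rewrite (rho_sym (x, l)) /=; clear; lia.
case: (leqP k l) => kl.
  by have := le k (l - k); rewrite subnKC // => /leq_trans; apply; rewrite leq_addl.
by have := le l (k - l); rewrite subnKC ?(ltnW kl) // rho_sym => /leq_trans; apply; rewrite leq_addr.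
Qed.

Lemma rho_word x y : rho (x, 0) (y, 0) <= wd x y.
Proof.
rewrite -[X in _ <= X]mul1n.
apply: (edge_lipschitz (word_metric gS) (f := fun x => (x, 0)) rho_refl rho_tri) => a b ab.
by apply: (unit_adj rhoP); apply/or3P/Or32; exact: ab.
Qed.

(* A cusped walk of length n is longest in the word metric if it climbs, moves at the top and
   descends; [cusp_growth t] is about [2 ^ (t / 2)]. *)
Definition cusp_growth t := if odd t then 6 * 2 ^ t./2 else 4 * 2 ^ t./2.

Lemma cusp_growth_mono t : cusp_growth t <= cusp_growth t.+1.
Proof.
rewrite /cusp_growth /= uphalf_half; case: (odd t) => /=; rewrite ?add0n ?add1n ?expnS; clear; lia.
Qed.

Lemma cusp_growth_step t l : l.*2 <= t.+1 -> 2 ^ l + cusp_growth t <= cusp_growth t.+1.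
Proof.
rewrite /cusp_growth /= uphalf_half => lt; have le : l <= odd t + t./2 by move: lt; rewrite -{1}(odd_double_half t); case: (odd t) => /=; clear; lia.
have := leq_pexp2l (isT : 0 < 2) le.
by case: (odd t) => /=; rewrite ?add0n ?add1n ?expnS; clear; lia.
Qed.

Lemma rho_growth u v : wd u.1 v.1 <= cusp_growth (rho u v + u.2 + v.2).
Proof.
have [s [ps lv sz]] := unit_walk rhoP u v; rewrite -sz -{}lv {sz v}.
move: cusp_growth cusp_growth_mono cusp_growth_step => F Fm Fs.
elim: s u ps => [|a s IH] u /=; first by rewrite (wd_refl gS).
case/andP=> ua ps; have le := IH a ps; have := rho_depth a (last a s); have := unit_le rhoP ps.
move: ua le => /or3P[/andP[/eqP-> lv]|/and3P[/eqP u0 /eqP a0 /(wd_gen gS) ua]|/and3P[/eqP ek _ ua]] le r1 r2.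
- apply: leq_trans le _; case/orP: lv => /eqP e; last by rewrite e !addSn addnS.
  rewrite e !addSn addnS addSn; exact: leq_trans (Fm _) (Fm _).
- apply: leq_trans (wd_tri gS a.1 _ _) _; apply: leq_trans (leq_add ua le) _.
  by rewrite u0 a0 !addSn; exact: (Fs _ 0).
- apply: leq_trans (wd_tri gS a.1 _ _) _; apply: leq_trans (leq_add ua le) _; rewrite ek !addSn.
  apply: Fs; rewrite -addnn addnAC leqW // leq_add2r; apply: leq_trans r2 _.
  by rewrite addnC leq_add2r.
Qed.

Lemma rho_level u v : wd u.1 v.1 <= 2 ^ (3 + (rho u v + u.2 + v.2)./2).
Proof.
apply: leq_trans (rho_growth u v) _; rewrite /cusp_growth expnD.
by case: ifP => _; rewrite leq_mul2r orbT.
Qed.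

(** Only level 0 has edges between different cosets, so the walk must visit it. This bounds the
    depth of simplices over several cosets. *)
Lemma rho_coset u v : co u.1 != co v.1 -> u.2 + v.2 < rho u v.
Proof.
have [s [ps lv <-]] := unit_walk rhoP u v; rewrite -{}lv.
elim: s u ps => [|a s IH] u /=; first by rewrite eqxx.
case/andP=> /or3P[/andP[/eqP-> lv]|/and3P[/eqP u0 /eqP a0 ua]|/and3P[/eqP ek ua _]] ps ne.
- have := IH a ps ne; case/orP: lv => /eqP->; rewrite ?addSn //.
  by move=> h; apply: leqW; exact: ltn_trans (ltnSn _) h.
- rewrite u0 add0n ltnS; apply: leq_trans (rho_depth (last a s) a) _.
  by rewrite a0 rho_sym; exact: (unit_le rhoP ps).
- have ae : co a.1 = co u.1 by apply/esym/coset_ofP.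
  by rewrite -ae in ne; rewrite ek leqW // IH.
Qed.

Lemma rho_horizontal x y k : same_coset H x y -> wd x y <= 2 ^ k -> rho (x, k) (y, k) <= 1.
Proof. by move=> xy le; apply: (unit_adj rhoP); rewrite /cusp_adj /= eqxx xy le !orbT. Qed.

Lemma rho_climb x y k j : same_coset H x y -> wd x y <= 2 ^ (k + j) -> rho (x, k) (y, k) <= j.*2.+1.
Proof.
move=> xy le; have h := rho_horizontal xy le.
have := rho_tri (x, k + j) (x, k) (y, k); have := rho_tri (y, k + j) (x, k + j) (y, k).
by rewrite !rho_vert; move: h; clear; lia.
Qed.

Definition hp_top u w := maxn (maxn u.2 w.2) (up_log 2 (wd u.1 w.1)).

(** The expected geodesic in a horoball: climb to the first level at which the two verticals are one
    horizontal step apart, cross, descend. *)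
Definition hpath u w p : Prop :=
  (p.1 = u.1 /\ u.2 <= p.2 <= hp_top u w) \/ (p.1 = w.1 /\ w.2 <= p.2 <= hp_top u w).

Lemma hp_topC u w : hp_top u w = hp_top w u.
Proof. by rewrite /hp_top (wd_sym gS) (maxnC u.2). Qed.

Lemma hpathC u w p : hpath u w p -> hpath w u p.
Proof. by rewrite /hpath (hp_topC w); case; [right|left]. Qed.

Lemma hp_topP u w : [/\ u.2 <= hp_top u w, w.2 <= hp_top u w & wd u.1 w.1 <= 2 ^ hp_top u w].
Proof.
split; try by rewrite /hp_top !leq_max leqnn ?orbT.
by apply: leq_trans (up_logP _ (isT : 1 < 2)) _; rewrite leq_exp2l // leq_maxr.
Qed.

Lemma hp_top_min u w n : u.2 <= n -> w.2 <= n -> wd u.1 w.1 <= 2 ^ n -> hp_top u w <= n.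
Proof. by move=> un wn le; rewrite !geq_max un wn; exact: up_log_min. Qed.

Lemma hpath_l u w : hpath u w u.
Proof. by left; have [? _ _] := hp_topP u w; split=> //; rewrite leqnn. Qed.

Lemma hpath_r u w : hpath u w w. Proof. exact/hpathC/hpath_l. Qed.

Lemma hpath_radius u w p : same_coset H u.1 w.1 -> hpath u w p -> rho p u <= 3 * rho u w + 8.
Proof.
case: u w => x k [y l]; rewrite /hpath; set J := hp_top _ _ => /= xy hp.
have [t1 t2 t3] := hp_topP (x, k) (y, l); rewrite -/J /= in t1 t2 t3.
have le : J <= maxn (maxn k l) (3 + (rho (x, k) (y, l) + k + l)./2).
  apply: hp_top_min; rewrite /= ?leq_max ?leqnn ?orbT //; apply: leq_trans (rho_level (x, k) (y, l)) _.
  by rewrite leq_exp2l // leq_maxr.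
have d1 := rho_depth (x, k) (y, l); have d2 := rho_depth (y, l) (x, k); rewrite (rho_sym (y, l)) /= in d1 d2.
have r1 := rho_horizontal xy t3.
case: p hp => z i /= [] [-> /andP[i1 i2]].
  by rewrite rho_vert; move: (rho _ _) le d1 d2 i1 i2 => r; clear; lia.
have := rho_tri (y, J) (y, i) (x, k); have := rho_tri (x, J) (y, J) (x, k).
rewrite (rho_sym (y, J) (x, J)) !rho_vert.
move: (rho (x, k) _) (rho (x, J) _) (rho (y, J) _) (rho (y, i) _) le d1 d2 r1 i1 i2 t1 t2.
by clear; lia.
Qed.

(** Horoballs are tree-like: by [2 ^ M + 2 ^ M = 2 ^ M.+1], the level at which two verticals merge
    exceeds the larger of the merging levels with a third vertical by at most 1. *)
Lemma hpath_thin_l u v w p : same_coset H u.1 v.1 -> same_coset H v.1 w.1 ->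
  p.1 = u.1 -> u.2 <= p.2 <= hp_top u w ->
  exists2 q, hpath u v q \/ hpath v w q & rho p q <= 2.
Proof.
case: p => z i /= uv vw -> /andP[i1 i2]; have [a1 a2 a3] := hp_topP u v; have [b1 b2 b3] := hp_topP v w.
case: (leqP i (hp_top u v)) => c1.
  by exists (u.1, i); rewrite ?rho_refl //; left; left; rewrite /= i1 c1.
have e1 : wd u.1 v.1 <= 2 ^ i by apply: leq_trans a3 _; rewrite leq_exp2l // ltnW.
case: (leqP i (hp_top v w)) => c2.
  exists (v.1, i); last exact: leq_trans (rho_horizontal uv e1) _.
  by right; left; rewrite /= c2 (leq_trans a2 (ltnW c1)).
pose M := maxn (hp_top u v) (hp_top v w).
have lM : hp_top u w <= M.+1.
  apply: hp_top_min; first by rewrite leqW // leq_max a1.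
    by rewrite leqW // leq_max b2 orbT.
  apply: leq_trans (wd_tri gS v.1 _ _) _; rewrite expnS mul2n -addnn leq_add //.
    by apply: leq_trans a3 _; rewrite leq_exp2l // leq_maxl.
  by apply: leq_trans b3 _; rewrite leq_exp2l // leq_maxr.
have iM : i = M.+1.
  by apply/eqP; rewrite eqn_leq (leq_trans i2 lM) /= /M gtn_max c1.
have r1 : rho (u.1, i) (u.1, M) <= 1 by rewrite rho_vert iM; clear; lia.
case: (leqP (hp_top v w) (hp_top u v)) => c3.
  have eM : M = hp_top u v by apply/maxn_idPl.
  by exists (u.1, M); [left; left; rewrite /= eM a1 leqnn | exact: leq_trans r1 _].
have eM : M = hp_top v w by apply/maxn_idPr/ltnW.
exists (v.1, M); first by right; left; rewrite /= eM b1 leqnn.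
apply: leq_trans (rho_tri (u.1, M) _ _) _; apply: (leq_add r1); apply: (rho_horizontal uv).
by apply: leq_trans a3 _; rewrite leq_exp2l // leq_maxl.
Qed.

Lemma hpath_thin u v w p : same_coset H u.1 v.1 -> same_coset H v.1 w.1 -> hpath u w p ->
  exists2 q, hpath u v q \/ hpath v w q & rho p q <= 2.
Proof.
move=> uv vw [[e le]|[e le]]; first exact: hpath_thin_l uv vw e le.
rewrite hp_topC in le; rewrite same_coset_sym in uv; rewrite same_coset_sym in vw.
have [q hq rq] := hpath_thin_l vw uv e le.
by exists q => //; case: hq => /hpathC; [right|left].
Qed.

End Cusped.

(** * Hyperbolicity of the cusped graph *)

Section CuspedHyperbolic.
Context (G : groupType) (S : seq G) (H : groupClosed G).
Context (dh : cone_vertex H -> cone_vertex H -> nat) (delta : nat).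
Hypothesis gS : generating_set S.
Notation CV := (cone_vertex H).
Notation CE := (coned_adj S (H := H)).
Notation wt := (@cwt G H).
Notation co := (coset_of H).
Notation wd := (word_dist S).
Hypothesis dhP : graph_metric CE wt dh.
Hypothesis hyp : forall x y z o,
  dh x z + dh y o <= maxn (dh x y + dh z o) (dh y z + dh x o) + delta.
Hypothesis fineP : forall n, exists r, forall c h1 h2, co h1 = c -> co h2 = c ->
  awalk CE wt (inr c) n (inl h1) (inl h2) -> word_dist S h1 h2 <= r.
Context (rho : G * nat -> G * nat -> nat).
Hypothesis rhoP : graph_metric (cusp_adj S H) (fun _ _ => 1) rho.
Notation geo := (geod CE wt dh).
Notation sg := (seg CE wt dh).
Notation pl := (poly CE wt dh).
Implicit Types (u v w p m n : G * nat) (s t r : seq CV) (e : left_coset H).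

Let wC := @cwtC G H.
Let Esym := coned_sym (H := H) gS.

Let sgC o (a b : CV) : sg o a b -> sg o b a.
Proof. by apply: seg_sym Esym wC dhP _ _ _. Qed.

Lemma geod_suffix (z a : CV) s s1 s2 : geo z s -> z :: s = s1 ++ a :: s2 ->
  geo a s2 /\ last a s2 = last z s.
Proof.
move=> gs; case: s1 => [[<- <-] //|b s1 [_ es]]; rewrite es in gs *.
rewrite -cat_rcons in gs *; have [_ g _] := geod_cat dhP gs.
by rewrite last_rcons in g; rewrite last_cat last_rcons.
Qed.

Lemma out_mark (z : CV) s s1 e s2 : geo z s -> z :: s = s1 ++ inr e :: s2 ->
  (s2 = [::] /\ inr e = last z s) \/
  exists g s3, [/\ s2 = inl g :: s3, co g = e, sg (inr e) (inl g) (last z s) & last z s != inr e].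
Proof.
move=> gs es; have [g ls] := geod_suffix gs es; rewrite -ls.
have un := geod_uniq Esym wC (@cwt_gt0 G H) dhP g.
case: s2 {es ls} g un => [|[h|c] s2] g un; first by left.
- right; exists h, s2; have /andP[/andP[/eqP he _] _] := g; split=> //.
    have [_ g' _] := geod_cat dhP (s1 := [:: inl h]) g; exists s2; split=> //.
    by case/andP: un.
  by rewrite /=; apply: contraTneq un => le; rewrite cons_uniq -{1}le mem_last.
- by have /andP[/andP[]] := g.
Qed.

Lemma in_mark (z : CV) s s1 e s2 : geo z s -> z :: s = s1 ++ inr e :: s2 ->
  (s1 = [::] /\ inr e = z) \/
  exists g s0, [/\ s1 = rcons s0 (inl g), co g = e, sg (inr e) (inl g) z & z != inr e].
Proof.
move=> gs es; have gr := geo_rev gS dhP gs; have lr := geo_rev_last gS gs.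
have := out_mark (s1 := rev s2) (e := e) (s2 := rev s1) gr.
rewrite -rev_rcons -lastI es rev_cat rev_cons cat_rcons lr => /(_ erefl).
case=> [[r0 ->]|[g [s3 [es1 ? ? ?]]]]; [left|right].
  by rewrite -[s1]revK r0.
exists g; by exists (rev s3); split=> //; rewrite -[s1]revK es1 rev_cons.
Qed.

(* Where a path of the guessed family of quasi-geodesics from v enters or leaves the horoball over e. *)
Definition mark e v m : Prop := (co v.1 = e /\ m = v) \/
  (co v.1 != e /\ exists g, [/\ m = (g, 0), co g = e & sg (inr e) (inl g) (inr (co v.1))]).

Lemma mark_coset e v m : mark e v m -> co m.1 = e.
Proof. by case=> [[<- ->]|[_ [g [-> <- _]]]]. Qed.

Lemma mark_exists e v : exists m, mark e v m.
Proof.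
case: (eqVneq (co v.1) e) => [ve|ve]; first by exists v; left.
have [s [gs ls]] := geod_exists dhP (inr e) (inr (co v.1)).
have [[s0 le]|[g [s3 [_ ge sgg _]]]] := out_mark (s1 := [::]) gs erefl.
  by rewrite ls in le; case: le ve => ->; rewrite eqxx.
by exists (g, 0); right; split=> //; exists g; rewrite ls in sgg.
Qed.

(** A coned-off geodesic between the cone vertices of the two cosets, each of its cone vertices
    being replaced by a path in the horoball. Marks refer to an end and a coset but not to the
    geodesic, so that the three paths of a triangle in one horoball can share their corners. *)
Definition guess u w p : Prop := exists s, [/\ geo (inr (co u.1)) s, last (inr (co u.1)) s = inr (co w.1) &
  (exists2 g, inl g \in s & p = (g, 0)) \/
  exists e m n, [/\ inr e \in inr (co u.1) :: s, mark e u m, mark e w n & hpath S m n p]].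

Lemma guess_conn u w : exists s : seq (G * nat), [/\ path (fun a b => rho a b <= 1) u s, last u s = w &
  forall p, p \in u :: s -> guess u w p].
Proof.
have [r [gr lr]] := geod_exists dhP (inr (co u.1)) (inr (co w.1)).
pose conn a b := exists s : seq (G * nat), [/\ path (fun a b => rho a b <= 1) a s, last a s = b &
  forall p, p \in a :: s -> guess u w p].
have ctrans a b c : conn a b -> conn b c -> conn a c.
  move=> [s [ps <- gs]] [t [pt <- gt]]; exists (s ++ t); rewrite cat_path ps pt last_cat; split=> // p.
  rewrite -cat_cons mem_cat => /orP[|pt']; first exact: gs.
  by apply: gt; rewrite in_cons pt' orbT.
have cstep a b : rho a b <= 1 -> guess u w a -> guess u w b -> conn a b.
  move=> ab ga gb; exists [:: b]; rewrite /= ab; split=> // p.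
  by rewrite !inE => /orP[]/eqP->.
have csym a b : conn a b -> conn b a.
  move=> [s [ps <- gs]]; exists (rev (belast a s)); split.
  - rewrite rev_path; apply: sub_path ps => x y; by rewrite (rho_sym gS rhoP).
  - by case: s {ps gs} => //= b' s; rewrite rev_cons last_rcons.
  - by move=> p; rewrite mem_rev_belast; exact: gs.
have cvert x k l : k <= l -> (forall i, k <= i <= l -> guess u w (x, i)) -> conn (x, k) (x, l).
  move=> kl; rewrite -(subnKC kl); elim: (l - k) => [|j IH] gi.
    by rewrite addn0; exists [::]; split=> // p; rewrite inE => /eqP->; apply: gi; rewrite leqnn leq_addr.
  apply: (ctrans _ (x, k + j)).
    by apply: IH => i /andP[ki il]; apply: gi; rewrite ki addnS leqW.
  apply: cstep; first by rewrite (rho_vert gS rhoP); clear; lia.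
    by apply: gi; rewrite leq_addr addnS leqnSn.
  by apply: gi; rewrite leq_addr leqnn.
have chp m n : same_coset H m.1 n.1 -> (forall p, hpath S m n p -> guess u w p) -> conn m n.
  case: m n => x k [y l] /= xy gi; have [t1 t2 t3] := hp_topP S (x, k) (y, l).
  set J := hp_top _ _ _ in t1 t2 t3.
  apply: (ctrans _ (x, J)); first by apply: cvert => // i ij; apply: gi; left.
  apply: (ctrans _ (y, J)).
    apply: cstep; first exact: (rho_horizontal rhoP).
      by apply: gi; left; rewrite /= t1 leqnn.
    by apply: gi; right; rewrite /= t2 leqnn.
  by apply: csym; apply: cvert => // i ij; apply: gi; right.
have main t1 z t2 m : inr (co u.1) :: r = t1 ++ z :: t2 ->
    match z with inl g => m = (g, 0) | inr e => mark e u m end -> conn m w.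
  elim: t2 t1 z m => [|z' t2 IH] t1 z m et zm.
    have [_] := geod_suffix gr et; rewrite lr /= => ez; rewrite ez in et zm.
    apply: chp; first by apply/coset_ofP; exact: mark_coset zm.
    move=> p hp; exists r; split=> //; right; exists (co w.1), m, w; split=> //; last by left.
    by rewrite et mem_cat mem_head orbT.
  have et' : inr (co u.1) :: r = rcons t1 z ++ z' :: t2 by rewrite cat_rcons.
  have [/geod_path/= /andP[zz' _] _] := geod_suffix gr et.
  have inr_r g : inl g \in inr (co u.1) :: r -> inl g \in r by rewrite inE.
  case: z zz' zm et et' => [g|e] zz' zm et et'.
    case: z' zz' et et' => [h /andP[_ gh]|e /eqP ge] et et'; last first.
      apply: (IH _ _ _ et'); have [[]|] := in_mark gr et'; first by case: (t1).
      move=> [g' [s0 [/eqP]]]; rewrite eqseq_rcons => /andP[_ /eqP[<-]] _ sgg ne.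
      by right; split; [rewrite eq_sym; apply: contra ne => /eqP-> | exists g].
    apply: (ctrans _ (h, 0)); last exact: IH et' _.
    rewrite zm; apply: cstep.
    + by apply: leq_trans (rho_word gS rhoP _ _) _; exact: (wd_gen gS).
    + exists r; split=> //; left; exists g => //; apply: inr_r.
      by rewrite et mem_cat mem_head orbT.
    + exists r; split=> //; left; exists h => //; apply: inr_r.
      by rewrite et' mem_cat mem_head orbT.
  have [[]//|[h [s3 [[ez _] he sgh ne]]]] := out_mark gr et; rewrite ez in et'.
  apply: (ctrans _ (h, 0)); last exact: IH et' _.
  have mk : mark e w (h, 0).
    by rewrite lr in sgh ne; right; split; [apply: contra ne => /eqP-> | exists h].
  apply: chp; first by apply/coset_ofP; rewrite (mark_coset zm) he.
  move=> p hp; exists r; split=> //; right; exists e, m, (h, 0); split=> //.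
  by rewrite et mem_cat mem_head orbT.
by apply: (main [::] (inr (co u.1)) r) => //; left.
Qed.

Lemma cusped_hyperbolic : exists delta', forall x y z o,
  rho x z + rho y o <= maxn (rho x y + rho z o) (rho y z + rho x o) + delta'.
Proof.
have [R RP] := gap gS dhP hyp fineP 5; have [T TP] := two_sides_close gS dhP hyp fineP.
have jump g g' p : co g = co g' -> wd g g' <= R -> hpath S (g, 0) (g', 0) p ->
    rho p (g, 0) <= 3 * R + 8.
  move=> gg' le hp; apply: leq_trans (hpath_radius gS rhoP _ hp) _; first exact/coset_ofP.
  by rewrite leq_add2r leq_mul2l (leq_trans (rho_word gS rhoP _ _) le) orbT.
have dist e (h h' : G) k : k <= 5 -> co h = e -> co h' = e -> pl (inr e) k (inl h) (inl h') -> wd h h' <= R.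
  by move=> k5 he he'; exact: (RP k e h h' k5 he he').
(* Room for [3 * R + 8], the radius of a horoball path between marks at word distance [R], and for
   the distances [R] and [T] to the other sides. *)
pose h := 5 * R + 2 * T + 20.
apply: (guess_hyperbolic (E := cusp_adj S H) (cusp_sym H gS) rhoP (L := guess) (h := h)).
- by rewrite /h addnS.
- move=> u w; have [s [ps ls gs]] := guess_conn u w; exists s; split=> //.
  by apply: sub_path ps => a b /leq_trans; apply; rewrite /h; clear; lia.
- move=> u v w p [r [gr lr pr]].
  have [s [gs ls]] := geod_exists dhP (inr (co u.1)) (inr (co v.1)).
  have [t [gt lt]] := geod_exists dhP (inr (co v.1)) (inr (co w.1)).
  have caseG g : inl g \in r -> exists2 q, guess u v q \/ guess v w q & rho (g, 0) q <= T.
    move=> gin; have [||||q] := TP (inr (co u.1)) s t r g _ _ gr; rewrite ?ls ?lt ?lr //.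
    rewrite inE /= mem_cat => qin dq; exists (q, 0); last exact: leq_trans (rho_word gS rhoP _ _) dq.
    case/orP: qin => qin; [left; exists s | right; exists t]; split=> //; left; by exists q.
  case: pr => [[g gin ->]|[e [m [n [er mu mw hp]]]]].
    by have [q ? dq] := caseG g gin; exists q => //; apply: leq_trans dq _; rewrite /h; clear; lia.
  have [k kv] := mark_exists e v.
  have sm : same_coset H m.1 k.1 by apply/coset_ofP; rewrite (mark_coset mu) (mark_coset kv).
  have sn : same_coset H k.1 n.1 by apply/coset_ofP; rewrite (mark_coset mw) (mark_coset kv).
  (* If both other sides pass through [e], the triangle in the horoball is thin. A side that misses
     [e] has the marks of its ends at distance at most [R], so the horoball path between them is
     short. If both miss it, [p] is near a mark, and so near the group vertex before [e] on its own
     side, for which [caseG] applies. *)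
  case: (boolP (inr e \in inr (co u.1) :: s)) => es; case: (boolP (inr e \in inr (co v.1) :: t)) => et.
  + have [q hq rq] := hpath_thin gS rhoP sm sn hp; exists q; last by apply: leq_trans rq _; rewrite /h; clear; lia.
    by case: hq => hq; [left; exists s | right; exists t]; split=> //; right; [exists e, m, k | exists e, k, n].
  + have [q hq rq] := hpath_thin gS rhoP sm sn hp.
    have Lk : guess u v k by exists s; split=> //; right; exists e, m, k; split=> //; exact: hpath_r.
    case: hq => hq; first by exists q; [left; exists s; split=> //; right; exists e, m, k | apply: leq_trans rq _; rewrite /h; clear; lia].
    exists k; first by left.
    apply: leq_trans (rho_tri rhoP q _ _) _; rewrite /h.
    have vt := geo_seg gt et; rewrite lt in vt.
    have ve : co v.1 != e by apply: contra et => /eqP->; rewrite mem_head.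
    have we : co w.1 != e by apply: contra et => /eqP<-; rewrite -lt mem_last.
    case: kv => [[ev]|[_ [a [ek ea sa]]]]; first by rewrite ev eqxx in ve.
    case: mw => [[ew]|[_ [b [en eb sb]]]]; first by rewrite ew eqxx in we.
    have dab : wd a b <= R.
      apply: (dist e _ _ 3) => //; apply: poly_cons sa _; apply: poly_cons vt _.
      exact: poly1 (sgC sb).
    rewrite ek en in hq *; have := jump a b q _ dab hq; rewrite ea eb => /(_ erefl).
    by move: rq; clear; lia.
  + have [q hq rq] := hpath_thin gS rhoP sm sn hp.
    have Lk : guess v w k by exists t; split=> //; right; exists e, k, n; split=> //; exact: hpath_l.
    case: hq => hq; last by exists q; [right; exists t; split=> //; right; exists e, k, n | apply: leq_trans rq _; rewrite /h; clear; lia].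
    exists k; first by right.
    apply: leq_trans (rho_tri rhoP q _ _) _; rewrite /h.
    have vt := geo_seg gs es; rewrite ls in vt.
    have ve : co u.1 != e by apply: contra es => /eqP->; rewrite mem_head.
    have we : co v.1 != e by apply: contra es => /eqP<-; rewrite -ls mem_last.
    case: kv => [[ev]|[_ [a [ek ea sa]]]]; first by rewrite ev eqxx in we.
    case: mu => [[ew]|[_ [b [en eb sb]]]]; first by rewrite ew eqxx in ve.
    have dab : wd a b <= R.
      apply: (dist e _ _ 3) => //; apply: poly_cons sa _; apply: poly_cons (sgC vt) _.
      exact: poly1 (sgC sb).
    rewrite ek en in hq *; have := jump a b q _ dab (hpathC gS hq); rewrite ea eb => /(_ erefl).
    by move: rq; clear; lia.
  + have us := geo_seg gs es; rewrite ls in us; have vt := geo_seg gt et; rewrite lt in vt.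
    have ue : co u.1 != e by apply: contra es => /eqP->; rewrite mem_head.
    have we : co w.1 != e by apply: contra et => /eqP<-; rewrite -lt mem_last.
    case: mu => [[ev]|[_ [a [em ea sa]]]]; first by rewrite ev eqxx in ue.
    case: mw => [[ew]|[_ [b [en eb sb]]]]; first by rewrite ew eqxx in we.
    have dab : wd a b <= R.
      apply: (dist e _ _ 4) => //; apply: poly_cons sa _; apply: poly_cons us _; apply: poly_cons vt _.
      exact: poly1 (sgC sb).
    rewrite em en in hp; have jp := jump a b p _ dab hp; rewrite ea eb in jp.
    have [r1 [r2 er']] : exists r1 r2, inr (co u.1) :: r = r1 ++ inr e :: r2.
      by case/splitPr: er => r1 r2; exists r1, r2.
    have [[_ e1]|[g [r0 [er1 ge sgg _]]]] := in_mark gr er'; first by case: e1 ue => ->; rewrite eqxx.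
    have gr' : inl g \in r.
      have : inl g \in inr (co u.1) :: r by rewrite er' er1 mem_cat mem_rcons mem_head.
      by rewrite inE.
    have [q hq dq] := caseG g gr'; exists q => //.
    have dag : wd a g <= R.
      by apply: (dist e _ _ 2) => //; apply: poly_cons sa _; exact: poly1 (sgC sgg).
    have := rho_tri rhoP (a, 0) p q; have := rho_tri rhoP (g, 0) (a, 0) q.
    have := rho_word gS rhoP a g; move: (jp erefl) dq dag; rewrite /h.
    by move: (rho _ _) (rho _ _) (rho _ _) (rho _ _) (rho _ _) => i1 i2 i3 i4 i5; clear; lia.
- move=> u w p uw1 [s [gs ls ps]].
  case: (eqVneq (co u.1) (co w.1)) => [uw|uw].
    have s0 : s = [::].
      have := geod_uniq Esym wC (@cwt_gt0 G H) dhP gs; rewrite uw in ls *.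
      by case: (s) ls => // z s1 /= ls1 /andP[+ _]; rewrite -ls1 mem_last.
    case: ps => [[g]|[e [m [n [er mu mw hp]]]]]; first by rewrite s0.
    move: er; rewrite s0 inE => /eqP[ee]; rewrite ee in mu mw.
    case: mu => [[_ em]|[]]; last by rewrite eqxx.
    case: mw => [[_ en]|[]]; last by rewrite uw eqxx.
    rewrite em en in hp; apply: leq_trans (hpath_radius gS rhoP _ hp) _; first exact/coset_ofP.
    by move: uw1; rewrite /h; clear; lia.
  case: (unit_le1 rhoP uw1) => [e|]; first by rewrite e eqxx in uw.
  case: u w uw uw1 gs ls ps => x k [y l] /= uw uw1 gs ls ps.
  case/or3P=> [/andP[/eqP/= e]|/and3P[/eqP/= k0 /eqP/= l0 xy]|/and3P[_ /= /coset_ofP e]]; try by rewrite e eqxx in uw.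
  rewrite k0 l0 in uw1 ps *; have xny : x != y by apply: contraNneq uw => ->.
  have Exy : CE (inl x) (inl y) by rewrite /= /cayley_adj xny.
  have Eax : CE (inr (co x)) (inl x) by rewrite /= eqxx.
  have Eyb : CE (inl y) (inr (co y)) by rewrite /= eqxx.
  have geo1 (z z' : CV) : CE z z' -> geo z [:: z'].
    by move=> zz'; rewrite /geod /= zz' /= addn0 (edge_dist dhP zz').
  have clA g : inl g \in s -> wd x g <= 2 * T + 1.
    move=> gin; have [t [gt lt]] := geod_exists dhP (inl x) (inr (co y)).
    have [||||q] := TP (inr (co x)) [:: inl x] t s g _ _ gs; rewrite /= ?lt ?ls //; try exact: geo1.
    rewrite !inE /= => /orP[/eqP[->] dq|qt dq]; first by rewrite (wd_sym gS) (leq_trans dq) //; clear; lia.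
    have [||||q'] := TP (inl x) [:: inl y] [:: inr (co y)] t q _ _ gt; rewrite /= ?lt //; try exact: geo1.
      by rewrite inE qt orbT.
    rewrite !inE /= orbF => q'in dq'.
    have q'x : wd x q' <= 1.
      case/orP: q'in => /eqP[->]; first by rewrite (wd_refl gS).
      exact: (wd_gen gS).
    have := wd_tri gS q x g; have := wd_tri gS q' x q; rewrite (wd_sym gS q' q) (wd_sym gS q g).
    by move: dq dq' q'x; clear; lia.
  have clx g : wd x g <= R -> rho (g, 0) (x, 0) <= R.
    by move=> le; rewrite (rho_sym gS rhoP); apply: leq_trans (rho_word gS rhoP _ _) le.
  case: ps => [[g gin ->]|[e [m [n [er mu mw hp]]]]].
    rewrite (rho_sym gS rhoP); apply: leq_trans (rho_word gS rhoP _ _) _.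
    by apply: leq_trans (clA g gin) _; rewrite /h; clear; lia.
  case: mu => /= -[ea mu]; case: mw => /= -[eb mw].
  + by rewrite ea eb eqxx in uw.
  + case: mw => b [en be sb]; rewrite mu en in hp.
    have dxb : wd x b <= R.
      rewrite (wd_sym gS); apply: (dist e _ _ 3) => //; apply: poly_cons sb _.
      apply: (poly_cons (v := inl y)); first by apply: (edge_seg dhP) => //; rewrite Esym.
      by apply: poly1; apply: (edge_seg dhP) => //; rewrite Esym.
    apply: leq_trans (jump x b p _ dxb hp) _; first by rewrite be.
    by rewrite /h; clear; lia.
  + case: mu => a [em ae sa]; rewrite mw em in hp.
    have dxa : wd y a <= R.
      rewrite (wd_sym gS); apply: (dist e _ _ 3) => //; apply: poly_cons sa _.
      apply: (poly_cons (v := inl x)); first by apply: (edge_seg dhP).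
      by apply: poly1; apply: (edge_seg dhP).
    have := jump y a p _ dxa (hpathC gS hp); rewrite eb ae => /(_ erefl).
    have := rho_tri rhoP (y, 0) p (x, 0); rewrite (rho_sym gS rhoP (y, 0) (x, 0)).
    move=> r1 r2; apply: leq_trans r1 _; apply: leq_trans (leq_add r2 uw1) _.
    by rewrite /h; clear; lia.
  + case: mu => a [em ae sa]; case: mw => b [en be sb]; rewrite em en in hp.
    have dab : wd a b <= R.
      apply: (dist e _ _ 5) => //; apply: poly_cons sa _.
      apply: (poly_cons (v := inl x)); first by apply: (edge_seg dhP).
      apply: (poly_cons (v := inl y)); first by apply: (edge_seg dhP).
      apply: (poly_cons (v := inr (co y))); first by apply: (edge_seg dhP).
      exact: poly1 (sgC sb).
    have jp := jump a b p _ dab hp; rewrite ae be in jp.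
    have [r1 [r2 er']] : exists r1 r2, inr (co x) :: s = r1 ++ inr e :: r2.
      by case/splitPr: er => r1 r2; exists r1, r2.
    have [[_ e1]|[g [r0 [er1 ge sgg _]]]] := in_mark gs er'; first by case: e1 ea => ->; rewrite eqxx.
    have gin : inl g \in s.
      have : inl g \in inr (co x) :: s by rewrite er' er1 mem_cat mem_rcons mem_head.
      by rewrite inE.
    have dag : wd a g <= R.
      by apply: (dist e _ _ 2) => //; apply: poly_cons sa _; exact: poly1 (sgC sgg).
    have := rho_tri rhoP (a, 0) p (x, 0); have := rho_tri rhoP (g, 0) (a, 0) (x, 0).
    have := rho_word gS rhoP a g; have := rho_word gS rhoP x g; rewrite (rho_sym gS rhoP (x, 0)).
    move: (jp erefl) dag (clA g gin); rewrite /h.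
    by move: (rho _ _) (rho _ _) (rho _ _) (rho _ _) (rho _ _) => i1 i2 i3 i4 i5; clear; lia.
Qed.

End CuspedHyperbolic.

Local Open Scope ring_scope.

(** * Finitely supported functions and their sums *)

Section FiniteSum.
Context (T : choiceType) (A : zmodType).
Implicit Types (f g : T -> A) (l : seq T).

Definition fin f : Prop := exists l, forall x, f x != 0 -> x \in l.

Definition fsum f : A := \sum_(x \in [set: T]) f x.

Lemma fsumE f l : (forall x, f x != 0 -> x \in l) -> fsum f = \sum_(x <- undup l) f x.
Proof.
move=> fl; rewrite /fsum (fsbigE (undup l)) ?undup_uniq //.
  by apply: eq_bigl => x; rewrite in_setT.
by move=> x _; rewrite mem_undup; apply: contraNeq; exact: fl.
Qed.

Lemma fin0 : fin (fun _ => 0). Proof. by exists [::] => x; rewrite eqxx. Qed.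

Lemma finD f g : fin f -> fin g -> fin (fun x => f x + g x).
Proof.
move=> [l1 h1] [l2 h2]; exists (l1 ++ l2) => x; rewrite mem_cat.
case: (eqVneq (f x) 0) => [->|/h1->//]; rewrite add0r => /h2->; exact: orbT.
Qed.

Lemma finN f : fin f -> fin (fun x => - f x).
Proof. by move=> [l h]; exists l => x; rewrite oppr_eq0; exact: h. Qed.

Lemma fin_sub f g : fin f -> (forall x, g x != 0 -> f x != 0) -> fin g.
Proof. by move=> [l h] gf; exists l => x /gf/h. Qed.

Lemma fin_point a f : (forall x, x != a -> f x = 0) -> fin f.
Proof. by move=> h; exists [:: a] => x; rewrite inE; apply: contraNT => /h->. Qed.

Lemma fsum0 f : (forall x, f x = 0) -> fsum f = 0.
Proof. by move=> h; rewrite (fsumE (l := [::])) ?big_nil // => x; rewrite h eqxx. Qed.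

Lemma fsumD f g : fin f -> fin g -> fsum (fun x => f x + g x) = fsum f + fsum g.
Proof.
move=> [l1 h1] [l2 h2]; rewrite !(fsumE (l := l1 ++ l2)) -?big_split // => x.
- by move=> /h2 xl; rewrite mem_cat xl orbT.
- by move=> /h1 xl; rewrite mem_cat xl.
- rewrite mem_cat; case: (eqVneq (f x) 0) => [->|/h1->//]; rewrite add0r => /h2->; exact: orbT.
Qed.

Lemma fsum_point a f : (forall x, x != a -> f x = 0) -> fsum f = f a.
Proof.
move=> h; rewrite (fsumE (l := [:: a])) ?big_seq1 // => x.
by rewrite inE; apply: contraNT => /h->.
Qed.

Lemma fsum_eq f g : (forall x, f x = g x) -> fsum f = fsum g.
Proof. by move=> h; congr fsum; exact: funext. Qed.

Lemma fsum_neq0 f : fsum f != 0 -> exists x, f x != 0.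
Proof.
move=> s; apply: contrapT => h; case/negP: s; apply/eqP/fsum0 => x.
by apply/eqP/negPn/negP => fx; apply: h; exists x.
Qed.

(* The form in which a property of finite sums reduces to sums of two terms. *)
Lemma fsum_morph (B : zmodType) (Q : A -> Prop) (h : A -> B) f : fin f -> (forall x, Q (f x)) ->
  Q 0 -> (forall a b, Q a -> Q b -> Q (a + b)) -> h 0 = 0 ->
  (forall a b, Q a -> Q b -> h (a + b) = h a + h b) ->
  h (fsum f) = \sum_(x \in [set: T]) h (f x) /\ Q (fsum f).
Proof.
move=> [l fl] Qf Q0 QD h0 hD; rewrite -/(@fsum _) (fsumE fl).
have -> : \sum_(x \in [set: T]) h (f x) = \sum_(x <- undup l) h (f x).
  rewrite (fsbigE (undup l)) ?undup_uniq //.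
    by apply: eq_bigl => x; rewrite in_setT.
  move=> x _; rewrite mem_undup => xl; have -> // : f x = 0.
  by apply: contraNeq xl; exact: fl.
elim: (undup l) => [|x s [IH QS]]; first by rewrite !big_nil.
by rewrite !big_cons hD // IH; split=> //; exact: QD.
Qed.

Lemma antisym_sum (F : T -> T -> A) l : (forall x y, F x y = - F y x) -> (forall x, F x x = 0) ->
  \sum_(x <- l) \sum_(y <- l) F x y = 0.
Proof.
move=> Fa F0; elim: l => [|x l IH]; first by rewrite big_nil.
rewrite big_cons [X in X + _]big_cons F0 add0r.
rewrite [X in _ + X](eq_bigr (fun y => F y x + \sum_(z <- l) F y z)); last first.
  by move=> y _; rewrite big_cons.
rewrite big_split /= IH addr0 -big_split big1 // => y _ /=; by rewrite (Fa x y) addNr.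
Qed.

Lemma fsum_antisym (F : T -> T -> A) : (exists l, forall x y, F x y != 0 -> x \in l /\ y \in l) ->
  (forall x y, F x y = - F y x) -> (forall x, F x x = 0) -> fsum (fun x => fsum (F x)) = 0.
Proof.
move=> [l h] Fa F0; rewrite (fsumE (l := l)); last first.
  by move=> x /fsum_neq0[y /h[]].
rewrite -[RHS](antisym_sum (undup l) Fa F0); apply: eq_bigr => x _.
by apply: fsumE => y /h[].
Qed.

End FiniteSum.

Lemma fsum_linear (T : choiceType) (A B : zmodType) (h : A -> B) (f : T -> A) : fin f ->
  h 0 = 0 -> (forall a b, h (a + b) = h a + h b) -> h (fsum f) = fsum (fun x => h (f x)).
Proof. by move=> ff h0 hD; have [] := @fsum_morph T A B (fun _ => True) h f ff (fun _ => I) I (fun _ _ _ _ => I) h0 (fun a b _ _ => hD a b). Qed.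

Lemma fsum_exchange (T U : choiceType) (A : zmodType) (F : T -> U -> A) :
  (exists (l : seq T) (k : seq U), forall x y, F x y != 0 -> x \in l /\ y \in k) ->
  fsum (fun x => fsum (F x)) = fsum (fun y => fsum (fun x => F x y)).
Proof.
move=> [l [k h]].
rewrite (fsumE (l := l)); last by move=> x /fsum_neq0[y /h[]].
rewrite [RHS](fsumE (l := k)); last by move=> y /fsum_neq0[x /h[]].
rewrite (eq_bigr (fun x => \sum_(y <- undup k) F x y)); last first.
  by move=> x _; apply: fsumE => y /h[].
by rewrite exchange_big; apply: eq_bigr => y _; apply/esym/fsumE => x /h[].
Qed.

Lemma fsum_bij (T U : choiceType) (A : zmodType) (f : T -> A) (g : U -> T) (g' : T -> U) :
  cancel g g' -> cancel g' g -> fin f -> fsum f = fsum (fun y => f (g y)).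
Proof.
move=> gK g'K [l h]; rewrite (fsumE h) (fsumE (l := [seq g' x | x <- l])); last first.
  by move=> y /h yl; apply/mapP; exists (g y); rewrite ?gK.
rewrite undup_map_inj ?big_map; last exact: can_inj g'K.
by apply: eq_bigr => x _; rewrite g'K.
Qed.

Lemma fsumN (T : choiceType) (B : zmodType) (f : T -> B) : fin f -> fsum (fun z => - f z) = - fsum f.
Proof.
move=> ff; apply/eqP; rewrite -addr_eq0 -fsumD //; last exact: finN.
by apply/eqP/fsum0 => z; exact: addNr.
Qed.

Lemma fsumB (T : choiceType) (B : zmodType) (f g : T -> B) : fin f -> fin g ->
  fsum (fun z => f z - g z) = fsum f - fsum g.
Proof. by move=> ff fg; rewrite (fsumD ff (finN fg)) fsumN. Qed.

Lemma fin_subr (T : choiceType) (A B : zmodType) (f : T -> A) (g : T -> B) :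
  fin f -> (forall x, g x != 0 -> f x != 0) -> fin g.
Proof. by move=> [l h] gf; exists l => x /gf/h. Qed.

Lemma adjacent_swap_ind (T : eqType) (P : seq T -> Prop) :
  (forall s1 x y s2, P (s1 ++ x :: y :: s2) -> P (s1 ++ y :: x :: s2)) ->
  forall s t, perm_eq s t -> P s -> P t.
Proof.
move=> sw; have one p s x r : P (p ++ s ++ x :: r) -> P (p ++ x :: s ++ r).
  elim: s p => [//|y s IH] p h; apply: sw; rewrite -cat_rcons; apply: IH.
  by rewrite cat_rcons.
have blk p s t r : P (p ++ s ++ t ++ r) -> P (p ++ t ++ s ++ r).
  elim: t p => [//|x t IH] p h; rewrite cat_cons -cat_rcons; apply: IH; rewrite cat_rcons.
  exact: one.
by apply: catCA_perm_ind => s1 s2 s3; exact: (blk [::]).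
Qed.

(** * Alternating chains and acyclicity *)

Section AlternatingChains.
Context (V : choiceType) (A : zmodType).
Notation C := (seq V -> A).
Implicit Types (c : C) (s t : seq V) (u v w x y : V).

Definition ctr v c : C := fun s => c (v :: s).

Fixpoint wedge_at u s c : A :=
  if s is x :: s' then (if x == u then c s' else 0) - wedge_at u s' (ctr x c) else 0.

(* Left multiplication by u in the exterior algebra; [ctr] and [bd] are the adjoint of it and of
   left multiplication by the sum of all vertices. *)
Definition wedge u c : C := fun s => wedge_at u s c.

Definition bd c : C := fun s => fsum (fun v => c (v :: s)).

(** Chains are functions on words, one value for each ordering of a simplex. Vanishing on repeated
    letters is a separate requirement because [A] may have 2-torsion. The empty word is included, so
    cycles are cycles of the augmented complex. *)
Definition alternating c : Prop :=
  (forall s1 x y s2, c (s1 ++ x :: y :: s2) = - c (s1 ++ y :: x :: s2)) /\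
  (forall s1 x s2, c (s1 ++ x :: x :: s2) = 0).

Lemma ctr_wedge u v c s : ctr v (wedge u c) s = (if v == u then c s else 0) - wedge u (ctr v c) s.
Proof. by []. Qed.

Lemma wedgeD u c c' s : wedge u (fun t => c t + c' t) s = wedge u c s + wedge u c' s.
Proof.
rewrite /wedge; elim: s c c' => [|x s IH] c c' /=; first by rewrite addr0.
rewrite [X in _ - X](IH (ctr x c) (ctr x c')) opprD addrACA; congr (_ + _).
by case: ifP => _; rewrite ?addr0.
Qed.

Lemma wedge0 u c s : (forall t, c t = 0) -> wedge u c s = 0.
Proof.
rewrite /wedge; elim: s c => [//|x s IH] c c0 /=; rewrite c0 IH; last by move=> t; exact: c0.
by rewrite if_same subr0.
Qed.

Lemma wedgeN u c s : wedge u (fun t => - c t) s = - wedge u c s.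
Proof.
apply/eqP; rewrite -addr_eq0 -wedgeD; apply/eqP/wedge0 => t; exact: addNr.
Qed.

Lemma wedgeB u c c' s : wedge u (fun t => c t - c' t) s = wedge u c s - wedge u c' s.
Proof. by rewrite (wedgeD u c (fun t => - c' t)) wedgeN. Qed.

Lemma wedge_supp u c s : wedge u c s != 0 -> exists t, perm_eq s (u :: t) /\ c t != 0.
Proof.
rewrite /wedge; elim: s c => [|x s IH] c /=; first by rewrite eqxx.
case: (eqVneq x u) => [->|_].
  case: (eqVneq (c s) 0) => [->|cs]; last by exists s.
  rewrite sub0r oppr_eq0 => /IH[t [p ct]]; exists (u :: t); split=> //.
  by rewrite perm_cons.
rewrite sub0r oppr_eq0 => /IH[t [p ct]]; exists (x :: t); split=> //.
rewrite -[x :: t]cat1s -[u :: _]cat1s perm_sym perm_catCA /=.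
by rewrite perm_cons perm_sym.
Qed.

Lemma fin_ctr v c : fin c -> fin (ctr v c).
Proof.
move=> [l h]; exists (map behead l) => s /h sl; by apply/mapP; exists (v :: s).
Qed.

Lemma fin_wedge u c : fin c -> fin (wedge u c).
Proof.
move=> [l h]; exists (flatten [seq permutations (u :: t) | t <- l]) => s /wedge_supp[t [p /h tl]].
by apply/flattenP; exists (permutations (u :: t)); [exact: map_f | rewrite mem_permutations].
Qed.

Lemma fin_heads c : fin c -> exists l : seq V, forall v s, c (v :: s) != 0 -> v \in l.
Proof.
move=> [l h]; exists (flatten l) => v s /h sl; by apply/flattenP; exists (v :: s); rewrite ?mem_head.
Qed.

Lemma fin_at c s : fin c -> fin (fun v => c (v :: s)).
Proof. by move=> /fin_heads[l h]; exists l => v /h. Qed.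

Lemma bd_supp c s : bd c s != 0 -> exists v, c (v :: s) != 0.
Proof. exact: fsum_neq0. Qed.

Lemma fin_bd c : fin c -> fin (bd c).
Proof.
move=> [l h]; exists (map behead l) => s /bd_supp[v /h sl]; by apply/mapP; exists (v :: s).
Qed.

Lemma bdD c c' s : fin c -> fin c' -> bd (fun t => c t + c' t) s = bd c s + bd c' s.
Proof. by move=> fc fc'; apply: fsumD; exact: fin_at. Qed.

Lemma bd0 c s : (forall t, c t = 0) -> bd c s = 0.
Proof. by move=> c0; apply: fsum0 => v. Qed.

Lemma bdN c s : fin c -> bd (fun t => - c t) s = - bd c s.
Proof.
move=> fc; apply/eqP; rewrite -addr_eq0 -bdD //; last exact: finN.
by apply/eqP/bd0 => t; exact: addNr.
Qed.

Lemma bdB c c' s : fin c -> fin c' -> bd (fun t => c t - c' t) s = bd c s - bd c' s.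
Proof. by move=> fc fc'; rewrite (bdD (c' := fun t => - c' t)) ?bdN //; exact: finN. Qed.

Lemma alt_ctr v c : alternating c -> alternating (ctr v c).
Proof. by case=> a1 a2; split=> [s1 x y s2|s1 x s2]; [exact: (a1 (v :: s1)) | exact: (a2 (v :: s1))]. Qed.

Lemma altD c c' : alternating c -> alternating c' -> alternating (fun s => c s + c' s).
Proof.
move=> [a1 a2] [b1 b2]; split=> [s1 x y s2|s1 x s2]; last by rewrite a2 b2 addr0.
by rewrite a1 b1 opprD.
Qed.

Lemma altN c : alternating c -> alternating (fun s => - c s).
Proof.
by move=> [a1 a2]; split=> [s1 x y s2|s1 x s2]; rewrite ?a2 ?oppr0 // a1.
Qed.

Lemma altB c c' : alternating c -> alternating c' -> alternating (fun s => c s - c' s).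
Proof. by move=> a b; apply: (altD a); exact: altN. Qed.

Lemma alt_wedge u c : alternating c -> alternating (wedge u c).
Proof.
rewrite /wedge => a; split=> [s1 x y s2|s1 x s2].
  elim: s1 c a => [|z s1 IH] c a /=.
    have -> : wedge_at u s2 (ctr y (ctr x c)) = - wedge_at u s2 (ctr x (ctr y c)).
      rewrite -[RHS](wedgeN u (ctr x (ctr y c))) /wedge; congr wedge_at; apply: funext => t.
      exact: (a.1 [::]).
    by rewrite /ctr !opprB addrA.
  rewrite IH; last exact: alt_ctr.
  case: a => a1 a2; case: eqP => _; first by rewrite a1 opprB opprK addrC.
  by rewrite !sub0r.
elim: s1 c a => [|z s1 IH] c a /=.
  rewrite subKr; apply: wedge0 => t; exact: (a.2 [::]).
rewrite IH; last exact: alt_ctr.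
by rewrite a.2 if_same subr0.
Qed.

Lemma alt_bd c : fin c -> alternating c -> alternating (bd c).
Proof.
move=> fc [a1 a2]; split=> [s1 x y s2|s1 x s2]; last first.
  by apply: fsum0 => v; exact: (a2 (v :: s1)).
rewrite -fsumN; last exact: fin_at.
by apply: fsum_eq => v; exact: (a1 (v :: s1)).
Qed.

Lemma alt_perm c s t : alternating c -> perm_eq s t -> c s != 0 -> c t != 0.
Proof.
move=> [a _]; apply: (adjacent_swap_ind (P := fun s => c s != 0)) => s1 x y s2.
by rewrite a oppr_eq0.
Qed.

Lemma not_uniq_perm s : ~~ uniq s -> exists x t, perm_eq s (x :: x :: t).
Proof.
elim: s => [//|y s IH] /=; rewrite negb_and negbK; case/orP => [ys|/IH[x [t p]]].
  by exists y, (rem y s); rewrite perm_cons perm_to_rem.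
exists x, (y :: t); apply: (@perm_trans _ (y :: x :: x :: t)); first by rewrite perm_cons.
by apply/permPl; exact: (perm_catCA [:: y] [:: x; x] t).
Qed.

Lemma alt_uniq c s : alternating c -> c s != 0 -> uniq s.
Proof.
move=> a cs; apply: contraT => /not_uniq_perm[x [t p]].
by have := alt_perm a p cs; rewrite (a.2 [::]) eqxx.
Qed.

Lemma alt_eq0 c u t s : alternating c -> (forall t, c (u :: t) = 0) -> perm_eq s (u :: t) -> c s = 0.
Proof.
by move=> a c0 p; apply/eqP/negPn/negP => /(alt_perm a p); rewrite c0 eqxx.
Qed.

Lemma wedge_fsum (T : choiceType) u (F : T -> C) s : (exists l : seq T, forall i t, F i t != 0 -> i \in l) ->
  wedge u (fun t => fsum (fun i => F i t)) s = fsum (fun i => wedge u (F i) s).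
Proof.
rewrite /wedge; elim: s F => [|x s IH] F [l h] /=; first by rewrite fsum0.
have -> : ctr x (fun t => fsum (fun i => F i t)) = fun t => fsum (fun i => ctr x (F i) t) by [].
have fF : fin (fun i => F i s) by exists l => i /h.
have fW : fin (fun i => wedge_at u s (ctr x (F i))).
  by exists l => i /(wedge_supp (u := u))[t [_ /h]].
rewrite IH; last by exists l => i t /h.
rewrite (fsumB (f := fun i => if x == u then F i s else 0)) //; last by case: (x == u) => //; exact: fin0.
by congr (_ - _); case: ifP => _ //; rewrite fsum0.
Qed.

(** The cone formula: left multiplication by a vertex is a contracting homotopy, down to the empty
    word. *)
Lemma bd_wedge u c s : fin c -> bd (wedge u c) s = c s - wedge u (bd c) s.
Proof.
move=> fc; rewrite /bd wedge_fsum; last by have [l h] := fin_heads fc; exists l => v t /h.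
have fW : fin (fun v => wedge u (ctr v c) s).
  have [l h] := fin_heads fc; exists l => v /wedge_supp[t [_ /h]//].
rewrite (fsum_eq (g := fun v => (if v == u then c s else 0) - wedge u (ctr v c) s)) //.
rewrite fsumB //; last by apply: (fin_point (a := u)) => v /negbTE->.
by congr (_ - _); rewrite (fsum_point (a := u)) ?eqxx // => v /negbTE->.
Qed.

Lemma ctr_bd v c s : fin c -> alternating c -> ctr v (bd c) s = - bd (ctr v c) s.
Proof.
move=> fc a; rewrite /ctr /bd -fsumN; last exact: (fin_at s (fin_ctr v fc)).
by apply: fsum_eq => w; exact: (a.1 [::]).
Qed.

Lemma bd_bd c s : fin c -> alternating c -> bd (bd c) s = 0.
Proof.
move=> fc [a1 a2]; have [l h] := fc; apply: (fsum_antisym (F := fun v w => c (w :: v :: s))).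
- exists (flatten l) => v w /h sl; split; apply/flattenP; exists (w :: v :: s) => //.
    by rewrite !inE eqxx orbT.
  by rewrite mem_head.
- by move=> v w; exact: (a1 [::]).
- by move=> v; exact: (a2 [::]).
Qed.

(* For a cycle c: replaces the vertex v by v'. *)
Definition move_vertex v v' c : C := fun s => c s - bd (wedge v' (wedge v (ctr v c))) s.

Lemma move_vertexE v v' c s : fin c -> alternating c -> (forall t, bd c t = 0) ->
  move_vertex v v' c s = c s - wedge v (ctr v c) s + wedge v' (ctr v c) s.
Proof.
move=> fc a b0; have fi := fin_ctr v fc; rewrite /move_vertex bd_wedge; last exact: fin_wedge.
rewrite opprB addrA addrAC; congr (_ - _ + _).
have -> : bd (wedge v (ctr v c)) = fun s => ctr v c s - wedge v (bd (ctr v c)) s.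
  by apply: funext => t; rewrite bd_wedge.
rewrite wedgeB [X in _ - X]wedge0 ?subr0 // => t; apply: wedge0 => {}t.
by apply/eqP; rewrite -oppr_eq0 -ctr_bd // /ctr b0.
Qed.

Lemma move_vertex_supp v v' c s : v != v' -> fin c -> alternating c -> (forall t, bd c t = 0) ->
  move_vertex v v' c s != 0 -> v \notin s /\
    (c s != 0 \/ exists t, perm_eq s (v' :: t) /\ c (v :: t) != 0).
Proof.
move=> vv' fc a b0; rewrite move_vertexE //.
have ai := alt_ctr v a; have a0 := altB a (alt_wedge v ai).
have c00 t : c (v :: t) - wedge v (ctr v c) (v :: t) = 0.
  have := ctr_wedge v v (ctr v c) t; rewrite {1}/ctr => ->.
  rewrite eqxx wedge0 ?subr0 ?subrr // => r; exact: (a.2 [::]).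
case: (eqVneq (wedge v' (ctr v c) s) 0) => [->|/wedge_supp[t [p ct]] _].
  rewrite addr0 => s0; have vs : v \notin s.
    apply: contra s0 => /perm_to_rem p; apply/eqP; exact: (alt_eq0 a0 c00 p).
  split=> //; left; apply: contraNneq s0 => ->; rewrite sub0r oppr_eq0.
  apply/negPn/negP => /wedge_supp[t [p _]]; move: vs; by rewrite (perm_mem p) mem_head.
split; last by right; exists t.
rewrite (perm_mem p) in_cons negb_or vv' /=.
by have := alt_uniq a ct; rewrite cons_uniq => /andP[].
Qed.

(** The exterior product of the letters of [s] with coefficient [a]. *)
Fixpoint basic (a : A) s : C :=
  if s is x :: s' then wedge x (basic a s') else fun t => if t is [::] then a else 0.

Lemma basic_supp a s t : basic a s t != 0 -> perm_eq t s.
Proof.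
elim: s t => [|x s IH] t /=; first by case: t; rewrite ?eqxx.
by case/wedge_supp => r [p /IH q]; apply: perm_trans p _; rewrite perm_cons.
Qed.

Lemma basic_self a s : uniq s -> basic a s s = a.
Proof.
elim: s => [//|x s IH] /= /andP[xs us].
transitivity ((if x == x then basic a s s else 0) - wedge x (ctr x (basic a s)) s) => //.
rewrite eqxx IH //.
rewrite wedge0 ?subr0 // => t; apply/eqP/negPn/negP => /basic_supp/perm_mem/(_ x).
by rewrite mem_head (negbTE xs).
Qed.

Lemma fin_basic a s : fin (basic a s).
Proof.
elim: s => [|x s IH] /=; last exact: fin_wedge.
by exists [:: [::]] => -[//|x t]; rewrite eqxx.
Qed.

Lemma alt_basic a s : alternating (basic a s).
Proof.
elim: s => [|x s IH] /=; last exact: alt_wedge.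
by split=> [[|z s1] x y s2|[|z s1] x s2] //=; rewrite oppr0.
Qed.

Lemma basic_eq c s t : alternating c -> uniq s -> perm_eq s t -> basic (c s) s t = c t.
Proof.
move=> [a _] us p; have [b _] := alt_basic (c s) s.
apply: (adjacent_swap_ind (P := fun t => basic (c s) s t = c t) _ p); last exact: basic_self.
by move=> s1 x y s2 e; rewrite b e a opprK.
Qed.

End AlternatingChains.

(** * Push-forward of chains *)

Section Push.
Context (V W : choiceType) (A : zmodType).
Implicit Types (c : seq V -> A) (f g : V -> W).

Fixpoint push_at f (t : seq W) c : A :=
  if t is w :: t' then fsum (fun v => if f v == w then push_at f t' (ctr v c) else 0)
  else c [::].

Definition push f c : seq W -> A := fun t => push_at f t c.

Lemma push_supp f c t : push f c t != 0 -> exists s, map f s = t /\ c s != 0.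
Proof.
rewrite /push; elim: t c => [|w t IH] c /=; first by exists [::].
case/fsum_neq0 => v; case: (eqVneq (f v) w) => [<-|_]; last by rewrite eqxx.
by case/IH => s [<- cs]; exists (v :: s).
Qed.

Lemma fin_push f c : fin c -> fin (push f c).
Proof.
by move=> [l h]; exists (map (map f) l) => t /push_supp[s [<- /h sl]]; exact: map_f.
Qed.

Lemma fin_push_at f c w t : fin c -> fin (fun v => if f v == w then push_at f t (ctr v c) else 0).
Proof.
move=> /fin_heads[l h]; exists l => v; case: ifP => _; last by rewrite eqxx.
by case/push_supp => s [_ /h].
Qed.

Lemma push0 f c t : (forall s, c s = 0) -> push f c t = 0.
Proof.
by move=> c0; apply/eqP/negPn/negP => /push_supp[s []]; rewrite c0 eqxx.
Qed.

Lemma pushD f c c' t : fin c -> fin c' -> push f (fun s => c s + c' s) t = push f c t + push f c' t.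
Proof.
rewrite /push; elim: t c c' => [//|w t IH] c c' fc fc' /=.
rewrite -fsumD; [|exact: fin_push_at|exact: fin_push_at].
apply: fsum_eq => v; case: ifP => _; last by rewrite addr0.
by apply: IH; exact: fin_ctr.
Qed.

Lemma pushN f c t : fin c -> push f (fun s => - c s) t = - push f c t.
Proof.
move=> fc; apply/eqP; rewrite -addr_eq0 -pushD //; last exact: finN.
by apply/eqP/push0 => s; exact: addNr.
Qed.

Lemma pushB f c c' t : fin c -> fin c' -> push f (fun s => c s - c' s) t = push f c t - push f c' t.
Proof. by move=> fc fc'; rewrite (pushD f t fc (finN fc')) pushN. Qed.

Lemma push_fsum (T : choiceType) f (F : T -> seq V -> A) t :
  (exists (l : seq T) (k : seq (seq V)), forall v s, F v s != 0 -> v \in l /\ s \in k) ->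
  push f (fun s => fsum (fun v => F v s)) t = fsum (fun v => push f (F v) t).
Proof.
rewrite /push; elim: t F => [//|w t IH] F [l [k h]] /=.
rewrite (fsum_eq (g := fun v => fsum (fun u => if f v == w then push_at f t (ctr v (F u)) else 0))).
  apply: fsum_exchange; exists (flatten k), l => v u; case: ifP => _; last by rewrite eqxx.
  case/push_supp => s [_ /h[ul sk]]; split=> //.
  by apply/flattenP; exists (v :: s); rewrite ?mem_head.
move=> v; case: ifP => _; last by rewrite fsum0.
apply: (IH (fun u => ctr v (F u))); exists l, (map behead k) => u s /h[ul sk]; split=> //.
by apply/mapP; exists (v :: s).
Qed.

Lemma bd_push f c t : fin c -> bd (push f c) t = push f (bd c) t.
Proof.
move=> fc; have [l h] := fc.
have -> : push f (bd c) t = fsum (fun v => push f (ctr v c) t).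
  apply: push_fsum; exists (flatten l), (map behead l) => v s /h sl; split.
    by apply/flattenP; exists (v :: s); rewrite ?mem_head.
  by apply/mapP; exists (v :: s).
rewrite /bd /push /=.
have K w v : (if f v == w then push f (ctr v c) t else 0) != 0 ->
    v \in flatten l /\ w \in [seq f v | v <- flatten l].
  case: (eqVneq (f v) w) => [<-|_]; last by rewrite eqxx.
  case/push_supp => s [_ /h sl]; have vl : v \in flatten l.
    by apply/flattenP; exists (v :: s); rewrite ?mem_head.
  by rewrite vl map_f.
rewrite (fsum_exchange (F := fun w v => if f v == w then push f (ctr v c) t else 0)).
  apply: fsum_eq => v; rewrite (fsum_point (a := f v)) ?eqxx // => w.
  by rewrite eq_sym => /negbTE->.
by exists [seq f v | v <- flatten l], (flatten l) => w v /K[].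
Qed.

Lemma alt_push f c : fin c -> alternating c -> alternating (push f c).
Proof.
rewrite /push => fc a; split=> [s1 x y s2|s1 x s2].
  elim: s1 c fc a => [|z s1 IH] c fc a /=; last first.
    rewrite -fsumN; last exact: fin_push_at.
    apply: fsum_eq => v; case: ifP => _; last by rewrite oppr0.
    by apply: IH; [exact: fin_ctr|exact: alt_ctr].
  pose F u v := if f v == x then if f u == y then push f (ctr u (ctr v c)) s2 else 0 else 0.
  transitivity (fsum (fun v => fsum (fun u => F u v))).
    by apply: fsum_eq => v; rewrite /F; case: ifP => // _; rewrite fsum0.
  have [l h] := fc; rewrite fsum_exchange; last first.
    exists (flatten l), (flatten l) => v u; rewrite /F.
    case: ifP => _; last by rewrite eqxx.
    case: ifP => _; last by rewrite eqxx.
    case/push_supp => s [_ /h sl]; split; apply/flattenP; exists (v :: u :: s) => //.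
      by rewrite mem_head.
    by rewrite !inE eqxx orbT.
  rewrite -fsumN; last exact: (fin_push_at _ _ (x :: s2)).
  apply: fsum_eq => u; rewrite /F; case: (f u == y); last by rewrite oppr0 fsum0 // => v; rewrite if_same.
  rewrite /= -fsumN; last exact/fin_push_at/fin_ctr.
  apply: fsum_eq => v; case: ifP => _; last by rewrite oppr0.
  rewrite -[RHS](pushN f s2); last exact/fin_ctr/fin_ctr.
  rewrite /push; congr push_at; apply: funext => s; exact: (a.1 [::]).
elim: s1 c fc a => [|z s1 IH] c fc a /=; last first.
  apply: fsum0 => v; case: ifP => // _; apply: IH; [exact: fin_ctr|exact: alt_ctr].
pose F v u := if (f v == x) && (f u == x) then push f (ctr u (ctr v c)) s2 else 0.
transitivity (fsum (fun v => fsum (F v))).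
  by apply: fsum_eq => v; rewrite /F; case: ifP => // _; rewrite fsum0.
apply: fsum_antisym.
- have [l h] := fc; exists (flatten l) => v u; rewrite /F.
  case: ifP => _; last by rewrite eqxx.
  case/push_supp => s [_ /h sl]; split; apply/flattenP; exists (v :: u :: s) => //.
    by rewrite mem_head.
  by rewrite !inE eqxx orbT.
- move=> v u; rewrite /F andbC; case: ifP => _; last by rewrite oppr0.
  rewrite -[RHS](pushN f s2); last exact/fin_ctr/fin_ctr.
  rewrite /push; congr push_at; apply: funext => s; exact: (a.1 [::]).
- move=> v; rewrite /F; case: ifP => // _; apply: push0 => s; exact: (a.2 [::]).
Qed.

Lemma push_wedge f u c t : fin c -> push f (wedge u c) t = wedge (f u) (push f c) t.
Proof.
rewrite /push; elim: t c => [//|w t IH] c fc /=.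
have fW : fin (fun v => if f v == w then push_at f t (wedge u (ctr v c)) else 0).
  have [l h] := fin_heads fc; exists l => v; case: ifP => _; last by rewrite eqxx.
  by case/push_supp => s [_ /wedge_supp[r [_ /h]]].
transitivity (fsum (fun v => (if v == u then if f v == w then push_at f t c else 0 else 0)
    - (if f v == w then push_at f t (wedge u (ctr v c)) else 0))).
  apply: fsum_eq => v; case: ifP => _; last by rewrite if_same subr0.
  rewrite -[RHS](_ : push f (fun s => (if v == u then c s else 0) - wedge u (ctr v c) s) t = _) //.
  rewrite pushB; last 2 first.
  + by case: (v == u) => //; exact: fin0.
  + exact/fin_wedge/fin_ctr.
  by congr (_ - _); case: ifP => _ //; exact: push0.
rewrite fsumB //; last first.
  by apply: (fin_point (a := u)) => v /negbTE->.
congr (_ - _); first by rewrite (fsum_point (a := u)) ?eqxx ?(eq_sym w) // => v /negbTE->.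
have -> : ctr w (fun t0 => push_at f t0 c) =
    fun s => fsum (fun v => if f v == w then push f (ctr v c) s else 0) by [].
transitivity (fsum (fun v => if f v == w then wedge (f u) (push f (ctr v c)) t else 0)).
  by apply: fsum_eq => v; case: ifP => // _; apply: IH; exact: fin_ctr.
have [l h] := fin_heads fc; apply: esym; apply: etrans.
  apply: (@wedge_fsum W A V (f u) (fun v s => if f v == w then push f (ctr v c) s else 0) t).
  exists l => v s; case: ifP => _; last by rewrite eqxx.
  by case/push_supp => r [_ /h].
by apply: fsum_eq => v; case: ifP => // _; rewrite wedge0.
Qed.

Lemma push_ext f g c t : (forall s, c s != 0 -> {in s, f =1 g}) -> push f c t = push g c t.
Proof.
rewrite /push; elim: t c => [//|w t IH] c fg /=; apply: fsum_eq => v.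
have -> : push_at f t (ctr v c) = push_at g t (ctr v c).
  by apply: IH => s cs x xs; apply: (fg (v :: s) cs); rewrite in_cons xs orbT.
case: (eqVneq (push_at g t (ctr v c)) 0) => [->|/push_supp[s [_ cs]]]; first by rewrite !if_same.
by rewrite (fg _ cs) // mem_head.
Qed.

End Push.

Lemma fin_family (T U : choiceType) (A : zmodType) (F : T -> U -> A) : (forall i, fin (F i)) ->
  (exists l : seq T, forall i x, F i x != 0 -> i \in l) ->
  exists (l : seq T) (k : seq U), forall i x, F i x != 0 -> i \in l /\ x \in k.
Proof.
move=> fF [l h]; have [k kP] := choice fF; exists l, (flatten [seq k i | i <- l]) => i x Fx.
have il := h _ _ Fx; split=> //; apply/flattenP; exists (k i); first exact: map_f.
exact: kP Fx.
Qed.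

(** * Filling cycles by dismantling *)

Section Chains.
Context (V : choiceType) (A : zmodType).
Implicit Types (c e : seq V -> A) (P Q : seq V -> Prop) (s t : seq V).

Lemma fin_fsum (T : choiceType) (F : T -> seq V -> A) : (forall i, fin (F i)) ->
  (exists l : seq T, forall i x, F i x != 0 -> i \in l) -> fin (fun s => fsum (fun i => F i s)).
Proof.
move=> fF fl; have [l [k h]] := fin_family fF fl.
by exists k => s /fsum_neq0[i /h[]].
Qed.

Lemma alt_fsum (T : choiceType) (F : T -> seq V -> A) : (forall i, alternating (F i)) ->
  (exists l : seq T, forall i x, F i x != 0 -> i \in l) -> alternating (fun s => fsum (fun i => F i s)).
Proof.
move=> aF [l h]; split=> [s1 x y s2|s1 x s2]; last by apply: fsum0 => i; exact: (aF i).2.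
rewrite -fsumN; last by exists l => i /h.
by apply: fsum_eq => i; exact: (aF i).1.
Qed.

Definition chain P c : Prop := [/\ fin c, alternating c & forall s, c s != 0 -> P s].

Lemma chainD P c c' : chain P c -> chain P c' -> chain P (fun s => c s + c' s).
Proof.
move=> [f1 a1 p1] [f2 a2 p2]; split; [exact: finD|exact: altD|].
move=> s; case: (eqVneq (c s) 0) => [->|/p1//]; by rewrite add0r => /p2.
Qed.

Lemma chainN P c : chain P c -> chain P (fun s => - c s).
Proof.
by move=> [f1 a1 p1]; split; [exact: finN|exact: altN|move=> s; rewrite oppr_eq0; exact: p1].
Qed.

Lemma chainB P c c' : chain P c -> chain P c' -> chain P (fun s => c s - c' s).
Proof. by move=> h /chainN; exact: chainD. Qed.

Lemma chain_sub P Q c : (forall s, P s -> Q s) -> chain P c -> chain Q c.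
Proof. by move=> PQ [f a p]; split=> // s /p/PQ. Qed.

Lemma off_vertex v c s : alternating c -> c s - wedge v (ctr v c) s != 0 -> v \notin s.
Proof.
move=> a; have a0 := altB a (alt_wedge v (alt_ctr v a)).
apply: contraNN => /perm_to_rem p; apply/eqP; apply: alt_eq0 a0 _ p => t.
rewrite (_ : wedge v (ctr v c) (v :: t) = c (v :: t) - wedge v (ctr v (ctr v c)) t); last first.
  by rewrite -[LHS]/((if v == v then c (v :: t) else 0) - _) eqxx.
rewrite [wedge v (ctr v (ctr v c)) t]wedge0 ?subr0 ?subrr // => r; exact: (a.2 [::]).
Qed.

Section Dismantling.
Context (adj : rel V) (B : V -> Prop) (b : V) (mu : V -> nat) (nxt : V -> V).
Hypothesis adj_refl : reflexive adj.
Hypothesis adj_sym : symmetric adj.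
Hypothesis Bb : B b.
Hypothesis mub : forall v, (mu b <= mu v)%N.
Hypothesis nxtP : forall v, B v -> v != b -> [/\ B (nxt v), (mu (nxt v) < mu v)%N &
  forall w, B w -> adj v w -> (mu w <= mu v)%N -> adj w (nxt v)].

Definition clique_in s : Prop := (forall x y, x \in s -> y \in s -> adj x y) /\ (forall x, x \in s -> B x).

Lemma clique_in_perm s t : perm_eq s t -> clique_in s -> clique_in t.
Proof.
move=> p [h1 h2]; split=> [x y|x]; rewrite -!(perm_mem p); [exact: h1 | exact: h2].
Qed.

Lemma clique_in_cons v s : clique_in s -> B v -> (forall w, w \in s -> adj w v) -> clique_in (v :: s).
Proof.
move=> [h1 h2] Bv h; split=> [x y|x]; rewrite !in_cons; last by case/orP => [/eqP->//|/h2].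
case/orP => [/eqP->|xs]; case/orP => [/eqP->|ys]; rewrite ?adj_refl //.
- by rewrite adj_sym h.
- exact: h.
- exact: h1.
Qed.

(** A vertex [v] of maximal [mu] is dominated by [nxt v], so [move_vertex] replaces it in the cycle
    at the cost of a boundary within the complex. The sum of [2 ^ mu x] over the vertices other than
    [b] decreases; once only [b] is left, the cone over [b] fills the cycle. *)
Lemma dismantle c : chain clique_in c -> (forall s, bd c s = 0) ->
  exists2 e, chain clique_in e & forall s, bd e s = c s.
Proof.
have main n : forall c (l : seq V), chain clique_in c -> (forall s, bd c s = 0) ->
    (forall s, c s != 0 -> {subset s <= l}) -> (forall x, x \in l -> B x) ->
    (\sum_(x <- l | x != b) 2 ^ mu x < n)%N -> exists2 e, chain clique_in e & forall s, bd e s = c s.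
  elim: n => [//|n IH] {}c l cc b0 sl Bl ln; have [fc ac pc] := cc.
  case: (boolP (all (pred1 b) l)) => [/allP lb|/allPn[x0 x0l /= x0b]].
    exists (wedge b c) => [|s]; last first.
      by rewrite bd_wedge // [wedge b (bd c) s]wedge0 ?subr0.
    split; [exact: fin_wedge|exact: alt_wedge|move=> s /wedge_supp[t [p ct]]].
    apply: (clique_in_perm (s := b :: t)); first by rewrite perm_sym.
    apply: clique_in_cons => //; first exact: pc.
    by move=> w wt; have /lb/= /eqP-> := sl _ ct _ wt; exact: adj_refl.
  have [v vin vmax] := argmax_seq mu x0 [seq x <- l | x != b].
  have [vl vb] : v \in l /\ v != b.
    move: vin; rewrite in_cons mem_filter => /orP[/eqP->|/andP[]] //.
  have vM w : w \in l -> (mu w <= mu v)%N.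
    by move=> wl; case: (eqVneq w b) => [->//|wb]; apply: vmax; rewrite in_cons mem_filter wb wl orbT.
  have [Bv' lt' adj'] := nxtP (Bl v vl) vb; set v' := nxt v in Bv' lt' adj'.
  have vv' : v != v' by apply: contraTneq lt' => <-; rewrite ltnn.
  have clq t : c (v :: t) != 0 -> clique_in (v' :: v :: t).
    move=> ct; have ht := pc _ ct; apply: clique_in_cons => // w wt; apply: adj'.
    - exact: ht.2.
    - by apply: ht.1; rewrite ?mem_head.
    - exact/vM/(sl _ ct).
  pose E := wedge v' (wedge v (ctr v c)).
  have cE : chain clique_in E.
    split; [exact/fin_wedge/fin_wedge/fin_ctr|exact/alt_wedge/alt_wedge/alt_ctr|].
    move=> s /wedge_supp[t [p /wedge_supp[r [q cr]]]]; apply: clique_in_perm (clq r cr).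
    by rewrite perm_sym; apply: perm_trans p _; rewrite perm_cons.
  have cc1 : chain clique_in (move_vertex v v' c).
    apply: (chainB cc); split.
    - by apply: fin_bd; case: cE.
    - by apply: alt_bd; case: cE.
    - move=> s /bd_supp[w /(let: And3 _ _ h := cE in h)[h1 h2]].
      by split=> [x y xs ys|x xs]; [apply: h1|apply: h2]; rewrite in_cons ?xs ?ys orbT.
  have [e1 ce1 be1] : exists2 e, chain clique_in e & forall s, bd e s = move_vertex v v' c s.
    apply: (IH _ (v' :: [seq x <- l | x != v])) => //.
    - move=> s; rewrite /move_vertex (bdB s fc); last by apply: fin_bd; case: cE.
      by rewrite b0 bd_bd ?subr0; case: cE.
    - move=> s /(move_vertex_supp vv' fc ac b0)[vs h] x xs.
      have xv : x != v by apply: contraNneq vs => <-.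
      rewrite in_cons mem_filter xv /=; case: h => [cs|[t [p ct]]]; first by rewrite (sl _ cs _ xs) orbT.
      move: xs; rewrite (perm_mem p) in_cons => /orP[->//|xt].
      by rewrite (sl _ ct) ?orbT // in_cons xt orbT.
    - by move=> x; rewrite in_cons mem_filter => /orP[/eqP->//|/andP[_ /Bl]].
    - rewrite ltnS in ln; apply: leq_trans ln; rewrite [X in (_ < X)%N](bigID (pred1 v)) /=.
      rewrite big_cons big_filter_cond (eq_bigl (fun i => (i != b) && (i != v))); last first.
        by move=> x; rewrite andbC.
      have lo : (2 ^ mu v <= \sum_(x <- l | (x != b) && (x == v)) 2 ^ mu x)%N.
        by rewrite (big_rem v vl) /= vb eqxx leq_addr.
      apply: leq_trans (leq_add lo (leqnn _)); apply: (@leq_ltn_trans (2 ^ mu v' + \sum_(x <- l | (x != b) && (x != v)) 2 ^ mu x)%N).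
        by case: ifP => _ //; exact: leq_addl.
      by rewrite ltn_add2r ltn_exp2l.
  exists (fun s => e1 s + E s); first exact: chainD.
  move=> s; have [fe1 _ _] := ce1; have [fE _ _] := cE.
  by rewrite bdD // be1 subrK.
move=> cc b0; have [[k kP] _ pc] := cc.
pose l := [seq x <- flatten k | `[< B x >] ].
apply: (main _ c l cc b0 _ _ (ltnSn _)) => [s cs x xs|x]; last by rewrite mem_filter => /andP[/asboolP].
rewrite mem_filter; apply/andP; split; first by apply/asboolP; exact: (pc _ cs).2.
by apply/flattenP; exists s => //; exact: kP.
Qed.

End Dismantling.

End Chains.

(** * The prism homotopy *)

Section Homotopy.
Context (V W : choiceType) (A : zmodType) (f g : V -> W) (rank : V -> nat).
Hypothesis rank_inj : injective rank.
Implicit Types (c : seq V -> A).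

Definition below n : V -> W := fun x => if (rank x < n)%N then g x else f x.

Definition hom_term v c : seq W -> A :=
  wedge (f v) (wedge (g v) (push (below (rank v)) (ctr v c))).

(* The prism homotopy from f to g: vertices are moved one at a time, in the order of their ranks. *)
Definition hom c : seq W -> A := fun t => fsum (fun v => hom_term v c t).

Lemma hom_term_supp v c t : hom_term v c t != 0 ->
  exists s, c (v :: s) != 0 /\ perm_eq t (f v :: g v :: map (below (rank v)) s).
Proof.
case/wedge_supp => t1 [p1 /wedge_supp[t2 [p2 /push_supp[s [es cs]]]]].
exists s; split=> //; apply: perm_trans p1 _; rewrite perm_cons es; exact: p2.
Qed.

Lemma hom_supp c t : hom c t != 0 ->
  exists v s, c (v :: s) != 0 /\ perm_eq t (f v :: g v :: map (below (rank v)) s).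
Proof. by case/fsum_neq0 => v /hom_term_supp[s h]; exists v, s. Qed.

Lemma fin_hom_term v c : fin c -> fin (hom_term v c).
Proof. by move=> fc; exact/fin_wedge/fin_wedge/fin_push/fin_ctr. Qed.

Lemma hom_heads c : fin c -> exists l : seq V, forall v t, hom_term v c t != 0 -> v \in l.
Proof. by move=> /fin_heads[l h]; exists l => v t /hom_term_supp[s [/h]]. Qed.

Lemma fin_hom c : fin c -> fin (hom c).
Proof. by move=> fc; apply: fin_fsum (hom_heads fc) => v; exact: fin_hom_term. Qed.

Lemma alt_hom c : fin c -> alternating c -> alternating (hom c).
Proof.
move=> fc ac; apply: alt_fsum (hom_heads fc) => v.
exact/alt_wedge/alt_wedge/(alt_push _ (fin_ctr v fc))/alt_ctr.
Qed.

(** The maps [below (rank v)] and [below (rank v).+1] differ only at [v], so words without [v]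
    cancel, and the two outer factors of [hom_term] exchange [f v] for [g v]. *)
Lemma hom_step v c t : fin c -> alternating c -> bd (hom_term v c) t + hom_term v (bd c) t =
  push (below (rank v).+1) c t - push (below (rank v)) c t.
Proof.
move=> fc ac; set y := push (below (rank v)) (ctr v c).
have fi := fin_ctr v fc; have ai := alt_ctr v ac.
have fy : fin y by exact: fin_push.
have b1 : bd (hom_term v c) t = wedge (g v) y t - wedge (f v) y t + wedge (f v) (wedge (g v) (bd y)) t.
  rewrite bd_wedge; last exact: fin_wedge.
  have -> : bd (wedge (g v) y) = fun s => y s - wedge (g v) (bd y) s.
    by apply: funext => s; rewrite bd_wedge.
  by rewrite wedgeB opprB addrA addrAC.
have b2 : hom_term v (bd c) t = - wedge (f v) (wedge (g v) (bd y)) t.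
  rewrite -wedgeN; congr (wedge _ _ t); apply: funext => s; rewrite -wedgeN; congr (wedge _ _ s).
  apply: funext => r; rewrite bd_push // -pushN; last exact: fin_bd.
  by congr (push _ _ r); apply: funext => q; exact: ctr_bd.
rewrite b1 b2 addrK.
have part h : push h c t = wedge (h v) (push h (ctr v c)) t +
    push h (fun s => c s - wedge v (ctr v c) s) t.
  have fw := fin_wedge v fi; rewrite -(push_wedge h v t fi) -(pushD h t fw (finD fc (finN fw))).
  by congr (push _ _ t); apply: funext => s; rewrite addrC subrK.
have eqb x : x != v -> below (rank v).+1 x = below (rank v) x.
  move=> xv; rewrite /below ltnS leq_eqVlt; case: eqP => [/rank_inj e|//].
  by rewrite e eqxx in xv.
have -> : push (below (rank v).+1) c t = wedge (below (rank v).+1 v) (push (below (rank v).+1) (ctr v c)) t +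
    push (below (rank v)) (fun s => c s - wedge v (ctr v c) s) t.
  rewrite part; congr (_ + _); apply: push_ext => s /(off_vertex ac) vs x xs; apply: eqb.
  by apply: contraNneq vs => <-.
rewrite [push (below (rank v)) c t]part opprD addrACA subrr addr0.
have -> : push (below (rank v).+1) (ctr v c) = y.
  apply: funext => s; apply: push_ext => r cr x xr; apply: eqb.
  have := alt_uniq ac cr; rewrite cons_uniq => /andP[vr _]; by apply: contraNneq vr => <-.
by rewrite /below ltnSn ltnn.
Qed.

(** A telescoping sum over the ranks. Only finitely many vertices occur in [c]; on these [below 0]
    is [f] and [below N] is [g]. *)
Lemma homP c t : fin c -> alternating c -> bd (hom c) t + hom (bd c) t = push g c t - push f c t.
Proof.
move=> fc ac; pose D n := push (below n.+1) c t - push (below n) c t.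
have [l0 h0] := fc; pose l := flatten l0; have fb := fin_bd fc.
have lP s x : c s != 0 -> x \in s -> x \in l.
  by move=> /h0 sl xs; apply/flattenP; exists s.
have [l1 h1] := hom_heads fc; have [l2 h2] := hom_heads fb.
have e1 : bd (hom c) t = fsum (fun v => bd (hom_term v c) t).
  rewrite /bd /hom; apply: fsum_exchange.
  have [k [m km]] := fin_family (fun v => fin_hom_term v fc) (hom_heads fc).
  by exists (flatten m), k => w v /km[vk wm]; split=> //; apply/flattenP; exists (w :: t); rewrite ?mem_head.
rewrite e1 /hom -fsumD; last 2 first.
- by exists l1 => v /bd_supp[w /h1].
- by exists l2 => v /h2.
rewrite (fsum_eq (g := fun v => D (rank v))); last by move=> v; exact: hom_step.
have D0 n : D n != 0 -> n \in [seq rank v | v <- l].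
  apply: contraNT => nl; rewrite subr_eq0; apply/eqP/push_ext => s cs x xs; rewrite /below ltnS leq_eqVlt.
  case: eqP => [e|//]; case/mapP: nl; exists x => //; exact: lP cs xs.
pose N := (\max_(v <- l) rank v).+1.
have lN v : v \in l -> (rank v < N)%N by move=> vl; rewrite ltnS; exact: leq_bigmax_seq.
have -> : fsum (fun v => D (rank v)) = fsum D.
  rewrite (fsumE D0) undup_map_inj // big_map; apply: fsumE => v /D0/mapP[w wl /rank_inj->//].
rewrite (fsumE (l := iota 0 N)); last first.
  by move=> n /D0/mapP[v /lN vN ->]; rewrite mem_iota.
rewrite undup_id ?iota_uniq // -{1}[N]subn0 -/(index_iota 0 N) telescope_sumr //.
congr (_ - _); apply: push_ext => s cs x xs; rewrite /below //.
by rewrite lN // (lP _ _ cs xs).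
Qed.

End Homotopy.

Local Close Scope ring_scope.

(** * Acyclicity of Rips complexes and of horoballs *)

Section Acyclicity.
Context (G : groupType) (S : seq G) (H : groupClosed G) (A : zmodType).
Hypothesis gS : generating_set S.
Notation wd := (word_dist S).
Notation co := (coset_of H).
Context (rho : G * nat -> G * nat -> nat) (delta : nat).
Hypothesis rhoP : graph_metric (cusp_adj S H) (fun _ _ => 1) rho.
Hypothesis rho_hyp : forall x y z o,
  rho x z + rho y o <= maxn (rho x y + rho z o) (rho y z + rho x o) + delta.
Notation V := (G * nat)%type.
Implicit Types (u v w : V) (c : seq V -> A).

Definition close D : rel V := fun u v => rho u v <= D.

Let rr := rho_refl rhoP.
Let rs := rho_sym gS rhoP.

Lemma close_refl D : reflexive (close D).
Proof. by move=> u; rewrite /close rr. Qed.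

Lemma close_sym D : symmetric (close D).
Proof. by move=> u v; rewrite /close rs. Qed.

(** Rips' argument: a vertex moves by [D./2] along a geodesic towards [b], or to [b] itself if this
    is within [D]. By the four-point inequality it stays within [D] of all neighbours that are not
    farther from [b]. *)
Lemma rips_acyclic D c : 2 * delta + 2 <= D -> chain (clique_in (close D) (fun _ => True)) c ->
  (forall s, bd c s = 0%R) ->
  exists2 e, chain (clique_in (close D) (fun _ => True)) e & forall s, bd e s = c s.
Proof.
move=> hD; pose b : V := (1%g, 0); pose mu v := rho v b.
have ex v : exists v', v != b -> mu v' < mu v /\
    forall w, rho v w <= D -> mu w <= mu v -> rho w v' <= D.
  case: (leqP (mu v) D) => vD.
    exists b => vb; rewrite /mu rr lt0n; split; last by move=> w _ /leq_trans; apply.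
    by apply: contra vb => /eqP/(rho_eq0 rhoP)->.
  have le : D./2 <= mu v by apply: leq_trans (ltnW vD); rewrite -divn2; exact: leq_div.
  have [z e1 e2] : exists2 z, rho v z + rho z b = mu v & D./2 <= rho v z <= D./2 + 0.
    by apply: (mid_point (wt := fun _ _ => 1) _ rhoP le).
  exists z => _; rewrite addn0 -eqn_leq in e2; rewrite -(eqP e2) in e1; have e3 := half_bit_double.
  have D2 : D./2.*2 <= D <= (D./2.*2).+1.
    by rewrite -{2 3}(odd_double_half D); case: (odd D); rewrite ?leqnn ?leqnSn.
  split; first by move: e1 D2 hD; rewrite /mu; move: (rho v b) (rho z b); clear; lia.
  move=> w vw ww; have := rho_hyp w v z b; rewrite -(eqP e2) (rs w v).
  by move: e1 vw ww D2 hD; rewrite /mu; move: (rho v b) (rho z b) (rho w b) (rho v w) (rho w z); clear; lia.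
have [nxt nxtP] := choice ex.
apply: (dismantle (b := b) (mu := mu) (nxt := nxt) (close_refl D) (close_sym D)) => //.
  by move=> v; rewrite /mu rr.
by move=> v _ /nxtP[h1 h2]; split=> // w _; exact: h2.
Qed.

(** Vertices climb until level [K], where all those that matter are one step from the vertical of
    [b]. Points on levels [l] and [m] at distance [r] have verticals adjacent at level
    [3 + (r + l + m)./2]; climbing by 7 = 2 * 3 + 1 absorbs the constant 3 on both verticals and the
    horizontal step. *)
Lemma horoball_acyclic D c (k : left_coset H) : 8 <= D ->
  chain (clique_in (close D) (fun u => co u.1 = k)) c -> (forall s, bd c s = 0%R) ->
  exists2 e, chain (clique_in (close D) (fun u => co u.1 = k)) e & forall s, bd e s = c s.
Proof.
move=> hD cc b0; have [[l lP] _ pc] := cc; set g := repr k; have gk : co g = k by rewrite /coset_of reprK.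
pose K := \max_(u <- flatten l) (u.2 + wd g u.1).
(* Bounded depth lets the distance to the top serve as a decreasing measure; [K + 7] leaves room for
   a climb that starts below [K]. *)
pose B u := [/\ co u.1 = k, wd g u.1 <= 2 ^ K & u.2 <= K + 7].
pose b : V := (g, K); pose mu u := if u == b then 0 else (K + 8 - u.2).+1.
pose nxt u : V := if K <= u.2 then b else (u.1, u.2 + 7).
have Bb : B b by split=> //=; rewrite ?(wd_refl gS) // leq_addr.
have cB : chain (clique_in (close D) B) c.
  have [f a _] := cc; split=> // s cs; have [h1 h2] := pc s cs; split=> // u us.
  have uK : u.2 + wd g u.1 <= K.
    apply: (leq_bigmax_seq (F := fun u => u.2 + wd g u.1)) => //; apply/flattenP.
    by exists s => //; exact: lP.
  split; first exact: h2.
    apply: ltnW; apply: leq_ltn_trans (ltn_expl _ (ltnSn 1)); exact: leq_trans (leq_addl _ _) uK.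
  by apply: leq_trans (leq_trans (leq_addr _ _) uK) _; exact: leq_addr.
have [||e ce be] := @dismantle _ _ (close D) B b mu nxt (close_refl D) (close_sym D) Bb _ _ c cB b0.
- by move=> v; rewrite /mu eqxx.
- move=> [x l0] [/= xk xg l7] vb; rewrite /nxt /mu (negbTE vb) /=.
  have lvl y m : B (y, m) -> (if (y, m) == b then 0 else (K + 8 - m).+1) <= (K + 8 - l0).+1 ->
      (K <= m \/ l0 <= m).
    by move=> [_ _ /= m7]; case: eqP => [[_ ->]|_]; [left | move: l7 m7; clear; lia].
  case: (leqP K l0) => Kl.
    split=> //; first by rewrite eqxx.
    move=> [y m] Bw _ le; have [yk yg m7] := Bw; rewrite /= in yk yg m7.
    have Km : K <= m by case: (lvl y m Bw le) => // h; exact: leq_trans h.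
    have := rho_tri rhoP (y, K) (y, m) b; rewrite /close (rho_vert gS rhoP).
    have : rho (y, K) (g, K) <= 1.
      apply: (rho_horizontal rhoP); first by apply/coset_ofP; rewrite gk.
      by rewrite (wd_sym gS).
    by rewrite -/b; move: (rho _ _) (rho _ _) Km m7 hD; clear; lia.
  split.
  + by split=> //=; move: Kl; clear; lia.
  + by case: ifP => // _; move: Kl => /=; clear; lia.
  + move=> [y m] Bw aw le; have [yk yg m7] := Bw; rewrite /= in yk yg m7.
    have lm : l0 <= m by case: (lvl y m Bw le) => // h; apply: leq_trans (ltnW Kl) h.
    rewrite /close in aw *; have := rho_level gS rhoP (x, l0) (y, m) => /=.
    set r := rho _ _ in aw *; set J := 3 + _ => hJ.
    have xy : same_coset H y x by apply/coset_ofP; rewrite yk.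
    pose T := maxn J (maxn (l0 + 7) m).
    have h1 : rho (y, T) (x, T) <= 1.
      apply: (rho_horizontal rhoP) => //; rewrite (wd_sym gS); apply: leq_trans hJ _.
      by rewrite leq_exp2l // leq_maxl.
    have := rho_tri rhoP (y, T) (y, m) (x, l0 + 7); have := rho_tri rhoP (x, T) (y, T) (x, l0 + 7).
    rewrite !(rho_vert gS rhoP); have := rho_depth rhoP (y, m) (x, l0); rewrite (rs (y, m) (x, l0)) -/r /=.
    move: h1; move: (rho (y, T) (x, T)) (rho (y, T) _) (rho (y, m) _) => i1 i2 i3.
    by rewrite /T /J; move: aw lm hD; clearbody r; clear; lia.
by exists e => //; apply: chain_sub ce => s [h1 h2]; split=> // x /h2[].
Qed.

End Acyclicity.

Local Open Scope ring_scope.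

(** * Extension groups *)

Section Homological.
Context (R : pzRingType) (G : groupType).
Notation gmod := (gmodule R G).

Definition mk_ghom (M N : gmod) (f : M -> N) (lf : linear f) (ef : equivariant f) : ghom M N :=
  @GHom R G M N (HB.pack_for {linear M -> N} f (GRing.isLinear.Build R M N *:%R f lf)) ef.

Lemma gactD (M : gmod) g (x y : M) : gact g (x + y) = gact g x + gact g y.
Proof. by have := gact_linear g 1 x y; rewrite !scale1r. Qed.

Lemma gact0 (M : gmod) g : gact g (0 : M) = 0.
Proof. by apply: (addrI (gact g (0 : M))); rewrite -gactD !addr0. Qed.

Lemma gactZ (M : gmod) g a (x : M) : gact g (a *: x) = a *: gact g x.
Proof. by have := gact_linear g a x 0; rewrite gact0 !addr0. Qed.

Lemma gactN (M : gmod) g (x : M) : gact g (- x) = - gact g x.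
Proof. by apply/eqP; rewrite -addr_eq0 -gactD addNr gact0. Qed.

Section Comp.
Context (M N L : gmod).

Lemma gcomp_linear (f : ghom N L) (g : ghom M N) : linear (fun x => f (g x)).
Proof. by move=> a x y; rewrite !linearP. Qed.

Lemma gcomp_equiv (f : ghom N L) (g : ghom M N) : equivariant (fun x => f (g x)).
Proof. by move=> h x; rewrite !ghom_equivariant. Qed.

Definition gcomp f g : ghom M L := mk_ghom (gcomp_linear f g) (gcomp_equiv f g).

End Comp.

Section Sub.
Context (M N : gmod) (f g : ghom M N).

Lemma gsub_linear : linear (fun x => f x - g x).
Proof. by move=> a x y; rewrite (linearP f) (linearP g) scalerBr opprD addrACA. Qed.

Lemma gsub_equiv : equivariant (fun x => f x - g x).
Proof. by move=> h x; rewrite !ghom_equivariant gactD gactN. Qed.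

Definition gsub : ghom M N := mk_ghom gsub_linear gsub_equiv.

End Sub.

Lemma gid_linear (M : gmod) : linear (@id M). Proof. by []. Qed.
Lemma gid_equiv (M : gmod) : equivariant (@id M). Proof. by []. Qed.
Definition gid (M : gmod) : ghom M M := mk_ghom (@gid_linear M) (@gid_equiv M).

Section Product.
Context (M N : gmod).

Definition prod_act g (x : M * N) : M * N := (gact g x.1, gact g x.2).

Lemma prod_act_linear g : linear (prod_act g).
Proof. by move=> a x y; congr pair; rewrite gactD gactZ. Qed.

Lemma prod_act1 x : prod_act 1%g x = x.
Proof. by case: x => x y; rewrite /prod_act !gact1. Qed.

Lemma prod_actM g h x : prod_act (g * h)%g x = prod_act g (prod_act h x).
Proof. by rewrite /prod_act !gactM. Qed.

Definition gprod : gmod := GModule prod_act_linear prod_act1 prod_actM.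

Lemma gfst_linear : linear (fst : gprod -> M). Proof. by []. Qed.
Lemma gfst_equiv : equivariant (fst : gprod -> M). Proof. by []. Qed.
Definition gfst : ghom gprod M := mk_ghom gfst_linear gfst_equiv.
Lemma gsnd_linear : linear (snd : gprod -> N). Proof. by []. Qed.
Lemma gsnd_equiv : equivariant (snd : gprod -> N). Proof. by []. Qed.
Definition gsnd : ghom gprod N := mk_ghom gsnd_linear gsnd_equiv.

End Product.

Section Submodule.
Context (M : gmod) (P : {pred M}).
Hypothesis P_submod : submod_closed P.
Hypothesis P_act : forall g x, x \in P -> gact g x \in P.

Definition sub_sort (_ : submod_closed P) : Type := {x : M | x \in P}.
Local Notation T := (sub_sort P_submod).

HB.instance Definition _ := GRing.isSubmodClosed.Build R M P
  (GRing.submod_closed_semi P_submod).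
HB.instance Definition _ := Choice.on T.
HB.instance Definition _ := SubChoice.on T.
HB.instance Definition _ := [SubChoice_isSubLmodule of T by <:].

Definition sub_act g (x : T) : T := Sub (gact g (val x)) (P_act g (valP x)).

Lemma sub_act_linear g : linear (sub_act g).
Proof. by move=> a x y; apply: val_inj; rewrite /= gactD gactZ. Qed.

Lemma sub_act1 x : sub_act 1%g x = x.
Proof. by apply: val_inj; rewrite /= gact1. Qed.

Lemma sub_actM g h x : sub_act (g * h)%g x = sub_act g (sub_act h x).
Proof. by apply: val_inj; rewrite /= gactM. Qed.

Definition gsubmod : gmod := GModule sub_act_linear sub_act1 sub_actM.

Definition gsubmod_val (x : gsubmod) : M := val (x : T).

Lemma gsubmod_val_linear : linear gsubmod_val. Proof. by []. Qed.
Lemma gsubmod_val_equiv : equivariant gsubmod_val. Proof. by []. Qed.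
Definition gincl : ghom gsubmod M := mk_ghom gsubmod_val_linear gsubmod_val_equiv.

Lemma gincl_inj : injective gincl. Proof. exact: val_inj. Qed.
Lemma gincl_mem x : gincl x \in P. Proof. exact: (valP (x : T)). Qed.
Definition glift x (Px : x \in P) : gsubmod := Sub x Px : T.

Lemma gcorestrict_linear (L : gmod) (f : ghom L M) (fP : forall x, f x \in P) :
  linear (fun x => glift (fP x)).
Proof. by move=> a x y; apply: gincl_inj; rewrite [RHS]linearP; exact: (linearP f). Qed.

Lemma gcorestrict_equiv (L : gmod) (f : ghom L M) (fP : forall x, f x \in P) :
  equivariant (fun x => glift (fP x)).
Proof. by move=> g x; apply: gincl_inj; rewrite [RHS]ghom_equivariant; exact: (ghom_equivariant f). Qed.

Definition gcorestrict (L : gmod) (f : ghom L M) (fP : forall x, f x \in P) : ghom L gsubmod :=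
  mk_ghom (gcorestrict_linear fP) (gcorestrict_equiv fP).

End Submodule.

Section Kernel.
Context (M N : gmod) (f : ghom M N).

Definition ker_pred : {pred M} := [pred x | f x == 0].

Lemma ker_submod : submod_closed ker_pred.
Proof.
split=> [|a x y]; rewrite !inE ?linear0 // => /eqP x0 /eqP y0.
by rewrite linearP x0 y0 scaler0 addr0.
Qed.

Lemma ker_act g x : x \in ker_pred -> gact g x \in ker_pred.
Proof. by rewrite !inE ghom_equivariant => /eqP->; rewrite gact0. Qed.

End Kernel.

(** Projectivity only speaks of surjections. The pull-back of [g] along [h] surjects onto [P], and a
    section of it gives the lift. *)
Lemma projective_lift (P Q Q' : gmod) (g : ghom Q Q') (h : ghom P Q') : projective P ->
  (forall x, exists y, g y = h x) -> exists l : ghom P Q, forall x, g (l x) = h x.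
Proof.
move=> pP gh; pose u : ghom (gprod P Q) Q' := gsub (gcomp h (gfst P Q)) (gcomp g (gsnd P Q)).
pose k : ghom (gsubmod (ker_submod u) (ker_act (f := u))) P := gcomp (gfst P Q) (gincl _ _).
have [|s sP] := pP _ _ k (gid P).
  move=> x; have [y yx] := gh x.
  have xy : ((x, y) : gprod P Q) \in ker_pred u by rewrite inE /= yx subrr.
  by exists (glift (ker_submod u) (ker_act (f := u)) xy).
exists (gcomp (gsnd P Q) (gcomp (gincl _ _) s)) => x.
have := gincl_mem (s x); rewrite inE => /eqP/subr0_eq/esym e.
by apply: etrans e _; congr (h _); exact: sP.
Qed.

Section Comparison.
Context (A : gmod).
Notation resol := (projective_resolution A).
Implicit Types P Q : resol.

(** The component in degree [n] of a chain map over the identity of [A]. The lower components are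
    existential, so that chain maps can be built and compared one degree at a time. *)
Fixpoint chain_at P Q n : ghom (res P n) (res Q n) -> Prop :=
  match n with
  | 0%N => fun f => forall x, res_aug Q (f x) = res_aug P x
  | n'.+1 => fun f => exists2 f', chain_at f' & forall x, res_d Q n' (f x) = f' (res_d P n' x)
  end.

Lemma res_dd P n x : res_d P n (res_d P n.+1 x) = 0.
Proof. by apply/res_exact; exists x. Qed.

Lemma res_aug_d P x : res_aug P (res_d P 0 x) = 0.
Proof. by apply/res_exact0; exists x. Qed.

Lemma chain_next P Q n f : @chain_at P Q n f ->
  exists f' : ghom (res P n.+1) (res Q n.+1), forall x, res_d Q n (f' x) = f (res_d P n x).
Proof.
move=> cf; apply: (projective_lift (h := gcomp f (res_d P n))); first exact: res_projective.
move=> x /=; case: n f cf x => [|n] f cf x; first by apply/res_exact0; rewrite cf res_aug_d.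
by case: cf => f' _ cf; apply/res_exact; rewrite cf res_dd linear0.
Qed.

Lemma chain_exists P Q n : exists f, @chain_at P Q n f.
Proof.
elim: n => [|n [f cf]]; last by have [f' h] := chain_next cf; exists f'; exists f.
apply: (projective_lift (h := res_aug P)); first exact: res_projective.
by move=> x; exact: res_aug_surj.
Qed.

Lemma chain_comp P Q Q' n (f : ghom (res Q n) (res Q' n)) (g : ghom (res P n) (res Q n)) :
  chain_at f -> chain_at g -> chain_at (gcomp f g).
Proof.
elim: n f g => [|n IH] f g /=; first by move=> cf cg x; rewrite cf cg.
move=> [f' cf df] [g' cg dg]; exists (gcomp f' g'); first exact: IH.
by move=> x /=; rewrite df dg.
Qed.

Definition homotopic_id Q n : ghom (res Q n) (res Q n) -> ghom (res Q n) (res Q n.+1) -> Prop :=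
  match n with
  | 0%N => fun u k => forall x, res_d Q 0 (k x) = u x - x
  | n'.+1 => fun u k => exists k' : ghom (res Q n') (res Q n'.+1), forall x, res_d Q n'.+1 (k x) = u x - x - k' (res_d Q n' x)
  end.

Lemma chain_homotopic Q n u : @chain_at Q Q n u -> exists k, @homotopic_id Q n u k.
Proof.
elim: n u => [|n IH] u /=.
  move=> cu; apply: (projective_lift (h := gsub u (gid _))); first exact: res_projective.
  by move=> x; apply/res_exact0; rewrite /= linearB cu subrr.
case=> u' cu du; have [k hk] := IH u' cu.
have [|l hl] := @projective_lift _ _ _ (res_d Q n.+1) (gsub (gsub u (gid _)) (gcomp k (res_d Q n)))
  (@res_projective _ _ _ Q n.+1); last by exists l, k.
move=> x; apply/res_exact; rewrite /= !linearB du.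
case: n IH u u' cu du k hk x => [|n] IH u u' cu du k hk x; first by rewrite hk subrr.
by case: hk => k' hk; rewrite hk res_dd linear0 subr0 subrr.
Qed.

Lemma coboundary_chain P Q M n (f : ghom (res P n) (res Q n)) (phi : ghom (res Q n) M) :
  chain_at f -> coboundary phi -> coboundary (gcomp phi f).
Proof.
case: n f phi => [|n] f phi /=; first by move=> _ h x; exact: h.
move=> [f' _ df] [psi h]; exists (gcomp psi f') => x /=.
by rewrite h df.
Qed.

(** A comparison map back to [P], followed by [f], is homotopic to the identity; on a cocycle the
    homotopy contributes a coboundary. *)
Lemma chain_injective P Q M n (f : ghom (res P n) (res Q n)) (phi : ghom (res Q n) M) :
  chain_at f -> cocycle phi -> coboundary (gcomp phi f) -> coboundary phi.
Proof.
move=> cf co cb; have [g cg] := chain_exists Q P n.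
have [k hk] := chain_homotopic (chain_comp cf cg).
have := coboundary_chain cg cb; case: n f phi cf co {cb} g cg k hk => [|n] f phi cf co g cg k /=.
  by move=> hk h x; have := co (k x); rewrite hk linearB /= h sub0r => /eqP; rewrite oppr_eq0 => /eqP.
move=> [k' hk] [psi h]; exists (gsub psi (gcomp phi k')) => x /=; have := co (k x).
by rewrite hk !linearB /= h => /eqP; rewrite subr_eq0 subr_eq => /eqP->; rewrite addrAC subrr add0r.
Qed.

Lemma cocycle_chain P Q M n (f : ghom (res P n) (res Q n)) (phi : ghom (res Q n) M) :
  chain_at f -> cocycle phi -> cocycle (gcomp phi f).
Proof. by move=> /chain_next[f' h] co x /=; rewrite -h co. Qed.

Lemma Ext_resolution Q M n : Ext_neq0 n A M ->
  exists f : ghom (res Q n) M, cocycle f /\ ~ coboundary f.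
Proof.
move=> [P [phi [co ncb]]]; have [f cf] := chain_exists Q P n.
exists (gcomp phi f); split; first exact: cocycle_chain.
by move=> cb; apply: ncb; exact: chain_injective cf co cb.
Qed.

End Comparison.

Section TensorUnique.
Context (B : gmodule int G) (D D' : gmod) (i : B -> D) (i' : B -> D').
Hypothesis (ti : is_tensor i) (ti' : is_tensor i').

Lemma tensor_iso : exists (F : ghom D D') (F' : ghom D' D), cancel F F' /\ cancel F' F.
Proof.
have [a e u] := ti; have [a' e' u'] := ti'.
have [F [FP _]] := u _ _ a' e'; have [F' [FP' _]] := u' _ _ a e; exists F, F'; split=> x.
- have [I [_ I1]] := u _ _ a e.
  have e1 : gcomp F' F x = I x by apply: I1 => y /=; rewrite FP FP'.
  by rewrite -[LHS]/(gcomp F' F x) e1 -(I1 (gid D)).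
- have [I [_ I1]] := u' _ _ a' e'.
  have e1 : gcomp F F' x = I x by apply: I1 => y /=; rewrite FP' FP.
  by rewrite -[LHS]/(gcomp F F' x) e1 -(I1 (gid D')).
Qed.

Lemma Ext_tensor n M : Ext_neq0 n D M -> Ext_neq0 n D' M.
Proof.
have [F [F' [K K']]] := tensor_iso; case=> P [phi [co ncb]].
have sj : surjection (gcomp F (res_aug P)).
  by move=> y; have [x hx] := res_aug_surj P (F' y); exists x; rewrite /= hx K'.
have ex x : gcomp F (res_aug P) x = 0 <-> exists y, res_d P 0 y = x.
  rewrite -res_exact0 /=; split=> [h|->]; last by rewrite linear0.
  by rewrite -[LHS]K h linear0.
by exists (ProjectiveResolution (@res_projective _ _ _ P) sj ex (@res_exact _ _ _ P)), phi.
Qed.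

End TensorUnique.

(** * Coefficients in finitely supported functions *)

Section FiniteSupportCoefficients.
Context (M : gmod).

(** Only the argument is translated, so the module depends on the [R]-module [M] alone; the action
    on [M] enters through [fs_eval]. *)
Definition fun_act g (f : G -> M) : G -> M := fun h => f (g^-1 * h)%g.

Lemma fun_act_linear g : linear (fun_act g). Proof. by []. Qed.
Lemma fun_act1 f : fun_act 1%g f = f.
Proof. by apply: funext => h; rewrite /fun_act invg1 mul1g. Qed.
Lemma fun_actM g h f : fun_act (g * h)%g f = fun_act g (fun_act h f).
Proof. by apply: funext => x; rewrite /fun_act invgM mulgA. Qed.

Definition gfun : gmod := GModule fun_act_linear fun_act1 fun_actM.

Definition fs_pred : {pred gfun} := [pred f | `[< fin (f : G -> M) >] ].

Lemma fs_predP (f : gfun) : reflect (fin (f : G -> M)) (f \in fs_pred).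
Proof. exact: asboolP. Qed.

Lemma fs_submod : submod_closed fs_pred.
Proof.
split=> [|a f g].
  by apply/fs_predP; exists [::] => x; rewrite -[X in X != _]/(0 : M) eqxx.
move=> /fs_predP ff /fs_predP fg; apply/fs_predP; apply: finD fg.
by apply: fin_sub ff _ => x; apply: contraNN => /eqP e; rewrite /= -[X in X == _]/(a *: f x) e scaler0.
Qed.

Lemma fs_act g f : f \in fs_pred -> gact g f \in fs_pred.
Proof.
move=> /fs_predP[l h]; apply/fs_predP; exists [seq (g * x)%g | x <- l] => x gx.
by apply/mapP; exists (g^-1 * x)%g; rewrite ?mulVKg //; exact: h gx.
Qed.

(* The RG-module induced from the R-module M. *)
Definition fsmod : gmod := gsubmod fs_submod fs_act.

Definition fsval (f : fsmod) : G -> M := gincl fs_submod fs_act f.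

Lemma fsval_fin f : fin (fsval f).
Proof. exact/fs_predP/gincl_mem. Qed.

Definition fs_sum (f : fsmod) : M := fsum (fun h => gact h (fsval f h)).

Lemma fin_fs_term (f : fsmod) : fin (fun h => gact h (fsval f h)).
Proof. by apply: fin_sub (fsval_fin f) _ => h; apply: contraNN => /eqP->; rewrite gact0. Qed.

Lemma fs_sum_linear : linear fs_sum.
Proof.
move=> a f g; rewrite /fs_sum.
have -> : a *: fsum (fun h => gact h (fsval f h)) = fsum (fun h => a *: gact h (fsval f h)).
  apply: (fsum_linear (h := fun x => a *: x) (fin_fs_term f)); first exact: scaler0.
  by move=> x y; rewrite scalerDr.
rewrite -fsumD; last 2 first.
- by apply: fin_sub (fin_fs_term f) _ => h; apply: contraNN => /eqP->; rewrite scaler0.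
- exact: fin_fs_term.
by apply: fsum_eq => h; rewrite -gactZ -gactD.
Qed.

Lemma fs_sum_equiv : equivariant fs_sum.
Proof.
move=> g f; rewrite /fs_sum (fsum_linear (h := gact g)) ?gact0 //; last 2 first.
- exact: fin_fs_term.
- by move=> x y; rewrite gactD.
rewrite (fsum_bij (g := fun h => (g * h)%g) (mulKg g) (mulVKg g)); last exact: fin_fs_term.
by apply: fsum_eq => h; rewrite gactM; congr (gact g (gact h _)); rewrite -[LHS]/(fsval f _) mulKg.
Qed.

Definition fs_eval : ghom fsmod M := mk_ghom fs_sum_linear fs_sum_equiv.

Lemma fs_eval_surj : surjection fs_eval.
Proof.
move=> m; pose f : gfun := fun h => if h == 1%g then m else 0.
have ff : f \in fs_pred by apply/fs_predP/(fin_point (a := 1%g)) => h /negbTE; rewrite /f => ->.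
exists (glift fs_submod fs_act ff); rewrite /= /fs_sum (fsum_point (a := 1%g)).
  by rewrite gact1 -[LHS]/(f 1%g) /f eqxx.
by move=> h h1; rewrite -[fsval _ h]/(f h) /f (negbTE h1) gact0.
Qed.

End FiniteSupportCoefficients.

(* The cokernel of Ext^n(A, F) -> Ext^n(A, M) embeds into Ext^(n+1), for F -> M surjective. *)
Lemma top_finite_support (A : gmod) (Q : projective_resolution A) n M :
  (forall N (f : ghom (res Q n.+1) N), cocycle f -> coboundary f) ->
  (exists f : ghom (res Q n) M, cocycle f /\ ~ coboundary f) ->
  exists f : ghom (res Q n) (fsmod M), cocycle f /\ ~ coboundary f.
Proof.
move=> top [phi [co ncb]]; pose p := fs_eval M.
have [f fP] := (@res_projective _ _ _ Q n) _ _ (fs_eval M) phi (@fs_eval_surj M).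
have kP x : gcomp f (res_d Q n) x \in ker_pred p by rewrite inE /= -[fs_sum _]/(p _) fP co.
pose k := gcorestrict (ker_submod p) (ker_act (f := p)) kP.
have kE x : gincl _ _ (k x) = f (res_d Q n x) by [].
have [|chi chiP] := top _ k.
  by move=> x; apply: gincl_inj; rewrite kE res_dd !linear0.
exists (gsub f (gcomp (gincl _ _) chi)); split.
  by move=> x; rewrite /= -[gsubmod_val _]/(gincl _ _ _) -chiP -[gincl _ _ _]/(f (res_d Q n x)) subrr.
move=> cb; apply: ncb.
have e x : phi x = p (gsub f (gcomp (gincl _ _) chi) x).
  have /eqP h := gincl_mem (chi x).
  transitivity (p (f x) - p (gincl _ _ (chi x))); first by rewrite h subr0 fP.
  exact: esym (linearB p _ _).
case: n phi co f fP kP k kE chi chiP cb e {top} => [|n] phi co f fP kP k kE chi chiP.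
  by move=> cb e x; rewrite e cb linear0.
by case=> psi h e; exists (gcomp p psi) => x; rewrite e h.
Qed.

End Homological.

(** * Resolutions from relative chains *)

Section RelativeChains.
Context (G : groupType) (S : seq G) (H : groupClosed G) (A : zmodType).
Hypothesis gS : generating_set S.
Notation co := (coset_of H).
Context (rho : G * nat -> G * nat -> nat) (delta : nat).
Hypothesis rhoP : graph_metric (cusp_adj S H) (fun _ _ => 1%N) rho.
Hypothesis rho_hyp : forall x y z o,
  (rho x z + rho y o <= maxn (rho x y + rho z o) (rho y z + rho x o) + delta)%N.
Notation V := (G * nat)%type.
Context (D : nat).
Hypothesis D_rips : (2 * delta + 2 <= D)%N.
Hypothesis D_horo : (8 <= D)%N.
Implicit Types (u v w : V) (c e : seq V -> A) (s t : seq V) (k : left_coset H).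

Definition mixed s : bool := has (fun u => has (fun v => co u.1 != co v.1) s) s.

Lemma mixed_perm s t : perm_eq s t -> mixed s = mixed t.
Proof.
move=> p; rewrite /mixed (perm_has _ p); apply: eq_has => u; exact: perm_has.
Qed.

Lemma mixed_cons v s : mixed s -> mixed (v :: s).
Proof.
case/hasP => u us /hasP[w ws uw]; apply/hasP; exists u; first by rewrite in_cons us orbT.
by apply/hasP; exists w => //; rewrite in_cons ws orbT.
Qed.

Definition inco k s : bool := all (fun u => co u.1 == k) s.

Lemma inco_mixed k s : inco k s -> mixed s = false.
Proof.
move=> /allP sk; apply/negP => /hasP[u /sk/eqP-> /hasP[w /sk/eqP-> ]]; by rewrite eqxx.
Qed.

Lemma not_mixed_inco u s : mixed (u :: s) = false -> inco (co u.1) (u :: s).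
Proof.
move=> nm; apply/allP => v vs; apply/negPn/negP => ne; move/negP: nm; apply.
by apply/hasP; exists v => //; apply/hasP; exists u; rewrite ?mem_head.
Qed.

Lemma mixed2 v u : mixed [:: v; u] = (co v.1 != co u.1).
Proof. by rewrite /mixed /= !eqxx /= !orbF [co u.1 == _]eq_sym orbb. Qed.

Definition rst (Q : pred (seq V)) c : seq V -> A := fun s => if Q s then c s else 0.

Lemma fin_rst Q c : fin c -> fin (rst Q c).
Proof. by move=> fc; apply: fin_sub fc _ => s; rewrite /rst; case: ifP => //; rewrite eqxx. Qed.

Lemma alt_rst (Q : pred (seq V)) c : (forall s t, perm_eq s t -> Q s = Q t) -> alternating c -> alternating (rst Q c).
Proof.
move=> Qp [a1 a2]; split=> [s1 x y s2|s1 x s2]; last by rewrite /rst a2 if_same.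
rewrite /rst (Qp _ (s1 ++ y :: x :: s2)); first by case: ifP => _; rewrite ?oppr0.
by rewrite perm_cat2l -[x :: _]/([:: x] ++ [:: y] ++ s2) -[y :: x :: _]/([:: y] ++ [:: x] ++ s2); apply/permPl/perm_catCA.
Qed.

(** The degree is shifted by one: edges between cosets generate the kernel of the augmentation and
    therefore sit in degree 0 of its resolution. *)
Definition relsimp n s : Prop := [/\ size s = n.+2, clique_in (close rho D) (fun _ => True) s & mixed s].

Definition rbd c := rst mixed (bd c).

Lemma rbdE c s : mixed s -> rbd c s = bd c s.
Proof. by rewrite /rbd /rst => ->. Qed.

Lemma clique_behead v s : clique_in (close rho D) (fun _ : V => True) (v :: s) ->
  clique_in (close rho D) (fun _ => True) s.
Proof. by move=> [h _]; split=> // x y xs ys; apply: h; rewrite in_cons ?xs ?ys orbT. Qed.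

Lemma rbd_chain n c : chain (relsimp n.+1) c -> chain (relsimp n) (rbd c).
Proof.
move=> [fc ac pc]; split; [exact/fin_rst/fin_bd| |].
  by apply: alt_rst; [exact: mixed_perm | exact: alt_bd].
move=> s; rewrite /rbd /rst; case: ifP => [ms|]; last by rewrite eqxx.
by case/bd_supp => v /pc[[sz] cl _]; split=> //; exact: clique_behead cl.
Qed.

Lemma rbd_rbd c s : fin c -> alternating c -> rbd (rbd c) s = 0.
Proof.
move=> fc ac; rewrite /rbd {1}/rst; case: ifP => // ms.
rewrite -[RHS](bd_bd s fc ac); apply: fsum_eq => v.
by rewrite /rst mixed_cons.
Qed.

Lemma bd_size n c s : chain (relsimp n) c -> size s != n.+1 -> bd c s = 0.
Proof.
move=> [_ _ pc] sz; apply/eqP/negPn/negP => /bd_supp[v /pc[[e] _ _]].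
by rewrite e eqxx in sz.
Qed.

(** The long exact sequence of the pair by hand. The boundary of [c] is a sum of cycles over single
    cosets, which are filled in the horoballs; [c] minus these fillings is a cycle of the Rips
    complex, and the mixed part of a filling of it is the desired chain. *)
Lemma rel_fill n c : chain (relsimp n) c ->
  (forall k s, bd (rst (inco k) (bd c)) s = 0) -> (forall s, mixed s -> bd c s = 0) ->
  exists2 e, chain (relsimp n.+1) e & forall s, rbd e s = c s.
Proof.
move=> cc b0 bm; have [fc ac pc] := cc; have fb := fin_bd fc; have ab := alt_bd fc ac.
have inc_perm k s t : perm_eq s t -> inco k s = inco k t by move=> p; exact: perm_all.
have ck k : chain (clique_in (close rho D) (fun u => co u.1 = k)) (rst (inco k) (bd c)).
  split; [exact: fin_rst|by apply: alt_rst (inc_perm k) ab|].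
  move=> s; rewrite /rst; case: ifP => [/allP sk|]; last by rewrite eqxx.
  case/bd_supp => v /pc[_ /clique_behead[h _] _]; split=> // x /sk/eqP; exact.
have ex k : exists e, chain (clique_in (close rho D) (fun u => co u.1 = k)) e /\
    forall s, bd e s = rst (inco k) (bd c) s.
  by have [e h1 h2] := horoball_acyclic gS rhoP D_horo (ck k) (b0 k); exists e.
have [a aP] := choice ex.
have sums (ks : seq (left_coset H)) : exists2 e,
    chain (fun s => clique_in (close rho D) (fun _ => True) s /\ mixed s = false) e &
    forall s, bd e s = \sum_(k <- ks) rst (inco k) (bd c) s.
  elim: ks => [|k ks [e ce be]].
    exists (fun _ => 0); last by move=> s; rewrite big_nil bd0.
    by split; [exact: fin0|split=> *; rewrite ?oppr0|move=> s; rewrite eqxx].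
  have [cak bak] := aP k; exists (fun s => a k s + e s).
    apply: chainD ce; apply: chain_sub cak => s [h1 h2]; split=> //; apply: (inco_mixed (k := k)).
    by apply/allP => u /h2/eqP.
  move=> s; have [f1 _ _] := cak; have [f2 _ _] := ce.
  by rewrite bdD // bak be big_cons.
have [l lP] := fb; have [e1 ce1 be1] := sums (undup [seq co (head (1%g, 0%N) s).1 | s <- l]).
have bdE s : bd e1 s = bd c s.
  rewrite be1; case: (eqVneq (bd c s) 0) => [b00|bn0].
    by rewrite b00 big1 // => k _; rewrite /rst b00 if_same.
  have ns : mixed s = false by apply/negP => /bm b00; rewrite b00 eqxx in bn0.
  case: s ns bn0 => [|u s] ns bn0; first by rewrite (bd_size (s := [::]) cc) ?eqxx in bn0.
  have iu := not_mixed_inco ns.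
  rewrite (bigD1_seq (co u.1)) ?undup_uniq //=; last first.
    by rewrite mem_undup; apply/mapP; exists (u :: s) => //; exact: lP.
  rewrite {1}/rst iu big1 ?addr0 // => k ku; rewrite /rst /inco /= eq_sym (negbTE ku) //.
have [f1 a1 p1] := ce1.
have cc' : chain (clique_in (close rho D) (fun _ => True)) (fun s => c s - e1 s).
  by apply: chainB; [apply: chain_sub cc => s [_ h _] | apply: chain_sub ce1 => s []].
have [s|e2 [f2 a2 p2] be2] := rips_acyclic gS rhoP rho_hyp D_rips cc'.
  by rewrite bdB // bdE subrr.
(* The filling may have components in other degrees; they are cut off together with the simplices
   over one coset. *)
exists (rst (fun s => mixed s && (size s == n.+3)) e2).
  split; [exact: fin_rst| |].
    by apply: alt_rst a2 => s t p; rewrite (mixed_perm p) (perm_size p).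
  by move=> s; rewrite /rst; case: ifP => [/andP[ms /eqP sz] /p2|]; last by rewrite eqxx.
move=> s; rewrite /rbd {1}/rst; case: ifP => [ms|nm]; last first.
  by apply/esym/eqP/negPn/negP => /pc[_ _]; rewrite nm.
have e10 : e1 s = 0 by apply/eqP/negPn/negP => /p1[_]; rewrite ms.
rewrite /bd /rst (fsum_eq (g := fun v => if size s == n.+2 then e2 (v :: s) else 0)); last first.
  by move=> v; rewrite mixed_cons //= eqSS.
case: eqP => [_|sz]; first by rewrite -/(bd e2 s) be2 e10 subr0.
by rewrite fsum0 //; apply/esym/eqP/negPn/negP => /pc[].
Qed.

Lemma rel_exact n c : chain (relsimp n.+1) c -> (forall s, rbd c s = 0) ->
  exists2 e, chain (relsimp n.+2) e & forall s, rbd e s = c s.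
Proof.
move=> cc r0; have [fc ac pc] := cc.
have bm s : mixed s -> bd c s = 0 by move=> ms; rewrite -rbdE.
apply: rel_fill => // k s; rewrite /bd /rst /=; case: (boolP (inco k s)) => sk; last first.
  by apply: fsum0 => v; case: ifP => // /andP[_ si]; case/negP: sk.
case: s sk => [|u s] sk.
  by apply: fsum0 => v; rewrite -/(bd c [:: v]) (bd_size cc) // if_same.
rewrite -[RHS](bd_bd (u :: s) fc ac); apply: fsum_eq => v.
case: ifP => // ni; apply/esym/bm; apply/negPn/negP => nm; move/negP: ni; apply.
have := not_mixed_inco (negbTE nm); move: sk => /= /andP[/eqP uk sk] /and3P[_ /eqP e h].
by rewrite /inco /= -e uk eqxx.
Qed.

(** The connecting map: an edge between two cosets goes to the difference of the cosets of its
    ends. *)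
Definition raug c k : A := fsum (fun u => if co u.1 == k then bd c [:: u] else 0).

Lemma raug_fin_term c k : fin c -> fin (fun u => if co u.1 == k then bd c [:: u] else 0).
Proof.
move=> /fin_bd/fin_heads[l h]; exists l => u; case: ifP => _; last by rewrite eqxx.
exact: h.
Qed.

Lemma rel_exact0 c : chain (relsimp 0) c -> (forall k, raug c k = 0) ->
  exists2 e, chain (relsimp 1) e & forall s, rbd e s = c s.
Proof.
move=> cc r0; have [fc ac pc] := cc; apply: rel_fill => //.
  move=> k [|u s]; last first.
    by apply: fsum0 => v; rewrite /rst (bd_size (s := v :: u :: s) cc) ?if_same.
  rewrite -[RHS](r0 k); apply: fsum_eq => v.
  by rewrite /rst /inco /= andbT.
case=> [|u [|v s]] //; first by rewrite /mixed /= eqxx.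
by move=> _; rewrite (bd_size (s := [:: u, v & s]) cc).
Qed.

(* Edges inside one coset contribute nothing to the augmentation. *)
Lemma raug_rst c k : fin c -> alternating c -> raug (rst mixed c) k = raug c k.
Proof.
move=> fc ac; have [l h] := fc.
have hl v u : c [:: v; u] != 0 -> v \in flatten l /\ u \in flatten l.
  by move=> /h sl; split; apply/flattenP; exists [:: v; u]; rewrite // !inE eqxx ?orbT.
have F1 u : fin (fun v => c [:: v; u]) by exact: (fin_at [:: u] fc).
have F2 u : fin (fun v => if mixed [:: v; u] then 0 else c [:: v; u]).
  by apply: fin_sub (F1 u) _ => v; case: ifP => //; rewrite eqxx.
transitivity (fsum (fun u => (if co u.1 == k then bd c [:: u] else 0) -
   (if co u.1 == k then fsum (fun v => if mixed [:: v; u] then 0 else c [:: v; u]) else 0))).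
  apply: fsum_eq => u; case: ifP => _; last by rewrite subr0.
  rewrite -fsumB //; apply: fsum_eq => v; rewrite /rst; case: ifP => _; by rewrite ?subr0 ?subrr.
rewrite fsumB; last 2 first.
- exact: raug_fin_term.
- exists (flatten l) => u; case: ifP => _; last by rewrite eqxx.
  by case/fsum_neq0 => v; case: ifP => _; [rewrite eqxx | case/hl].
rewrite [X in _ - X](_ : _ = 0) ?subr0 //.
pose F u v := if (co u.1 == k) && (co v.1 == k) then c [:: v; u] else 0.
transitivity (fsum (fun u => fsum (F u))).
  apply: fsum_eq => u; rewrite /F; case: (eqVneq (co u.1) k) => [uk|_] /=; last by rewrite fsum0.
  by apply: fsum_eq => v; rewrite mixed2 uk; case: eqP.
apply: fsum_antisym.
- by exists (flatten l) => u v; rewrite /F; case: ifP => _; [case/hl | rewrite eqxx].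
- move=> u v; rewrite /F andbC; case: ifP => _; last by rewrite oppr0.
  exact: (ac.1 [::]).
- by move=> u; rewrite /F; case: ifP => // _; exact: (ac.2 [::]).
Qed.

Lemma raug_rbd c k : fin c -> alternating c -> raug (rbd c) k = 0.
Proof.
move=> fc ac; rewrite raug_rst; [|exact: fin_bd|exact: alt_bd].
by apply: fsum0 => u; rewrite bd_bd ?if_same.
Qed.

Lemma raug_fin c : fin c -> fin (raug c).
Proof.
move=> fc; have [l h] := fin_heads (fin_bd fc); exists [seq co u.1 | u <- l] => k /fsum_neq0[u].
by case: (eqVneq (co u.1) k) => [<- /h ul|_]; [exact: map_f | rewrite eqxx].
Qed.

Lemma raug_sum c : fin c -> alternating c -> fsum (raug c) = 0.
Proof.
move=> fc ac; have [l h] := fin_heads (fin_bd fc).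
rewrite /raug fsum_exchange; last first.
  exists [seq co u.1 | u <- l], l => k u.
  by case: (eqVneq (co u.1) k) => [<- /h ul|_]; [split=> //; exact: (map_f (fun u => co u.1)) | rewrite eqxx].
rewrite -[RHS](bd_bd [::] fc ac); apply: fsum_eq => u.
by rewrite (fsum_point (a := co u.1)) ?eqxx // => k; rewrite eq_sym => /negbTE->.
Qed.

(** Put [d] on one point of level 0 in each coset. As the sum vanishes this is a cycle of the
    augmented complex, and the edges of a filling that join different cosets are a preimage. *)
Lemma raug_surj (d : left_coset H -> A) : fin d -> fsum d = 0 ->
  exists2 c, chain (relsimp 0) c & forall k, raug c k = d k.
Proof.
move=> [l h] d0; pose pt k : V := (repr k, 0%N).
have ptK k : co (pt k).1 = k by rewrite /coset_of reprK.
pose b : seq V -> A := fun s => if s is [:: u] then if u == pt (co u.1) then d (co u.1) else 0 else 0.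
have fb : fin b.
  exists [seq [:: pt k] | k <- l] => -[|u [|v s]]; rewrite /b ?eqxx //.
  case: (eqVneq u (pt (co u.1))) => [e /h ul|_]; last by rewrite eqxx.
  by apply/mapP; exists (co u.1); rewrite -?e.
have ab : alternating b by split=> [[|z [|z' s1]] x y s2|[|z [|z' s1]] x s2] /=; rewrite ?oppr0.
have bk k : fsum (fun u => if co u.1 == k then b [:: u] else 0) = d k.
  rewrite (fsum_point (a := pt k)); first by rewrite /= ptK !eqxx.
  move=> u; rewrite /b.
  by case: (eqVneq (co u.1) k) => [->|//] /negbTE->.
have b0 s : bd b s = 0.
  case: s => [|u s]; last exact: fsum0.
  rewrite -[RHS]d0 /bd -(fsum_eq bk) fsum_exchange.
    apply: fsum_eq => u; rewrite (fsum_point (a := co u.1)) ?eqxx // => k.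
    by rewrite eq_sym => /negbTE->.
  have [m hm] := fin_heads fb; exists [seq co u.1 | u <- m], m => k u.
  by case: (eqVneq (co u.1) k) => [<- /hm um|_]; [split=> //; exact: (map_f (fun u => co u.1)) | rewrite eqxx].
have cb : chain (clique_in (close rho D) (fun _ => True)) b.
  split=> // -[|u [|v s]]; rewrite ?eqxx // => _; split=> // x y.
  by rewrite !inE => /eqP-> /eqP->; exact: (close_refl rhoP).
have [e [fe ae pe] be] := rips_acyclic gS rhoP rho_hyp D_rips cb b0.
pose Q s := mixed s && (size s == 2%N).
have fr : fin (rst Q e) by exact: fin_rst.
exists (rst Q e).
  split=> //; first by apply: alt_rst ae => s t p; rewrite /Q (mixed_perm p) (perm_size p).
  by move=> s; rewrite /rst; case: ifP => [/andP[ms /eqP sz] /pe|]; last by rewrite eqxx.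
move=> k; transitivity (raug (rst mixed e) k).
  apply: fsum_eq => u; case: ifP => // _; apply: fsum_eq => v.
  by rewrite /rst /Q andbT.
rewrite raug_rst // -bk; apply: fsum_eq => u; case: ifP => // _; exact: be.
Qed.

(** Every vertex of a mixed simplex is within [D] of a vertex over another coset, so its depth is at
    most [D]. Bounded distance and depth leave finitely many vertices up to translation. *)
Lemma relsimp_letters : exists l : seq V, forall n s u v, relsimp n s -> u \in s -> v \in s ->
  ((u.1^-1 * v.1)%g, v.2) \in l.
Proof.
have [m mP] := wd_ball gS (2 ^ (3 + (D + D + D)./2)).
exists [seq (x, i) | x <- m, i <- iota 0 D.+1] => n s u v [_ [cl _] ms] us vs.
have depth w : w \in s -> (w.2 <= D)%N.
  move=> ws; case/hasP: ms => a as_ /hasP[a' a's ne].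
  have [t ts ne'] : exists2 t, t \in s & co w.1 != co t.1.
    case: (eqVneq (co w.1) (co a.1)) => [e|]; last by exists a.
    by exists a' => //; rewrite e.
  have := rho_coset gS rhoP ne'; have := cl _ _ ws ts; rewrite /close => h1 h2.
  by apply: leq_trans h1; apply: leq_trans (ltnW h2); exact: leq_addr.
apply/allpairsP; exists ((u.1^-1 * v.1)%g, v.2); split=> //; last by rewrite mem_iota add0n ltnS; exact: depth vs.
apply: mP; apply: leq_trans (rho_level gS rhoP u v) _; rewrite leq_exp2l // leq_add2l half_leq //.
by rewrite !leq_add ?depth //; exact: cl.
Qed.

Lemma relsimp_bounded : exists N, forall n s, relsimp n s -> uniq s -> (n < N)%N.
Proof.
have [l lP] := relsimp_letters; exists (size l) => n s rs us.
have [sz _ _] := rs; case: s rs us sz => // u s rs us sz.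
pose f v : V := ((u.1^-1 * v.1)%g, v.2).
have fi : injective f by move=> [x i] [y j] [/mulgI-> ->].
have : (size (map f (u :: s)) <= size l)%N.
  apply: uniq_leq_size; first by rewrite map_inj_uniq.
  by move=> _ /mapP[v vs ->]; apply: lP rs _ vs; exact: mem_head.
by rewrite size_map sz => /ltnW.
Qed.

End RelativeChains.

(** * Relative chains as modules over the group ring *)

Section ChainModules.
Context (R : pzRingType) (G : groupType) (S : seq G) (H : groupClosed G).
Hypothesis gS : generating_set S.
Notation co := (coset_of H).
Context (rho : G * nat -> G * nat -> nat) (delta : nat).
Hypothesis rhoP : graph_metric (cusp_adj S H) (fun _ _ => 1%N) rho.
Hypothesis rho_hyp : forall x y z o,
  (rho x z + rho y o <= maxn (rho x y + rho z o) (rho y z + rho x o) + delta)%N.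
Notation V := (G * nat)%type.
Context (D : nat).
Hypothesis D_rips : (2 * delta + 2 <= D)%N.
Hypothesis D_horo : (8 <= D)%N.
Implicit Types (u v w : V) (s t : seq V) (k : left_coset H).
Notation rs := (relsimp H rho D).

Definition vact (g : G) u : V := ((g * u.1)%g, u.2).

Lemma vact1 u : vact 1%g u = u. Proof. by case: u => x i; rewrite /vact mul1g. Qed.
Lemma vactM g h u : vact (g * h)%g u = vact g (vact h u). Proof. by rewrite /vact mulgA. Qed.
Lemma vactK g : cancel (vact g) (vact g^-1%g).
Proof. by move=> u; rewrite -vactM mulVg vact1. Qed.
Lemma vactVK g : cancel (vact g^-1%g) (vact g).
Proof. by move=> u; rewrite -vactM mulgV vact1. Qed.
Lemma vact_inj g : injective (vact g). Proof. exact: can_inj (vactK g). Qed.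

Definition word_act (g : G) (c : seq V -> R^o) : seq V -> R^o := fun s => c (map (vact g^-1%g) s).

Lemma word_act_linear g : linear (word_act g). Proof. by []. Qed.
Lemma word_act1 c : word_act 1%g c = c.
Proof.
by apply: funext => s; rewrite /word_act invg1 (eq_map vact1) map_id.
Qed.
Lemma word_actM g h c : word_act (g * h)%g c = word_act g (word_act h c).
Proof.
by apply: funext => s; rewrite /word_act invgM -map_comp; congr c; apply: eq_map => u; rewrite vactM.
Qed.

Definition gword : gmodule R G := GModule word_act_linear word_act1 word_actM.

Lemma same_coset_mull g x y : same_coset H (g * x)%g (g * y)%g = same_coset H x y.
Proof. by rewrite /same_coset invgM !mulgA mulgVK. Qed.

Lemma coset_of_mull g x y : (co (g * x)%g == co (g * y)%g) = (co x == co y).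
Proof.
apply/eqP/eqP => /coset_ofP; rewrite ?same_coset_mull => h; apply/coset_ofP => //.
by rewrite same_coset_mull.
Qed.

Lemma relsimp_act g n s : rs n s -> rs n (map (vact g) s).
Proof.
move=> [sz [cl _] ms]; split; first by rewrite size_map.
  split=> // _ _ /mapP[x xs ->] /mapP[y ys ->].
  by rewrite /close (rho_mull rhoP); exact: cl.
case/hasP: ms => u us /hasP[w ws uw]; apply/hasP; exists (vact g u); first exact: map_f.
by apply/hasP; exists (vact g w); rewrite ?map_f //= coset_of_mull.
Qed.

Definition chain_pred n : {pred gword} := [pred c | `[< chain (rs n) (c : seq V -> R^o) >] ].

Lemma chain_predP n (c : gword) : reflect (chain (rs n) (c : seq V -> R^o)) (c \in chain_pred n).
Proof. exact: asboolP. Qed.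

Lemma chain_submod n : submod_closed (chain_pred n).
Proof.
split=> [|a c c'].
  apply/chain_predP; split; first by exists [::] => x; rewrite -[X in X != _]/(0 : R) eqxx.
    by split=> [s1 x y s2|//]; exact: (esym (oppr0 _)).
  by move=> s; rewrite -[X in X != _]/(0 : R) eqxx.
move=> /chain_predP[f a1 p] /chain_predP cc'; apply/chain_predP; apply: chainD cc'.
have nz s : a *: (c s : R^o) != 0 -> c s != 0.
  by apply: contraNN => /eqP->; rewrite scaler0.
split; [exact: fin_sub f nz| |by move=> s /nz/p].
by split=> [s1 x y s2|s1 x s2]; rewrite -[LHS]/(a *: (c _ : R^o)) ?a1.2 ?scaler0 // a1.1 scalerN.
Qed.

Lemma chain_act n g c : c \in chain_pred n -> gact g c \in chain_pred n.
Proof.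
move=> /chain_predP[[l h] [a1 a2] p]; apply/chain_predP; split.
- exists [seq map (vact g) s | s <- l] => s cs; apply/mapP; exists (map (vact g^-1%g) s); first exact: h cs.
  by rewrite -map_comp map_id_in // => u _; exact: vactVK.
- by split=> [s1 x y s2|s1 x s2]; rewrite /= /word_act !map_cat /= ?a2 // a1.
- move=> s /p/(relsimp_act g); rewrite -map_comp map_id_in // => u _; exact: vactVK.
Qed.

Definition chains n : gmodule R G := gsubmod (chain_submod n) (@chain_act n).

Definition cv n (x : chains n) : seq V -> R^o := gincl _ _ x.

Lemma cvP n (x : chains n) : chain (rs n) (cv x).
Proof. exact/chain_predP/gincl_mem. Qed.

Definition cmk n c (cc : chain (rs n) c) : chains n := glift (chain_submod n) (@chain_act n) (introT (chain_predP n c) cc).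

Lemma cv_mk n c (cc : chain (rs n) c) : cv (cmk cc) = c. Proof. by []. Qed.

Lemma cv_inj n (x y : chains n) : (forall s, cv x s = cv y s) -> x = y.
Proof. by move=> h; apply: gincl_inj; exact: funext. Qed.

Lemma cv_lin n a (x y : chains n) s : cv (a *: x + y) s = a *: cv x s + cv y s.
Proof. by []. Qed.

Lemma cv0 n s : cv (0 : chains n) s = 0. Proof. by []. Qed.

Lemma cv_act n g (x : chains n) s : cv (gact g x) s = cv x (map (vact g^-1%g) s).
Proof. by []. Qed.

Lemma bd_lin a (c c' : seq V -> R^o) s : fin c -> fin c' ->
  bd (fun s => a *: c s + c' s) s = a *: bd c s + bd c' s.
Proof.
move=> fc fc'; have fac : fin (fun s => a *: c s).
  by apply: fin_sub fc _ => t; apply: contraNN => /eqP->; rewrite scaler0.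
rewrite (bdD s fac fc'); congr (_ + _).
by rewrite /bd (fsum_linear (h := fun x => a *: x) (fin_at s fc)) ?scaler0 // => x y; rewrite scalerDr.
Qed.

Lemma bd_act g (c : seq V -> R^o) s : fin c -> bd (word_act g c) s = bd c (map (vact g^-1%g) s).
Proof.
move=> fc; rewrite /bd [RHS](fsum_bij (vactVK g) (vactK g)) //.
exact: (fin_at (map (vact g^-1%g) s) fc).
Qed.

Lemma mixed_act g s : mixed H (map (vact g) s) = mixed H s.
Proof.
rewrite /mixed has_map; apply: eq_has => u; rewrite /= has_map; apply: eq_has => v /=.
by rewrite coset_of_mull.
Qed.

Definition chain_bd n (x : chains n.+1) : chains n := cmk (rbd_chain (cvP x)).

Lemma chain_bd_linear n : linear (@chain_bd n).
Proof.
move=> a x y; apply: cv_inj => s; have [f1 _ _] := cvP x; have [f2 _ _] := cvP y.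
rewrite cv_lin !cv_mk /rbd /rst; case: ifP => _; last by rewrite scaler0 addr0.
exact: bd_lin.
Qed.

Lemma chain_bd_equiv n : equivariant (@chain_bd n).
Proof.
move=> g x; apply: cv_inj => s; have [f1 _ _] := cvP x.
by rewrite cv_act !cv_mk /rbd /rst mixed_act; case: ifP => // _; exact: bd_act.
Qed.

Definition bdm n : ghom (chains n.+1) (chains n) := mk_ghom (@chain_bd_linear n) (@chain_bd_equiv n).

Lemma bdm_exact n x : bdm n x = 0 <-> exists y, bdm n.+1 y = x.
Proof.
split=> [x0|[y <-]]; last first.
  by have [f a _] := cvP y; apply: cv_inj => s; exact: rbd_rbd.
have [s|e ce be] := rel_exact gS rhoP rho_hyp D_rips D_horo (cvP x).
  by rewrite -[LHS]/(cv (bdm n x) s) x0.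
by exists (cmk ce); exact: cv_inj.
Qed.

Definition coset_fun_act (g : G) (d : left_coset H -> R^o) : left_coset H -> R^o :=
  fun k => d (coset_act g^-1%g k).

Lemma coset_fun_linear g : linear (coset_fun_act g). Proof. by []. Qed.
Lemma coset_fun1 d : coset_fun_act 1%g d = d.
Proof. by apply: funext => k; rewrite /coset_fun_act invg1 coset_act1. Qed.
Lemma coset_funM g h d : coset_fun_act (g * h)%g d = coset_fun_act g (coset_fun_act h d).
Proof. by apply: funext => k; rewrite /coset_fun_act invgM coset_actM. Qed.

Definition gcoset : gmodule R G := GModule coset_fun_linear coset_fun1 coset_funM.

Definition delta_pred : {pred gcoset} :=
  [pred d | `[< fin (d : left_coset H -> R^o) /\ fsum (d : left_coset H -> R^o) = 0 >] ].

Lemma delta_predP (d : gcoset) :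
  reflect (fin (d : left_coset H -> R^o) /\ fsum (d : left_coset H -> R^o) = 0) (d \in delta_pred).
Proof. exact: asboolP. Qed.

Lemma fsum_lin (T : choiceType) a (f f' : T -> R^o) : fin f -> fin f' ->
  fin (fun x => a *: f x + f' x) /\ fsum (fun x => a *: f x + f' x) = a *: fsum f + fsum f'.
Proof.
move=> ff ff'; have fa : fin (fun z => a *: f z).
  by apply: fin_sub ff _ => t; apply: contraNN => /eqP->; rewrite scaler0.
split; first exact: finD.
rewrite (fsumD fa ff'); congr (_ + _).
by rewrite (fsum_linear (h := fun x => a *: x) ff) ?scaler0 // => x y; rewrite scalerDr.
Qed.

Lemma delta_submod : submod_closed delta_pred.
Proof.
split=> [|a d d' /delta_predP[f1 s1] /delta_predP[f2 s2]].
  apply/delta_predP; split; first by exists [::] => x; rewrite -[X in X != _]/(0 : R) eqxx.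
  exact: fsum0.
apply/delta_predP; have [f3 s3] := fsum_lin a f1 f2; split; first exact: f3.
by apply: etrans s3 _; rewrite s1 s2 scaler0 addr0.
Qed.

Lemma coset_actK g : cancel (@coset_act G H g) (coset_act g^-1%g).
Proof. by move=> k; rewrite -coset_actM mulVg coset_act1. Qed.
Lemma coset_actVK g : cancel (@coset_act G H g^-1%g) (coset_act g).
Proof. by move=> k; rewrite -coset_actM mulgV coset_act1. Qed.

Lemma delta_act g d : d \in delta_pred -> gact g d \in delta_pred.
Proof.
move=> /delta_predP[[l h] s0]; apply/delta_predP; split.
  exists [seq coset_act g k | k <- l] => k dk; apply/mapP; exists (coset_act g^-1%g k); first exact: h dk.
  by rewrite coset_actVK.
rewrite -[RHS]s0 [RHS](fsum_bij (coset_actVK g) (coset_actK g)) //; by exists l.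
Qed.

Definition delta_mod : gmodule R G := gsubmod delta_submod delta_act.
Definition dv (x : delta_mod) : left_coset H -> R^o := gincl _ _ x.

Lemma dvP (x : delta_mod) : fin (dv x) /\ fsum (dv x) = 0.
Proof. exact/delta_predP/gincl_mem. Qed.

Definition dmk d (h : fin d /\ fsum d = 0) : delta_mod := glift delta_submod delta_act (introT (delta_predP d) h).

Lemma dv_mk d h : dv (@dmk d h) = d. Proof. by []. Qed.

Lemma dv_inj (x y : delta_mod) : (forall k, dv x k = dv y k) -> x = y.
Proof. by move=> h; apply: gincl_inj; exact: funext. Qed.

Lemma aug_prop (x : chains 0) : fin (raug (H := H) (cv x)) /\ fsum (raug (H := H) (cv x)) = 0.
Proof. by have [f a _] := cvP x; split; [exact: raug_fin | exact: raug_sum]. Qed.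

Definition chain_aug (x : chains 0) : delta_mod := dmk (aug_prop x).

Lemma chain_aug_linear : linear chain_aug.
Proof.
move=> a x y; apply: dv_inj => k; have [f1 _ _] := cvP x; have [f2 _ _] := cvP y.
rewrite dv_mk; have [_ e] := fsum_lin a (raug_fin_term k f1) (raug_fin_term k f2).
apply: etrans e.
apply: fsum_eq => u; case: ifP => _; last by rewrite scaler0 addr0.
exact: bd_lin.
Qed.

Lemma chain_aug_equiv : equivariant chain_aug.
Proof.
move=> g x; apply: dv_inj => k; have [f1 _ _] := cvP x.
rewrite dv_mk -[RHS]/(raug (cv x) (coset_act g^-1%g k)) /raug.
rewrite [RHS](fsum_bij (vactVK g) (vactK g)); last exact: raug_fin_term.
apply: fsum_eq => u; rewrite /= -(coset_actE H) (inj_eq (can_inj (coset_actVK g))).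
by case: ifP => // _; exact: bd_act.
Qed.

Definition augm : ghom (chains 0) delta_mod := mk_ghom chain_aug_linear chain_aug_equiv.

Lemma augm_surj : surjection augm.
Proof.
move=> d; have [f1 s1] := dvP d.
have [c cc e] := raug_surj gS rhoP rho_hyp D_rips f1 s1.
by exists (cmk cc); apply: dv_inj => k; exact: e.
Qed.

Lemma augm_exact x : augm x = 0 <-> exists y, bdm 0 y = x.
Proof.
split=> [x0|[y <-]]; last first.
  by have [f a _] := cvP y; apply: dv_inj => k; exact: raug_rbd.
have [k|e ce be] := rel_exact0 gS rhoP rho_hyp D_rips D_horo (cvP x).
  by rewrite -[LHS]/(dv (augm x) k) x0.
by exists (cmk ce); exact: cv_inj.
Qed.

End ChainModules.

(** * The augmentation kernel after extension of scalars *)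

Section Tensor.
Context (R : pzRingType) (G : groupType) (H : groupClosed G).
Notation ZGH := {freeg (left_coset H) / int}.
Notation dmod := (delta_mod R H).

Lemma coeff_fin (x : ZGH) : fin (fun k => (coeff k x)%:~R : R^o) /\
  fsum (fun k => (coeff k x)%:~R : R^o) = (deg x)%:~R.
Proof.
have h k : ((coeff k x)%:~R : R^o) != 0 -> k \in dom x.
  by apply: contraNT => /coeff_outdom->.
split; first by exists (dom x).
rewrite (fsumE h) undup_id ?uniq_dom // -[in RHS](freeg_sumE x) raddf_sum /= rmorph_sum.
by apply: eq_bigr => k _; rewrite degU.
Qed.

Lemma iota_prop (x : Delta H) : fin (fun k => (coeff k (val x))%:~R : R^o) /\
  fsum (fun k => (coeff k (val x))%:~R : R^o) = 0.
Proof.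
have [f ->] := coeff_fin (val x); split=> //.
by have := valP x; rewrite inE => /eqP->.
Qed.

Definition diota (x : Delta H) : dmod := dmk (iota_prop x).

Let k0 : left_coset H := coset_of H 1%g.

Lemma diff_ker k : (<< k >> - << k0 >> : ZGH) \in @aug_ker G H.
Proof. by rewrite inE degB !degU subrr. Qed.

(** These elements with [k != k0] form a basis of the kernel, over the integers as well as over [R];
    the universal property is checked on it. *)
Definition diff k : Delta H := exist (fun D => D \in @aug_ker G H) (<< k >> - << k0 >>) (diff_ker k).

Lemma Delta_diff (x : Delta H) : x = \sum_(k <- dom (val x)) (diff k *~ coeff k (val x)).
Proof.
apply: val_inj; rewrite raddf_sum /=.
rewrite (eq_bigr (fun k => << coeff k (val x) *g k >> - (<< k0 >> : ZGH) *~ coeff k (val x))); last first.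
  move=> k _; have -> : val (diff k *~ coeff k (val x)) = val (diff k) *~ coeff k (val x) by exact: raddfMz.
  by rewrite /= mulrzBl freeg_mulz intz.
rewrite sumrB freeg_sumE -mulrz_sumr.
have -> : \sum_(k <- dom (val x)) coeff k (val x) = deg (val x).
  rewrite -[in RHS](freeg_sumE (val x)) raddf_sum /=.
  by apply: eq_bigr => k _; rewrite degU.
by have := valP x; rewrite inE => /eqP->; rewrite mulr0z subr0.
Qed.

Lemma coeff_diff k z : coeff z (val (diff k)) = (k == z)%:R - (k0 == z)%:R.
Proof. by rewrite /= coeffB !coeffU !mul1r. Qed.

Lemma dv_sum (l : seq (left_coset H)) (F : left_coset H -> dmod) z :
  dv (\sum_(k <- l) F k) z = \sum_(k <- l) dv (F k) z.
Proof. by elim: l => [|k l IH]; rewrite ?big_nil // !big_cons -IH. Qed.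

Lemma dmod_diff (d : dmod) (l : seq (left_coset H)) : (forall k, dv d k != 0 -> k \in l) ->
  d = \sum_(k <- undup l) (dv d k : R) *: (diota (diff k) : dmod).
Proof.
move=> h; apply: dv_inj => z; rewrite dv_sum; have [fd d0] := dvP d.
rewrite (eq_bigr (fun k => dv d k * (k == z)%:R - dv d k * (k0 == z)%:R)); last first.
  move=> k _; rewrite -[LHS]/(dv d k * (coeff z (val (diff k)))%:~R) coeff_diff.
  by rewrite rmorphB /= !mulrz_nat mulrBr.
rewrite sumrB -[X in _ - X]mulr_suml -(fsumE h) d0 mul0r subr0.
case: (boolP (z \in undup l)) => zl; last first.
  rewrite big1_seq => [|k /andP[_ kl]].
    by apply/eqP/negPn/negP => /h; rewrite -mem_undup (negbTE zl).
  by case: eqP => [e|_]; [rewrite -e kl in zl | rewrite mulr0].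
rewrite (bigD1_seq z) ?undup_uniq //= eqxx mulr1 big1 ?addr0 // => k /negbTE->.
by rewrite mulr0.
Qed.

Section Universal.
Context (M : gmodule R G) (f : Delta H -> M).
Hypothesis (fD : {morph f : x y / x + y}) (fE : equivariant f).

Let f0 : f 0 = 0. Proof. by apply: (addrI (f 0)); rewrite -fD !addr0. Qed.
Let fB : additive f.
Proof.
by move=> x y; apply: (addIr (f y)); rewrite -fD !subrK.
Qed.
Let fa : {additive Delta H -> M} :=
  HB.pack_for {additive Delta H -> M} f (GRing.isAdditive.Build (Delta H) M f fB).

Definition dlift (d : dmod) : M := fsum (fun k => (dv d k : R) *: f (diff k)).

Lemma dlift_fin (d : dmod) : fin (fun k => (dv d k : R) *: f (diff k)).
Proof. by apply: fin_subr (dvP d).1 _ => k; apply: contraNN => /eqP->; rewrite scale0r. Qed.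

Lemma dlift_linear : linear dlift.
Proof.
move=> a x y; rewrite /dlift.
have fZ : fin (fun k => a *: ((dv x k : R) *: f (diff k))).
  by apply: fin_sub (dlift_fin x) _ => k; apply: contraNN => /eqP->; rewrite scaler0.
have -> : a *: fsum (fun k => (dv x k : R) *: f (diff k)) = fsum (fun k => a *: ((dv x k : R) *: f (diff k))).
  by apply: (fsum_linear (h := fun z => a *: z) (dlift_fin x)); [exact: scaler0|move=> u v; exact: scalerDr].
rewrite -(fsumD fZ (dlift_fin y)); apply: fsum_eq => k.
by rewrite scalerA -scalerDl.
Qed.

Lemma diff_act g k : diff (coset_act g k) = gact g (diff k) + diff (coset_act g k0).
Proof.
apply: val_inj; rewrite /= raddfB /= !ZGH_actU addrA subrK.
by [].
Qed.

Lemma dlift_equiv : equivariant dlift.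
Proof.
move=> g d; rewrite /dlift (fsum_bij (coset_actK g) (coset_actVK g)); last exact: dlift_fin.
have -> : gact g (fsum (fun k => (dv d k : R) *: f (diff k))) = fsum (fun k => gact g ((dv d k : R) *: f (diff k))).
  by apply: (fsum_linear (dlift_fin d)); [exact: gact0|exact: gactD].
have [fd d0] := dvP d.
have fg : fin (fun k => gact g ((dv d k : R) *: f (diff k))).
  by apply: fin_sub (dlift_fin d) _ => k; apply: contraNN => /eqP->; rewrite gact0.
(* Translation does not permute the basis, but the correction is the same for all [k]; it gets
   multiplied by the sum of the coefficients, which is 0. *)
transitivity (fsum (fun k => gact g ((dv d k : R) *: f (diff k)) + (dv d k : R) *: f (diff (coset_act g k0)))).
  apply: fsum_eq => k; rewrite -[dv (gact g d) _]/(dv d (coset_act g^-1%g (coset_act g k))) coset_actK.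
  by rewrite diff_act fD fE scalerDr gactZ.
rewrite fsumD //; last by apply: fin_subr fd _ => k; apply: contraNN => /eqP->; rewrite scale0r.
rewrite -[X in _ + X](fsum_linear (h := fun z : R^o => (z : R) *: f (diff (coset_act g k0))) fd).
- by rewrite d0 scale0r addr0.
- by rewrite scale0r.
- by move=> a b; rewrite scalerDl.
Qed.

Definition dliftm : ghom dmod M := mk_ghom dlift_linear dlift_equiv.

Lemma dlift_iota x : dliftm (diota x) = f x.
Proof.
rewrite -[LHS]/(dlift (diota x)) /dlift [in RHS](Delta_diff x) -[RHS]/(fa _) raddf_sum.
rewrite (fsumE (l := dom (val x))); last first.
  move=> k; apply: contraNT => /coeff_outdom e.
  by rewrite -[dv _ k]/((coeff k (val x))%:~R) e scale0r.
rewrite undup_id ?uniq_dom //; apply: eq_bigr => k _.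
by rewrite raddfMz -[dv _ k]/((coeff k (val x))%:~R) scaler_int.
Qed.

Lemma dlift_unique (F : ghom dmod M) : (forall x, F (diota x) = f x) -> forall d, F d = dliftm d.
Proof.
move=> FP d; have [[l h] _] := dvP d; rewrite {1}(dmod_diff h) linear_sum.
rewrite -[RHS]/(dlift d) /dlift (fsumE (l := l)).
  by apply: eq_bigr => k _; rewrite linearZ /= FP.
by move=> k dk; apply: h; apply: contraNN dk => /eqP->; rewrite scale0r.
Qed.

End Universal.

Lemma delta_tensor : is_tensor diota.
Proof.
split.
- move=> x y; apply: dv_inj => k.
  by rewrite -[LHS]/((coeff k (val x + val y))%:~R) coeffD rmorphD.
- move=> g x; apply: dv_inj => k.
  rewrite -[LHS]/((coeff k (ZGH_act g (val x)))%:~R) -[RHS]/((coeff (coset_act g^-1%g k) (val x))%:~R).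
  congr (_%:~R); rewrite -[k in LHS](coset_actVK g).
  apply: (ZGH_additive_ext (f := coeff (coset_act g (coset_act g^-1%g k)) \o ZGH_act g)
    (f' := coeff (coset_act g^-1%g k))) => m c /=.
  by rewrite ZGH_actU !coeffU (inj_eq (can_inj (coset_actK g))).
- move=> M f fD fE; exists (dliftm fD fE); split; first exact: dlift_iota.
  exact: dlift_unique.
Qed.

End Tensor.

Section Basic.
Context (V : choiceType) (R : pzRingType).

Lemma wedge_scale u a (c : seq V -> R^o) s : wedge u (fun t => a * c t) s = a * wedge u c s.
Proof.
rewrite /wedge; elim: s c => [|x s IH] c /=; first by rewrite mulr0.
by rewrite (IH (ctr x c)) mulrBr; congr (_ - _); case: ifP => _; rewrite ?mulr0.
Qed.

Lemma basic_scale (a : R) (s t : seq V) : basic (a : R^o) s t = a * basic (1 : R^o) s t.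
Proof.
elim: s t => [|x s IH] t /=; first by case: t => [|? ?]; rewrite ?mulr1 ?mulr0.
by rewrite -wedge_scale; congr (wedge _ _ t); apply: funext.
Qed.

Lemma wedge_map (W : choiceType) (f : V -> W) u (c : seq W -> R^o) s : injective f ->
  wedge (f u) c (map f s) = wedge u (fun t => c (map f t)) s.
Proof.
move=> fi; rewrite /wedge; elim: s c => [//|x s IH] c /=.
by rewrite (IH (ctr (f x) c)) (inj_eq fi).
Qed.

Lemma basic_map (W : choiceType) (f : V -> W) (a : R^o) (s t : seq V) : injective f ->
  basic a (map f s) (map f t) = basic a s t.
Proof.
move=> fi; elim: s t => [|x s IH] t /=; first by case: t.
by rewrite wedge_map //; congr (wedge _ _ t); apply: funext.
Qed.

End Basic.

(** * Stabilizers of simplices and averaging weights *)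

Section Stabilizer.
Context (G : groupType).
Notation V := (G * nat)%type.
Notation va := (@vact G).
Implicit Types (s t : seq V) (g h : G).

(** The stabilizer of the unordered simplex. That of a nonempty word itself is trivial. *)
Definition stab s : {pred G} := [pred g | perm_eq (map (va g) s) s].

Lemma map_va1 s : map (va 1%g) s = s.
Proof. by rewrite (eq_map (@vact1 G)) map_id. Qed.

Lemma map_vaM g h s : map (va (g * h)%g) s = map (va g) (map (va h) s).
Proof. by rewrite -map_comp; apply: eq_map => u; rewrite /= vactM. Qed.

Lemma map_vaK g : cancel (map (va g)) (map (va g^-1%g)).
Proof. by move=> s; rewrite -map_vaM mulVg map_va1. Qed.

Lemma stab1 s : 1%g \in stab s.
Proof. by rewrite inE map_va1. Qed.

Lemma stabM s : monoid.mulg_closed (stab s).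
Proof.
move=> g h; rewrite !inE map_vaM => gs hs; apply: perm_trans gs; exact: perm_map.
Qed.

Lemma stabV s : monoid.invg_closed (stab s).
Proof.
move=> g; rewrite !inE => gs; rewrite perm_sym -{1}[s](map_vaK g); exact: perm_map.
Qed.

Definition stab_group s : groupClosed G := HB.pack_for (groupClosed G) (stab s)
  (isInvClosed.Build G (stab s) (@stabV s)) (isMul1Closed.Build G (stab s) (@stab1 s))
  (isMulClosed.Build G (stab s) (@stabM s)).

Lemma va_free g h s : s != [::] -> map (va g) s = map (va h) s -> g = h.
Proof. by case: s => // -[x i] s _ /= [/mulIg->]. Qed.

Lemma stab_finite s : s != [::] -> finite_set [set g | g \in stab s]%classic.
Proof.
case: s => // u s _; apply/finite_seqP.
pose l := [seq (v.1 * u.1^-1)%g | v <- u :: s].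
have e g : (g \in [seq h <- l | h \in stab (u :: s)]) = (g \in stab (u :: s)).
  rewrite mem_filter; apply/andP/idP => [[]//|gs]; split=> //.
  apply/mapP; exists (va g u); last by rewrite /= mulgK.
  have := gs; rewrite inE => /perm_mem <-; exact: mem_head.
exists [seq h <- l | h \in stab (u :: s)].
by apply/seteqP; split=> g h; [exact: etrans (e g) h | exact: etrans (esym (e g)) h].
Qed.

Definition same_orbit s : pred (seq V) := fun t => `[< exists g, perm_eq (map (va g) s) t >].

Lemma same_orbitP s t : reflect (exists g, perm_eq (map (va g) s) t) (same_orbit s t).
Proof. exact: asboolP. Qed.

Lemma same_orbit_refl s : same_orbit s s.
Proof. by apply/same_orbitP; exists 1%g; rewrite map_va1. Qed.

Lemma same_orbit_eq s t : same_orbit s t -> same_orbit s =1 same_orbit t.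
Proof.
have tr a b c : same_orbit a b -> same_orbit b c -> same_orbit a c.
  move=> /same_orbitP[g p] /same_orbitP[h q]; apply/same_orbitP; exists (h * g)%g.
  by rewrite map_vaM; apply: perm_trans q; exact: perm_map.
have sy a b : same_orbit a b -> same_orbit b a.
  move=> /same_orbitP[g p]; apply/same_orbitP; exists (g^-1)%g.
  by rewrite perm_sym -{1}[a](map_vaK g); exact: perm_map.
by move=> st r; apply/idP/idP; [apply: tr; exact: sy | exact: tr].
Qed.

(** [choose] depends on the orbit as a predicate only, which makes the representative constant on
    the orbit. *)
Definition canon s : seq V := choose (same_orbit s) s.

Lemma canonP s : same_orbit s (canon s).
Proof. exact: chooseP (same_orbit_refl s). Qed.

Lemma canon_eq s t : same_orbit s t -> canon s = canon t.
Proof.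
move=> st; rewrite /canon (eq_choose (same_orbit_eq st)); apply: choose_id.
- by rewrite -(same_orbit_eq st) same_orbit_refl.
- exact: same_orbit_refl.
Qed.

Lemma canon_act g s : canon (map (va g) s) = canon s.
Proof. by apply/esym/canon_eq/same_orbitP; exists g. Qed.

Lemma canon_neq0 s : s != [::] -> canon s != [::].
Proof.
have /same_orbitP[g /perm_size] := canonP s; rewrite size_map.
by case: s => // u s; case: (canon _).
Qed.

(* Within each orbit of unordered simplices only the orderings in the orbit of one fixed ordering
   are used; there are as many of them as elements of the stabilizer of the simplex. *)
Definition chosen s : Prop := exists g, s = map (va g) (canon s).

Lemma chosen_act g s : chosen (map (va g) s) <-> chosen s.
Proof.
rewrite /chosen canon_act; split=> -[h e].
  by exists (g^-1 * h)%g; rewrite map_vaM -e map_vaK.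
by exists (g * h)%g; rewrite map_vaM -e.
Qed.

End Stabilizer.

Section Weights.
Context (R : pzRingType) (G : groupType).
Hypothesis ntor : no_torsion R G.
Notation V := (G * nat)%type.
Notation va := (@vact G).
Implicit Types (s t : seq V) (g h : G).

(** The order of the stabilizer is a multiple of 1 in [R], so it is central, and so is its inverse.
    This matters because [R] need not be commutative. *)
Lemma stab_unit s : exists u : R, forall L : seq G, s != [::] -> uniq L -> (forall g, (g \in L) = (g \in stab s)) ->
  (size L)%:R * u = 1 /\ forall a : R, u * a = a * u.
Proof.
case: (eqVneq s [::]) => [->|s0]; first by exists 0.
have fs := stab_finite s0; have [n nP] := (finite_setP _).1 fs.
have [u [nu un]] := @ntor (stab_group s) n nP; exists u => L _ uL LP.
have -> : size L = n.
  rewrite -(card_fset_set nP); apply: perm_size; apply: uniq_perm uL _ _; first exact: finmap.fset_uniq.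
  by move=> g; rewrite LP; apply: esym; apply: etrans (in_fset_set fs g) _; apply/idP/idP; rewrite in_setE.
split=> // a; rewrite -[LHS]mulr1 -nu mulrA -(mulrA u a) (commr_nat a n) mulrA un mul1r.
by [].
Qed.

Definition unit_of s : R := projT1 (cid (stab_unit s)).

Lemma unit_ofP s (L : seq G) : s != [::] -> uniq L -> (forall g, (g \in L) = (g \in stab s)) ->
  (size L)%:R * unit_of s = 1 /\ forall a : R, unit_of s * a = a * unit_of s.
Proof. exact: (projT2 (cid (stab_unit s))). Qed.

Lemma stab_enum s : s != [::] -> exists2 L : seq G, uniq L & forall g, (g \in L) = (g \in stab s).
Proof.
move=> s0; have fs := stab_finite s0; exists (finmap.enum_fset (fset_set [set g | g \in stab s]%classic)).
  exact: finmap.fset_uniq.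
by move=> g; apply: etrans (in_fset_set fs g) _; apply/idP/idP; rewrite in_setE.
Qed.

Definition weight s : R := if `[< chosen s >] then unit_of (canon s) else 0.

Lemma weight_central s a : s != [::] -> weight s * a = a * weight s.
Proof.
move=> s0; rewrite /weight; case: ifP => _; last by rewrite mul0r mulr0.
have c0 := canon_neq0 s0; have [L uL LP] := stab_enum c0.
by have [_] := unit_ofP c0 uL LP; exact.
Qed.

Lemma weight_act g s : weight (map (va g) s) = weight s.
Proof.
rewrite /weight canon_act; congr (if _ then _ else _).
by apply/asboolP/asboolP => /chosen_act.
Qed.

Lemma weight_sum s : s != [::] -> fsum (fun t => if perm_eq t s then weight t : R^o else 0) = 1.
Proof.
move=> s0; have c0 := canon_neq0 s0; have [L uL LP] := stab_enum c0.
set r := canon s in c0 L uL LP *.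
have [g0 p0] : exists g0, perm_eq (map (va g0) r) s.
  have /same_orbitP[g p] := canonP s; exists (g^-1)%g.
  by rewrite perm_sym -{1}[s](map_vaK g); exact: perm_map.
have cr t : perm_eq t s -> canon t = r.
  move=> p; apply: canon_eq; apply/same_orbitP; exists 1%g; by rewrite map_va1.
rewrite (fsumE (l := [seq map (va (g0 * h)%g) r | h <- L])); last first.
  move=> t; case: ifP => [p|]; last by rewrite eqxx.
  rewrite /weight; case: ifP => [/asboolP[g e]|]; last by rewrite eqxx.
  move=> _; rewrite (cr t p) in e; apply/mapP; exists (g0^-1 * g)%g; last by rewrite mulVKg.
  rewrite LP inE map_vaM -e; rewrite -[X in perm_eq _ X](map_vaK g0); apply: perm_map.
  by apply: perm_trans p _; rewrite perm_sym.
rewrite undup_id; last first.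
  rewrite map_inj_in_uniq // => h h' _ _ /(va_free c0)/mulgI//.
rewrite big_map big_seq (eq_bigr (fun _ => unit_of r)); last first.
  move=> h hL; have ph : perm_eq (map (va (g0 * h)%g) r) s.
    apply: perm_trans p0; rewrite map_vaM; apply: perm_map.
    by move: hL; rewrite LP inE.
  rewrite ph /weight (cr _ ph) asboolT //.
  by exists (g0 * h)%g; rewrite (cr _ ph).
rewrite -big_seq big_const_seq count_predT iter_addr_0.
by have [<- _] := unit_ofP c0 uL LP; rewrite mulr_natl.
Qed.

End Weights.

(** * Projectivity of relative chains *)

Section Projective.
Context (R : pzRingType) (G : groupType) (S : seq G) (H : groupClosed G).
Hypothesis gS : generating_set S.
Context (rho : G * nat -> G * nat -> nat).
Hypothesis rhoP : graph_metric (cusp_adj S H) (fun _ _ => 1%N) rho.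
Hypothesis ntor : no_torsion R G.
Notation V := (G * nat)%type.
Notation va := (@vact G).
Context (D : nat).
Implicit Types (s t : seq V) (g h : G).
Notation rs := (relsimp H rho D).
Notation C := (chains R rhoP D).

Lemma relsimp_perm n s t : perm_eq s t -> rs n s -> rs n t.
Proof.
move=> p [sz [cl _] ms]; split; first by rewrite -(perm_size p).
  by split=> // x y; rewrite -!(perm_mem p); exact: cl.
by rewrite -(mixed_perm _ p).
Qed.

Lemma basic_chain n s (a : R^o) : rs n s -> chain (rs n) (basic a s).
Proof.
move=> h; split; [exact: fin_basic|exact: alt_basic|].
by move=> t /basic_supp; rewrite perm_sym => p; exact: relsimp_perm p h.
Qed.

Definition simplex n s : C n := if pselect (rs n s) is left h then cmk rhoP (basic_chain 1 h) else 0.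

Lemma cv_simplex n s : rs n s -> cv (simplex n s) = basic (1 : R^o) s.
Proof. by rewrite /simplex; case: pselect. Qed.

Lemma simplex_act n g s : simplex n (map (va g) s) = gact g (simplex n s).
Proof.
case: (pselect (rs n s)) => [h|nh].
  apply: cv_inj => t; rewrite cv_act !cv_simplex //; last exact: (relsimp_act rhoP g h).
  rewrite -{1}[t](map_vaK g^-1%g) invgK basic_map //; exact: vact_inj.
rewrite /simplex; case: pselect => [h|_]; last by case: pselect => // _; rewrite gact0.
by case: nh; have := relsimp_act rhoP (g^-1)%g h; rewrite map_vaK.
Qed.

Lemma cv_sum n (I : eqType) (l : seq I) (F : I -> C n) t : cv (\sum_(i <- l) F i) t = \sum_(i <- l) cv (F i) t.
Proof. by elim: l => [|i l IH]; rewrite ?big_nil // !big_cons -IH. Qed.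

(** For an alternating chain the summand [cv x s] times the basic chain of [s] is the same for all
    orderings of a simplex, so weights with sum 1 recover it. *)
Lemma chain_expand n (x : C n) (w : seq V -> R) l :
  (forall s, cv x s != 0 -> fsum (fun t => if perm_eq t s then w t : R^o else 0) = 1) ->
  (forall s, cv x s != 0 -> s \in l) ->
  x = \sum_(s <- undup l) ((w s * cv x s : R) *: (simplex n s : C n)).
Proof.
move=> w1 xl; have [fx ax px] := cvP x; apply: cv_inj => t; rewrite cv_sum.
case: (eqVneq (cv x t) 0) => [t0|tn0].
  rewrite t0 big1 // => s _; rewrite -[LHS]/((w s * cv x s) * cv (simplex n s) t).
  case: (eqVneq (cv x s) 0) => [->|sn0]; first by rewrite mulr0 mul0r.
  rewrite cv_simplex; last exact: px.
  case: (eqVneq (basic (1 : R^o) s t) 0) => [->|/basic_supp p]; first by rewrite mulr0.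
  by move: sn0; rewrite perm_sym in p; move/(alt_perm ax p); rewrite t0 eqxx.
have ut := alt_uniq ax tn0.
rewrite -[LHS]mul1r -[1](w1 t tn0) (fsumE (l := l)); last first.
  move=> s; case: ifP => [p _|]; last by rewrite eqxx.
  by apply: xl; apply: (alt_perm ax _ tn0); rewrite perm_sym.
rewrite mulr_suml; apply: eq_bigr => s _.
rewrite -[RHS]/((w s * cv x s) * cv (simplex n s) t); case: ifP => [p|np].
  have sn0 : cv x s != 0 by apply: (alt_perm ax _ tn0); rewrite perm_sym.
  rewrite cv_simplex; last exact: px.
  rewrite -mulrA -(basic_scale (cv x s)) (basic_eq ax) //; exact: alt_uniq sn0.
case: (eqVneq (cv x s) 0) => [->|sn0]; first by rewrite mulr0 !mul0r.
rewrite cv_simplex; last exact: px.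
case: (eqVneq (basic (1 : R^o) s t) 0) => [->|/basic_supp p]; first by rewrite mulr0 mul0r.
by rewrite perm_sym np in p.
Qed.

Section Extension.
Context (n : nat) (M : gmodule R G) (m : seq V -> M).
Hypothesis m_act : forall g s, s != [::] -> m (map (va g) s) = gact g (m s).

(** The values [m] are equivariant but not necessarily alternating; the weights take care of the
    orderings. *)
Definition extend (x : C n) : M := fsum (fun s => (weight ntor s * cv x s : R) *: m s).

Lemma chain_neq0 (x : C n) s : cv x s != 0 -> s != [::].
Proof. by have [_ _ p] := cvP x; move=> /p[]; case: s. Qed.

Lemma extend_term (x : C n) s : (weight ntor s * cv x s : R) *: m s != 0 -> cv x s != 0.
Proof. by apply: contraNN => /eqP->; rewrite mulr0 scale0r. Qed.

Lemma extend_fin (x : C n) : fin (fun s => (weight ntor s * cv x s : R) *: m s).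
Proof. have [fx _ _] := cvP x; exact: fin_subr fx (@extend_term x). Qed.

Lemma extend_linear : linear extend.
Proof.
move=> a x y; rewrite /extend.
have fZ : fin (fun s => a *: ((weight ntor s * cv x s : R) *: m s)).
  by apply: fin_sub (extend_fin x) _ => k; apply: contraNN => /eqP->; rewrite scaler0.
have -> : a *: fsum (fun s => (weight ntor s * cv x s : R) *: m s) =
    fsum (fun s => a *: ((weight ntor s * cv x s : R) *: m s)).
  by apply: (fsum_linear (h := fun z => a *: z) (extend_fin x)); [exact: scaler0|move=> u v; exact: scalerDr].
rewrite -(fsumD fZ (extend_fin y)); apply: fsum_eq => s.
rewrite scalerA -scalerDl cv_lin; case: (eqVneq s [::]) => [->|s0].
  have c0 (z : C n) : cv z [::] = 0 by apply/eqP/negPn/negP => /chain_neq0.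
  by rewrite !c0 scaler0 addr0 !mulr0 addr0.
by congr (_ *: _); rewrite mulrDr mulrA -(weight_central ntor a s0) mulrA.
Qed.

Lemma extend_equiv : equivariant extend.
Proof.
move=> g x; rewrite /extend.
have -> : gact g (fsum (fun s => (weight ntor s * cv x s : R) *: m s)) =
    fsum (fun s => gact g ((weight ntor s * cv x s : R) *: m s)).
  by apply: (fsum_linear (extend_fin x)); [exact: gact0|exact: gactD].
have K2 : cancel (map (va g^-1%g)) (map (va g)) by move=> s; rewrite -{1}[g]invgK map_vaK.
rewrite (fsum_bij (map_vaK g) K2); last exact: extend_fin.
apply: fsum_eq => s; rewrite cv_act map_vaK weight_act gactZ.
case: (eqVneq s [::]) => [->|s0]; last by rewrite m_act.
have -> : cv x [::] = 0 by apply/eqP/negPn/negP => /chain_neq0.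
by rewrite mulr0 !scale0r.
Qed.

Definition extendm : ghom (C n) M := mk_ghom extend_linear extend_equiv.

End Extension.

Lemma ghom_expand n (M : gmodule R G) (f : ghom (C n) M) (w : seq V -> R) x :
  (forall s, cv x s != 0 -> fsum (fun t => if perm_eq t s then w t : R^o else 0) = 1) ->
  f x = fsum (fun s => (w s * cv x s : R) *: f (simplex n s)).
Proof.
move=> w1; have [[l xl] _ _] := cvP x; rewrite {1}(chain_expand w1 xl) linear_sum.
rewrite (fsumE (l := l)); first by apply: eq_bigr => s _; rewrite linearZ.
move=> s h; apply: xl; apply: contraNN h => /eqP->; by rewrite mulr0 scale0r.
Qed.

(** Lift the value on one canonical word for each orbit and translate the lift. This is well defined
    on chosen words, because [G] acts freely on nonempty words, and all other words have weight
    0. *)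
Lemma chains_projective n : projective (C n).
Proof.
move=> M N p f sp; pose y s : N := f (simplex n s).
have [m0 m0P] := choice (fun s => sp (y s)).
have exg s : exists g, chosen s -> s = map (va g) (canon s).
  by case: (pselect (chosen s)) => [[g e]|nc]; [exists g | exists 1%g].
have [gg ggP] := choice exg.
pose m s : M := if `[< chosen s >] then gact (gg s) (m0 (canon s)) else 0.
have mE s g : canon s != [::] -> s = map (va g) (canon s) -> m s = gact g (m0 (canon s)).
  move=> c0 e; have ch : chosen s by exists g.
  by rewrite /m asboolT //; congr (gact _ _); apply: (va_free c0); rewrite -e -(ggP s ch).
have m_act g s : s != [::] -> m (map (va g) s) = gact g (m s).
  move=> s0; have c0 := canon_neq0 s0; case: (pselect (chosen s)) => [[h e]|nc].
    rewrite (mE s h c0 e) (mE _ (g * h)%g) ?canon_act // ?gactM //.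
    by rewrite map_vaM -e.
  rewrite /m !asboolF ?gact0 //; by rewrite chosen_act.
exists (extendm n m_act) => x.
rewrite (ghom_expand f (w := weight ntor)); last by move=> s /chain_neq0; exact: weight_sum.
rewrite -[LHS]/(p (extend m x)) /extend (fsum_linear (extend_fin m x)) ?linear0 //; last first.
  by move=> a b; rewrite linearD.
apply: fsum_eq => s; rewrite linearZ /=; case: (eqVneq s [::]) => [->|s0].
  have -> : cv x [::] = 0 by apply/eqP/negPn/negP => /chain_neq0.
  by rewrite mulr0 !scale0r.
case: (pselect (chosen s)) => [[h e]|nc]; last by rewrite /weight asboolF // mul0r !scale0r.
congr (_ *: _); rewrite (mE s h (canon_neq0 s0) e) ghom_equivariant m0P /y {2}e simplex_act.
by rewrite ghom_equivariant.
Qed.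

End Projective.

Section Words.
Context (T : eqType).

Fixpoint words n (l : seq T) : seq (seq T) :=
  if n is n'.+1 then [seq x :: s | x <- l, s <- words n' l] else [:: [::]].

Lemma mem_words l s : {subset s <= l} -> s \in words (size s) l.
Proof.
elim: s => [//|x s IH] h; apply/allpairsP; exists (x, s); split=> //=.
  exact/h/mem_head.
by apply: IH => y ys; apply: h; rewrite in_cons ys orbT.
Qed.

End Words.

Section ZeroMap.
Context (R : pzRingType) (G : groupType) (M N : gmodule R G).

Lemma gzero_linear : linear (fun _ : M => 0 : N).
Proof. by move=> a x y; rewrite scaler0 addr0. Qed.
Lemma gzero_equiv : equivariant (fun _ : M => 0 : N).
Proof. by move=> g x; rewrite gact0. Qed.
Definition gzero : ghom M N := mk_ghom gzero_linear gzero_equiv.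

End ZeroMap.

(** * The resolution and its compactly supported cochains *)

Section Resolution.
Context (R : pzRingType) (G : groupType) (S : seq G) (H : groupClosed G).
Hypothesis gS : generating_set S.
Context (rho : G * nat -> G * nat -> nat) (delta : nat).
Hypothesis rhoP : graph_metric (cusp_adj S H) (fun _ _ => 1%N) rho.
Hypothesis rho_hyp : forall x y z o,
  (rho x z + rho y o <= maxn (rho x y + rho z o) (rho y z + rho x o) + delta)%N.
Hypothesis ntor : no_torsion R G.
Notation V := (G * nat)%type.
Notation va := (@vact G).

Section Fixed.
Context (D : nat).
Notation C := (chains R rhoP D).
Implicit Types (s t : seq V).

(** The functional depends on finitely many coefficients of the chain. Linear functionals of this
    kind are the values at 1 of equivariant maps to finitely supported functions; [spread] is the
    inverse construction. *)
Definition compact n (M : lmodType R) (phi : C n -> M) : Prop :=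
  exists L : seq (seq V), forall x, (forall s, s \in L -> cv x s = 0) -> phi x = 0.

Section Functional.
Context (n : nat) (M : gmodule R G).

(** There are finitely many simplices up to translation, and [f] has a finitely supported value on
    each, so only finitely many translates contribute at 1. *)
Lemma compact_of_fs (f : ghom (C n) (fsmod M)) :
  linear (fun x => fsval (f x) 1%g : M) /\ compact (fun x => fsval (f x) 1%g : M).
Proof.
split; first by move=> a x y; rewrite linearP.
have [l lP] := relsimp_letters gS rhoP D.
have [k kP] := choice (fun s : seq V => fsval_fin (f (simplex R rhoP D n s))).
exists (flatten [seq [seq map (va g^-1%g) s | g <- k s] | s <- words n.+2 l]) => x xL.
rewrite (ghom_expand f (w := weight ntor)); last by move=> s /chain_neq0; exact: weight_sum.
have ff : fin (fun s => (weight ntor s * cv x s : R) *: f (simplex R rhoP D n s)).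
  have [fx _ _] := cvP x; apply: fin_subr fx _ => s; apply: contraNN => /eqP->.
  by rewrite mulr0 scale0r.
rewrite (fsum_linear (h := fun y => fsval y 1%g : M) ff) //.
apply: fsum0 => s; rewrite -[LHS]/((weight ntor s * cv x s : R) *: (fsval (f (simplex R rhoP D n s)) 1%g : M)).
case: (eqVneq (cv x s) 0) => [->|sn0]; first by rewrite mulr0 scale0r.
case: (eqVneq (fsval (f (simplex R rhoP D n s)) 1%g) 0) => [->|fn0]; first by rewrite scaler0.
have [_ _ px] := cvP x; have hs := px s sn0; have [sz _ _] := hs.
case: s hs sz sn0 fn0 => // u s hs sz sn0 fn0.
pose s' := map (va u.1^-1%g) (u :: s); have es : u :: s = map (va u.1) s'.
  by rewrite /s' -map_vaM mulgV map_va1.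
have s'w : s' \in words n.+2 l.
  rewrite -sz -(size_map (va u.1^-1%g)); apply: mem_words => _ /mapP[v vs ->].
  exact: lP hs (mem_head _ _) vs.
move/eqP: sn0; case; apply: xL; apply/flattenP.
exists [seq map (va g^-1%g) s' | g <- k s']; first exact: map_f.
apply/mapP; exists (u.1^-1)%g; last by rewrite invgK.
apply: kP; move: fn0; rewrite es simplex_act ghom_equivariant.
by rewrite -[fsval (gact _ _) _]/(fsval (f (simplex R rhoP D n s')) (u.1^-1 * 1)%g) mulg1.
Qed.

Context (phi : C n -> M).
Hypothesis (phi_lin : linear phi) (phi_cpt : compact phi).

Definition spread (x : C n) : gfun M := fun h => phi (gact h^-1%g x).

Lemma spread_fs x : spread x \in @fs_pred R G M.
Proof.
apply/fs_predP; have [L LP] := phi_cpt; have [[k kP] _ px] := cvP x.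
exists [seq ((head (1%g, 0%N) p.2).1 * (head (1%g, 0%N) p.1).1^-1)%g | p <- [seq (s, t) | s <- L, t <- k]] => h.
case: (pselect (exists2 s, s \in L & cv (gact h^-1%g x) s != 0)) => [[s sL xs] _|nex]; last first.
  rewrite /spread LP ?eqxx // => s sL; apply/eqP/negPn/negP => xs; apply: nex; by exists s.
rewrite cv_act invgK in xs.
apply/mapP; exists (s, map (va h) s).
  by apply/allpairsP; exists (s, map (va h) s); split=> //; exact: kP.
by have [] := px _ xs; case: (s) => // -[u i] s' _ _ _; rewrite /= mulgK.
Qed.

Lemma spread_linear : linear (fun x => glift (@fs_submod R G M) (@fs_act R G M) (spread_fs x)).
Proof.
move=> a x y; apply: gincl_inj; rewrite [RHS]linearP; apply: funext => h.
by rewrite -[LHS]/(phi (gact h^-1%g (a *: x + y))) gactD gactZ phi_lin.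
Qed.

Lemma spread_equiv : equivariant (fun x => glift (@fs_submod R G M) (@fs_act R G M) (spread_fs x)).
Proof.
move=> g x; apply: gincl_inj; rewrite [RHS]ghom_equivariant; apply: funext => h.
rewrite -[LHS]/(phi (gact h^-1%g (gact g x))) -gactM -[RHS]/(phi (gact (g^-1 * h)^-1%g x)).
by rewrite invgM invgK.
Qed.

Definition spreadm : ghom (C n) (fsmod M) := mk_ghom spread_linear spread_equiv.

Lemma spreadE x h : fsval (spreadm x) h = phi (gact h^-1%g x). Proof. by []. Qed.

End Functional.

Lemma fs_determined n (M : gmodule R G) (f : ghom (C n) (fsmod M)) x h :
  fsval (f x) h = fsval (f (gact h^-1%g x)) 1%g.
Proof.
rewrite ghom_equivariant -[RHS]/(fsval (f x) (h^-1^-1 * 1)%g); by rewrite invgK mulg1.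
Qed.

Lemma fsval_inj (M : gmodule R G) (a b : fsmod M) : (forall h, fsval a h = fsval b h) -> a = b.
Proof. by move=> h; apply: gincl_inj; exact: funext. Qed.

End Fixed.

Definition big D := (2 * delta + 2 <= D)%N /\ (8 <= D)%N.

Definition cusp_resolution D (hD : big D) : projective_resolution (delta_mod R H) :=
  ProjectiveResolution (@chains_projective R G S H rho rhoP ntor D)
    (@augm_surj R G S H gS rho delta rhoP rho_hyp D hD.1)
    (@augm_exact R G S H gS rho delta rhoP rho_hyp D hD.1 hD.2)
    (@bdm_exact R G S H gS rho delta rhoP rho_hyp D hD.1 hD.2).

(** Alternating chains live on words without repetition, and mixed simplices with distinct vertices
    have bounded size. *)
Lemma resolution_vanishes D (hD : big D) : exists N, forall n (M : gmodule R G)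
  (f : ghom (res (cusp_resolution hD) n) M), (N <= n)%N -> coboundary f.
Proof.
have [N NP] := relsimp_bounded gS rhoP D; exists N => n M f Nn.
have x0 (x : chains R rhoP D n) : x = 0.
  apply: cv_inj => s; rewrite cv0; apply/eqP/negPn/negP => xs.
  have [_ ax px] := cvP x; have := NP _ _ (px _ xs) (alt_uniq ax xs).
  by rewrite ltnNge Nn.
have f0 x : f x = 0 by rewrite (x0 x) linear0.
case: n f f0 {x0 Nn} => [//|n] f f0.
by exists (gzero _ _) => x; exact: f0.
Qed.

Section Inclusion.
Context (D0 D1 : nat).
Hypothesis D01 : (D0 <= D1)%N.

Lemma relsimp_le n s : relsimp H rho D0 n s -> relsimp H rho D1 n s.
Proof.
move=> [sz [cl _] ms]; split=> //; split=> // x y xs ys; exact: leq_trans (cl _ _ xs ys) D01.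
Qed.

Lemma incl_chain n (x : chains R rhoP D0 n) : chain (relsimp H rho D1 n) (cv x).
Proof. apply: chain_sub (cvP x); exact: relsimp_le. Qed.

Definition incl_fun n (x : chains R rhoP D0 n) : chains R rhoP D1 n := cmk rhoP (incl_chain x).

Lemma incl_linear n : linear (@incl_fun n).
Proof. by move=> a x y; apply: cv_inj. Qed.

Lemma incl_equiv n : equivariant (@incl_fun n).
Proof. by move=> g x; apply: cv_inj. Qed.

Definition incl n : ghom (chains R rhoP D0 n) (chains R rhoP D1 n) :=
  mk_ghom (@incl_linear n) (@incl_equiv n).

Lemma cv_incl n x s : cv (incl n x) s = cv x s. Proof. by []. Qed.

(** Enlarging the parameter is a map of resolutions of one module, so by [chain_injective] a
    nontrivial class remains nontrivial on the smaller complex. *)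
Lemma incl_chain_at (h0 : big D0) (h1 : big D1) n :
  @chain_at R G _ (cusp_resolution h0) (cusp_resolution h1) n (incl n).
Proof.
elim: n => [|n IH]; first by move=> x; exact: dv_inj.
by exists (incl n) => // x; exact: cv_inj.
Qed.

End Inclusion.

End Resolution.

Lemma preimage_words (T U : eqType) (f : T -> U) : (forall y, exists l : seq T, forall x, f x = y -> x \in l) ->
  forall L : seq (seq U), exists L' : seq (seq T), forall s, map f s \in L -> s \in L'.
Proof.
move=> fp L; have [l lP] := choice fp.
exists (flatten [seq words (size t) (flatten (map l t)) | t <- L]) => s sL.
apply/flattenP; exists (words (size (map f s)) (flatten (map l (map f s)))).
  exact: (map_f (fun t => words (size t) (flatten (map l t)))).
rewrite size_map; apply: mem_words => x xs; apply/flattenP; exists (l (f x)); last exact: lP.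
by apply: map_f; exact: map_f.
Qed.

Section PushMore.
Context (R : pzRingType) (V W U : choiceType).

Lemma push_scale (f : V -> W) a (c : seq V -> R^o) t : fin c ->
  push f (fun s => a * c s) t = a * push f c t.
Proof.
rewrite /push; elim: t c => [//|w t IH] c fc /=.
rewrite (fsum_linear (h := fun x : R^o => a * x : R^o) (fin_push_at f w t fc)) ?mulr0 //; last first.
  by move=> x y; rewrite mulrDr.
apply: fsum_eq => v; case: ifP => _; last by rewrite mulr0.
exact: (IH (ctr v c) (fin_ctr v fc)).
Qed.

Lemma fin_scale (T : choiceType) (a : R) (c : T -> R^o) : fin c -> fin (fun s => a * c s : R^o).
Proof. by move=> fc; apply: fin_sub fc _ => s; apply: contraNN => /eqP->; rewrite mulr0. Qed.

Lemma push_lin (f : V -> W) a (c c' : seq V -> R^o) t : fin c -> fin c' ->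
  push f (fun s => a *: c s + c' s) t = a *: push f c t + push f c' t.
Proof.
by move=> fc fc'; rewrite (pushD f t (fin_scale a fc) fc') push_scale.
Qed.

Lemma push_id (A : zmodType) (c : seq V -> A) t : push id c t = c t.
Proof.
rewrite /push; elim: t c => [//|w t IH] c /=; rewrite (fsum_point (a := w)) ?eqxx ?IH // => v /negbTE->//.
Qed.

Lemma push_comp (A : zmodType) (f : V -> W) (g : W -> U) (c : seq V -> A) t : fin c ->
  push g (push f c) t = push (fun v => g (f v)) c t.
Proof.
rewrite /push; elim: t c => [//|u t IH] c fc /=.
have [l h] := fc.
have F w v : (if g w == u then if f v == w then push g (push f (ctr v c)) t else 0 else 0) != 0 ->
    w \in map f (flatten l) /\ v \in flatten l.
  case: ifP => _; last by rewrite eqxx.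
  case: (eqVneq (f v) w) => [<-|_]; last by rewrite eqxx.
  case/push_supp => r [_ /push_supp[s [_ /h sl]]].
  have vl : v \in flatten l by apply/flattenP; exists (v :: s); rewrite ?mem_head.
  by split=> //; exact: map_f.
transitivity (fsum (fun w => fsum (fun v => if g w == u then if f v == w then push g (push f (ctr v c)) t else 0 else 0))).
  apply: fsum_eq => w; case: ifP => _; last by rewrite fsum0.
  transitivity (push g (fun s => fsum (fun v => if f v == w then push f (ctr v c) s else 0)) t) => //.
  rewrite push_fsum.
    by apply: fsum_eq => v; case: ifP => // _; rewrite push0.
  exists (flatten l), (map (map f) (map behead l)) => v s; case: ifP => _; last by rewrite eqxx.
  case/push_supp => r [<- /h rl]; split; first by apply/flattenP; exists (v :: r); rewrite ?mem_head.
  by apply: map_f; apply/mapP; exists (v :: r).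
rewrite fsum_exchange; last by exists (map f (flatten l)), (flatten l).
apply: fsum_eq => v; rewrite (fsum_point (a := f v)); last first.
  by move=> w; rewrite eq_sym => /negbTE->; rewrite if_same.
rewrite eqxx; case: ifP => // _; exact: IH (fin_ctr v fc).
Qed.

Lemma wedge_lin (T : choiceType) (u : T) a (c c' : seq T -> R^o) t :
  wedge u (fun s => a *: c s + c' s) t = a *: wedge u c t + wedge u c' t.
Proof. by rewrite (wedgeD u (fun s => a * c s : R^o) c') wedge_scale. Qed.

Lemma hom_lin (f g : V -> W) rank a (c c' : seq V -> R^o) t : fin c -> fin c' ->
  hom f g rank (fun s => a *: c s + c' s) t = a *: hom f g rank c t + hom f g rank c' t.
Proof.
move=> fc fc'; have [l1 h1] := hom_heads f g rank fc; have [l2 h2] := hom_heads f g rank fc'.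
have f1 : fin (fun v => hom_term f g rank v c t : R^o) by exists l1 => v /h1.
have f2 : fin (fun v => hom_term f g rank v c' t : R^o) by exists l2 => v /h2.
have [_ <-] := fsum_lin a f1 f2; apply: fsum_eq => v; rewrite /hom_term; apply: etrans (wedge_lin _ a _ _ t).
congr (wedge _ _ t); apply: funext => r; apply: etrans (wedge_lin _ a _ _ r).
congr (wedge _ _ r); apply: funext => q.
exact: (push_lin _ a q (fin_ctr v fc) (fin_ctr v fc')).
Qed.

End PushMore.

(** * Transfer along a quasi-isometry of pairs *)

Section Transport.
Context (R : pzRingType) (G G' : groupType) (S : seq G) (S' : seq G').
Context (H : groupClosed G) (H' : groupClosed G').
Context (rho : G * nat -> G * nat -> nat) (rho' : G' * nat -> G' * nat -> nat).
Hypothesis rhoP : graph_metric (cusp_adj S H) (fun _ _ => 1%N) rho.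
Hypothesis rhoP' : graph_metric (cusp_adj S' H') (fun _ _ => 1%N) rho'.
Notation V := (G * nat)%type.
Notation V' := (G' * nat)%type.
Context (D D' : nat) (f : V -> V').
Notation C := (chains R rhoP D).
Notation C' := (chains R rhoP' D').
Hypothesis f_co : forall u v, coset_of H u.1 = coset_of H v.1 -> coset_of H' (f u).1 = coset_of H' (f v).1.
Hypothesis f_close : forall u v, close rho D u v -> close rho' D' (f u) (f v).
Hypothesis f_proper : forall y, exists l : seq V, forall u, f u = y -> u \in l.

Lemma mixed_push t : mixed H' (map f t) -> mixed H t.
Proof.
case/hasP=> _ /mapP[u ut ->] /hasP[_ /mapP[v vt ->] ne]; apply/hasP; exists u => //.
by apply/hasP; exists v => //; apply: contraNneq ne => e; apply/eqP/f_co.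
Qed.

Lemma push_rst (c : seq V -> R^o) s : fin c -> mixed H' s -> push f (rst (mixed H) c) s = push f c s.
Proof.
move=> fc ms; apply/eqP; rewrite eq_sym -subr_eq0 -pushB //; last exact: fin_rst.
apply/negPn/negP => /push_supp[t [e]]; rewrite -e in ms.
by rewrite /rst (mixed_push ms) subrr eqxx.
Qed.

Lemma pmap_chain n (x : C n) : chain (relsimp H' rho' D' n) (rst (mixed H') (push f (cv x))).
Proof.
have [fx ax px] := cvP x; split; first exact/fin_rst/fin_push.
  by apply: alt_rst; [exact: mixed_perm|exact: alt_push].
move=> s; rewrite /rst; case: ifP => [ms|]; last by rewrite eqxx.
case/push_supp => t [e /px[sz [cl _] _]]; split=> //; first by rewrite -e size_map.
split=> // a b; rewrite -e => /mapP[u ut ->] /mapP[v vt ->]; exact/f_close/cl.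
Qed.

(** There is no equivariance; linearity, compatibility with the boundary and properness remain.
    Simplices whose image lies over one coset are dropped. *)
Definition pmap n (x : C n) : C' n := cmk rhoP' (pmap_chain x).

Lemma pmap_linear n : linear (@pmap n).
Proof.
move=> a x y; apply: cv_inj => s; have [f1 _ _] := cvP x; have [f2 _ _] := cvP y.
rewrite cv_lin !cv_mk /rst; case: ifP => _; last by rewrite scaler0 addr0.
exact: push_lin.
Qed.

Lemma pmap_bd n (x : C n.+1) : bdm R rhoP' D' n (pmap x) = pmap (bdm R rhoP D n x).
Proof.
apply: cv_inj => s; have [fx _ _] := cvP x.
rewrite -[LHS]/(rbd H' (rst (mixed H') (push f (cv x))) s) -[RHS]/(rst (mixed H') (push f (rbd H (cv x))) s).
rewrite /rbd /rst; case: ifP => // ms.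
rewrite -[RHS]/(push f (rst (mixed H) (bd (cv x))) s) push_rst //; last exact: fin_bd.
rewrite -bd_push //; apply: fsum_eq => v; by rewrite mixed_cons.
Qed.

Lemma pmap_proper n (L : seq (seq V')) : exists L' : seq (seq V), forall x : C n,
  (forall s, s \in L' -> cv x s = 0) -> forall s, s \in L -> cv (pmap x) s = 0.
Proof.
have [L' LP] := preimage_words f_proper L; exists L' => x xL s sL.
rewrite cv_mk /rst; case: ifP => // _; apply/eqP/negPn/negP => /push_supp[t [e xt]].
by rewrite xL ?eqxx // in xt; apply: LP; rewrite e.
Qed.

End Transport.

(** * The prism homotopy on relative chains *)

Section HomotopyTransport.
Context (R : pzRingType) (G : groupType) (S : seq G) (H : groupClosed G).
Hypothesis gS : generating_set S.
Context (rho : G * nat -> G * nat -> nat).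
Hypothesis rhoP : graph_metric (cusp_adj S H) (fun _ _ => 1%N) rho.
Notation V := (G * nat)%type.
Context (D0 D1 : nat) (f : V -> V) (rank : V -> nat).
Hypothesis D01 : (D0 <= D1)%N.
Hypothesis rank_inj : injective rank.
Hypothesis f_co : forall u, coset_of H (f u).1 = coset_of H u.1.
Hypothesis f_close : forall u v, close rho D0 u v -> close rho D1 (f u) (f v).
Hypothesis f_mix : forall u v, close rho D0 u v -> close rho D1 (f u) v.
Hypothesis f_proper : forall y, exists l : seq V, forall u, f u = y -> u \in l.
Notation C0 := (chains R rhoP D0).
Notation C1 := (chains R rhoP D1).
Notation h := (hom f id rank).

(** As [f] preserves every coset, the prism over a simplex in one coset stays over that coset.
    Therefore the homotopy descends to relative chains. *)
Lemma hom_mixed (c : seq V -> R^o) s : mixed H s -> h c s != 0 ->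
  exists t, c t != 0 /\ mixed H t.
Proof.
move=> ms /hom_supp[v [t [ct p]]]; exists (v :: t); split=> //.
rewrite (mixed_perm _ p) in ms; apply: contraT => nm.
have iv := not_mixed_inco (negbTE nm); rewrite (inco_mixed (k := coset_of H v.1)) // in ms.
move: iv => /andP[_ /allP iv]; rewrite /inco /= f_co eqxx /=; apply/allP => _ /mapP[u ut ->].
by rewrite /below; case: ifP => _; rewrite ?f_co; exact: iv.
Qed.

Lemma hom_rst (c : seq V -> R^o) s : fin c -> mixed H s -> h (rst (mixed H) c) s = h c s.
Proof.
move=> fc ms; have fr := fin_rst (mixed H) fc.
apply/eqP; rewrite eq_sym -subr_eq0 addrC -scaleN1r -hom_lin //.
apply/negPn/negP => /(hom_mixed ms)[t []] /=; rewrite /rst => + mt; rewrite mt.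
by rewrite scaleN1r addNr eqxx.
Qed.

Lemma hmap_chain n (x : C0 n) : chain (relsimp H rho D1 n.+1) (rst (mixed H) (h (cv x))).
Proof.
have [fx ax px] := cvP x; split; first exact/fin_rst/fin_hom.
  by apply: alt_rst; [exact: mixed_perm|exact: alt_hom].
move=> s; rewrite /rst; case: ifP => [ms|]; last by rewrite eqxx.
case/hom_supp => v [t [/px[sz [cl _] _] p]]; split=> //.
  by rewrite (perm_size p) /= size_map -sz.
have src a : a \in s -> exists2 u, u \in v :: t & a = f u \/ a = u.
  rewrite (perm_mem p) !in_cons => /or3P[/eqP->|/eqP->|/mapP[u ut ->]].
  - by exists v; [exact: mem_head | left].
  - by exists v; [exact: mem_head | right].
  - exists u; first by rewrite in_cons ut orbT.
    by rewrite /below; case: ifP; [right | left].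
split=> // a b /src[u us ea] /src[w ws eb]; have uw := cl _ _ us ws.
case: ea eb => -> [->|->]; [exact: f_close|exact: f_mix| |exact: leq_trans uw D01].
by rewrite (close_sym gS rhoP); apply: f_mix; rewrite (close_sym gS rhoP).
Qed.

Definition hmap n (x : C0 n) : C1 n.+1 := cmk rhoP (hmap_chain x).

Lemma hmap_linear n : linear (@hmap n).
Proof.
move=> a x y; apply: cv_inj => s; have [f1 _ _] := cvP x; have [f2 _ _] := cvP y.
rewrite cv_lin !cv_mk /rst; case: ifP => _; last by rewrite scaler0 addr0.
exact: hom_lin.
Qed.

Lemma hmap_proper n (L : seq (seq V)) : exists L' : seq (seq V), forall x : C0 n,
  (forall s, s \in L' -> cv x s = 0) -> forall s, s \in L -> cv (hmap x) s = 0.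
Proof.
have [l lP] := choice f_proper.
exists (flatten [seq words (size t).-1 (t ++ flatten (map l t)) | t <- L]) => x xL s sL.
rewrite cv_mk /rst; case: ifP => // _; apply/eqP/negPn/negP => /hom_supp[v [t [xt p]]].
rewrite xL ?eqxx // in xt; apply/flattenP.
exists (words (size s).-1 (s ++ flatten (map l s))).
  exact: (map_f (fun t => words (size t).-1 (t ++ flatten (map l t)))).
rewrite (perm_size p) /= size_map; apply: mem_words => u ut; rewrite mem_cat.
have fl : f u \in s -> u \in flatten (map l s).
  by move=> fs; apply/flattenP; exists (l (f u)); [exact: map_f|exact: lP].
move: ut; rewrite in_cons => /orP[/eqP->|ut].
  by rewrite (perm_mem p) !in_cons eqxx orbT.
case: (ltnP (rank u) (rank v)) => uv.
  apply/orP; left; rewrite (perm_mem p) !in_cons; apply/or3P/Or33/mapP; exists u => //.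
  by rewrite /below uv.
apply/orP; right; apply: fl; rewrite (perm_mem p) !in_cons; apply/or3P/Or33/mapP; exists u => //.
by rewrite /below ltnNge uv.
Qed.

(** The first clause starts the complex: in degree 0 the boundary consists of single vertices, and
    their prisms lie over one coset. *)
Lemma hmap_bd n (x : C0 n) : (n = 0%N -> forall s, mixed H s -> h (bd (cv x)) s = 0) /\
  forall s, mixed H s -> cv (bdm R rhoP D1 n (hmap x)) s =
    cv x s - push f (cv x) s - h (rst (mixed H) (bd (cv x))) s.
Proof.
have [fx ax px] := cvP x; split=> [n0 s ms|s ms].
  apply/eqP/negPn/negP => /(hom_mixed ms)[t [bt mt]].
  have [v /px[]] := bd_supp bt; rewrite n0 /= => -[sz] _ _.
  by case: t mt sz {bt} => [//|u [|//]]; rewrite /mixed /= eqxx.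
rewrite -[LHS]/(rbd H (rst (mixed H) (h (cv x))) s) /rbd /rst ms.
transitivity (bd (h (cv x)) s); first by apply: fsum_eq => v; rewrite mixed_cons.
rewrite -/(rst (mixed H) (bd (cv x))) hom_rst //; last exact: fin_bd.
by rewrite -(push_id (cv x) s) -(homP f id rank_inj s fx ax) addrK.
Qed.

End HomotopyTransport.

Lemma rank_exists (G : groupType) (S : seq G) : generating_set S ->
  exists rank : G * nat -> nat, injective rank.
Proof.
move=> gS; have [w wP] := choice gS.2.
exists (fun u : G * nat => pickle ([seq index x S | x <- w u.1], u.2)) => -[x i] [y j] /= e.
have [ew ->] := pcan_inj pickleK e; congr (_, _).
have [xS <-] := wP x; have [yS <-] := wP y; congr (\prod_(s <- _) s)%g.
have inj (a b : seq G) : {subset a <= S} -> {subset b <= S} ->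
    [seq index x S | x <- a] = [seq index x S | x <- b] -> a = b.
  elim: a b => [|z a IH] [|z' b] //= aS bS [e1 e2]; congr (_ :: _).
    by rewrite -(nth_index z (aS z (mem_head _ _))) e1 nth_index // bS // mem_head.
  apply: IH => // t ts; [apply: aS|apply: bS]; by rewrite in_cons ts orbT.
exact: inj.
Qed.

(** * Extension of a map of pairs to the cusped graphs *)

Section LiftedMap.
Context (G G' : groupType) (S : seq G) (S' : seq G') (H : groupClosed G) (H' : groupClosed G').
Hypothesis (gS : generating_set S) (gS' : generating_set S').
Context (rho : G * nat -> G * nat -> nat) (rho' : G' * nat -> G' * nat -> nat).
Hypothesis rhoP : graph_metric (cusp_adj S H) (fun _ _ => 1%N) rho.
Hypothesis rhoP' : graph_metric (cusp_adj S' H') (fun _ _ => 1%N) rho'.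
Context (B : nat) (phi : G -> G') (psi : G' -> G).
Hypothesis phi_lip : coarse_lipschitz S S' B phi.
Hypothesis phi_co : forall x y, same_coset H x y -> same_coset H' (phi x) (phi y).
Hypothesis psi_phi : forall x, (word_dist S (psi (phi x)) x <= B)%N.

Definition lift_map (u : G * nat) : G' * nat := (phi u.1, u.2).

(** A horizontal edge on level [k] goes to points at word distance at most [B * (2 ^ k).+1], which
    is at most [2 ^ (k + B.+1)]. Climbing [B.+1] levels, crossing and descending takes [2 * B + 3]
    steps. *)
Lemma lift_lipschitz u v : (rho' (lift_map u) (lift_map v) <= (2 * B + 3) * rho u v)%N.
Proof.
apply: (edge_lipschitz rhoP (rho_refl rhoP') (rho_tri rhoP')) => {u v} -[x k] [y l].
rewrite /lift_map => /or3P[/andP[/eqP/= -> h]|/and3P[/eqP/= -> /eqP/= -> h]|/and3P[/eqP/= -> h le]].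
- by rewrite (rho_vert gS' rhoP'); case/orP: h => /eqP->; clear; lia.
- apply: leq_trans (rho_word gS' rhoP' _ _) _; apply: leq_trans (phi_lip x y) _.
  have := wd_gen gS h; move: (word_dist S x y) => d d1.
  by apply: (@leq_trans (B * 2)); [rewrite leq_mul2l ltnS d1 orbT | clear; lia].
- apply: (@leq_trans (B.+1.*2.+1)); last by clear; lia.
  apply: (rho_climb gS' rhoP'); first exact: phi_co.
  apply: leq_trans (phi_lip x y) _; rewrite -addSnnS expnD mulnC leq_mul //; last first.
    exact/ltnW/ltn_expl.
  apply: leq_ltn_trans le _; by rewrite ltn_exp2l.
Qed.

Lemma lift_proper (y : G' * nat) : exists l : seq (G * nat), forall u, lift_map u = y -> u \in l.
Proof.
have [m mP] := wd_ball_at gS (psi y.1) B; exists [seq (x, y.2) | x <- m] => -[x k] e; rewrite -e /=.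
by apply: map_f; apply: mP; rewrite -e; exact: psi_phi.
Qed.

Lemma lift_co (u v : G * nat) : coset_of H u.1 = coset_of H v.1 ->
  coset_of H' (lift_map u).1 = coset_of H' (lift_map v).1.
Proof. by move=> /coset_ofP h; apply/coset_ofP; exact: phi_co. Qed.

End LiftedMap.

(** * Transfer of classes in the top degree *)

Section Transfer.
Context (R : pzRingType) (G G' : groupType) (S : seq G) (S' : seq G').
Context (H : groupClosed G) (H' : groupClosed G').
Hypothesis (gS : generating_set S) (gS' : generating_set S').
Context (rho : G * nat -> G * nat -> nat) (rho' : G' * nat -> G' * nat -> nat) (delta delta' : nat).
Hypothesis rhoP : graph_metric (cusp_adj S H) (fun _ _ => 1%N) rho.
Hypothesis rhoP' : graph_metric (cusp_adj S' H') (fun _ _ => 1%N) rho'.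
Hypothesis rho_hyp : forall x y z o,
  (rho x z + rho y o <= maxn (rho x y + rho z o) (rho y z + rho x o) + delta)%N.
Hypothesis rho_hyp' : forall x y z o,
  (rho' x z + rho' y o <= maxn (rho' x y + rho' z o) (rho' y z + rho' x o) + delta')%N.
Hypothesis (ntor : no_torsion R G) (ntor' : no_torsion R G').
Context (B : nat) (phi : G -> G') (psi : G' -> G).
Hypothesis phi_lip : coarse_lipschitz S S' B phi.
Hypothesis psi_lip : coarse_lipschitz S' S B psi.
Hypothesis phi_co : forall x y, same_coset H x y -> same_coset H' (phi x) (phi y).
Hypothesis psi_co : forall x y, same_coset H' x y -> same_coset H (psi x) (psi y).
Hypothesis psi_phi : forall x, (word_dist S (psi (phi x)) x <= B)%N /\ same_coset H x (psi (phi x)).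
Hypothesis phi_psi : forall y, (word_dist S' (phi (psi y)) y <= B)%N /\ same_coset H' y (phi (psi y)).

Let K := (2 * B + 3)%N.
(** [D0] makes the first complex acyclic, [D1] the second one and also receives the images under
    [P]; [D2] receives the images under [Q] and the prisms. *)
Let D0 := (2 * delta + 10)%N.
Let D1 := (K * D0 + 2 * delta' + 10)%N.
Let D2 := (K * D1 + D0 + 2 * B + 1)%N.

Let big0 : big delta D0. Proof. by rewrite /big /D0; split; clear; lia. Qed.
Let big1 : big delta' D1. Proof. by rewrite /big /D1; split; clear; lia. Qed.
Let D02 : (D0 <= D2)%N. Proof. by rewrite /D2; clear; lia. Qed.
Let big2 : big delta D2. Proof. by case: big0 => h1 h2; split; exact: leq_trans D02. Qed.

Let P := lift_map phi.
Let Q := lift_map psi.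
Let f u := Q (P u).

Let P_close u v : close rho D0 u v -> close rho' D1 (P u) (P v).
Proof.
move=> h; apply: leq_trans (lift_lipschitz gS gS' rhoP rhoP' phi_lip phi_co u v) _.
by apply: (@leq_trans (K * D0)); [rewrite leq_mul2l; apply/orP; right; exact: h | rewrite /D1; clear; lia].
Qed.

Let Q_close u v : close rho' D1 u v -> close rho D2 (Q u) (Q v).
Proof.
move=> h; apply: leq_trans (lift_lipschitz gS' gS rhoP' rhoP psi_lip psi_co u v) _.
by apply: (@leq_trans (K * D1)); [rewrite leq_mul2l; apply/orP; right; exact: h | rewrite /D2; clear; lia].
Qed.

Let f_mix u v : close rho D0 u v -> close rho D2 (f u) v.
Proof.
move=> h; apply: leq_trans (rho_tri rhoP u _ _) _.
apply: (@leq_trans (B.*2.+1 + D0)); last by rewrite /D2; clear; lia.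
apply: leq_add h; case: u {v} => x k; have [dx sx] := psi_phi x.
apply: (rho_climb gS rhoP); first by rewrite same_coset_sym.
apply: leq_trans dx _; apply: ltnW; apply: leq_trans (ltn_expl B (ltnSn 1)) _.
by rewrite leq_exp2l // leq_addl.
Qed.

Let P_proper := lift_proper gS (fun x => (psi_phi x).1).
Let Q_proper := lift_proper gS' (fun x => (phi_psi x).1).
Let P_co := lift_co phi_co.
Let Q_co := lift_co psi_co.

Let f_proper y : exists l : seq (G * nat), forall u, f u = y -> u \in l.
Proof.
have [m mP] := wd_ball_at gS y.1 B; exists [seq (x, y.2) | x <- m] => -[x k] e; rewrite -e /=.
apply: map_f; apply: mP; rewrite -e; exact: (psi_phi x).1.
Qed.

Let f_co u : coset_of H (f u).1 = coset_of H u.1.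
Proof. by apply/esym/coset_ofP; exact: (psi_phi u.1).2. Qed.

Let f_close u v : close rho D0 u v -> close rho D2 (f u) (f v).
Proof. by move=> h; exact/Q_close/P_close. Qed.

Let pP n (x : chains R rhoP D0 n) := pmap rhoP' P_close x.
Let pQ n (y : chains R rhoP' D1 n) := pmap rhoP Q_close y.

Section Degree.
Context (rank : G * nat -> nat).
Hypothesis rank_inj : injective rank.
Let hm n (x : chains R rhoP D0 n) := hmap gS rank D02 f_close f_mix x.

Lemma pmap_homotopy n (x : chains R rhoP D0 n.+1) :
  incl R rhoP D02 n.+1 x = pQ (pP x) + bdm R rhoP D2 n.+1 (hm x) + hm (bdm R rhoP D0 n x).
Proof.
apply: cv_inj => s; have [fx ax px] := cvP x.
rewrite -[RHS]/(cv (pQ (pP x)) s + cv (bdm R rhoP D2 n.+1 (hm x)) s + cv (hm (bdm R rhoP D0 n x)) s) cv_incl.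
case: (boolP (mixed H s)) => ms; last first.
  have z m (y : chains R rhoP D2 m) : cv y s = 0.
    by have [_ _ py] := cvP y; apply/eqP/negPn/negP => /py[_ _]; exact/negP.
  by rewrite !z !addr0 -(cv_incl D02) z.
have [_ ->] := hmap_bd gS D02 rank_inj f_co f_close f_mix x; last exact: ms.
have -> : cv (pQ (pP x)) s = push f (cv x) s.
  rewrite -[LHS]/(rst (mixed H) (push Q (rst (mixed H') (push P (cv x)))) s) {1}/rst ms.
  by rewrite (push_rst Q_co) ?push_comp //; exact: fin_push.
have -> : cv (hm (bdm R rhoP D0 n x)) s = hom f id rank (rst (mixed H) (bd (cv x))) s.
  by rewrite -[LHS]/(rst (mixed H) _ s) /rst ms.
by rewrite -addrA subrK addrC subrK.
Qed.

Lemma pmap_homotopy0 (x : chains R rhoP D0 0) :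
  incl R rhoP D02 0 x = pQ (pP x) + bdm R rhoP D2 0 (hm x).
Proof.
apply: cv_inj => s; have [fx ax px] := cvP x.
rewrite -[RHS]/(cv (pQ (pP x)) s + cv (bdm R rhoP D2 0 (hm x)) s) cv_incl.
case: (boolP (mixed H s)) => ms; last first.
  have z m (y : chains R rhoP D2 m) : cv y s = 0.
    by have [_ _ py] := cvP y; apply/eqP/negPn/negP => /py[_ _]; exact/negP.
  by rewrite !z !addr0 -(cv_incl D02) z.
have [h0 ->] := hmap_bd gS D02 rank_inj f_co f_close f_mix x; last exact: ms.
have -> : cv (pQ (pP x)) s = push f (cv x) s.
  rewrite -[LHS]/(rst (mixed H) (push Q (rst (mixed H') (push P (cv x)))) s) {1}/rst ms.
  by rewrite (push_rst Q_co) ?push_comp //; exact: fin_push.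
have -> : hom f id rank (rst (mixed H) (bd (cv x))) s = 0.
  rewrite (hom_rst rank f_co (fin_bd fx) ms); exact: h0.
by rewrite subr0 addrC subrK.
Qed.

End Degree.

Section TrivialAction.
Context (M : gmodule R G).
Lemma triv_linear (g : G') : linear (@id M). Proof. by []. Qed.
(** Takes the [R]-module [M] over to the other group; no other action of [G'] on it is at hand. *)
Definition gtriv : gmodule R G' :=
  @GModule R G' M (fun _ => id) triv_linear (fun _ => erefl) (fun _ _ _ => erefl).
End TrivialAction.

(** The functional [ph] of the cocycle is pulled back along [pQ] and spread over [G']. If the result
    were a coboundary, the functional of a primitive, pulled back along [pP] and corrected by [ph]
    after the prism homotopy, would be a primitive of [F] on the complex with parameter [D0]. The
    inclusion into the complex with parameter [D2] rules this out. *)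
Lemma transfer n (M : gmodule R G) (F : ghom (chains R rhoP D2 n) (fsmod M)) :
  @cocycle R G _ _ (cusp_resolution gS rhoP rho_hyp ntor big2) n F ->
  ~ @coboundary R G _ _ (cusp_resolution gS rhoP rho_hyp ntor big2) n F ->
  exists (M' : gmodule R G'), Ext_neq0 n (delta_mod R H') M'.
Proof.
move=> co ncb; have [rank rank_inj] := rank_exists gS.
have [lphi cphi] := compact_of_fs gS ntor F.
have [ph phE] : exists ph : chains R rhoP D2 n -> M, ph = fun x => fsval (F x) 1%g by eexists.
rewrite -phE in lphi cphi.
have phbd x : ph (bdm R rhoP D2 n x) = 0 by rewrite phE (co x).
have phD x y : ph (x + y) = ph x + ph y by have := lphi 1 x y; rewrite !scale1r.
have FE (x : chains R rhoP D0 n) h : fsval (F (incl R rhoP D02 n x)) h = ph (incl R rhoP D02 n (gact h^-1%g x)).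
  by rewrite phE fs_determined -(ghom_equivariant (incl R rhoP D02 n)).
have [ph' ph'E] : exists ph' : chains R rhoP' D1 n -> gtriv M, ph' = fun y => ph (pQ y) by eexists.
have lph' : linear ph'.
  move=> a x y; rewrite ph'E /pQ (pmap_linear rhoP Q_close); exact: lphi.
have cph' : compact ph'.
  have [L LP] := cphi; have [L' LP'] := pmap_proper R rhoP' rhoP Q_close Q_proper n L.
  by exists L' => x xL; rewrite ph'E; apply: LP => s sL; exact: LP' sL.
exists (fsmod (gtriv M)), (cusp_resolution gS' rhoP' rho_hyp' ntor' big1), (spreadm lph' cph').
split.
  move=> z; apply: fsval_inj => h; rewrite spreadE -(ghom_equivariant (bdm R rhoP' D1 n)).
  by rewrite ph'E /pQ -(pmap_bd rhoP Q_co) phbd.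
move=> cb; apply: ncb.
apply: (chain_injective (incl_chain_at gS rhoP rho_hyp ntor D02 big0 big2 n) co).
case: n F co ph phE lphi cphi phbd phD FE ph' ph'E lph' cph' cb => [|n] F co ph phE lphi cphi phbd phD FE ph' ph'E lph' cph'.
  move=> cb x; apply: fsval_inj => h; rewrite -[LHS]/(fsval (F (incl R rhoP D02 0 x)) h) FE.
  rewrite (pmap_homotopy0 rank_inj) phD phbd addr0.
  have := cb (pP (gact h^-1%g x)) => /(congr1 (fun v => fsval v 1%g)); rewrite spreadE invg1 gact1 ph'E.
  by [].
case=> g gP; have [lpsi cpsi] := compact_of_fs gS' ntor' g.
have [ps ps_def] : exists ps : chains R rhoP' D1 n -> M, ps = fun x => fsval (g x) 1%g by eexists.
have lps : linear ps by rewrite ps_def; exact: lpsi.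
have cps : compact ps by rewrite ps_def; exact: cpsi.
have psE y : ph (pQ y) = ps (bdm R rhoP' D1 n y).
  rewrite ps_def; have := gP y => /(congr1 (fun v => fsval v 1%g)).
  by rewrite spreadE invg1 gact1 ph'E.
pose hm m (x : chains R rhoP D0 m) := hmap gS rank D02 f_close f_mix x.
pose th (x : chains R rhoP D0 n) : M := ps (pP x) + ph (hm n x).
have lth : linear th.
  move=> a x y; have e1 : pP (a *: x + y) = a *: pP x + pP y by exact: pmap_linear.
  have e2 : hm n (a *: x + y) = a *: hm n x + hm n y by exact: hmap_linear.
  by rewrite /th e1 e2 lps lphi scalerDr addrACA.
have cth : compact th.
  have [L1 LP1] := cps; have [L1' LP1'] := pmap_proper R rhoP rhoP' P_close P_proper n L1.
  have [L2 LP2] := cphi.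
  have [L2' LP2'] := hmap_proper R gS rhoP rank D02 f_close f_mix f_proper n L2.
  exists (L1' ++ L2') => x xL; rewrite /th.
  have -> : ps (pP x) = 0.
    by apply: LP1 => s sL; apply: LP1' sL => t tL; apply: xL; rewrite mem_cat tL.
  rewrite add0r; apply: LP2 => s sL; apply: LP2' sL => t tL; apply: xL; by rewrite mem_cat tL orbT.
exists (spreadm lth cth) => x; apply: fsval_inj => h.
rewrite -[LHS]/(fsval (F (incl R rhoP D02 n.+1 x)) h) FE spreadE.
rewrite (pmap_homotopy rank_inj) !phD phbd addr0 /th.
rewrite -(ghom_equivariant (bdm R rhoP D0 n)); congr (_ + _).
by rewrite psE /pP (pmap_bd rhoP' P_co).
Qed.

(** Moves up to the largest degree with a nonzero class, which exists because the resolution has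
    finite length. A rise of the degree is harmless for the inequality of dimensions. *)
Lemma cohomology_transfer n (M : gmodule R G) : Ext_neq0 n (delta_mod R H) M ->
  exists m (M' : gmodule R G'), (n <= m)%N /\ Ext_neq0 m (delta_mod R H') M'.
Proof.
move=> ext; pose res2 := cusp_resolution gS rhoP rho_hyp ntor big2.
pose E m := `[< exists (L : gmodule R G) (F : ghom (res res2 m) L), cocycle F /\ ~ coboundary F >].
have [F hF] := Ext_resolution res2 ext.
have En : E n by apply/asboolP; exists M, F.
have [N NP] := resolution_vanishes gS rhoP rho_hyp ntor big2.
have EN m : E m -> (m <= N)%N.
  move=> /asboolP[L [F' [_ ncb]]]; rewrite leqNgt; apply/negP => Nm; apply: ncb.
  by apply: NP; exact: ltnW.
have [m Em mmax] := ex_maxnP (ex_intro _ n En) EN.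
have top L (F' : ghom (res res2 m.+1) L) : cocycle F' -> coboundary F'.
  move=> co; apply: contrapT => ncb; suff /mmax : E m.+1 by rewrite ltnn.
  by apply/asboolP; exists L, F'.
have /asboolP[L [F' hF']] := Em.
have [F2 [co ncb]] := top_finite_support top (ex_intro _ F' hF').
have [M' e] := transfer co ncb.
by exists m, M'; split=> //; exact: mmax.
Qed.

End Transfer.

Lemma cohomology_transfer_le (K : realType) (R : pzRingType) (G G' : groupType)
    (H : groupClosed G) (H' : groupClosed G') S dh delta S' dh' delta' B phi psi :
  @fine_hyperbolic G H S dh delta -> @fine_hyperbolic G' H' S' dh' delta' ->
  no_torsion R G -> no_torsion R G' ->
  coarse_lipschitz S S' B phi -> coarse_lipschitz S' S B psi ->
  (forall x y, same_coset H x y -> same_coset H' (phi x) (phi y)) ->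
  (forall x y, same_coset H' x y -> same_coset H (psi x) (psi y)) ->
  (forall x, (word_dist S (psi (phi x)) x <= B)%N /\ same_coset H x (psi (phi x))) ->
  (forall y, (word_dist S' (phi (psi y)) y <= B)%N /\ same_coset H' y (phi (psi y))) ->
  (relative_cd R H K <= relative_cd R H' K)%E.
Proof.
move=> fh fh' nt nt' l1 l2 c1 c2 d1 d2; apply: ge_ereal_sup => _ [i [M [n [-> [D [iota [ti ext]]]]]] <-].
have gS := fh_gen fh; have gS' := fh_gen fh'.
have [rho rhoP] := cusp_metric_exists H gS; have [rho' rhoP'] := cusp_metric_exists H' gS'.
have [e hyp] := cusped_hyperbolic gS (fh_metric fh) (fh_hyp fh) (fh_fine fh) rhoP.
have [e' hyp'] := cusped_hyperbolic gS' (fh_metric fh') (fh_hyp fh') (fh_fine fh') rhoP'.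
have ext0 := Ext_tensor ti (delta_tensor R H) ext.
have [m [M' [nm ext']]] := cohomology_transfer gS gS' rhoP rhoP' hyp hyp' nt nt' l1 l2 c1 c2 d1 d2 ext0.
apply: (@le_trans _ _ (m.+1%:R)%:E); first by rewrite lee_fin ler_nat ltnS.
apply: ereal_sup_ubound; exists m.+1 => //; exists M', m; split=> //.
by exists (delta_mod R H'), (@diota R G' H'); split=> //; exact: delta_tensor.
Qed.

Theorem theorem1p7 (K : realType) (R : pzRingType)
    (G G' : groupType) (H : groupClosed G) (H' : groupClosed G')
    (qi_GG' : quasi_isometric K G G')
    (rel_hyp_G : relatively_hyperbolic K H)
    (rel_hyp_G' : relatively_hyperbolic K H')
    (no_torsion_G : no_torsion R G)
    (no_torsion_G' : no_torsion R G')
    (unconstricted_H : unconstricted K (subgroup_type H))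
    (unconstricted_H' : unconstricted K (subgroup_type H'))
    (Finfty_H : type_Finfty K (subgroup_type H))
    (Finfty_H' : type_Finfty K (subgroup_type H')) :
  relative_cd R H K = relative_cd R H' K.
Proof.
have [S [dh [delta fh]]] := relatively_hyperbolic_fine rel_hyp_G.
have [S' [dh' [delta' fh']]] := relatively_hyperbolic_fine rel_hyp_G'.
have [phi [psi [B [[l1 l2] c1 c2 d1 d2]]]] := pair_quasi_isometry fh fh' unconstricted_H unconstricted_H' qi_GG'.
apply/eqP; rewrite eq_le.
rewrite (cohomology_transfer_le K fh fh' no_torsion_G no_torsion_G' l1 l2 c1 c2 d1 d2).
by rewrite (cohomology_transfer_le K fh' fh no_torsion_G' no_torsion_G l2 l1 c2 c1 d2 d1).
Qed.
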